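(* For each large $n$, with $\lambda=\lambda(n)$, define $$\Omega=\{z\in\mathbb C:|\operatorname{Re}z|<1,\ |e^{\phi_\lambda(z)}|<1\},$$ $$\mho_-=\{z\in\mathbb C:|\operatorname{Re}z|>1,\ |e^{\phi_\lambda(z)}|<1\},\qquad \mho_+=\{z\in\mathbb C:|e^{\phi_\lambda(z)}|>1\}$$ (these sets depend on $n$ through $\lambda$ and $\phi_\lambda$). Let $z\in\mathbb C$ be fixed. (i) If $z\in\Omega$ for all sufficiently large $n$, then $$\lim_{n\to\infty}\left|\frac{T_{2n}(\lambda z)}{\xi(1/2+\lambda z)}-1\right|=0.$$ (ii) If $z\in\mho_-$ for all sufficiently large $n$, then $$\lim_{n\to\infty}\left|\frac{T_{2n}(\lambda z)}{\xi(1/2+\lambda z)}\right|=0.$$ (iii) If $z\in\mho_+$ for all sufficiently large $n$, then $$\lim_{n\to\infty}\left|\frac{T_{2n}(\lambda z)}{\xi(1/2+\lambda z)}\right|=\infty.$$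
   Context: $\xi(z)=\tfrac12\pi^{-z/2}\Gamma(z/2)z(z-1)\zeta(z)$ is Riemann's xi function (entire, with $\xi(z)=\xi(1-z)$), and $f(z)=\xi(1/2+z)$, an even entire function. $T_m(z)$ denotes the degree-$m$ Taylor (Maclaurin) polynomial of $f$ at $0$, and $T_m(\lambda z)$ is its value at $\lambda z$. For all sufficiently large $n$, $\lambda=\lambda(n)$ is the unique $\lambda>1/2$ with $2-\frac{\lambda}{n}\frac{f'(\lambda)}{f(\lambda)}=0$. The phase $\phi_\lambda$ is defined by $e^{n\phi_\lambda(z)}=\frac{z^{2n}f(\lambda)}{f(\lambda z)}$; thus $|e^{\phi_\lambda(z)}|=\left|\frac{z^{2n}f(\lambda)}{f(\lambda z)}\right|^{1/n}$, which is interpreted as $+\infty$ at zeros of $f(\lambda z)$; likewise $\left|\frac{T_{2n}(\lambda z)}{\xi(1/2+\lambda z)}\right|$ is interpreted as $+\infty$ when the denominator vanishes. *)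

(* Defs.v *)
From Stdlib Require Export Reals Factorial.
From Coquelicot Require Export Coquelicot.

Open Scope R_scope.

Definition Cexp (z : C) : C := (exp (Re z) * cos (Im z), exp (Re z) * sin (Im z)).

(* [x ^ z] for a real base [x > 0] (principal value). *)
Definition RCpow (x : R) (z : C) : C := Cexp (z * ln x)%C.

(* Euler's integral; meaningful for [Re z > 0]. *)
Definition CGamma (z : C) : C :=
  RInt_gen (V := C_R_CompleteNormedModule)
    (fun t : R => (RCpow t (z - 1) * exp (- t))%C)
    (at_right 0) (Rbar_locally p_infty).

(* The Dirichlet series [sum_(k >= 1) k ^ (-z)], summed componentwise;
   meaningful for [Re z > 1]. *)
Definition Czeta (z : C) : C :=
  (Series (fun k => Re (RCpow (INR (S k)) (- z))),
   Series (fun k => Im (RCpow (INR (S k)) (- z)))).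

Definition entire (f : C -> C) : Prop := forall z : C, ex_derive f z.

(* Since Gamma and zeta enter through analytic continuation, the product
   formula is imposed only where the integral and the series converge; by the
   identity theorem this and [entire] determine [xi] on the whole plane. *)
Record is_riemann_xi (xi : C -> C) : Prop := {
  xi_entire : entire xi;
  xi_reflection : forall z : C, xi z = xi (1 - z)%C;
  xi_formula : forall z : C, 1 < Re z ->
    xi z = (/ 2 * RCpow PI (- (z / 2)) * CGamma (z / 2) * z * (z - 1)
            * Czeta z)%C }.

Definition shifted_xi (xi : C -> C) (z : C) : C := xi (/ 2 + z)%C.

Fixpoint C_derive_n (f : C -> C) (k : nat) : C -> C :=
  match k with
  | O => f
  | S k' => C_derive (C_derive_n f k')
  end.

Definition taylor_poly (f : C -> C) (m : nat) (z : C) : C :=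
  sum_n (fun k => (C_derive_n f k 0 / INR (Factorial.fact k) * z ^ k)%C) m.

Definition is_scaling (f : C -> C) (n : nat) (l : R) : Prop :=
  / 2 < l /\ (2 - l / INR n * (C_derive f l / f l) = 0)%C.

(* [Rpower 0 y] is [1] in Stdlib, hence the case distinction. *)
Definition nth_root (n : nat) (x : R) : R :=
  if Rlt_dec 0 x then Rpower x (/ INR n) else 0.

Definition abs_exp_phase (f : C -> C) (n : nat) (l : R) (z : C) : Rbar :=
  if Ceq_dec (f (l * z)%C) 0 then p_infty
  else Finite (nth_root n (Cmod (z ^ (2 * n) * f l / f (l * z))%C)).

Definition Omega (f : C -> C) (n : nat) (l : R) (z : C) : Prop :=
  Rabs (Re z) < 1 /\ Rbar_lt (abs_exp_phase f n l z) 1.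

Definition mho_minus (f : C -> C) (n : nat) (l : R) (z : C) : Prop :=
  1 < Rabs (Re z) /\ Rbar_lt (abs_exp_phase f n l z) 1.

Definition mho_plus (f : C -> C) (n : nat) (l : R) (z : C) : Prop :=
  Rbar_lt 1 (abs_exp_phase f n l z).

Definition abs_quot (a b : C) : Rbar :=
  if Ceq_dec b 0 then p_infty else Finite (Cmod (a / b)%C).

Definition abs_quot_sub1 (a b : C) : Rbar :=
  if Ceq_dec b 0 then p_infty else Finite (Cmod (a / b - 1)%C).

(* Convergence in [Rbar] for the order topology; Coquelicot's [is_lim_seq]
   only takes real-valued sequences. *)
Definition is_Rbar_lim_seq (u : nat -> Rbar) (l : Rbar) : Prop :=
  (forall a : R, Rbar_lt a l -> eventually (fun n => Rbar_lt a (u n))) /\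
  (forall b : R, Rbar_lt l b -> eventually (fun n => Rbar_lt (u n) b)).

(* Main.v *)
(** Write [l] for the scaling point, [L = ln (l / (2 pi))] and [E = |z| ^ (2 n) |f l| / |f (l z)|], so that the phase
    condition compares [E] with 1.

    The coefficients of [w ^ (2 k)] in the Taylor series of [f], multiplied by [l ^ (2 k) / f l], are the Fourier
    coefficients of [t |-> f (l e^{i t}) e^{- 2 i n t} / f l] up to a shift. Since [l] is the saddle point, Stirling's
    formula shows that this function looks like the Gaussian [exp (- kappa t ^ 2)], [kappa ~ l L / 4], and is negligible
    away from [t = 0] and [t = pi]. Hence the scaled coefficients are uniformly small, while those with [k] near [n] are
    almost constant and not smaller than a power of [l]. Summation in [k] gives that [T_{2n}] (for [|z| > 1]) and
    [T_{2n} - f] (for [|z| < 1]) are [o(1)] times [|z| ^ (2 n) |f l|], and, unless [z ^ 2 = 1], at least [c / l] times it;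
    the latter holds for [T_{2n}] on [|z| = 1] too. This proves (i) and (ii), and reduces (iii) to the exponential growth
    of [E].

    For [Re z > 0], Stirling's formula gives [ln E = (l / 2) (L A + B) + O(ln l)] with [A = ln |z| + 1 - Re z], and where [A]
    vanishes the sign of [B] is that of [Re z - 1]; so [E > 1] for all large [n] forces exponential growth. What remains is
    [z = i y] with [0 < |y| <= 1 / e], where [E > 1] means that [f] is of size at most [exp (- l / 2)] at [i y l], up to
    powers of [l]. Consecutive values of [l] being about [4 / L] apart, Newton interpolation at some [L ^ 2] of these
    points would make [f (5 / 2 + i y l)] smaller than Stirling's formula allows. *)
Require Import Defs.
From Stdlib Require Import Lra Lia ZArith List.
Import ListNotations.
(* [ZArith] brings in another [eventually]. *)
Import Hierarchy.

(** * Complex differentiability *)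

(** Stirling's formula bounds [f] from below only where zeta is under control, at real part at least
    [5 / 2]. For fixed [z] off the imaginary axis the point [l z] gets there up to sign; on the axis
    it never does. There [E > 1] comes without a margin, and [f] may be small at single points; only
    smallness at many consecutive points is absurd. That absurdity is a count of exponents. With
    [M ~ L ^ 2] nodes on either side, at most [4 y / L] apart, the window has half-length
    [w ~ 4 y L]. On the circle of radius [3 w] about [5 / 2 + i y l], [f] exceeds the lower bound at
    the centre by a factor of about [exp (3 w L / 2) = exp (6 y M)] at most. The node polynomial is
    smaller at the centre than on the circle by about [4 ^ (- 2 M)], here estimated by
    [exp (- 5 M / 2)]. Since [y <= 1 / e < 3 / 8], one has [6 y < 9 / 4 < 5 / 2], and the remainder
    loses. The values at the nodes, below [exp (- 49 l / 100)], are amplified only by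
    [exp (O (L ^ 3))] and stay below [exp (- 3 l / 8)], a lower bound of the value at the centre up
    to constants. *)

Lemma C_ext (a b : C) : Re a = Re b -> Im a = Im b -> a = b.
Proof. destruct a, b; simpl; congruence. Qed.

Lemma Re_le_Cmod (z : C) : Rabs (Re z) <= Cmod z.
Proof. apply re_le_Cmod. Qed.

Lemma Im_le_Cmod (z : C) : Rabs (Im z) <= Cmod z.
Proof. apply Rle_trans with (2 := Rmax_Cmod z), Rmax_r. Qed.

Lemma Cmod_le_Re_Im (z : C) : Cmod z <= Rabs (Re z) + Rabs (Im z).
Proof.
  destruct z as [x y]; unfold Cmod; simpl.
  rewrite <- (sqrt_Rsqr (Rabs x + Rabs y)).
  2: pose proof (Rabs_pos x); pose proof (Rabs_pos y); lra.
  apply sqrt_le_1_alt; unfold Rsqr.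
  pose proof (Rabs_pos x); pose proof (Rabs_pos y).
  pose proof (Rsqr_abs x); pose proof (Rsqr_abs y); unfold Rsqr in *; nra.
Qed.

Lemma Cmod_minus_sym (a b : C) : Cmod (a - b) = Cmod (b - a).
Proof. rewrite <- Cmod_opp; f_equal; ring. Qed.

Lemma Cmod_triangle_minus (a b : C) : Cmod (a - b) <= Cmod a + Cmod b.
Proof. unfold Cminus; rewrite <- (Cmod_opp b); apply Cmod_triangle. Qed.

Lemma Cmod_triangle_rev (a b : C) : Cmod a - Cmod b <= Cmod (a - b).
Proof.
  assert (H := Cmod_triangle (a - b) b).
  replace (a - b + b)%C with a in H by ring; lra.
Qed.

Section ComplexContinuity.
Context {U : UniformSpace}.

Lemma continuous_Re (f : U -> C) x : continuous f x -> continuous (fun y => Re (f y)) x.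
Proof. intros H; apply (continuous_comp f (@fst R R)); auto; apply continuous_fst. Qed.

Lemma continuous_Im (f : U -> C) x : continuous f x -> continuous (fun y => Im (f y)) x.
Proof. intros H; apply (continuous_comp f (@snd R R)); auto; apply continuous_snd. Qed.

Lemma continuous_C (f : U -> C) x : continuous (fun y => Re (f y)) x ->
  continuous (fun y => Im (f y)) x -> continuous f x.
Proof.
  intros H1 H2 P [eps HP].
  specialize (H1 _ (locally_ball (Re (f x)) eps)).
  specialize (H2 _ (locally_ball (Im (f x)) eps)).
  unfold filtermap in H1, H2.
  generalize (filter_and _ _ H1 H2); unfold filtermap.
  unfold filtermap; apply filter_imp; intros y [A B]; apply HP; split; assumption.
Qed.

Lemma continuous_Cplus (f g : U -> C) x : continuous f x -> continuous g x ->
  continuous (fun y => (f y + g y)%C) x.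
Proof.
  intros Hf Hg; apply continuous_C; simpl;
  apply (continuous_plus (V := R_NormedModule)); now (apply continuous_Re || apply continuous_Im).
Qed.

Lemma continuous_Copp (f : U -> C) x : continuous f x -> continuous (fun y => (- f y)%C) x.
Proof.
  intros Hf; apply continuous_C; simpl;
  apply (continuous_opp (V := R_NormedModule)); now (apply continuous_Re || apply continuous_Im).
Qed.

Lemma continuous_Cminus (f g : U -> C) x : continuous f x -> continuous g x ->
  continuous (fun y => (f y - g y)%C) x.
Proof. intros; apply continuous_Cplus; auto; now apply continuous_Copp. Qed.

Lemma continuous_Cmult (f g : U -> C) x : continuous f x -> continuous g x ->
  continuous (fun y => (f y * g y)%C) x.
Proof.
  intros Hf Hg; apply continuous_C; simpl.
  - apply (continuous_minus (V := R_NormedModule)); apply (continuous_mult (K := R_AbsRing));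
    now (apply continuous_Re || apply continuous_Im).
  - apply (continuous_plus (V := R_NormedModule)); apply (continuous_mult (K := R_AbsRing));
    now (apply continuous_Re || apply continuous_Im).
Qed.

Lemma continuous_RtoC (f : U -> R) x : continuous f x -> continuous (fun y => RtoC (f y)) x.
Proof. intros Hf; apply continuous_C; simpl; auto; apply continuous_const. Qed.

Lemma continuous_Cpow (f : U -> C) n x : continuous f x -> continuous (fun y => (f y ^ n)%C) x.
Proof.
  intros Hf; induction n; simpl; [apply continuous_const | now apply continuous_Cmult].
Qed.

Lemma continuous_real_comp (f : U -> R) (g : R -> R) x : continuous f x ->
  ex_derive g (f x) -> continuous (fun y => g (f y)) x.
Proof.
  intros Hf Hg; apply (continuous_comp f g); auto.
  now apply (ex_derive_continuous (V := R_NormedModule)).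
Qed.

Lemma continuous_Cexp (f : U -> C) x : continuous f x -> continuous (fun y => Cexp (f y)) x.
Proof.
  intros Hf; apply continuous_C; simpl; apply (continuous_mult (K := R_AbsRing));
  apply continuous_real_comp; try (now apply continuous_Re || now apply continuous_Im);
  auto_derive; auto.
Qed.

Lemma continuous_C_eps (f : U -> C) x : continuous f x <->
  forall eps, 0 < eps -> locally x (fun y => Cmod (f y - f x) < eps).
Proof.
  split.
  - intros H eps Heps.
    assert (He : 0 < eps / 2) by lra.
    generalize (H _ (locally_ball (f x) (mkposreal _ He))).
    unfold filtermap; apply filter_imp; intros y [A B].
    apply Rle_lt_trans with (1 := Cmod_le_Re_Im _).
    unfold ball in A, B; simpl in A, B; unfold AbsRing_ball, abs, minus, plus, opp in A, B; simpl in A, B.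
    unfold Re, Im; simpl; lra.
  - intros H; apply continuous_C; intros P [eps HP];
    generalize (H eps (cond_pos eps)); unfold filtermap; apply filter_imp; intros y Hy; apply HP;
    unfold ball; simpl; unfold AbsRing_ball, abs, minus, plus, opp; simpl;
    refine (Rle_lt_trans _ _ _ _ Hy); [apply (Re_le_Cmod (f y - f x)) | apply (Im_le_Cmod (f y - f x))].
Qed.

Lemma continuous_Cmod (f : U -> C) x : continuous f x -> continuous (fun y => Cmod (f y)) x.
Proof.
  intros H P [eps HP].
  generalize (proj1 (continuous_C_eps f x) H eps (cond_pos eps)); unfold filtermap; apply filter_imp.
  intros y Hy; apply HP; unfold ball; simpl; unfold AbsRing_ball, abs, minus, plus, opp; simpl.
  apply Rle_lt_trans with (2 := Hy).
  pose proof (Cmod_triangle_rev (f y) (f x)); pose proof (Cmod_triangle_rev (f x) (f y)).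
  rewrite (Cmod_minus_sym (f x)) in H1; apply Rabs_le; lra.
Qed.

Lemma continuous_Cinv (f : U -> C) x : continuous f x -> f x <> 0 ->
  continuous (fun y => (/ f y)%C) x.
Proof.
  intros Hf Hx.
  assert (Hr := continuous_Re _ _ Hf); assert (Hi := continuous_Im _ _ Hf).
  assert (Hd : Re (f x) ^ 2 + Im (f x) ^ 2 <> 0).
  { intro E; apply Hx; apply C_ext; simpl; nra. }
  assert (Hc : continuous (fun y => / (Re (f y) ^ 2 + Im (f y) ^ 2)) x).
  { apply (continuous_real_comp _ Rinv).
    - apply (continuous_plus (V := R_NormedModule));
      apply (continuous_real_comp _ (fun t => t ^ 2)); auto; auto_derive; auto.
    - auto_derive; auto. }
  apply continuous_C; simpl; apply (continuous_mult (K := R_AbsRing)); auto.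
  now apply (continuous_opp (V := R_NormedModule)).
Qed.

End ComplexContinuity.

(** The uniform structure of [C] is that of a product, so its balls are squares; the estimates below
    are made on discs. *)
Lemma locally_C_Cmod (z : C) (P : C -> Prop) :
  locally (T := C_UniformSpace) z P <-> exists d, 0 < d /\ forall w, Cmod (w - z) < d -> P w.
Proof.
  split.
  - intros [eps H]; exists eps; split; [apply cond_pos |].
    intros w Hw; apply H; split;
    unfold ball; simpl; unfold AbsRing_ball, abs, minus, plus, opp; simpl;
    refine (Rle_lt_trans _ _ _ _ Hw); [apply (Re_le_Cmod (w - z)) | apply (Im_le_Cmod (w - z))].
  - intros [d [Hd H]].
    assert (He : 0 < d / 2) by lra.
    exists (mkposreal _ He); intros w [A B]; apply H.
    apply Rle_lt_trans with (1 := Cmod_le_Re_Im _).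
    unfold ball in A, B; simpl in A, B; unfold AbsRing_ball, abs, minus, plus, opp in A, B; simpl in A, B.
    unfold Re, Im; simpl; lra.
Qed.

(** Carathéodory's form of complex differentiability. *)
Definition cdiff (f : C -> C) (z l : C) : Prop :=
  exists phi : C -> C, continuous phi z /\ phi z = l /\
    forall w, f w = (f z + phi w * (w - z))%C.

(** With a continuous quotient the rules of differentiation become algebra. The equivalence serves
    to enter from [entire] and to leave through [C_derive]. *)
Lemma is_derive_iff_cdiff (f : C -> C) (z l : C) : is_derive f z l <-> cdiff f z l.
Proof.
  split.
  - intros [_ H].
    specialize (H z (fun P HP => HP)).
    exists (fun w => if Ceq_dec w z then l else ((f w - f z) / (w - z))%C).
    split; [| split].
    + apply continuous_C_eps; intros eps Heps.
      assert (He : 0 < eps / 2) by lra.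
      specialize (H (mkposreal _ He)).
      apply locally_C in H; revert H; unfold filtermap; apply filter_imp; intros w Hw.
      destruct (Ceq_dec z z) as [_|]; [| tauto].
      destruct (Ceq_dec w z) as [E|E].
      * replace (l - l)%C with (RtoC 0) by ring; rewrite Cmod_0; auto.
      * assert (Hn : (w - z)%C <> 0) by now apply Cminus_eq_contra.
        apply Cmod_gt_0 in Hn as Hp.
        change (Cmod ((f w - f z) - (w - z) * l) <= eps / 2 * Cmod (w - z)) in Hw.
        replace ((f w - f z) / (w - z) - l)%C with (((f w - f z) - (w - z) * l) / (w - z))%C
          by (field; auto).
        rewrite Cmod_div; auto.
        apply Rle_lt_trans with (eps / 2); [| lra].
        apply Rmult_le_reg_r with (1 := Hp).
        unfold Rdiv at 1; rewrite Rmult_assoc, Rinv_l, Rmult_1_r; lra.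
    + destruct (Ceq_dec z z); tauto.
    + intros w; destruct (Ceq_dec w z) as [->|E]; [ring |].
      assert (Hn : (w - z)%C <> 0) by now apply Cminus_eq_contra.
      field; auto.
  - intros [phi [Hc [Hl He]]]; split.
    + apply is_linear_scal_l.
    + intros x Hx.
      assert (x = z) as ->.
      { symmetry. apply (is_filter_lim_locally_unique (V := AbsRing_NormedModule C_AbsRing)).
        exact Hx. }
      intros eps.
      apply locally_C.
      generalize (proj1 (continuous_C_eps phi z) Hc eps (cond_pos eps)).
      unfold filtermap; apply filter_imp; intros w Hw.
      change (Cmod ((f w - f z) - (w - z) * l) <= eps * Cmod (w - z)).
      rewrite (He w), <- Hl.
      replace (f z + phi w * (w - z) - f z - (w - z) * phi z)%C with ((phi w - phi z) * (w - z))%C by ring.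
      rewrite Cmod_mult; apply Rmult_le_compat_r; [apply Cmod_ge_0 | lra].
Qed.

Lemma cdiff_continuous (f : C -> C) (z l : C) : cdiff f z l -> continuous f z.
Proof.
  intros [phi [Hc [_ He]]].
  apply (continuous_ext (fun w => (f z + phi w * (w - z))%C)); [intros; now rewrite <- He |].
  apply continuous_Cplus; [apply continuous_const |].
  apply continuous_Cmult; auto.
  apply continuous_Cminus; [apply continuous_id | apply continuous_const].
Qed.

Lemma cdiff_ext (f g : C -> C) (z l : C) : (forall w, f w = g w) -> cdiff f z l -> cdiff g z l.
Proof.
  intros H [phi [Hc [Hl He]]]; exists phi; repeat split; auto.
  intros w; rewrite <- !H; auto.
Qed.

Lemma cdiff_const (c z : C) : cdiff (fun _ => c) z 0.
Proof. exists (fun _ => RtoC 0); repeat split; [apply continuous_const | intros; ring]. Qed.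

Lemma cdiff_id (z : C) : cdiff (fun w => w) z 1.
Proof. exists (fun _ => RtoC 1); repeat split; [apply continuous_const | intros; ring]. Qed.

Lemma cdiff_plus (f g : C -> C) (z l m : C) : cdiff f z l -> cdiff g z m ->
  cdiff (fun w => (f w + g w)%C) z (l + m)%C.
Proof.
  intros [p [Hc [<- He]]] [q [Hd [<- Hf]]]; exists (fun w => (p w + q w)%C); repeat split.
  - now apply continuous_Cplus.
  - intros w; rewrite He, Hf; ring.
Qed.

Lemma cdiff_mult (f g : C -> C) (z l m : C) : cdiff f z l -> cdiff g z m ->
  cdiff (fun w => (f w * g w)%C) z (l * g z + f z * m)%C.
Proof.
  intros Hf0 Hg0; assert (Hg1 := cdiff_continuous _ _ _ Hg0).
  destruct Hf0 as [p [Hc [<- He]]]; destruct Hg0 as [q [Hd [<- Hf]]].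
  exists (fun w => (p w * g w + f z * q w)%C); repeat split.
  - apply continuous_Cplus; apply continuous_Cmult; auto; apply continuous_const.
  - intros w; rewrite (He w), (Hf w); ring.
Qed.

Lemma cdiff_opp (f : C -> C) (z l : C) : cdiff f z l -> cdiff (fun w => (- f w)%C) z (- l)%C.
Proof.
  intros [p [Hc [<- He]]]; exists (fun w => (- p w)%C); repeat split.
  - now apply continuous_Copp.
  - intros w; rewrite He; ring.
Qed.

Lemma cdiff_minus (f g : C -> C) (z l m : C) : cdiff f z l -> cdiff g z m ->
  cdiff (fun w => (f w - g w)%C) z (l - m)%C.
Proof. intros; apply cdiff_plus; auto; now apply cdiff_opp. Qed.

Lemma cdiff_comp (f g : C -> C) (z l m : C) : cdiff f (g z) l -> cdiff g z m ->
  cdiff (fun w => f (g w)) z (l * m)%C.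
Proof.
  intros [p [Hc [<- He]]] Hg0; assert (Hg1 := cdiff_continuous _ _ _ Hg0).
  destruct Hg0 as [q [Hd [<- Hf]]].
  exists (fun w => (p (g w) * q w)%C); repeat split.
  - apply continuous_Cmult; auto; now apply continuous_comp.
  - intros w; rewrite (He (g w)), (Hf w) at 1; ring_simplify.
    rewrite (Hf w); ring.
Qed.

Lemma cdiff_eq (f : C -> C) (z l m : C) : cdiff f z l -> l = m -> cdiff f z m.
Proof. now intros H <-. Qed.

Lemma Cexp_plus (a b : C) : Cexp (a + b) = (Cexp a * Cexp b)%C.
Proof.
  destruct a, b; apply C_ext; simpl; rewrite exp_plus, ?cos_plus, ?sin_plus; ring.
Qed.

Lemma Cexp_0 : Cexp 0 = 1.
Proof. apply C_ext; simpl; rewrite exp_0, ?cos_0, ?sin_0; ring. Qed.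

Lemma Cmod_Cexp (z : C) : Cmod (Cexp z) = exp (Re z).
Proof.
  transitivity (sqrt (Rsqr (exp (Re z)))); [| apply sqrt_Rsqr; left; apply exp_pos].
  unfold Cmod, Cexp; simpl fst; simpl snd; f_equal; unfold Rsqr.
  pose proof (sin2_cos2 (Im z)) as H; unfold Rsqr in H.
  replace (exp (Re z) * exp (Re z)) with
    (exp (Re z) * exp (Re z) * (sin (Im z) * sin (Im z) + cos (Im z) * cos (Im z))) by (rewrite H; ring).
  ring.
Qed.

Lemma Cexp_neq_0 (z : C) : Cexp z <> 0.
Proof. apply Cmod_gt_0; rewrite Cmod_Cexp; apply exp_pos. Qed.

Lemma Cexp_RtoC (x : R) : Cexp x = exp x.
Proof. apply C_ext; simpl; rewrite ?cos_0, ?sin_0; ring. Qed.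

(* A vector-valued mean value bound through the real function [t => Re (c * f t)]. *)
Lemma Cexp_remainder (v : C) : Cmod (Cexp v - 1 - v) <= Cmod v ^ 2 * exp (Cmod v).
Proof.
  set (r := Cmod v).
  assert (Hr : 0 <= r) by apply Cmod_ge_0.
  (* [K1] bounds the derivative that the mean value theorem produces in [K2]; each of the two
     applications contributes one factor [r]. *)
  assert (K1 : forall c : C, Cmod c <= 1 -> forall t, 0 <= t <= 1 ->
    Re (c * (Cexp (t * v) - 1)) <= r * exp r).
  { intros c Hc t Ht.
    destruct (Req_dec t 0) as [->|Ht0].
    { replace (0 * v)%C with (RtoC 0) by ring; rewrite Cexp_0.
      replace (c * (1 - 1))%C with (RtoC 0) by ring; simpl.
      pose proof (exp_pos r); nra. }
    destruct (MVT_gen (fun t : R => Re (c * (Cexp (t * v) - 1))) 0 t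
      (fun t : R => Re (c * (v * Cexp (t * v))))) as [s [Hs E]].
    - intros x _; destruct c, v; simpl; auto_derive; auto; unfold Rminus; ring.
    - intros x _; apply continuity_pt_filterlim.
      apply (ex_derive_continuous (V := R_NormedModule)).
      destruct c, v; simpl; auto_derive; auto.
    - rewrite Rmin_left, Rmax_right in Hs by lra.
      replace (0 * v)%C with (RtoC 0) in E by ring; rewrite Cexp_0 in E.
      replace (Re (c * (1 - 1))) with 0 in E by (simpl; ring).
      rewrite Rminus_0_r in E; rewrite E.
      assert (B : Re (c * (v * Cexp (s * v))) <= r * exp r).
      { apply Rle_trans with (1 := Rle_abs _), Rle_trans with (1 := Re_le_Cmod _).
        rewrite !Cmod_mult, Cmod_Cexp; fold r.
        assert (exp (Re (s * v)) <= exp r).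
        { destruct (Rle_lt_dec (Re (s * v)) r) as [[H|H]|H].
          - left; now apply exp_increasing.
          - right; now rewrite H.
          - exfalso; pose proof (Re_le_Cmod v); fold r in H0.
            rewrite re_scal_l in H; unfold Rabs in H0; destruct Rcase_abs; nra. }
        pose proof (exp_pos (Re (s * v))); pose proof (Cmod_ge_0 c).
        apply Rle_trans with (1 * (r * exp (Re (s * v)))); [| nra].
        apply Rmult_le_compat_r; nra. }
      pose proof (exp_pos r); assert (0 <= r * exp r) by nra. nra. }
  assert (K2 : forall c : C, Cmod c <= 1 -> Re (c * (Cexp v - 1 - v)) <= r ^ 2 * exp r).
  { intros c Hc.
    destruct (MVT_gen (fun t : R => Re (c * (Cexp (t * v) - 1 - t * v))) 0 1
      (fun t : R => Re (c * v * (Cexp (t * v) - 1)))) as [s [Hs E]].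
    - intros x _; destruct c, v; simpl; auto_derive; auto; unfold Rminus; ring.
    - intros x _; apply continuity_pt_filterlim.
      apply (ex_derive_continuous (V := R_NormedModule)).
      destruct c, v; simpl; auto_derive; auto.
    - rewrite Rmin_left, Rmax_right in Hs by lra.
      replace (1 * v)%C with v in E by ring.
      replace (0 * v)%C with (RtoC 0) in E by ring; rewrite Cexp_0 in E.
      replace (Re (c * (1 - 1 - 0))) with 0 in E by (simpl; ring).
      rewrite Rminus_0_r, Rminus_0_r, Rmult_1_r in E; rewrite E.
      destruct (Req_dec r 0) as [Hr0|Hr0].
      + assert (v = 0) as -> by now apply Cmod_eq_0.
        replace (c * 0 * (Cexp (s * 0) - 1))%C with (RtoC 0) by ring; simpl.
        rewrite Hr0; simpl; lra.
      + specialize (K1 (c * (v / r))%C).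
        assert (Hrc : RtoC r <> 0) by (intro H; apply Hr0; now apply RtoC_inj).
        assert (Hm : Cmod (c * (v / r)) <= 1).
        { rewrite Cmod_mult, Cmod_div, Cmod_R, Rabs_right by (auto; lra); fold r.
          unfold Rdiv; rewrite Rinv_r, Rmult_1_r; auto. }
        specialize (K1 Hm s Hs).
        replace (c * v * (Cexp (s * v) - 1))%C with (r * (c * (v / r) * (Cexp (s * v) - 1)))%C
          by (field; auto).
        rewrite re_scal_l; nra. }
  set (u := (Cexp v - 1 - v)%C).
  destruct (Ceq_dec u 0) as [->|Hu].
  { rewrite Cmod_0; pose proof (exp_pos r); pose proof (pow2_ge_0 r); nra. }
  assert (Hp := proj1 (Cmod_gt_0 u) Hu).
  assert (Hpc : RtoC (Cmod u) <> 0) by (intro H; apply RtoC_inj in H; lra).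
  (* This multiplier has modulus one and turns [Re (c * u)] into [Cmod u]. *)
  specialize (K2 (Cconj u / Cmod u)%C); fold u in K2.
  replace (Cconj u / Cmod u * u)%C with (RtoC (Cmod u)) in K2.
  - apply K2; rewrite Cmod_div, Cmod_conj, Cmod_R, Rabs_right by (auto; lra).
    unfold Rdiv; rewrite Rinv_r; lra.
  - replace (Cconj u / Cmod u * u)%C with ((u * Cconj u) / Cmod u)%C by (field; auto).
    rewrite <- Cmod2_conj; rewrite RtoC_pow; field; auto.
Qed.

(** The exponential, power series and Mellin integrals all come with an explicit second-order
    remainder; this is how they become differentiable. *)
Lemma cdiff_of_quadratic (f : C -> C) (z l : C) (d M : R) : 0 < d ->
  (forall w, Cmod (w - z) < d -> Cmod (f w - f z - (w - z) * l) <= M * Cmod (w - z) ^ 2) ->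
  cdiff f z l.
Proof.
  intros Hd H.
  exists (fun w => if Ceq_dec w z then l else ((f w - f z) / (w - z))%C).
  split; [| split].
  - apply continuous_C_eps; intros eps Heps.
    apply locally_C_Cmod.
    exists (Rmin d (eps / (Rabs M + 1))).
    assert (HM := Rabs_pos M).
    split; [apply Rmin_glb_lt; auto; apply Rdiv_lt_0_compat; lra |].
    intros w Hw.
    destruct (Ceq_dec z z) as [_|]; [| tauto].
    destruct (Ceq_dec w z) as [E|E].
    + replace (l - l)%C with (RtoC 0) by ring; rewrite Cmod_0; auto.
    + assert (Hn : (w - z)%C <> 0) by now apply Cminus_eq_contra.
      apply Cmod_gt_0 in Hn as Hp.
      replace ((f w - f z) / (w - z) - l)%C with (((f w - f z) - (w - z) * l) / (w - z))%C
        by (field; auto).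
      rewrite Cmod_div; auto.
      apply Rle_lt_trans with ((Rabs M + 1) * Cmod (w - z)).
      * apply Rmult_le_reg_r with (1 := Hp).
        unfold Rdiv; rewrite Rmult_assoc, Rinv_l, Rmult_1_r by lra.
        apply Rle_trans with (1 := H w (Rlt_le_trans _ _ _ Hw (Rmin_l _ _))).
        pose proof (Rle_abs M); nra.
      * assert (Hw2 := Rlt_le_trans _ _ _ Hw (Rmin_r _ _)).
        apply Rmult_lt_compat_r with (r := Rabs M + 1) in Hw2; [| lra].
        unfold Rdiv in Hw2; rewrite Rmult_assoc, Rinv_l in Hw2; lra.
  - destruct (Ceq_dec z z); tauto.
  - intros w; destruct (Ceq_dec w z) as [->|E]; [ring |].
    assert (Hn : (w - z)%C <> 0) by now apply Cminus_eq_contra.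
    field; auto.
Qed.

Lemma cdiff_Cexp (z : C) : cdiff Cexp z (Cexp z).
Proof.
  apply cdiff_of_quadratic with (d := 1) (M := exp (Re z) * exp 1); [lra |].
  intros w Hw.
  replace (Cexp w - Cexp z - (w - z) * Cexp z)%C with (Cexp z * (Cexp (w - z) - 1 - (w - z)))%C.
  2: { replace w with (z + (w - z))%C at 3 by ring; rewrite Cexp_plus; ring. }
  rewrite Cmod_mult, Cmod_Cexp, Rmult_assoc.
  apply Rmult_le_compat_l; [left; apply exp_pos |].
  apply Rle_trans with (1 := Cexp_remainder _).
  rewrite Rmult_comm; apply Rmult_le_compat_r; [apply pow2_ge_0 |].
  left; now apply exp_increasing.
Qed.

(** * Contour integration *)

Definition CI (f : R -> C) (a b : R) : C := RInt (V := C_R_CompleteNormedModule) f a b.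

Definition ex_CI (f : R -> C) (a b : R) : Prop := ex_RInt (V := C_R_NormedModule) f a b.

Lemma norm_C_R (z : C) : norm (V := C_R_NormedModule) z = Cmod z.
Proof.
  unfold norm; simpl; unfold prod_norm, Cmod; f_equal.
  unfold norm; simpl; unfold abs; simpl.
  pose proof (Rsqr_abs (fst z)) as H1; pose proof (Rsqr_abs (snd z)) as H2; unfold Rsqr in *.
  rewrite !Rmult_1_r; congruence.
Qed.

Lemma CI_correct (f : R -> C) (a b : R) : ex_CI f a b ->
  is_RInt (V := C_R_NormedModule) f a b (CI f a b).
Proof. exact (RInt_correct (V := C_R_CompleteNormedModule) f a b). Qed.

Lemma CI_unique (f : R -> C) (a b : R) (l : C) :
  is_RInt (V := C_R_NormedModule) f a b l -> CI f a b = l.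
Proof. exact (is_RInt_unique (V := C_R_CompleteNormedModule) f a b l). Qed.

Lemma ex_CI_continuous (f : R -> C) (a b : R) :
  (forall t, Rmin a b <= t <= Rmax a b -> continuous f t) -> ex_CI f a b.
Proof. exact (ex_RInt_continuous (V := C_R_CompleteNormedModule) f a b). Qed.

Lemma Re_CI (f : R -> C) (a b : R) : ex_CI f a b -> Re (CI f a b) = RInt (fun t => Re (f t)) a b.
Proof.
  intros H; symmetry; apply is_RInt_unique.
  apply (is_RInt_fct_extend_fst (U := R_NormedModule) (V := R_NormedModule)).
  now apply CI_correct.
Qed.

Lemma is_CI_components (f : R -> C) (a b : R) (l : C) :
  is_RInt (fun t => Re (f t)) a b (Re l) -> is_RInt (fun t => Im (f t)) a b (Im l) ->
  is_RInt (V := C_R_NormedModule) f a b l.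
Proof.
  intros H1 H2; destruct l as [l1 l2].
  now apply (is_RInt_fct_extend_pair (U := R_NormedModule) (V := R_NormedModule)).
Qed.

Lemma is_CI_Cmult_l (c : C) (f : R -> C) (a b : R) (l : C) :
  is_RInt (V := C_R_NormedModule) f a b l ->
  is_RInt (V := C_R_NormedModule) (fun t => (c * f t)%C) a b (c * l)%C.
Proof.
  intros H.
  assert (H1 := is_RInt_fct_extend_fst (U := R_NormedModule) (V := R_NormedModule) _ _ _ _ H).
  assert (H2 := is_RInt_fct_extend_snd (U := R_NormedModule) (V := R_NormedModule) _ _ _ _ H).
  apply is_CI_components; simpl.
  - apply (is_RInt_minus (V := R_NormedModule)); now apply (is_RInt_scal (V := R_NormedModule)).
  - apply (is_RInt_plus (V := R_NormedModule)); now apply (is_RInt_scal (V := R_NormedModule)).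
Qed.

Lemma ex_CI_Cmult_l (c : C) (f : R -> C) (a b : R) : ex_CI f a b -> ex_CI (fun t => (c * f t)%C) a b.
Proof. intros [l H]; exists (c * l)%C; now apply is_CI_Cmult_l. Qed.

Lemma CI_Cmult_l (c : C) (f : R -> C) (a b : R) : ex_CI f a b ->
  CI (fun t => (c * f t)%C) a b = (c * CI f a b)%C.
Proof. intros H; apply CI_unique, is_CI_Cmult_l; now apply CI_correct. Qed.

Lemma ex_CI_plus (f g : R -> C) (a b : R) : ex_CI f a b -> ex_CI g a b ->
  ex_CI (fun t => (f t + g t)%C) a b.
Proof. exact (ex_RInt_plus (V := C_R_NormedModule) f g a b). Qed.

Lemma CI_plus (f g : R -> C) (a b : R) : ex_CI f a b -> ex_CI g a b ->
  CI (fun t => (f t + g t)%C) a b = (CI f a b + CI g a b)%C.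
Proof. exact (RInt_plus (V := C_R_CompleteNormedModule) f g a b). Qed.

Lemma CI_minus (f g : R -> C) (a b : R) : ex_CI f a b -> ex_CI g a b ->
  CI (fun t => (f t - g t)%C) a b = (CI f a b - CI g a b)%C.
Proof. exact (RInt_minus (V := C_R_CompleteNormedModule) f g a b). Qed.

Lemma CI_ext (f g : R -> C) (a b : R) :
  (forall t, Rmin a b < t < Rmax a b -> f t = g t) -> CI f a b = CI g a b.
Proof. exact (RInt_ext (V := C_R_CompleteNormedModule) f g a b). Qed.

Lemma CI_Chasles (f : R -> C) (a b c : R) : ex_CI f a b -> ex_CI f b c ->
  (CI f a b + CI f b c)%C = CI f a c.
Proof. exact (RInt_Chasles (V := C_R_CompleteNormedModule) f a b c). Qed.

Lemma CI_const (c : C) (a b : R) : CI (fun _ => c) a b = ((b - a)%R * c)%C.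
Proof.
  unfold CI; rewrite RInt_const.
  change (scal (b - a) c = ((b - a)%R * c)%C); apply scal_R_Cmult.
Qed.

Lemma Cmod_CI_le (f : R -> C) (g : R -> R) (a b : R) : a <= b -> ex_CI f a b -> ex_RInt g a b ->
  (forall t, a <= t <= b -> Cmod (f t) <= g t) -> Cmod (CI f a b) <= RInt g a b.
Proof.
  intros Hab Hf Hg H; rewrite <- norm_C_R.
  apply (norm_RInt_le (V := C_R_NormedModule) f g a b); auto.
  - intros; rewrite norm_C_R; auto.
  - now apply CI_correct.
  - apply (RInt_correct (V := R_CompleteNormedModule)); auto.
Qed.

Lemma Cmod_CI_le_const (f : R -> C) (M a b : R) : a <= b -> ex_CI f a b ->
  (forall t, a <= t <= b -> Cmod (f t) <= M) -> Cmod (CI f a b) <= (b - a) * M.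
Proof.
  intros Hab Hf H; rewrite <- norm_C_R.
  apply (norm_RInt_le_const (V := C_R_NormedModule) f a b); auto.
  - intros; rewrite norm_C_R; auto.
  - now apply CI_correct.
Qed.

Lemma CI_FTC (F f : R -> C) (a b : R) :
  (forall t, Rmin a b <= t <= Rmax a b ->
     is_derive (fun t => Re (F t)) t (Re (f t)) /\ is_derive (fun t => Im (F t)) t (Im (f t))) ->
  (forall t, Rmin a b <= t <= Rmax a b -> continuous f t) ->
  CI f a b = (F b - F a)%C.
Proof.
  intros HF Hf; apply CI_unique, is_CI_components; simpl.
  - apply (is_RInt_derive (V := R_CompleteNormedModule) (fun t => Re (F t))).
    + intros; now apply HF.
    + intros; apply continuous_Re; auto.
  - apply (is_RInt_derive (V := R_CompleteNormedModule) (fun t => Im (F t))).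
    + intros; now apply HF.
    + intros; apply continuous_Im; auto.
Qed.

Lemma CI_affine (u v : C) (a b : R) :
  CI (fun t : R => (u + v * t)%C) a b = (u * (b - a) + v * (b * b - a * a) / 2)%C.
Proof.
  rewrite (CI_FTC (fun t : R => (u * t + v * t * t / 2)%C)).
  - field; intro H; apply RtoC_inj in H; lra.
  - intros t _; destruct u as [u1 u2], v as [v1 v2]; simpl; split; auto_derive; auto; unfold Rdiv; field.
  - intros t _; apply continuous_Cplus; [apply continuous_const |].
    apply continuous_Cmult; [apply continuous_const | apply continuous_RtoC, continuous_id].
Qed.

Lemma continuous_pair_C (f g : R -> R) (t : R) : continuous f t -> continuous g t ->
  continuous (fun t => ((f t, g t) : C)) t.
Proof. intros; apply continuous_C; auto. Qed.

(** * Goursat's theorem on rectangles *)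

Definition rect_int (k : C -> C) (a b c d : R) : C :=
  (CI (fun t => k (t, c)) a b - CI (fun t => k (t, d)) a b
   + Ci * (CI (fun t => k (b, t)) c d - CI (fun t => k (a, t)) c d))%C.

Section RectInt.
Variable k : C -> C.

Definition cont_rect (a b c d : R) : Prop :=
  forall x y, a <= x <= b -> c <= y <= d -> continuous k ((x, y) : C).

Lemma ex_CI_horizontal a b c d x1 x2 y : cont_rect a b c d ->
  a <= x1 <= b -> a <= x2 <= b -> c <= y <= d -> ex_CI (fun t => k (t, y)) x1 x2.
Proof.
  intros H H1 H2 Hy; apply ex_CI_continuous; intros t Ht.
  apply (continuous_comp (fun t : R => ((t, y) : C)) k).
  - apply continuous_pair_C; [apply continuous_id | apply continuous_const].
  - apply H; auto; unfold Rmin, Rmax in Ht; destruct Rle_dec; lra.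
Qed.

Lemma ex_CI_vertical a b c d x y1 y2 : cont_rect a b c d ->
  a <= x <= b -> c <= y1 <= d -> c <= y2 <= d -> ex_CI (fun t => k (x, t)) y1 y2.
Proof.
  intros H H1 H2 Hy; apply ex_CI_continuous; intros t Ht.
  apply (continuous_comp (fun t : R => ((x, t) : C)) k).
  - apply continuous_pair_C; [apply continuous_const | apply continuous_id].
  - apply H; auto; unfold Rmin, Rmax in Ht; destruct Rle_dec; lra.
Qed.

Lemma rect_int_quarter a m b c n d : cont_rect a b c d -> a <= m <= b -> c <= n <= d ->
  rect_int k a b c d = (rect_int k a m c n + rect_int k m b c n
                        + rect_int k a m n d + rect_int k m b n d)%C.
Proof.
  intros H Hm Hn; unfold rect_int.
  assert (X : forall y, c <= y <= d ->
    (CI (fun t => k (t, y)) a m + CI (fun t => k (t, y)) m b)%C = CI (fun t => k (t, y)) a b).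
  { intros y Hy; apply CI_Chasles; apply (ex_CI_horizontal a b c d); auto; lra. }
  assert (Y : forall x, a <= x <= b ->
    (CI (fun t => k (x, t)) c n + CI (fun t => k (x, t)) n d)%C = CI (fun t => k (x, t)) c d).
  { intros x Hx; apply CI_Chasles; apply (ex_CI_vertical a b c d); auto; lra. }
  rewrite <- (X c), <- (X d), <- (Y a), <- (Y b) by lra.
  ring.
Qed.

Lemma rect_int_bound a b c d M : cont_rect a b c d -> a <= b -> c <= d ->
  (forall x y, a <= x <= b -> c <= y <= d -> Cmod (k (x, y)) <= M) ->
  Cmod (rect_int k a b c d) <= 2 * ((b - a) + (d - c)) * M.
Proof.
  intros H Hab Hcd HM; unfold rect_int.
  assert (B1 : forall y, c <= y <= d -> Cmod (CI (fun t => k (t, y)) a b) <= (b - a) * M).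
  { intros y Hy; apply Cmod_CI_le_const; auto.
    apply (ex_CI_horizontal a b c d); auto; lra. }
  assert (B2 : forall x, a <= x <= b -> Cmod (CI (fun t => k (x, t)) c d) <= (d - c) * M).
  { intros y Hy; apply Cmod_CI_le_const; auto.
    apply (ex_CI_vertical a b c d); auto; lra. }
  apply Rle_trans with (1 := Cmod_triangle _ _).
  rewrite Cmod_mult, Cmod_Ci, Rmult_1_l.
  pose proof (Cmod_triangle_minus (CI (fun t => k (t, c)) a b) (CI (fun t => k (t, d)) a b)).
  pose proof (Cmod_triangle_minus (CI (fun t => k (b, t)) c d) (CI (fun t => k (a, t)) c d)).
  pose proof (B1 c ltac:(lra)); pose proof (B1 d ltac:(lra)).
  pose proof (B2 a ltac:(lra)); pose proof (B2 b ltac:(lra)); lra.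
Qed.

End RectInt.

(** An affine function has a primitive, so its integral round a rectangle vanishes. In Goursat's
    argument this removes the linearisation of [k] at the limit point. *)
Lemma rect_int_affine_minus (k : C -> C) (u v : C) a b c d :
  cont_rect k a b c d -> a <= b -> c <= d ->
  rect_int (fun w => (k w - (u + v * w))%C) a b c d = rect_int k a b c d.
Proof.
  intros H Hab Hcd; unfold rect_int.
  assert (E1 : forall y, c <= y <= d -> CI (fun t => (k (t, y) - (u + v * (t, y)))%C) a b
    = (CI (fun t => k (t, y)) a b
       - ((u + v * Ci * y) * (b - a) + v * (b * b - a * a) / 2))%C).
  { intros y Hy; rewrite <- CI_affine, <- CI_minus.
    - apply CI_ext; intros t _; f_equal; destruct u, v; apply C_ext; simpl; ring.
    - apply (ex_CI_horizontal k a b c d); auto; lra.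
    - apply ex_CI_continuous; intros t _; apply continuous_Cplus; [apply continuous_const |].
      apply continuous_Cmult; [apply continuous_const | apply continuous_RtoC, continuous_id]. }
  assert (E2 : forall x, a <= x <= b -> CI (fun t => (k (x, t) - (u + v * (x, t)))%C) c d
    = (CI (fun t => k (x, t)) c d
       - ((u + v * x) * (d - c) + v * Ci * (d * d - c * c) / 2))%C).
  { intros y Hy; rewrite <- CI_affine, <- CI_minus.
    - apply CI_ext; intros t _; f_equal; destruct u, v; apply C_ext; simpl; ring.
    - apply (ex_CI_vertical k a b c d); auto; lra.
    - apply ex_CI_continuous; intros t _; apply continuous_Cplus; [apply continuous_const |].
      apply continuous_Cmult; [apply continuous_const | apply continuous_RtoC, continuous_id]. }
  rewrite !E1, !E2 by lra.
  assert (HC : (Ci * Ci = - (1))%C) by (apply C_ext; simpl; ring).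
  assert (H2 : RtoC 2 <> 0) by (intro E; apply RtoC_inj in E; lra).
  field; auto.
Qed.

Section Goursat.
Variables (k : C -> C) (a b c d : R).
Hypothesis Hab : a <= b.
Hypothesis Hcd : c <= d.
Hypothesis Hk : forall x y, a <= x <= b -> c <= y <= d -> exists l, cdiff k (x, y) l.

Definition sub_width (n : nat) : R := (b - a) / 2 ^ n.
Definition sub_height (n : nat) : R := (d - c) / 2 ^ n.
Definition sub_rect_int (p : R * R) (n : nat) : C :=
  rect_int k (fst p) (fst p + sub_width n) (snd p) (snd p + sub_height n).
Definition large_at (eta : R) (p : R * R) (n : nat) : Prop := eta / 4 ^ n <= Cmod (sub_rect_int p n).

(** The tests make the bisection an explicit function of the corner. The fourth quarter is taken
    without a test: if the other three are below the threshold, it cannot be, because the four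
    integrals add up to that of the whole. *)
Definition choose_quarter (eta : R) (n : nat) (p : R * R) : R * R :=
  let x := fst p in let y := snd p in
  let x' := x + sub_width (S n) in let y' := y + sub_height (S n) in
  if Rle_dec (eta / 4 ^ S n) (Cmod (sub_rect_int (x, y) (S n))) then (x, y)
  else if Rle_dec (eta / 4 ^ S n) (Cmod (sub_rect_int (x', y) (S n))) then (x', y)
  else if Rle_dec (eta / 4 ^ S n) (Cmod (sub_rect_int (x, y') (S n))) then (x, y')
  else (x', y').

Definition sub_corner (eta : R) : nat -> R * R := nat_rect (fun _ => (R * R)%type) (a, c) (choose_quarter eta).

Lemma cont_rect_of_cdiff : cont_rect k a b c d.
Proof. intros x y Hx Hy; destruct (Hk x y Hx Hy) as [l Hl]; now apply cdiff_continuous with l. Qed.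

Lemma sub_width_S n : sub_width n = sub_width (S n) + sub_width (S n).
Proof. unfold sub_width; simpl; field; apply pow_nonzero; lra. Qed.

Lemma sub_height_S n : sub_height n = sub_height (S n) + sub_height (S n).
Proof. unfold sub_height; simpl; field; apply pow_nonzero; lra. Qed.

Lemma sub_width_pos n : 0 <= sub_width n.
Proof. unfold sub_width; apply Rmult_le_pos; [lra | left; apply Rinv_0_lt_compat, pow_lt; lra]. Qed.

Lemma sub_height_pos n : 0 <= sub_height n.
Proof. unfold sub_height; apply Rmult_le_pos; [lra | left; apply Rinv_0_lt_compat, pow_lt; lra]. Qed.

Definition sub_rect_inside (p : R * R) (n : nat) : Prop :=
  a <= fst p /\ fst p + sub_width n <= b /\ c <= snd p /\ snd p + sub_height n <= d.

Lemma choose_quarter_large eta n p : sub_rect_inside p n -> large_at eta p n -> large_at eta (choose_quarter eta n p) (S n).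
Proof.
  destruct p as [x y]; unfold sub_rect_inside, large_at; simpl fst; simpl snd; intros [H1 [H2 [H3 H4]]] Hb.
  unfold choose_quarter; simpl fst; simpl snd.
  destruct Rle_dec as [|N1]; [simpl; auto |].
  destruct Rle_dec as [|N2]; [simpl; auto |].
  destruct Rle_dec as [|N3]; [simpl; auto |].
  apply Rnot_lt_le; intro N4; apply (Rle_not_lt _ _ Hb).
  pose proof (sub_width_pos (S n)) as W; pose proof (sub_height_pos (S n)) as V.
  unfold sub_rect_int in *; simpl fst in *; simpl snd in *; rewrite (sub_width_S n), (sub_height_S n) in *.
  rewrite (rect_int_quarter k x (x + sub_width (S n)) (x + (sub_width (S n) + sub_width (S n))) y
    (y + sub_height (S n)) (y + (sub_height (S n) + sub_height (S n)))); try lra.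
  2: { intros u v Hu Hv; apply cont_rect_of_cdiff; lra. }
  apply Rle_lt_trans with (1 := Cmod_triangle _ _).
  pose proof (Cmod_triangle (rect_int k x (x + sub_width (S n)) y (y + sub_height (S n)))
    (rect_int k (x + sub_width (S n)) (x + (sub_width (S n) + sub_width (S n))) y (y + sub_height (S n)))).
  pose proof (Cmod_triangle (rect_int k x (x + sub_width (S n)) y (y + sub_height (S n)) +
    rect_int k (x + sub_width (S n)) (x + (sub_width (S n) + sub_width (S n))) y (y + sub_height (S n)))
    (rect_int k x (x + sub_width (S n)) (y + sub_height (S n)) (y + (sub_height (S n) + sub_height (S n))))).
  rewrite !Rplus_assoc in *.
  replace (eta / 4 ^ n) with (4 * (eta / 4 ^ S n)) by (simpl; field; apply pow_nonzero; lra).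
  lra.
Qed.

Lemma corner_step eta n : sub_rect_inside (sub_corner eta n) n ->
  (fst (sub_corner eta n) <= fst (sub_corner eta (S n)) <= fst (sub_corner eta n) + sub_width (S n)) /\
  (snd (sub_corner eta n) <= snd (sub_corner eta (S n)) <= snd (sub_corner eta n) + sub_height (S n)) /\
  sub_rect_inside (sub_corner eta (S n)) (S n).
Proof.
  simpl sub_corner; fold (sub_corner eta n); destruct (sub_corner eta n) as [x y].
  unfold sub_rect_inside; simpl fst; simpl snd; intros [H1 [H2 [H3 H4]]].
  pose proof (sub_width_pos (S n)) as W; pose proof (sub_height_pos (S n)) as V.
  rewrite (sub_width_S n) in H2; rewrite (sub_height_S n) in H4.
  unfold choose_quarter; simpl fst; simpl snd.
  destruct Rle_dec; [| destruct Rle_dec; [| destruct Rle_dec]]; simpl fst; simpl snd; repeat split; lra.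
Qed.

Lemma corner_inside eta n : sub_rect_inside (sub_corner eta n) n.
Proof.
  induction n; [| now apply corner_step].
  unfold sub_rect_inside, sub_width, sub_height; simpl; lra.
Qed.

Lemma nested_limit (u w : nat -> R) (p : R) : (forall n, w n = p / 2 ^ n) ->
  (forall n, u n <= u (S n) <= u n + w (S n)) -> 
  exists x, forall n, u n <= x <= u n + w n.
Proof.
  intros Hw Hu.
  assert (Hww : forall n, w n = w (S n) + w (S n)).
  { intros n; rewrite !Hw; simpl; field; apply pow_nonzero; lra. }
  assert (Hlim : is_lim_seq w 0).
  { apply is_lim_seq_ext with (fun n => p * (/ 2) ^ n).
    - intros n; rewrite Hw, pow_inv; auto.
    - replace (Finite 0) with (Rbar_mult p 0) by (simpl; f_equal; ring).
      apply is_lim_seq_scal_l, is_lim_seq_geom; rewrite Rabs_right; lra. }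
  assert (Hinc : forall n, u n <= u (S n)) by (intros; apply Hu).
  assert (Hdec : forall n, u (S n) + w (S n) <= u n + w n).
  { intros n; pose proof (Hu n); rewrite (Hww n); lra. }
  assert (Hp : forall n, 0 <= w n).
  { intros n; pose proof (Hu n); rewrite Hww; lra. }
  assert (Hub : forall n, u n <= u O + w O).
  { intros n; assert (u n + w n <= u O + w O); [| pose proof (Hp n); lra].
    induction n; [lra | pose proof (Hdec n); lra]. }
  destruct (ex_finite_lim_seq_incr u (u O + w O) Hinc Hub) as [x Hx].
  exists x; intros n; split.
  - apply (is_lim_seq_incr_compare u x Hx Hinc).
  - apply (is_lim_seq_decr_compare (fun n => u n + w n) x); auto.
    replace (Finite x) with (Finite (x + 0)) by (f_equal; ring).
    apply is_lim_seq_plus'; auto.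
Qed.

Theorem goursat_rectangle : rect_int k a b c d = 0.
Proof.
  destruct (Ceq_dec (rect_int k a b c d) 0) as [E|E]; auto.
  exfalso; apply Cmod_gt_0 in E; set (eta := Cmod (rect_int k a b c d)) in E.
  assert (Hbig : forall n, large_at eta (sub_corner eta n) n).
  { induction n.
    - unfold large_at, sub_rect_int, sub_width, sub_height; simpl.
      replace (a + (b - a) / 1) with b by field; replace (c + (d - c) / 1) with d by field.
      fold eta; lra.
    - apply choose_quarter_large; auto; apply corner_inside. }
  destruct (nested_limit (fun n => fst (sub_corner eta n)) sub_width (b - a)) as [x Hx]; auto.
  { intros n; apply corner_step, corner_inside. }
  destruct (nested_limit (fun n => snd (sub_corner eta n)) sub_height (d - c)) as [y Hy]; auto.
  { intros n; apply corner_step, corner_inside. }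
  assert (I0 := corner_inside eta O); unfold sub_rect_inside in I0.
  assert (Hxab : a <= x <= b) by (specialize (Hx O); simpl in *; unfold sub_width in *; simpl in *; lra).
  assert (Hycd : c <= y <= d) by (specialize (Hy O); simpl in *; unfold sub_height in *; simpl in *; lra).
  destruct (Hk x y Hxab Hycd) as [l [phi [Hc [Hl He]]]].
  set (s := (b - a) + (d - c)).
  assert (Hs : 0 <= s) by (unfold s; lra).
  (* The bisection ends in [eta <= 2 * eps * s ^ 2], which this value makes impossible; the [+ 1]
     covers a degenerate rectangle. *)
  set (eps := eta / (4 * (s * s + 1))).
  assert (Heps : 0 < eps) by (apply Rdiv_lt_0_compat; nra).
  apply continuous_C_eps with (eps := eps) in Hc; auto.
  apply locally_C_Cmod in Hc; destruct Hc as [dl [Hdl Hphi]].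
  assert (exists n, s / 2 ^ n < dl) as [n Hn].
  { destruct (pow_lt_1_zero (/ 2)) with (y := dl / (s + 1)) as [N HN].
    - rewrite Rabs_right; lra.
    - apply Rdiv_lt_0_compat; lra.
    - exists N; specialize (HN N (Nat.le_refl N)).
      rewrite Rabs_right in HN by (apply Rle_ge, pow_le; lra).
      rewrite pow_inv in HN.
      apply Rle_lt_trans with ((s + 1) * / 2 ^ N).
      + apply Rmult_le_compat_r; [left; apply Rinv_0_lt_compat, pow_lt |]; lra.
      + apply Rmult_lt_compat_l with (r := s + 1) in HN; [| lra].
        replace ((s + 1) * (dl / (s + 1))) with dl in HN by (field; lra); auto. }
  specialize (Hx n); specialize (Hy n); specialize (Hbig n).
  assert (In := corner_inside eta n); unfold sub_rect_inside in In.
  unfold large_at, sub_rect_int in Hbig; destruct (sub_corner eta n) as [x0 y0]; simpl fst in *; simpl snd in *.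
  pose proof (sub_width_pos n) as Wp; pose proof (sub_height_pos n) as Hp.
  assert (Ewh : sub_width n + sub_height n = s / 2 ^ n) by (unfold sub_width, sub_height, s; field; apply pow_nonzero; lra).
  assert (Hcont : cont_rect k x0 (x0 + sub_width n) y0 (y0 + sub_height n)).
  { intros u v Hu Hv; apply cont_rect_of_cdiff; lra. }
  rewrite <- (rect_int_affine_minus k (k (x, y) - l * (x, y)) l) in Hbig; auto; try lra.
  assert (Hcont2 : cont_rect (fun w => (k w - (k (x, y) - l * (x, y) + l * w))%C)
    x0 (x0 + sub_width n) y0 (y0 + sub_height n)).
  { intros u v Hu Hv; apply continuous_Cminus; [now apply Hcont |].
    apply continuous_Cplus; [apply continuous_const |].
    apply continuous_Cmult; [apply continuous_const | apply continuous_id]. }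
  assert (B := rect_int_bound _ _ _ _ _ (eps * (sub_width n + sub_height n)) Hcont2
     ltac:(lra) ltac:(lra)).
  assert (Hpt : forall u v, x0 <= u <= x0 + sub_width n -> y0 <= v <= y0 + sub_height n ->
     Cmod (k (u, v) - (k (x, y) - l * (x, y) + l * (u, v))) <= eps * (sub_width n + sub_height n)).
  { intros u v Hu Hv; rewrite (He (u, v)), <- Hl.
    replace (k (x, y) + phi (u, v) * ((u, v) - (x, y)) -
      (k (x, y) - phi (x, y) * (x, y) + phi (x, y) * (u, v)))%C
      with ((phi (u, v) - phi (x, y)) * ((u, v) - (x, y)))%C by ring.
    assert (Hd : Cmod ((u, v) - (x, y)) <= sub_width n + sub_height n).
    { apply Rle_trans with (1 := Cmod_le_Re_Im _); simpl.
      apply Rplus_le_compat; apply Rabs_le; lra. }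
    rewrite Cmod_mult; apply Rmult_le_compat; try apply Cmod_ge_0; auto.
    left; apply Hphi; lra. }
  specialize (B Hpt).
  assert (Hfin : eta / 4 ^ n <= 2 * eps * (s / 2 ^ n) ^ 2).
  { apply Rle_trans with (1 := Hbig), Rle_trans with (1 := B); rewrite <- Ewh.
    right; ring. }
  replace (4 ^ n) with ((2 ^ n) ^ 2) in Hfin.
  2: { rewrite <- pow_mult, Nat.mul_comm, pow_mult; f_equal; ring. }
  assert (P : 0 < 2 ^ n) by (apply pow_lt; lra).
  apply Rmult_le_compat_r with (r := (2 ^ n) ^ 2) in Hfin; [| apply pow2_ge_0].
  replace (eta / (2 ^ n) ^ 2 * (2 ^ n) ^ 2) with eta in Hfin by (field; lra).
  replace (2 * eps * (s / 2 ^ n) ^ 2 * (2 ^ n) ^ 2) with (2 * eps * s ^ 2) in Hfin by (field; lra).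
  unfold eps in Hfin.
  replace (2 * (eta / (4 * (s * s + 1))) * s ^ 2) with (eta * (2 * (s * s) / (4 * (s * s + 1)))) in Hfin by (field; nra).
  assert (2 * (s * s) / (4 * (s * s + 1)) < 1).
  { apply Rmult_lt_reg_r with (4 * (s * s + 1)); [nra |].
    unfold Rdiv; rewrite Rmult_assoc, Rinv_l; nra. }
  nra.
Qed.

End Goursat.

(** * Fourier coefficients on circles *)

Definition cis (t : R) : C := (cos t, sin t).

Lemma cis_plus s t : cis (s + t) = (cis s * cis t)%C.
Proof. unfold cis; apply C_ext; simpl; rewrite ?cos_plus, ?sin_plus; ring. Qed.

Lemma cis_0 : cis 0 = 1.
Proof. unfold cis; rewrite cos_0, sin_0; reflexivity. Qed.

Lemma Cmod_cis t : Cmod (cis t) = 1.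
Proof.
  unfold Cmod, cis; simpl fst; simpl snd.
  pose proof (sin2_cos2 t) as H; unfold Rsqr in H.
  replace (cos t ^ 2 + sin t ^ 2) with 1 by (simpl; lra); apply sqrt_1.
Qed.

Lemma cis_neq_0 t : cis t <> 0.
Proof. apply Cmod_gt_0; rewrite Cmod_cis; lra. Qed.

Lemma cis_opp t : cis (- t) = (/ cis t)%C.
Proof.
  assert (H : (cis (- t) * cis t)%C = 1) by (rewrite <- cis_plus, Rplus_opp_l; apply cis_0).
  pose proof (cis_neq_0 t).
  transitivity (cis (- t) * cis t / cis t)%C; [field; auto | rewrite H; field; auto].
Qed.

Lemma cis_INR_mult n t : cis (INR n * t) = (cis t ^ n)%C.
Proof.
  induction n; [simpl; rewrite Rmult_0_l; apply cis_0 |].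
  rewrite S_INR, Rmult_plus_distr_r, Rmult_1_l, cis_plus, IHn; simpl; ring.
Qed.

Lemma cis_2PI_mult (m : Z) : cis (IZR m * (2 * PI)) = 1.
Proof.
  assert (H : cis (2 * PI) = 1) by (unfold cis; rewrite cos_2PI, sin_2PI; reflexivity).
  assert (N : forall n, cis (INR n * (2 * PI)) = 1).
  { intros n; rewrite cis_INR_mult, H; apply Cpow_1_l. }
  destruct (Z_lt_le_dec m 0) as [Hm|Hm].
  - replace (IZR m * (2 * PI)) with (- (INR (Z.to_nat (- m)) * (2 * PI))).
    + rewrite cis_opp, N; field.
    + rewrite INR_IZR_INZ, Z2Nat.id, opp_IZR by lia; ring.
  - rewrite <- (Z2Nat.id m) by lia; rewrite <- INR_IZR_INZ; apply N.
Qed.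

Lemma cis_period t : cis (t + 2 * PI) = cis t.
Proof.
  rewrite cis_plus; replace (2 * PI) with (IZR 1 * (2 * PI)) by ring.
  rewrite cis_2PI_mult; ring.
Qed.

Lemma Cexp_cis (x y : R) : Cexp (x, y) = (exp x * cis y)%C.
Proof. apply C_ext; simpl; ring. Qed.

Lemma continuous_cis {U : UniformSpace} (f : U -> R) x : continuous f x ->
  continuous (fun y => cis (f y)) x.
Proof.
  intros H; apply continuous_C; simpl; apply continuous_real_comp; auto; auto_derive; auto.
Qed.

Lemma continuous_Rmult_const {U : UniformSpace} (a : R) (f : U -> R) x : continuous f x ->
  continuous (fun y => a * f y) x.
Proof. intros; now apply (continuous_scal_r (V := R_NormedModule)). Qed.

(** This is [2 * PI] times the Fourier coefficient. The index is an integer because the vanishing at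
    negative [m] is what turns a Fourier series into a power series. *)
Definition circle_coef (h : C -> C) (c : C) (m : Z) (r : R) : C :=
  CI (fun t => (h (c + r * cis t) * cis (- (IZR m * t)))%C) 0 (2 * PI).

Lemma continuous_circle (h : C -> C) (c : C) (r t : R) :
  continuous h (c + r * cis t)%C -> continuous (fun t => h (c + r * cis t)%C) t.
Proof.
  intros H; apply (continuous_comp (fun t : R => (c + r * cis t)%C) h); auto.
  apply continuous_Cplus; [apply continuous_const |].
  apply continuous_Cmult; [apply continuous_const | apply continuous_cis, continuous_id].
Qed.

Lemma Cmod_circle (c : C) (r t : R) : 0 <= r -> Cmod ((c + r * cis t) - c) = r.
Proof.
  intros Hr; replace (c + r * cis t - c)%C with (r * cis t)%C by ring.
  rewrite Cmod_mult, Cmod_cis, Cmod_R, Rabs_right; lra.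
Qed.

(* In the coordinate [u = ln r + i t] circles become vertical segments, and the horizontal
   sides of the rectangle cancel by periodicity. *)
Lemma circle_coef_radius (h : C -> C) (c : C) (m : Z) (r1 r2 : R) : 0 < r1 <= r2 ->
  (forall w, Cmod (w - c) <= r2 -> exists l, cdiff h w l) ->
  (circle_coef h c m r1 * exp (- IZR m * ln r1))%C =
  (circle_coef h c m r2 * exp (- IZR m * ln r2))%C.
Proof.
  intros [H1 H12] Hh.
  set (k := fun u : C => (h (c + Cexp u) * Cexp (- IZR m * u))%C).
  assert (Hln : ln r1 <= ln r2) by (destruct H12 as [H|H]; [left; now apply ln_increasing | right; now f_equal]).
  assert (HPI := PI_RGT_0).
  assert (HG : rect_int k (ln r1) (ln r2) 0 (2 * PI) = 0).
  { apply goursat_rectangle; auto; [lra |].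
    intros x y Hx _; destruct (Hh (c + Cexp (x, y))%C) as [l Hl].
    - replace (c + Cexp (x, y) - c)%C with (Cexp (x, y)) by ring.
      rewrite Cmod_Cexp; simpl; rewrite <- (exp_ln r2) by lra.
      destruct (proj2 Hx) as [H|H]; [left; now apply exp_increasing | right; now f_equal].
    - eexists; unfold k; apply cdiff_mult.
      + apply (cdiff_comp h (fun u => (c + Cexp u)%C)); [exact Hl |].
        apply cdiff_plus; [apply cdiff_const | apply cdiff_Cexp].
      + apply (cdiff_comp Cexp (fun u => (- IZR m * u)%C)); [apply cdiff_Cexp |].
        apply cdiff_mult; [apply cdiff_const | apply cdiff_id]. }
  assert (Ek : forall x y, k (x, y)
    = (h (c + exp x * cis y) * (exp (- IZR m * x) * cis (- (IZR m * y))))%C).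
  { intros x y; unfold k; rewrite Cexp_cis; f_equal.
    replace (- IZR m * (x, y))%C with ((- IZR m * x, - (IZR m * y)) : C).
    - apply Cexp_cis.
    - apply C_ext; simpl; ring. }
  assert (EV : forall r, 0 < r <= r2 ->
    CI (fun t => k (ln r, t)) 0 (2 * PI) = (circle_coef h c m r * exp (- IZR m * ln r))%C).
  { intros r Hr; unfold circle_coef; rewrite Cmult_comm, <- CI_Cmult_l.
    - apply CI_ext; intros t _; rewrite Ek, exp_ln by lra; ring.
    - apply ex_CI_continuous; intros t _; apply continuous_Cmult.
      + apply continuous_circle.
        destruct (Hh (c + r * cis t)%C) as [l Hl]; [rewrite Cmod_circle; lra |].
        now apply cdiff_continuous with l.
      + apply continuous_cis, (continuous_opp (V := R_NormedModule)).
        apply continuous_Rmult_const, continuous_id. }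
  unfold rect_int in HG.
  rewrite (CI_ext (fun t => k (t, 2 * PI)) (fun t => k (t, 0))) in HG.
  2: { intros t _; rewrite !Ek, Rmult_0_r, Ropp_0, cis_opp, cis_2PI_mult, cis_0.
       replace (2 * PI) with (0 + 2 * PI) by ring; rewrite cis_period, cis_0; field. }
  rewrite !EV in HG by lra.
  assert (HC : Ci <> 0) by apply Ci_nz.
  set (A := (circle_coef h c m r1 * exp (- IZR m * ln r1))%C) in *.
  set (B := (circle_coef h c m r2 * exp (- IZR m * ln r2))%C) in *.
  set (D := CI (fun t => k (t, 0)) (ln r1) (ln r2)) in *.
  assert (HBA : (Ci * (B - A))%C = 0) by (rewrite <- HG; ring).
  apply Ceq_minus.
  transitivity (- (Ci * (B - A)) / Ci)%C; [field; auto | rewrite HBA; field; auto].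
Qed.

Lemma CI_period_shift (f : R -> C) (T a : R) : (forall t, continuous f t) ->
  (forall t, f (t + T) = f t) -> CI f a (a + T) = CI f 0 T.
Proof.
  intros Hc Hp.
  assert (Hex : forall x y, ex_CI f x y) by (intros; apply ex_CI_continuous; auto).
  assert (Hs : CI f T (a + T) = CI f 0 a).
  { unfold CI.
    replace T with (1 * 0 + T) at 1 by ring; replace (a + T) with (1 * a + T) by ring.
    rewrite <- (RInt_comp_lin (V := C_R_CompleteNormedModule) f 1 T 0 a).
    - apply CI_ext; intros t _; rewrite Rmult_1_l, Hp; transitivity (1 * f t)%C; [apply scal_R_Cmult | ring].
    - apply Hex. }

  rewrite <- (CI_Chasles f a 0 (a + T)), <- (CI_Chasles f 0 T (a + T)), Hs; auto.
  transitivity (CI f a 0 + CI f 0 a + CI f 0 T)%C; [ring |].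
  rewrite CI_Chasles; auto.
  unfold CI; rewrite RInt_point; apply Cplus_0_l.
Qed.

(** * Uniqueness of Fourier coefficients *)

Section FourierUniqueness.
Variable d : R -> C.
Hypothesis Hd : forall t, continuous d t.
Hypothesis Hper : forall t, d (t + 2 * PI) = d t.
Hypothesis Hcoef : forall m : Z, CI (fun t => (d t * cis (- (IZR m * t)))%C) 0 (2 * PI) = 0.

(** A trigonometric polynomial of degree one with values in [[0, 1]] and maximum [1] at [t0]; its
    powers concentrate at [t0] and take the role of an approximate identity. *)
Definition bump (t0 t : R) : R := (1 + cos (t - t0)) / 2.

Lemma continuous_bump t0 t : continuous (bump t0) t.
Proof.
  apply (ex_derive_continuous (V := R_NormedModule)); unfold bump; auto_derive; auto.
Qed.

Lemma bump_cis t0 t : RtoC (bump t0 t) =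
  (/ 2 + cis (- t0) / 4 * cis (- (-1 * t)) + cis t0 / 4 * cis (- (1 * t)))%C.
Proof.
  replace (- (-1 * t)) with t by ring; replace (- (1 * t)) with (- t) by ring.
  unfold bump, cis; rewrite !cos_neg, !sin_neg, cos_minus; apply C_ext; simpl; field.
Qed.

(** By [bump_cis], one more factor [bump] only mixes the moments of index [m - 1], [m] and [m + 1],
    so the induction has to be on [N] with all [m] at once. *)
Lemma bump_moment_0 t0 (N : nat) : forall m : Z,
  CI (fun t => (d t * cis (- (IZR m * t)) * (bump t0 t ^ N)%R)%C) 0 (2 * PI) = 0.
Proof.
  assert (HcN : forall n m t, continuous (fun t => (d t * cis (- (IZR m * t)) * (bump t0 t ^ n)%R)%C) t).
  { intros n m t; apply continuous_Cmult; [apply continuous_Cmult; auto |].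
    - apply continuous_cis, (continuous_opp (V := R_NormedModule)).
      apply continuous_Rmult_const, continuous_id.
    - apply continuous_RtoC, (continuous_real_comp _ (fun x => x ^ n)); [apply continuous_bump | auto_derive; auto]. }
  assert (Hex : forall n m, ex_CI (fun t => (d t * cis (- (IZR m * t)) * (bump t0 t ^ n)%R)%C) 0 (2 * PI))
    by (intros; apply ex_CI_continuous; auto).
  induction N; intros m.
  - rewrite <- (Hcoef m); apply CI_ext; intros t _; simpl; ring.
  - transitivity (CI (fun t => (/ 2 * (d t * cis (- (IZR m * t)) * (bump t0 t ^ N)%R) +
      (cis (- t0) / 4 * (d t * cis (- (IZR (m - 1) * t)) * (bump t0 t ^ N)%R) +
       cis t0 / 4 * (d t * cis (- (IZR (m + 1) * t)) * (bump t0 t ^ N)%R)))%C) 0 (2 * PI)).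
    + apply CI_ext; intros t _.
      replace (- (IZR (m - 1) * t)) with (- (IZR m * t) + - (-1 * t)) by (rewrite minus_IZR; ring).
      replace (- (IZR (m + 1) * t)) with (- (IZR m * t) + - (1 * t)) by (rewrite plus_IZR; ring).
      rewrite !cis_plus; simpl pow; rewrite RtoC_mult, (bump_cis t0 t); ring.
    + rewrite CI_plus, CI_plus, !CI_Cmult_l, !IHN; auto; try ring;
        [| | | apply ex_CI_plus]; apply ex_CI_Cmult_l; auto.
Qed.

(** If [d t0] were not zero, the real part of [Cconj (d t0) * d] would be bounded below near [t0],
    and its integral against a high power of [bump] would be dominated by that neighbourhood and be
    positive, although all these integrals vanish. *)
Lemma fourier_unique : forall t0, d t0 = 0.
Proof.
  intros t0; destruct (Ceq_dec (d t0) 0) as [E|E]; auto; exfalso.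
  apply Cmod_gt_0 in E; set (e := d t0) in *.
  assert (HPI := PI_RGT_0).
  set (psi := fun t => Re (Cconj e * d t)).
  assert (Hpsi : forall t, continuous psi t).
  { intros t; apply continuous_Re, continuous_Cmult; auto; apply continuous_const. }
  set (s := Cmod e ^ 2 / 2).
  assert (Hs : 0 < s) by (unfold s; simpl; nra).
  destruct (proj1 (continuous_C_eps d t0) (Hd t0) (Cmod e / 2) ltac:(lra)) as [dl0 Hdl0].
  set (dl := Rmin (dl0 / 2) (PI / 2)).
  assert (Hdl : 0 < dl) by (apply Rmin_glb_lt; [pose proof (cond_pos dl0) |]; lra).
  assert (HdlPI : dl <= PI / 2) by apply Rmin_r.
  assert (Hnear : forall t, Rabs (t - t0) <= dl -> s <= psi t).
  { intros t Ht; assert (Hb : Cmod (d t - d t0) < Cmod e / 2).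
    { apply Hdl0; unfold ball; simpl; unfold AbsRing_ball, abs, minus, plus, opp; simpl.
      apply Rle_lt_trans with (1 := Ht).
      apply Rle_lt_trans with (1 := Rmin_l _ _); pose proof (cond_pos dl0); lra. }
    fold e in Hb; unfold psi.
    replace (Cconj e * d t)%C with (e * Cconj e + Cconj e * (d t - e))%C by ring.
    rewrite <- Cmod2_conj, re_plus, re_RtoC.
    assert (B := Re_le_Cmod (Cconj e * (d t - e))).
    rewrite Cmod_mult, Cmod_conj in B; apply Rabs_le_between in B.
    assert (Cmod e * Cmod (d t - e) <= Cmod e * (Cmod e / 2)) by (apply Rmult_le_compat_l; lra).
    unfold s; lra. }
  destruct (ex_RInt_ub (V := R_NormedModule) psi (t0 - PI) (t0 + PI)) as [M HM].
  { apply (ex_RInt_continuous (V := R_CompleteNormedModule)); auto. }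
  rewrite Rmin_left, Rmax_right in HM by lra.
  assert (HM0 : 0 <= M).
  { apply Rle_trans with (norm (psi t0)); [apply norm_ge_0 | apply HM; lra]. }
  (* Values of [bump] at distance [dl / 2] and [dl] from [t0]. The inner interval contributes at
     least [dl * s * q1 ^ N], the outer part at least [- 2 * PI * M * q2 ^ N], and [q2 < q1] decides
     for large [N]. *)
  set (q1 := (1 + cos (dl / 2)) / 2); set (q2 := (1 + cos dl) / 2).
  assert (Hq2 : 0 < q2).
  { unfold q2; assert (0 <= cos dl) by (apply cos_ge_0; lra); lra. }
  assert (Hq : q2 < q1).
  { unfold q1, q2; assert (cos dl < cos (dl / 2)) by (apply cos_decreasing_1; lra); lra. }
  assert (Hcos : forall x y, 0 <= x -> x <= Rabs y -> Rabs y <= PI -> cos y <= cos x).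
  { intros x y Hx Hxy Hy; replace (cos y) with (cos (Rabs y)).
    - apply cos_decr_1; lra.
    - unfold Rabs; destruct Rcase_abs; auto; apply cos_neg. }
  assert (Hbp : forall t, 0 <= bump t0 t) by (intros; unfold bump; pose proof (COS_bound (t - t0)); lra).
  assert (HI : forall N a b, ex_RInt (fun t => psi t * bump t0 t ^ N) a b).
  { intros N a b; apply (ex_RInt_continuous (V := R_CompleteNormedModule)); intros t _.
    apply (continuous_mult (K := R_AbsRing)); auto.
    apply (continuous_real_comp _ (fun x => x ^ N)); [apply continuous_bump | auto_derive; auto]. }
  assert (HZ : forall N, RInt (fun t => psi t * bump t0 t ^ N) (t0 - PI) (t0 + PI) = 0).
  { intros N.
    set (g := fun t => (Cconj e * (d t * (bump t0 t ^ N)%R))%C).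
    assert (Hg : forall t, continuous g t).
    { intros t; apply continuous_Cmult; [apply continuous_const |]; apply continuous_Cmult; auto.
      apply continuous_RtoC, (continuous_real_comp _ (fun x => x ^ N)); [apply continuous_bump | auto_derive; auto]. }
    assert (E1 : CI g (t0 - PI) (t0 + PI) = 0).
    { replace (t0 + PI) with (t0 - PI + 2 * PI) by ring.
      rewrite CI_period_shift; auto.
      - unfold g; rewrite CI_Cmult_l.
        + rewrite <- (Cmult_0_r (Cconj e)); f_equal; rewrite <- (bump_moment_0 t0 N 0).
          apply CI_ext; intros t _; rewrite Rmult_0_l, Ropp_0, cis_0; ring.
        + apply ex_CI_continuous; intros t _; apply continuous_Cmult; auto.
          apply continuous_RtoC, (continuous_real_comp _ (fun x => x ^ N)); [apply continuous_bump | auto_derive; auto].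
      - intros t; unfold g, bump; rewrite Hper.
        replace (t + 2 * PI - t0) with (t - t0 + 2 * PI) by ring; now rewrite cos_plus, cos_2PI, sin_2PI, Rmult_1_r, Rmult_0_r, Rminus_0_r. }
    apply (f_equal Re) in E1; rewrite Re_CI in E1 by (apply ex_CI_continuous; auto).
    rewrite re_RtoC in E1; rewrite <- E1; apply RInt_ext; intros t _.
    unfold psi, g; rewrite Cmult_assoc, re_scal_r; auto. }
  assert (Hkey : forall N, dl * s * q1 ^ N <= 2 * PI * M * q2 ^ N).
  { intros N.
    (* Between [dl / 2] and [dl] the integrand is nonnegative, so the bound meant for the outer part
       holds there too. *)
    assert (Hfar : forall t, dl / 2 <= Rabs (t - t0) <= PI -> - (M * q2 ^ N) <= psi t * bump t0 t ^ N).
    { intros t Ht; assert (P := pow_le _ N (Hbp t)).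
      destruct (Rle_lt_dec (Rabs (t - t0)) dl) as [H|H].
      - specialize (Hnear t H); assert (0 <= M * q2 ^ N) by (apply Rmult_le_pos; auto; apply pow_le; lra).
        nra.
      - assert (B : bump t0 t ^ N <= q2 ^ N).
        { apply pow_incr; split; auto; unfold bump, q2.
          assert (cos (t - t0) <= cos dl) by (apply Hcos; lra); lra. }
        assert (Ht2 : t0 - PI <= t <= t0 + PI) by (destruct Ht as [_ Ht]; apply Rabs_le_between in Ht; lra).
        specialize (HM t Ht2); unfold norm in HM; simpl in HM; unfold abs in HM; simpl in HM.
        apply Rabs_le_between in HM; nra. }
    specialize (HZ N).
    rewrite <- (RInt_Chasles _ (t0 - PI) (t0 - dl / 2)) in HZ by auto.
    rewrite <- (RInt_Chasles _ (t0 - dl / 2) (t0 + dl / 2) (t0 + PI)) in HZ by auto.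
    unfold plus in HZ; simpl in HZ.
    assert (HA : (PI - dl / 2) * (- (M * q2 ^ N)) <= RInt (fun t => psi t * bump t0 t ^ N) (t0 - PI) (t0 - dl / 2)).
    { replace ((PI - dl / 2) * (- (M * q2 ^ N))) with (RInt (fun _ => - (M * q2 ^ N)) (t0 - PI) (t0 - dl / 2)).
      - apply RInt_le; auto; [lra | apply ex_RInt_const |].
        intros t Ht; apply Hfar; rewrite Rabs_left; lra.
      - rewrite RInt_const; unfold scal; simpl; unfold mult; simpl; ring. }
    assert (HB : dl * (s * q1 ^ N) <= RInt (fun t => psi t * bump t0 t ^ N) (t0 - dl / 2) (t0 + dl / 2)).
    { replace (dl * (s * q1 ^ N)) with (RInt (fun _ => s * q1 ^ N) (t0 - dl / 2) (t0 + dl / 2)).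
      - apply RInt_le; auto; [lra | apply ex_RInt_const |].
        intros t Ht; apply Rmult_le_compat; try lra.
        + apply pow_le; lra.
        + apply Hnear, Rabs_le; lra.
        + apply pow_incr; split; [lra |]; unfold q1, bump.
          assert (cos (dl / 2) <= cos (t - t0)); [| lra].
          assert (Ha : Rabs (t - t0) <= dl / 2) by (apply Rabs_le; lra).
          replace (cos (t - t0)) with (cos (Rabs (t - t0))).
          * apply cos_decr_1; pose proof (Rabs_pos (t - t0)); lra.
          * unfold Rabs; destruct Rcase_abs; auto; apply cos_neg.
      - rewrite RInt_const; unfold scal; simpl; unfold mult; simpl; field. }
    assert (HC : (PI - dl / 2) * (- (M * q2 ^ N)) <= RInt (fun t => psi t * bump t0 t ^ N) (t0 + dl / 2) (t0 + PI)).
    { replace ((PI - dl / 2) * (- (M * q2 ^ N))) with (RInt (fun _ => - (M * q2 ^ N)) (t0 + dl / 2) (t0 + PI)).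
      - apply RInt_le; auto; [lra | apply ex_RInt_const |].
        intros t Ht; apply Hfar; rewrite Rabs_right; lra.
      - rewrite RInt_const; unfold scal; simpl; unfold mult; simpl; ring. }
    assert (0 <= M * q2 ^ N) by (apply Rmult_le_pos; auto; apply pow_le; lra).
    nra. }
  assert (HPM : 0 <= PI * M) by (apply Rmult_le_pos; lra).
  assert (Hdls : 0 < dl * s) by (apply Rmult_lt_0_compat; lra).
  destruct (pow_lt_1_zero (q2 / q1)) with (y := dl * s / (2 * PI * M + 1)) as [N HN].
  - rewrite Rabs_right; [| apply Rle_ge, Rlt_le, Rdiv_lt_0_compat; lra].
    apply Rmult_lt_reg_r with q1; [lra |]; replace (q2 / q1 * q1) with q2 by (field; lra); lra.
  - apply Rdiv_lt_0_compat; lra.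
  - specialize (HN N (Nat.le_refl N)); specialize (Hkey N).
    rewrite Rabs_right in HN by (apply Rle_ge, pow_le, Rlt_le, Rdiv_lt_0_compat; lra).
    unfold Rdiv in HN at 1; rewrite Rpow_mult_distr, pow_inv in HN.
    assert (P1 : 0 < q1 ^ N) by (apply pow_lt; lra).
    apply Rmult_lt_compat_r with (r := q1 ^ N * (2 * PI * M + 1)) in HN; [| apply Rmult_lt_0_compat; lra].
    replace (q2 ^ N * / q1 ^ N * (q1 ^ N * (2 * PI * M + 1))) with ((2 * PI * M + 1) * q2 ^ N) in HN
      by (field; lra).
    replace (dl * s / (2 * PI * M + 1) * (q1 ^ N * (2 * PI * M + 1))) with (dl * s * q1 ^ N) in HN
      by (field; lra).
    assert (0 < q2 ^ N) by (apply pow_lt; lra); nra.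
Qed.

End FourierUniqueness.

(** * Taylor series of entire functions *)

Lemma sum_Sn_C (a : nat -> C) n : sum_n a (S n) = (sum_n a n + a (S n))%C.
Proof. exact (sum_Sn a n). Qed.

Ltac Cring := match goal with |- @eq _ ?a ?b => change (@eq C a b) end; ring.

Lemma sum_n_Cmult_l (c : C) (a : nat -> C) n : sum_n (fun k => (c * a k)%C) n = (c * sum_n a n)%C.
Proof.
  induction n; [now rewrite !sum_O | rewrite !sum_Sn_C, IHn; Cring].
Qed.

(** [Lim_seq] is total, so this is always defined; it is used only for terms dominated by a
    geometric sequence, where [cseries_geom] gives the speed of convergence. *)
Definition cseries (a : nat -> C) : C :=
  (real (Lim_seq (fun n => Re (sum_n a n))), real (Lim_seq (fun n => Im (sum_n a n)))).

(** The explicit Cauchy rate survives the passage [m -> infinity], so it also bounds the distance to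
    the limit. *)
Lemma cauchy_seq_lim (u : nat -> R) (e : nat -> R) : is_lim_seq e 0 ->
  (forall n m, (n <= m)%nat -> Rabs (u m - u n) <= e n) ->
  forall n, Rabs (real (Lim_seq u) - u n) <= e n.
Proof.
  intros He Hu.
  assert (H : ex_finite_lim_seq u).
  { apply ex_lim_seq_cauchy_corr; intros eps.
    apply is_lim_seq_spec in He; destruct (He (pos_div_2 eps)) as [N HN].
    exists N; intros n m Hn Hm.
    pose proof (Hu N n Hn); pose proof (Hu N m Hm); specialize (HN N (Nat.le_refl N)).
    simpl in HN; rewrite Rminus_0_r in HN; apply Rabs_lt_between in HN.
    apply Rabs_le_between in H; apply Rabs_le_between in H0; apply Rabs_lt_between; lra. }
  destruct H as [l Hl]; rewrite (is_lim_seq_unique _ _ Hl); simpl; intros n.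
  assert (L : is_lim_seq (fun m => Rabs (u m - u n)) (Rabs (l - u n))).
  { apply (is_lim_seq_abs (fun m => u m - u n) (l - u n)).
    apply (is_lim_seq_minus' u (fun _ => u n)); auto; apply is_lim_seq_const. }
  apply (is_lim_seq_le_loc (fun m => Rabs (u m - u n)) (fun _ => e n) (Rabs (l - u n)) (e n)); auto.
  - exists n; intros; auto.
  - apply is_lim_seq_const.
Qed.

Lemma is_lim_geom_tail (M q : R) : 0 <= q < 1 -> is_lim_seq (fun n => M * q ^ S n / (1 - q)) 0.
Proof.
  intros Hq; apply is_lim_seq_ext with (fun n => (M * q / (1 - q)) * q ^ n).
  - intros n; simpl; field; lra.
  - replace (Finite 0) with (Rbar_mult (M * q / (1 - q)) 0) by (simpl; f_equal; ring).
    apply is_lim_seq_scal_l, is_lim_seq_geom; rewrite Rabs_right; lra.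
Qed.

Lemma sum_n_geom_diff (a : nat -> C) (M q : R) : 0 <= q < 1 ->
  (forall k, Cmod (a k) <= M * q ^ k) ->
  forall n m, (n <= m)%nat -> Cmod (sum_n a m - sum_n a n) <= M * q ^ S n / (1 - q).
Proof.
  intros Hq Ha n m Hm.
  assert (HM : 0 <= M) by (specialize (Ha O); pose proof (Cmod_ge_0 (a O)); simpl in Ha; lra).
  assert (B : forall j, Cmod (sum_n a (n + j) - sum_n a n) <= M * (q ^ S n - q ^ S (n + j)) / (1 - q)).
  { induction j.
    - rewrite Nat.add_0_r; replace (sum_n a n - sum_n a n)%C with (RtoC 0) by ring.
      rewrite Cmod_0; right; field; lra.
    - rewrite Nat.add_succ_r, sum_Sn_C.
      replace (sum_n a (n + j) + a (S (n + j)) - sum_n a n)%C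
        with (sum_n a (n + j) - sum_n a n + a (S (n + j)))%C by ring.
      apply Rle_trans with (1 := Cmod_triangle _ _).
      apply Rle_trans with (1 := Rplus_le_compat _ _ _ _ IHj (Ha _)).
      right; simpl; field; lra. }
  replace m with (n + (m - n))%nat by lia.
  apply Rle_trans with (1 := B _).
  unfold Rdiv; apply Rmult_le_compat_r; [left; apply Rinv_0_lt_compat; lra |].
  apply Rmult_le_compat_l; auto.
  pose proof (pow_le q (S (n + (m - n))) (proj1 Hq)); lra.
Qed.

Lemma cseries_geom (a : nat -> C) (M q : R) : 0 <= q < 1 ->
  (forall k, Cmod (a k) <= M * q ^ k) ->
  forall n, Cmod (cseries a - sum_n a n) <= M * q ^ S n / (1 - q).
Proof.
  intros Hq Ha n.
  assert (HD := sum_n_geom_diff a M q Hq Ha).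
  assert (HR := cauchy_seq_lim (fun n => Re (sum_n a n)) _ (is_lim_geom_tail M q Hq)).
  assert (HI := cauchy_seq_lim (fun n => Im (sum_n a n)) _ (is_lim_geom_tail M q Hq)).
  specialize (HR (fun n m H => Rle_trans _ _ _ (Re_le_Cmod (sum_n a m - sum_n a n)) (HD n m H))).
  specialize (HI (fun n m H => Rle_trans _ _ _ (Im_le_Cmod (sum_n a m - sum_n a n)) (HD n m H))).
  apply Rle_plus_epsilon; intros eps Heps.
  assert (L := is_lim_geom_tail M q Hq); apply is_lim_seq_spec in L.
  destruct (L (mkposreal (eps / 2) ltac:(lra))) as [N HN]; simpl in HN.
  specialize (HN (N + n)%nat ltac:(lia)); rewrite Rminus_0_r in HN.
  apply Rle_lt_trans with (1 := Rle_abs _) in HN.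
  replace (cseries a - sum_n a n)%C with
    ((cseries a - sum_n a (N + n)) + (sum_n a (N + n) - sum_n a n))%C by ring.
  apply Rle_trans with (1 := Cmod_triangle _ _).
  assert (H1 := HD n (N + n)%nat ltac:(lia)).
  specialize (HR (N + n)%nat); specialize (HI (N + n)%nat).
  assert (H2 : Cmod (cseries a - sum_n a (N + n)) <=
    Rabs (real (Lim_seq (fun n => Re (sum_n a n))) - Re (sum_n a (N + n)))
    + Rabs (real (Lim_seq (fun n => Im (sum_n a n))) - Im (sum_n a (N + n))))
    by exact (Cmod_le_Re_Im (cseries a - sum_n a (N + n))).
  change (M * q ^ S (N + n) / (1 - q) < eps / 2) in HN.
  lra.
Qed.

Lemma cseries_unique (a : nat -> C) (M q : R) (l : C) : 0 <= q < 1 ->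
  (forall k, Cmod (a k) <= M * q ^ k) ->
  (forall eps, 0 < eps -> exists N, forall n, (N <= n)%nat -> Cmod (l - sum_n a n) < eps) ->
  l = cseries a.
Proof.
  intros Hq Ha Hl.
  apply Ceq_minus, Cmod_eq_0, Rle_antisym; [| apply Cmod_ge_0].
  apply Rle_plus_epsilon; intros eps Heps.
  destruct (Hl (eps / 2)) as [N HN]; [lra |].
  assert (L := is_lim_geom_tail M q Hq); apply is_lim_seq_spec in L.
  destruct (L (mkposreal (eps / 2) ltac:(lra))) as [N' HN']; simpl in HN'.
  specialize (HN (N + N')%nat ltac:(lia)); specialize (HN' (N + N')%nat ltac:(lia)).
  rewrite Rminus_0_r in HN'; apply Rle_lt_trans with (1 := Rle_abs _) in HN'.
  assert (B := cseries_geom a M q Hq Ha (N + N')%nat).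
  replace (l - cseries a)%C with ((l - sum_n a (N + N')) - (cseries a - sum_n a (N + N')))%C by ring.
  apply Rle_trans with (1 := Cmod_triangle_minus _ _); simpl in *; lra.
Qed.

Lemma CI_cis_mult (j : Z) : CI (fun t => cis (IZR j * t)) 0 (2 * PI) = if Z.eq_dec j 0 then RtoC (2 * PI) else 0.
Proof.
  destruct Z.eq_dec as [->|Hj].
  - rewrite (CI_ext _ (fun _ => RtoC 1)).
    + rewrite CI_const, Rminus_0_r; ring.
    + intros t _; rewrite Rmult_0_l; apply cis_0.
  - assert (Hr : IZR j <> 0) by (intro E; apply Hj, eq_IZR; auto).
    assert (Hc : RtoC (IZR j) <> 0) by (intro E; apply Hr, RtoC_inj; auto).
    rewrite (CI_FTC (fun t => (- Ci * / IZR j * cis (IZR j * t))%C)).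
    + rewrite cis_2PI_mult, Rmult_0_r, cis_0; ring.
    + intros t _; split.
      * apply (is_derive_ext (fun t => / IZR j * sin (IZR j * t))).
        { intros s; rewrite <- RtoC_inv by auto; simpl; ring. }
        simpl; auto_derive; auto; field; auto.
      * apply (is_derive_ext (fun t => - / IZR j * cos (IZR j * t))).
        { intros s; rewrite <- RtoC_inv by auto; simpl; ring. }
        simpl; auto_derive; auto; field; auto.
    + intros t _; apply continuous_cis, continuous_Rmult_const, continuous_id.
Qed.

(** * Functions equal to the sum of their Fourier series *)

Section FourierSeries.
Variables (phi : R -> C) (c : nat -> C) (M q : R).
Hypothesis Hphi : forall t, continuous phi t.
Hypothesis Hper : forall t, phi (t + 2 * PI) = phi t.
Hypothesis Hq : 0 <= q < 1.
Hypothesis Hc : forall k, Cmod (c k) <= M * q ^ k.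
Hypothesis Hpos : forall k : nat,
  CI (fun t => (phi t * cis (- (IZR (Z.of_nat k) * t)))%C) 0 (2 * PI) = (2 * PI * c k)%C.
Hypothesis Hneg : forall m : Z, (m < 0)%Z ->
  CI (fun t => (phi t * cis (- (IZR m * t)))%C) 0 (2 * PI) = 0.

Definition fourier_term (t : R) (k : nat) : C := (c k * cis (INR k * t))%C.

Lemma fourier_term_bound t k : Cmod (fourier_term t k) <= M * q ^ k.
Proof. unfold fourier_term; rewrite Cmod_mult, Cmod_cis, Rmult_1_r; apply Hc. Qed.

Lemma continuous_fourier_sum n t : continuous (fun t => sum_n (fourier_term t) n) t.
Proof.
  assert (H : forall k t, continuous (fun t => fourier_term t k) t).
  { intros k s; apply continuous_Cmult; [apply continuous_const |].
    apply continuous_cis, continuous_Rmult_const, continuous_id. }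
  induction n.
  - apply (continuous_ext (fun t => fourier_term t 0)); auto.
    intros; now rewrite sum_O.
  - apply (continuous_ext (fun t => (sum_n (fourier_term t) n + fourier_term t (S n))%C)).
    + intros; now rewrite sum_Sn_C.
    + apply continuous_Cplus; auto.
Qed.

Lemma continuous_fourier_series t : continuous (fun t => cseries (fourier_term t)) t.
Proof.
  apply continuous_C_eps; intros eps Heps.
  assert (L := is_lim_geom_tail M q Hq); apply is_lim_seq_spec in L.
  destruct (L (mkposreal (eps / 3) ltac:(lra))) as [N HN]; simpl in HN.
  specialize (HN N (Nat.le_refl N)); rewrite Rminus_0_r in HN.
  apply Rle_lt_trans with (1 := Rle_abs _) in HN.
  generalize (proj1 (continuous_C_eps _ t) (continuous_fourier_sum N t) (eps / 3) ltac:(lra)).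
  apply filter_imp; intros s Hs.
  assert (B1 := cseries_geom _ M q Hq (fourier_term_bound t) N).
  assert (B2 := cseries_geom _ M q Hq (fourier_term_bound s) N).
  replace (cseries (fourier_term s) - cseries (fourier_term t))%C with
    ((cseries (fourier_term s) - sum_n (fourier_term s) N)
     + (sum_n (fourier_term s) N - sum_n (fourier_term t) N)
     - (cseries (fourier_term t) - sum_n (fourier_term t) N))%C by ring.
  apply Rle_lt_trans with (1 := Cmod_triangle_minus _ _).
  pose proof (Cmod_triangle (cseries (fourier_term s) - sum_n (fourier_term s) N)
     (sum_n (fourier_term s) N - sum_n (fourier_term t) N)).
  simpl in *; lra.
Qed.

Lemma continuous_mult_cis (f : R -> C) m t : continuous f t ->
  continuous (fun t => (f t * cis (- (IZR m * t)))%C) t.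
Proof.
  intros; apply continuous_Cmult; auto.
  apply continuous_cis, (continuous_opp (V := R_NormedModule)), continuous_Rmult_const, continuous_id.
Qed.

Lemma CI_fourier_sum n m :
  CI (fun t => (sum_n (fourier_term t) n * cis (- (IZR m * t)))%C) 0 (2 * PI)
  = if Z_le_dec 0 m then (if Z_le_dec m (Z.of_nat n) then (2 * PI * c (Z.to_nat m))%C else 0) else 0.
Proof.
  assert (T : forall k, CI (fun t => (fourier_term t k * cis (- (IZR m * t)))%C) 0 (2 * PI)
     = if Z.eq_dec (Z.of_nat k) m then (2 * PI * c k)%C else 0).
  { intros k.
    rewrite (CI_ext _ (fun t => (c k * cis (IZR (Z.of_nat k - m) * t))%C)).
    - rewrite CI_Cmult_l, CI_cis_mult.
      + destruct Z.eq_dec, Z.eq_dec; try lia; rewrite ?RtoC_mult; ring.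
      + apply ex_CI_continuous; intros; apply continuous_cis, continuous_Rmult_const, continuous_id.
    - intros t _; unfold fourier_term; rewrite minus_IZR, <- INR_IZR_INZ.
      replace ((INR k - IZR m) * t) with (INR k * t + - (IZR m * t)) by ring.
      rewrite cis_plus; ring. }
  induction n.
  - rewrite (CI_ext _ (fun t => (fourier_term t 0 * cis (- (IZR m * t)))%C)).
    + rewrite T; destruct Z.eq_dec; repeat destruct Z_le_dec; subst; try lia; auto.
    + intros; now rewrite sum_O.
  - rewrite (CI_ext _ (fun t => (sum_n (fourier_term t) n * cis (- (IZR m * t))
       + fourier_term t (S n) * cis (- (IZR m * t)))%C)).
    + rewrite CI_plus, IHn, T.
      * destruct Z.eq_dec; repeat destruct Z_le_dec; subst; try lia;
        rewrite ?Nat2Z.id; ring.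
      * apply ex_CI_continuous; intros; apply continuous_mult_cis, continuous_fourier_sum.
      * apply ex_CI_continuous; intros; apply continuous_mult_cis.
        apply continuous_Cmult; [apply continuous_const |].
        apply continuous_cis, continuous_Rmult_const, continuous_id.
    + intros; rewrite sum_Sn_C; ring.
Qed.

Lemma CI_fourier_series m :
  CI (fun t => (cseries (fourier_term t) * cis (- (IZR m * t)))%C) 0 (2 * PI)
  = CI (fun t => (phi t * cis (- (IZR m * t)))%C) 0 (2 * PI).
Proof.
  apply Ceq_minus, Cmod_eq_0, Rle_antisym; [| apply Cmod_ge_0].
  apply Rle_plus_epsilon; intros eps Heps.
  assert (HPI := PI_RGT_0).
  assert (L := is_lim_geom_tail M q Hq); apply is_lim_seq_spec in L.
  assert (He : 0 < eps / (2 * PI)) by (apply Rdiv_lt_0_compat; lra).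
  destruct (L (mkposreal _ He)) as [N HN]; simpl in HN.
  (* The partial sum must be accurate and must also contain the character of index [m]; for [m < 0]
     the second summand is [0]. *)
  set (n := (N + Z.to_nat m)%nat).
  specialize (HN n ltac:(unfold n; lia)); rewrite Rminus_0_r in HN.
  apply Rle_lt_trans with (1 := Rle_abs _) in HN.
  replace (CI (fun t => (phi t * cis (- (IZR m * t)))%C) 0 (2 * PI)) with
    (CI (fun t => (sum_n (fourier_term t) n * cis (- (IZR m * t)))%C) 0 (2 * PI)).
  2: { rewrite CI_fourier_sum; destruct Z_le_dec.
       - destruct Z_le_dec; [| unfold n in *; lia].
         rewrite <- Hpos, Z2Nat.id by lia; auto.
       - rewrite Hneg by lia; auto. }
  rewrite <- CI_minus.
  - apply Rle_trans with ((2 * PI - 0) * (eps / (2 * PI))); [| right; field; lra].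
    apply Cmod_CI_le_const; [lra | |].
    + apply ex_CI_continuous; intros t _; apply continuous_Cminus; apply continuous_mult_cis;
      [apply continuous_fourier_series | apply continuous_fourier_sum].
    + intros t _; replace (cseries (fourier_term t) * cis (- (IZR m * t))
        - sum_n (fourier_term t) n * cis (- (IZR m * t)))%C with
        ((cseries (fourier_term t) - sum_n (fourier_term t) n) * cis (- (IZR m * t)))%C by ring.
      rewrite Cmod_mult, Cmod_cis, Rmult_1_r.
      apply Rle_trans with (1 := cseries_geom _ M q Hq (fourier_term_bound t) n).
      left; exact HN.
  - apply ex_CI_continuous; intros; apply continuous_mult_cis, continuous_fourier_series.
  - apply ex_CI_continuous; intros; apply continuous_mult_cis, continuous_fourier_sum.
Qed.

(** Geometric decay makes the series converge uniformly, so its sum is continuous and has the same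
    Fourier coefficients as [phi]; the difference is zero by [fourier_unique]. *)
Theorem fourier_series_eq t : phi t = cseries (fourier_term t).
Proof.
  apply Ceq_minus.
  apply (fourier_unique (fun t => (phi t - cseries (fourier_term t))%C)).
  - intros s; apply continuous_Cminus; auto; apply continuous_fourier_series.
  - intros s; rewrite Hper; f_equal.
    unfold cseries, fourier_term.
    assert (E : forall n, sum_n (fun k => (c k * cis (INR k * (s + 2 * PI)))%C) n
      = sum_n (fun k => (c k * cis (INR k * s))%C) n).
    { intros n; apply sum_n_ext; intros k; rewrite Rmult_plus_distr_l, cis_plus.
      rewrite INR_IZR_INZ, cis_2PI_mult; Cring. }
    apply C_ext; simpl; f_equal; apply Lim_seq_ext; intros n;
      [exact (f_equal Re (E n)) | exact (f_equal Im (E n))].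
  - intros m; rewrite (CI_ext _ (fun t => (phi t * cis (- (IZR m * t))
        - cseries (fourier_term t) * cis (- (IZR m * t)))%C)) by (intros; ring).
    rewrite CI_minus, CI_fourier_series; [ring | |];
    apply ex_CI_continuous; intros; apply continuous_mult_cis; auto; apply continuous_fourier_series.
Qed.

End FourierSeries.

Definition holo (f : C -> C) : Prop := forall w, exists l, cdiff f w l.

Lemma holo_of_entire (f : C -> C) : entire f -> holo f.
Proof. intros H w; destruct (H w) as [l Hl]; exists l; now apply is_derive_iff_cdiff. Qed.

Lemma holo_continuous (f : C -> C) w : holo f -> continuous f w.
Proof. intros H; destruct (H w) as [l Hl]; now apply cdiff_continuous with l. Qed.

Lemma C_derive_cdiff (f : C -> C) (z l : C) : cdiff f z l -> C_derive f z = l.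
Proof. intros H; apply is_C_derive_unique; now apply is_derive_iff_cdiff. Qed.

Lemma polar_half (w : C) : 0 <= Re w -> exists t, - (PI / 2) <= t <= PI / 2 /\ w = (Cmod w * cis t)%C.
Proof.
  intros Hw; destruct (Ceq_dec w 0) as [->|H].
  - exists 0; split; [pose proof PI_RGT_0; lra |].
    rewrite Cmod_0; ring.
  - apply Cmod_gt_0 in H; exists (asin (Im w / Cmod w)).
    assert (Hb : -1 <= Im w / Cmod w <= 1).
    { assert (B := Im_le_Cmod w); apply Rabs_le_between in B.
      split; [apply Rmult_le_reg_r with (Cmod w) | apply Rmult_le_reg_r with (Cmod w)]; auto;
      replace (Im w / Cmod w * Cmod w) with (Im w) by (field; lra); lra. }
    split; [apply asin_bound |].
    unfold cis; rewrite cos_asin, sin_asin by auto.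
    apply C_ext; simpl; [| change (snd w) with (Im w); field; lra].
    rewrite Rmult_0_l, Rminus_0_r.
    change (fst w) with (Re w).
    transitivity (sqrt (Rsqr (Re w))); [symmetry; now apply sqrt_Rsqr |].
    transitivity (sqrt (Rsqr (Cmod w)) * sqrt (1 - Rsqr (Im w / Cmod w))).
    + rewrite <- sqrt_mult_alt by apply Rle_0_sqr; f_equal.
      assert (E := Cmod2_alt w); unfold Rsqr, Rdiv; simpl in E.
      change (fst w) with (Re w) in E; change (snd w) with (Im w) in E.
      field_simplify; [simpl; nra | lra].
    + rewrite sqrt_Rsqr by lra; auto.
Qed.

Lemma polar (w : C) : exists t, w = (Cmod w * cis t)%C.
Proof.
  destruct (Rle_dec 0 (Re w)) as [H|H].
  - destruct (polar_half w H) as [t [_ E]]; now exists t.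
  - destruct (polar_half (- w)%C) as [t [_ E]]; [simpl; unfold Re in *; lra |].
    exists (t + PI); rewrite Cmod_opp in E.
    replace w with (- - w)%C at 1 by ring; rewrite E, cis_plus.
    replace (cis PI) with (- (1))%C; [ring |].
    unfold cis; rewrite cos_PI, sin_PI; apply C_ext; simpl; ring.
Qed.

Lemma circle_bounded (f : C -> C) (c : C) (r : R) : holo f ->
  exists M, forall t, Cmod (f (c + r * cis t)%C) <= M.
Proof.
  intros Hf.
  assert (Hc : forall t, continuous (fun t => f (c + r * cis t)%C) t)
    by (intros; apply continuous_circle, holo_continuous; auto).
  destruct (ex_RInt_ub (V := C_R_NormedModule) (fun t => f (c + r * cis t)%C) 0 (2 * PI)) as [M HM].
  { apply ex_CI_continuous; auto. }
  assert (HPI := PI_RGT_0).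
  rewrite Rmin_left, Rmax_right in HM by lra.
  exists M; intros t.
  destruct (archimed (t / (2 * PI))) as [A1 A2].
  set (m := up (t / (2 * PI))) in *.
  assert (Hb : 0 <= t - IZR (m - 1) * (2 * PI) <= 2 * PI).
  { rewrite minus_IZR.
    apply Rmult_lt_compat_r with (r := 2 * PI) in A1; [| lra].
    apply Rmult_le_compat_r with (r := 2 * PI) in A2; [| lra].
    replace (t / (2 * PI) * (2 * PI)) with t in A1 by (field; lra).
    replace ((IZR m - t / (2 * PI)) * (2 * PI)) with (IZR m * (2 * PI) - t) in A2 by (field; lra).
    lra. }
  specialize (HM _ Hb); rewrite norm_C_R in HM.
  replace (cis t) with (cis (t - IZR (m - 1) * (2 * PI))); auto.
  replace t with ((t - IZR (m - 1) * (2 * PI)) + IZR (m - 1) * (2 * PI)) at 2 by ring.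
  rewrite cis_plus, cis_2PI_mult; ring.
Qed.

(** The Taylor coefficient as a contour integral. The radius [1] is a normalisation: by
    [circle_coef_tcoef] radius [r] only brings in the factor [r ^ m]. *)
Definition tcoef (f : C -> C) (m : nat) : C := (circle_coef f 0 (Z.of_nat m) 1 / (2 * PI))%C.

Lemma RtoC_neq (x : R) : x <> 0 -> RtoC x <> 0.
Proof. intros H E; apply H, RtoC_inj; auto. Qed.

Lemma two_PI_neq_0 : (2 * PI)%C <> 0.
Proof. pose proof PI_RGT_0; rewrite <- RtoC_mult; apply RtoC_neq; lra. Qed.

Lemma circle_coef_scale (f : C -> C) (m : Z) (r1 r2 : R) : holo f -> 0 < r1 -> 0 < r2 ->
  (circle_coef f 0 m r1 * exp (- IZR m * ln r1))%C = (circle_coef f 0 m r2 * exp (- IZR m * ln r2))%C.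
Proof.
  intros Hf H1 H2; destruct (Rle_dec r1 r2).
  - apply circle_coef_radius; auto; lra.
  - symmetry; apply circle_coef_radius; auto; lra.
Qed.

Lemma exp_INR_ln n r : 0 < r -> exp (INR n * ln r) = r ^ n.
Proof.
  intros Hr; rewrite <- Rpower_pow by auto; reflexivity.
Qed.

Lemma circle_coef_tcoef (f : C -> C) (m : nat) (r : R) : holo f -> 0 < r ->
  circle_coef f 0 (Z.of_nat m) r = (2 * PI * tcoef f m * r ^ m)%C.
Proof.
  intros Hf Hr; assert (E := circle_coef_scale f (Z.of_nat m) r 1 Hf Hr Rlt_0_1).
  rewrite ln_1, Rmult_0_r, exp_0, <- INR_IZR_INZ in E.
  rewrite <- Ropp_mult_distr_l, exp_Ropp, exp_INR_ln in E by auto.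
  assert (P : r ^ m <> 0) by (apply pow_nonzero; lra).
  pose proof two_PI_neq_0.
  unfold tcoef; rewrite <- RtoC_pow.
  transitivity (circle_coef f 0 (Z.of_nat m) r * RtoC (/ (r ^ m)%R) * RtoC ((r ^ m)%R))%C.
  - rewrite RtoC_inv by auto; field; now apply RtoC_neq.
  - rewrite E; pose proof PI_RGT_0; field; apply RtoC_neq; lra.
Qed.

Lemma ex_circle_coef (f : C -> C) (c : C) (m : Z) (r : R) : holo f ->
  ex_CI (fun t => (f (c + r * cis t) * cis (- (IZR m * t)))%C) 0 (2 * PI).
Proof.
  intros Hf; apply ex_CI_continuous; intros t _; apply continuous_mult_cis.
  apply continuous_circle, holo_continuous; auto.
Qed.

Lemma circle_coef_bound (f : C -> C) (c : C) (m : Z) (r M : R) : holo f ->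
  (forall t, Cmod (f (c + r * cis t)%C) <= M) -> Cmod (circle_coef f c m r) <= 2 * PI * M.
Proof.
  intros Hf HM; pose proof PI_RGT_0.
  replace (2 * PI * M) with ((2 * PI - 0) * M) by ring.
  apply Cmod_CI_le_const; [lra | now apply ex_circle_coef |].
  intros t _; rewrite Cmod_mult, Cmod_cis, Rmult_1_r; auto.
Qed.

(** By invariance the radius can be shrunk to [0]: the coefficient stays bounded by continuity at
    the origin, while for negative [m] the accompanying power of the radius tends to [0]. *)
Lemma circle_coef_neg (f : C -> C) (m : Z) (r : R) : holo f -> 0 < r -> (m < 0)%Z ->
  circle_coef f 0 m r = 0.
Proof.
  intros Hf Hr Hm; pose proof PI_RGT_0.
  assert (Hcont := proj1 (continuous_C_eps f (RtoC 0)) (holo_continuous f (RtoC 0) Hf) 1 Rlt_0_1).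
  apply locally_C_Cmod in Hcont; destruct Hcont as [d [Hd Hdf]].
  set (K := (circle_coef f 0 m r * exp (- IZR m * ln r))%C).
  assert (HK : K = 0).
  { apply Cmod_eq_0, Rle_antisym; [| apply Cmod_ge_0].
    apply Rle_plus_epsilon; intros eps Heps; rewrite Rplus_0_l.
    set (M := 2 * PI * (Cmod (f 0) + 1)).
    assert (HM : 0 < M) by (pose proof (Cmod_ge_0 (f 0)); apply Rmult_lt_0_compat; lra).
    set (rho := Rmin 1 (Rmin (d / 2) (eps / M))).
    assert (He : 0 < eps / M) by (apply Rdiv_lt_0_compat; auto).
    assert (Hrho : 0 < rho) by (repeat apply Rmin_glb_lt; lra).
    assert (Hr1 : rho <= 1) by apply Rmin_l.
    assert (Hr2 : rho <= d / 2) by (apply Rle_trans with (1 := Rmin_r _ _), Rmin_l).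
    assert (Hr3 : rho <= eps / M) by (apply Rle_trans with (1 := Rmin_r _ _), Rmin_r).
    unfold K; rewrite (circle_coef_scale f m r rho Hf Hr Hrho), Cmod_mult, Cmod_R.
    assert (B : Cmod (circle_coef f 0 m rho) <= M).
    { apply circle_coef_bound; auto; intros t.
      assert (Cmod (f (0 + rho * cis t)%C - f 0) < 1).
      { apply Hdf; rewrite Cmod_circle; lra. }
      pose proof (Cmod_triangle_rev (f (0 + rho * cis t)%C) (f 0)); lra. }
    assert (E : Rabs (exp (- IZR m * ln rho)) <= rho).
    { rewrite Rabs_right by (left; apply exp_pos).
      rewrite <- (exp_ln rho) at 2 by auto.
      assert (IZR m <= -1) by (apply IZR_le; lia).
      assert (ln rho <= 0).
      { rewrite <- ln_1; destruct Hr1 as [H1|H1]; [left; now apply ln_increasing | right; now rewrite H1]. }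
      assert (Hle : - IZR m * ln rho <= ln rho) by nra.
      destruct Hle as [Hl|Hl]; [left; now apply exp_increasing | right; now rewrite Hl]. }
    apply Rle_trans with (M * (eps / M)).
    - apply Rmult_le_compat; auto; [apply Cmod_ge_0 | apply Rabs_pos | lra].
    - right; field; lra. }
  assert (P := exp_pos (- IZR m * ln r)).
  transitivity (K / exp (- IZR m * ln r))%C.
  - unfold K; field; apply RtoC_neq; lra.
  - rewrite HK; field; apply RtoC_neq; lra.
Qed.

Lemma tcoef_bound (f : C -> C) (m : nat) (r M : R) : holo f -> 0 < r ->
  (forall t, Cmod (f (r * cis t)%C) <= M) -> Cmod (tcoef f m) * r ^ m <= M.
Proof.
  intros Hf Hr HM; pose proof PI_RGT_0.
  assert (B : Cmod (circle_coef f 0 (Z.of_nat m) r) <= 2 * PI * M).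
  { apply circle_coef_bound; auto; intros t; rewrite Cplus_0_l; auto. }
  rewrite circle_coef_tcoef, !Cmod_mult, !Cmod_R in B by auto.
  rewrite Cmod_pow, Cmod_R, !Rabs_right in B by lra.
  apply Rmult_le_reg_l with (2 * PI); lra.
Qed.

(** On the circle through [w] the Fourier coefficients of [f] are [tcoef f k * Cmod w ^ k], none at
    negative index, and Cauchy's estimate on the circle of radius [r] dominates them by powers of
    [Cmod w / r]. So [f] is the sum of this series. *)
Theorem taylor_remainder (f : C -> C) (w : C) (r M : R) : holo f -> Cmod w < r ->
  (forall t, Cmod (f (r * cis t)%C) <= M) ->
  f w = cseries (fun k => (tcoef f k * w ^ k)%C) /\
  forall n, Cmod (f w - sum_n (fun k => (tcoef f k * w ^ k)%C) n)
    <= M * (Cmod w / r) ^ S n / (1 - Cmod w / r).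
Proof.
  intros Hf Hw HM.
  assert (Hr : 0 < r) by (pose proof (Cmod_ge_0 w); lra).
  assert (Hq : 0 <= Cmod w / r < 1).
  { split; [apply Rdiv_le_0_compat; auto; apply Cmod_ge_0 |].
    apply -> Rdiv_lt_1; auto. }
  assert (Hb : forall k, Cmod (tcoef f k * w ^ k) <= M * (Cmod w / r) ^ k).
  { intros k; rewrite Cmod_mult, Cmod_pow; unfold Rdiv; rewrite Rpow_mult_distr, pow_inv.
    assert (T := tcoef_bound f k r M Hf Hr HM).
    assert (P : 0 < r ^ k) by (apply pow_lt; auto).
    replace (M * (Cmod w ^ k * / r ^ k)) with (M / r ^ k * Cmod w ^ k) by (field; lra).
    apply Rmult_le_compat_r; [apply pow_le, Cmod_ge_0 |].
    apply Rmult_le_reg_r with (r ^ k); auto.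
    replace (M / r ^ k * r ^ k) with M by (field; lra); auto. }
  assert (E : f w = cseries (fun k => (tcoef f k * w ^ k)%C)).
  { destruct (Ceq_dec w 0) as [->|Hw0].
    (* The circle through [w] degenerates at the origin. There only the constant term is left, and
       it equals [f 0] because the means over small circles tend to the central value. *)
    - apply (cseries_unique _ M _ _ Hq Hb); intros eps Heps; exists O; intros n _.
      assert (S0 : sum_n (fun k => (tcoef f k * 0 ^ k)%C) n = f 0).
      { assert (T0 : tcoef f 0 = f 0).
        { unfold tcoef; pose proof two_PI_neq_0 as H2.
          assert (L : circle_coef f 0 (Z.of_nat 0) 1 = (2 * PI * f 0)%C).
          { apply Ceq_minus, Cmod_eq_0, Rle_antisym; [| apply Cmod_ge_0].
            apply Rle_plus_epsilon; intros e He; rewrite Rplus_0_l.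
            pose proof PI_RGT_0.
            assert (Hcont := proj1 (continuous_C_eps f (RtoC 0)) (holo_continuous f (RtoC 0) Hf) (e / (2 * PI))
              ltac:(apply Rdiv_lt_0_compat; lra)).
            apply locally_C_Cmod in Hcont; destruct Hcont as [d [Hd Hdf]].
            assert (Er := circle_coef_scale f (Z.of_nat 0) 1 (d / 2) Hf Rlt_0_1 ltac:(lra)).
            simpl in Er; rewrite Ropp_0, !Rmult_0_l, exp_0, !Cmult_1_r in Er.
            simpl Z.of_nat; rewrite Er.
            replace (2 * PI * f 0)%C with (CI (fun _ => f 0) 0 (2 * PI)).
            2: { rewrite CI_const, Rminus_0_r, RtoC_mult; ring. }
            unfold circle_coef; rewrite <- CI_minus.
            - apply Rle_trans with ((2 * PI - 0) * (e / (2 * PI))); [| right; field; lra].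
              apply Cmod_CI_le_const; [lra | |].
              + apply ex_CI_continuous; intros t _; apply continuous_Cminus; [| apply continuous_const].
                apply continuous_mult_cis, continuous_circle, holo_continuous; auto.
              + intros t _; rewrite Rmult_0_l, Ropp_0, cis_0, Cmult_1_r.
                left; apply Hdf; rewrite Cmod_circle; lra.
            - now apply ex_circle_coef.
            - apply ex_CI_continuous; intros; apply continuous_const. }
          rewrite L; pose proof PI_RGT_0; field; apply RtoC_neq; lra. }
        induction n; [rewrite sum_O, <- T0; simpl; Cring |].
        rewrite sum_Sn_C, IHn; simpl; Cring. }
      rewrite S0; replace (f 0 - f 0)%C with (RtoC 0) by ring; rewrite Cmod_0; auto.
    - destruct (polar w) as [t Et].
      assert (Hwp := proj1 (Cmod_gt_0 w) Hw0).
      assert (F := fourier_series_eq (fun s => f (0 + Cmod w * cis s)%C)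
        (fun k => (tcoef f k * (Cmod w) ^ k)%C) M (Cmod w / r)).
      rewrite Et at 1; rewrite <- (Cplus_0_l (Cmod w * cis t)%C).
      rewrite F; auto.
      + assert (X : forall n, sum_n (fourier_term (fun k => (tcoef f k * (Cmod w) ^ k)%C) t) n
           = sum_n (fun k => (tcoef f k * w ^ k)%C) n).
        { intros n; apply sum_n_ext; intros k; unfold fourier_term.
          rewrite cis_INR_mult.
          replace (w ^ k)%C with ((Cmod w * cis t) ^ k)%C by now rewrite <- Et.
          rewrite Cpow_mult_l; Cring. }
        apply C_ext; simpl; f_equal; apply Lim_seq_ext; intros n;
          [exact (f_equal Re (X n)) | exact (f_equal Im (X n))].
      + intros s; apply continuous_circle, holo_continuous; auto.
      + intros s; now rewrite cis_period.
      + intros k; rewrite <- Hb, !Cmod_mult, !Cmod_pow, Cmod_R, Rabs_right; lra.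
      + intros k; transitivity (circle_coef f 0 (Z.of_nat k) (Cmod w)); [reflexivity |].
        rewrite circle_coef_tcoef by auto; ring.
      + intros m Hm; apply (circle_coef_neg f m (Cmod w)); auto. }
  split; auto; intros n; rewrite E; apply cseries_geom; auto.
Qed.

(** A fixed ratio loses nothing for entire functions: a bound on radius [2 * Cmod w] always provides
    it, as in [half_dom_power]. *)
Definition half_dom (a : nat -> C) (M : R) : Prop := forall k, Cmod (a k) <= M * (/ 2) ^ k.

Lemma half_range : 0 <= / 2 < 1.
Proof. lra. Qed.

Lemma cseries_half_bound (a : nat -> C) M : half_dom a M -> Cmod (cseries a) <= 2 * M.
Proof.
  intros H; assert (B := cseries_geom a M (/ 2) half_range H O); rewrite sum_O in B; simpl in B.
  specialize (H O); simpl in H.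
  replace (cseries a) with ((cseries a - a O) + a O)%C by ring.
  apply Rle_trans with (1 := Cmod_triangle _ _); lra.
Qed.

Lemma cseries_lin (a b : nat -> C) (c : C) Ma Mb : half_dom a Ma -> half_dom b Mb ->
  cseries (fun k => (a k + c * b k)%C) = (cseries a + c * cseries b)%C.
Proof.
  intros Ha Hb.
  assert (Hs : half_dom (fun k => (a k + c * b k)%C) (Ma + Cmod c * Mb)).
  { intros k; apply Rle_trans with (1 := Cmod_triangle _ _); rewrite Cmod_mult.
    specialize (Ha k); specialize (Hb k); pose proof (Cmod_ge_0 c); nra. }
  symmetry; apply (cseries_unique _ _ (/ 2) _ half_range Hs); intros eps Heps.
  assert (HMa : 0 <= Ma) by (specialize (Ha O); pose proof (Cmod_ge_0 (a O)); simpl in Ha; lra).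
  assert (HMb : 0 <= Mb) by (specialize (Hb O); pose proof (Cmod_ge_0 (b O)); simpl in Hb; lra).
  assert (L := is_lim_geom_tail (Ma + Cmod c * Mb) (/ 2) half_range); apply is_lim_seq_spec in L.
  destruct (L (mkposreal eps Heps)) as [N HN]; simpl pos in HN.
  exists N; intros n Hn; specialize (HN n Hn); rewrite Rminus_0_r in HN.
  apply Rle_lt_trans with (1 := Rle_abs _) in HN.
  apply Rle_lt_trans with (2 := HN).
  assert (E : sum_n (fun k => (a k + c * b k)%C) n = (sum_n a n + c * sum_n b n)%C).
  { clear; induction n; [now rewrite !sum_O | rewrite !sum_Sn_C, IHn; Cring]. }
  rewrite E.
  replace (cseries a + c * cseries b - (sum_n a n + c * sum_n b n))%C with
    ((cseries a - sum_n a n) + c * (cseries b - sum_n b n))%C by ring.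
  apply Rle_trans with (1 := Cmod_triangle _ _); rewrite Cmod_mult.
  assert (A := cseries_geom a Ma (/ 2) half_range Ha n).
  assert (B := cseries_geom b Mb (/ 2) half_range Hb n).
  apply Rmult_le_compat_l with (r := Cmod c) in B; [| apply Cmod_ge_0].
  apply Rle_trans with (1 := Rplus_le_compat _ _ _ _ A B); right; field.
Qed.

(** The first clause says that the radius of convergence is infinite, in the form of Cauchy's
    estimate on every radius; it is stable under differentiation. *)
Definition power_sum (f : C -> C) (a : nat -> C) : Prop :=
  (forall r, 0 < r -> exists M, forall k, Cmod (a k) * r ^ k <= M) /\
  (forall w, f w = cseries (fun k => (a k * w ^ k)%C)).

Lemma half_dom_power (a : nat -> C) (w : C) (r M : R) : 0 < r -> 2 * Cmod w <= r ->
  (forall k, Cmod (a k) * r ^ k <= M) -> half_dom (fun k => (a k * w ^ k)%C) M.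
Proof.
  intros Hr Hw HM k; rewrite Cmod_mult, Cmod_pow.
  apply Rle_trans with (Cmod (a k) * (r * / 2) ^ k).
  - apply Rmult_le_compat_l; [apply Cmod_ge_0 |].
    apply pow_incr; pose proof (Cmod_ge_0 w); lra.
  - rewrite Rpow_mult_distr, <- Rmult_assoc; apply Rmult_le_compat_r; auto.
    apply pow_le; lra.
Qed.

(** In the induction each new factor [z + h] multiplies the old remainder and adds
    [h ^ 2 * (k z ^ (k - 1))]; the square of [k] pays for the sum of these additions. *)
Lemma pow_quadratic (z h : C) (k : nat) : Cmod h <= 1 ->
  Cmod ((z + h) ^ k - z ^ k - h * (INR k * z ^ pred k)) <= Cmod h ^ 2 * (INR k ^ 2 * (Cmod z + 1) ^ k).
Proof.
  intros Hh; set (r := Cmod z + 1).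
  assert (Hz := Cmod_ge_0 z).
  assert (Hr : 1 <= r) by (unfold r; lra).
  induction k.
  - simpl; replace (1 - 1 - h * (0 * 1))%C with (RtoC 0) by ring; rewrite Cmod_0; lra.
  - replace ((z + h) ^ S k - z ^ S k - h * (INR (S k) * z ^ pred (S k)))%C with
      ((z + h) * ((z + h) ^ k - z ^ k - h * (INR k * z ^ pred k)) + h ^ 2 * (INR k * z ^ pred k))%C.
    2: { rewrite S_INR, RtoC_plus; destruct k; simpl; ring. }
    apply Rle_trans with (1 := Cmod_triangle _ _); rewrite !Cmod_mult, !Cmod_pow, Cmod_R.
    rewrite (Rabs_right (INR k)) by (apply Rle_ge, pos_INR).
    assert (B1 : Cmod (z + h) <= r) by (unfold r; pose proof (Cmod_triangle z h); lra).
    assert (B2 : Cmod z ^ pred k <= r ^ S k).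
    { apply Rle_trans with (r ^ pred k); [apply pow_incr; unfold r; lra |].
      apply Rle_pow; auto; lia. }
    assert (B3 := Rmult_le_compat _ _ _ _ (Cmod_ge_0 _) (Cmod_ge_0 _) B1 IHk).
    assert (P : 0 <= INR k) by apply pos_INR.
    assert (Q : 0 <= r ^ S k) by (apply pow_le; lra).
    apply Rmult_le_compat_l with (r := INR k) in B2; auto.
    apply Rmult_le_compat_l with (r := Cmod h ^ 2) in B2; [| apply pow2_ge_0].
    apply Rle_trans with (1 := Rplus_le_compat _ _ _ _ B3 B2).
    rewrite S_INR; replace (r * (Cmod h ^ 2 * (INR k ^ 2 * r ^ k))) with
      (Cmod h ^ 2 * (INR k ^ 2 * r ^ S k)) by (simpl; ring).
    rewrite <- Rmult_plus_distr_l; apply Rmult_le_compat_l; [apply pow2_ge_0 |].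
    rewrite <- Rmult_plus_distr_r; apply Rmult_le_compat_r; auto; nra.
Qed.

Lemma INR_sq_le_pow4 k : INR k ^ 2 <= 4 ^ k.
Proof.
  induction k; [simpl; lra |].
  rewrite S_INR; simpl (4 ^ S k).
  destruct k; [simpl; lra |].
  assert (1 <= INR (S k)) by (rewrite S_INR; pose proof (pos_INR k); lra); nra.
Qed.

(** Termwise differentiation: the second-order remainders of the single powers sum to a multiple of
    [Cmod h ^ 2]. That the derivative is again a [power_sum] allows iteration. *)
Lemma power_sum_derive (f : C -> C) (a : nat -> C) : power_sum f a ->
  (forall w, cdiff f w (cseries (fun k => (INR (S k) * a (S k) * w ^ k)%C))) /\
  power_sum (C_derive f) (fun k => (INR (S k) * a (S k))%C).
Proof.
  intros [Hb Hf].
  assert (Hb' : forall r, 0 < r -> exists M, forall k, Cmod (INR (S k) * a (S k)) * r ^ k <= M).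
  { intros r Hr; destruct (Hb (4 * r)) as [M HM]; [lra |].
    exists (M / r); intros k; specialize (HM (S k)).
    rewrite Cmod_mult, Cmod_R, Rabs_right by (apply Rle_ge, pos_INR).
    apply Rmult_le_reg_r with r; auto.
    replace (M / r * r) with M by (field; lra).
    apply Rle_trans with (2 := HM).
    rewrite Rpow_mult_distr; simpl (r ^ S k).
    assert (I1 : INR (S k) <= 4 ^ S k).
    { apply Rle_trans with (2 := INR_sq_le_pow4 (S k)).
      assert (1 <= INR (S k)) by (rewrite S_INR; pose proof (pos_INR k); lra); nra. }
    assert (0 <= Cmod (a (S k)) * (r * r ^ k)).
    { apply Rmult_le_pos; [apply Cmod_ge_0 |]; apply Rmult_le_pos; [lra | apply pow_le; lra]. }
    nra. }
  assert (HD : forall w, cdiff f w (cseries (fun k => (INR (S k) * a (S k) * w ^ k)%C))).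
  { intros z.
    assert (Hz := Cmod_ge_0 z).
    (* [8 = 2 * 4]: the powers of [4] absorb the factor [k ^ 2] of [pow_quadratic], those of [2]
       give [half_dom]. *)
    destruct (Hb (8 * (Cmod z + 1))) as [M HM]; [lra |].
    apply cdiff_of_quadratic with (d := 1) (M := 2 * M); [lra |].
    intros w Hw; set (h := (w - z)%C) in *.
    assert (Ew : w = (z + h)%C) by (unfold h; ring).
    rewrite Ew.
    assert (Hzh : Cmod (z + h) <= Cmod z + 1) by (pose proof (Cmod_triangle z h); lra).
    assert (D1 : half_dom (fun k => (a k * (z + h) ^ k)%C) M) by
      (apply half_dom_power with (8 * (Cmod z + 1)); auto; lra).
    assert (D2 : half_dom (fun k => (a k * z ^ k)%C) M) by
      (apply half_dom_power with (8 * (Cmod z + 1)); auto; lra).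
    destruct (Hb' (2 * (Cmod z + 1))) as [M' HM']; [lra |].
    assert (D3 : half_dom (fun k => (INR (S k) * a (S k) * z ^ k)%C) M') by
      (apply half_dom_power with (2 * (Cmod z + 1)); auto; lra).
    (* the derived series, shifted so that it starts with a zero term *)
    assert (D4 : half_dom (fun k => (INR k * a k * z ^ pred k)%C) (2 * Rabs M')).
    { intros [| k]; simpl pred.
      - replace (INR 0 * a O * z ^ 0)%C with (RtoC 0) by (simpl; ring).
        rewrite Cmod_0; pose proof (Rabs_pos M'); simpl; lra.
      - apply Rle_trans with (1 := D3 k); simpl; pose proof (Rle_abs M').
        assert (0 < (/ 2) ^ k) by (apply pow_lt; lra); nra. }
    assert (E4 : cseries (fun k => (INR k * a k * z ^ pred k)%C)
       = cseries (fun k => (INR (S k) * a (S k) * z ^ k)%C)).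
    { symmetry; apply (cseries_unique _ _ (/ 2) _ half_range D4); intros eps Heps.
      assert (L := is_lim_geom_tail M' (/ 2) half_range); apply is_lim_seq_spec in L.
      destruct (L (mkposreal eps Heps)) as [N HN]; simpl pos in HN.
      exists (S N); intros [| n] Hn; [lia |]; specialize (HN n ltac:(lia)).
      rewrite Rminus_0_r in HN; apply Rle_lt_trans with (1 := Rle_abs _) in HN.
      apply Rle_lt_trans with (2 := HN).
      assert (Es : sum_n (fun k => (INR k * a k * z ^ pred k)%C) (S n)
         = sum_n (fun k => (INR (S k) * a (S k) * z ^ k)%C) n).
      { clear; induction n.
        - rewrite sum_Sn_C, !sum_O; simpl; Cring.
        - rewrite sum_Sn_C, IHn, sum_Sn_C; reflexivity. }
      rewrite Es; apply cseries_geom; auto using half_range. }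
    rewrite <- E4, !Hf.
    assert (L1 := cseries_lin _ _ (- (1))%C _ _ D1 D2).
    assert (D12 : half_dom (fun k => (a k * (z + h) ^ k + - (1) * (a k * z ^ k))%C) (2 * M)).
    { intros k; apply Rle_trans with (1 := Cmod_triangle _ _).
      rewrite (Cmod_mult (- (1))), Cmod_opp, Cmod_1, Rmult_1_l.
      specialize (D1 k); specialize (D2 k); lra. }
    assert (L2 := cseries_lin _ _ (- h)%C _ _ D12 D4); rewrite L1 in L2.
    replace (cseries (fun k => (a k * (z + h) ^ k)%C) - cseries (fun k => (a k * z ^ k)%C)
      - h * cseries (fun k => (INR k * a k * z ^ pred k)%C))%C
      with (cseries (fun k => (a k * (z + h) ^ k)%C) + - (1) * cseries (fun k => (a k * z ^ k)%C)
      + - h * cseries (fun k => (INR k * a k * z ^ pred k)%C))%C by ring.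
    rewrite <- L2.
    replace (2 * M * Cmod h ^ 2) with (2 * (M * Cmod h ^ 2)) by ring.
    apply cseries_half_bound; intros k.
    replace (a k * (z + h) ^ k + - (1) * (a k * z ^ k) + - h * (INR k * a k * z ^ pred k))%C with
      (a k * ((z + h) ^ k - z ^ k - h * (INR k * z ^ pred k)))%C by ring.
    rewrite Cmod_mult.
    apply Rle_trans with (Cmod (a k) * (Cmod h ^ 2 * (INR k ^ 2 * (Cmod z + 1) ^ k))).
    - apply Rmult_le_compat_l; [apply Cmod_ge_0 | apply pow_quadratic; lra].
    - specialize (HM k).
      replace (8 * (Cmod z + 1)) with (2 * (4 * (Cmod z + 1))) in HM by ring.
      rewrite !Rpow_mult_distr in HM.
      assert (P2 : 0 < 2 ^ k) by (apply pow_lt; lra).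
      assert (Pz : 0 <= (Cmod z + 1) ^ k) by (apply pow_le; lra).
      assert (I := INR_sq_le_pow4 k).
      rewrite pow_inv; apply Rmult_le_reg_r with (2 ^ k); auto.
      replace (M * Cmod h ^ 2 * / 2 ^ k * 2 ^ k) with (Cmod h ^ 2 * M) by (field; lra).
      replace (Cmod (a k) * (Cmod h ^ 2 * (INR k ^ 2 * (Cmod z + 1) ^ k)) * 2 ^ k)
        with (Cmod h ^ 2 * (Cmod (a k) * (2 ^ k * (INR k ^ 2 * (Cmod z + 1) ^ k)))) by ring.
      apply Rmult_le_compat_l; [apply pow2_ge_0 |].
      apply Rle_trans with (2 := HM).
      apply Rmult_le_compat_l; [apply Cmod_ge_0 |].
      apply Rmult_le_compat_l; [lra |].
      apply Rmult_le_compat_r; auto. }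
  split; auto; split; auto.
  intros w; apply C_derive_cdiff, HD.
Qed.

Lemma power_sum_at_0 (f : C -> C) (a : nat -> C) : power_sum f a -> f 0 = a O.
Proof.
  intros [Hb Hf]; rewrite Hf; symmetry.
  destruct (Hb 1 Rlt_0_1) as [M HM].
  assert (D : half_dom (fun k => (a k * 0 ^ k)%C) M).
  { apply half_dom_power with 1; auto; rewrite ?Cmod_0; lra. }
  apply (cseries_unique _ _ _ _ half_range D); intros eps Heps; exists O; intros n _.
  replace (sum_n (fun k => (a k * 0 ^ k)%C) n) with (a O).
  - replace (a O - a O)%C with (RtoC 0) by ring; now rewrite Cmod_0.
  - induction n; [rewrite sum_O; simpl; Cring |].
    rewrite sum_Sn_C, <- IHn; simpl; Cring.
Qed.

Lemma power_sum_C_derive_n (f : C -> C) (a : nat -> C) (n : nat) : power_sum f a ->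
  exists b, power_sum (C_derive_n f n) b /\
    forall k, (INR (Factorial.fact k) * b k = INR (Factorial.fact (k + n)) * a (k + n)%nat)%C.
Proof.
  intros H; induction n.
  - exists a; split; auto; intros k; now rewrite Nat.add_0_r.
  - destruct IHn as [b [Hb E]].
    exists (fun k => (INR (S k) * b (S k))%C); split; [apply power_sum_derive; auto |].
    intros k; specialize (E (S k)).
    replace (k + S n)%nat with (S k + n)%nat by lia; rewrite <- E.
    change (Factorial.fact (S k)) with (S k * Factorial.fact k)%nat.
    rewrite mult_INR, RtoC_mult; ring.
Qed.

Lemma holo_power_sum (f : C -> C) : holo f -> power_sum f (tcoef f).
Proof.
  intros Hf; split.
  - intros r Hr; destruct (circle_bounded f 0 r Hf) as [M HM].
    exists M; intros k; apply tcoef_bound; auto; intros t.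
    specialize (HM t); rewrite Cplus_0_l in HM; auto.
  - intros w; destruct (circle_bounded f 0 (Cmod w + 1) Hf) as [M HM].
    apply (taylor_remainder f w (Cmod w + 1) M Hf); [lra |].
    intros t; specialize (HM t); rewrite Cplus_0_l in HM; auto.
Qed.

(** The bridge from the iterated derivatives in [taylor_poly] to contour integrals, in terms of
    which all later estimates are made. *)
Lemma C_derive_n_tcoef (f : C -> C) (n : nat) : holo f ->
  (C_derive_n f n 0 / INR (Factorial.fact n))%C = tcoef f n.
Proof.
  intros Hf; destruct (power_sum_C_derive_n f _ n (holo_power_sum f Hf)) as [b [Hb E]].
  rewrite (power_sum_at_0 _ _ Hb); specialize (E O); simpl in E.
  assert (P : RtoC (INR (Factorial.fact n)) <> 0) by (apply RtoC_neq, INR_fact_neq_0).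
  transitivity (1 * b O / INR (Factorial.fact n))%C; [field; auto |].
  rewrite E; field; auto.
Qed.

Lemma taylor_poly_tcoef (f : C -> C) (m : nat) (z : C) : holo f ->
  taylor_poly f m z = sum_n (fun k => (tcoef f k * z ^ k)%C) m.
Proof.
  intros Hf; apply sum_n_ext; intros k; now rewrite C_derive_n_tcoef.
Qed.

Lemma holo_C_derive (f : C -> C) : holo f -> holo (C_derive f).
Proof.
  intros Hf w; eexists.
  apply (power_sum_derive _ _ (proj2 (power_sum_derive f _ (holo_power_sum f Hf)))).
Qed.

Lemma holo_cdiff (f : C -> C) (w : C) : holo f -> cdiff f w (C_derive f w).
Proof. intros Hf; destruct (Hf w) as [l Hl]; rewrite (C_derive_cdiff _ _ _ Hl); auto. Qed.

Lemma CI_sum_n (u : nat -> R -> C) (a b : R) n : (forall k t, continuous (u k) t) ->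
  CI (fun t => sum_n (fun k => u k t) n) a b = sum_n (fun k => CI (u k) a b) n.
Proof.
  intros Hu.
  assert (Hc : forall n t, continuous (fun t => sum_n (fun k => u k t) n) t).
  { intros m; induction m; intros t.
    - apply (continuous_ext (u O)); auto; intros; now rewrite sum_O.
    - apply (continuous_ext (fun t => (sum_n (fun k => u k t) m + u (S m) t)%C)).
      + intros; now rewrite sum_Sn_C.
      + apply continuous_Cplus; auto. }
  induction n.
  - rewrite sum_O; apply CI_ext; intros; now rewrite sum_O.
  - rewrite sum_Sn_C, <- IHn, <- CI_plus; try (apply ex_CI_continuous; auto).
    apply CI_ext; intros; now rewrite sum_Sn_C.
Qed.

Lemma sum_n_geometric (x : C) n : x <> 1 -> sum_n (fun k => (x ^ k)%C) n = ((1 - x ^ S n) / (1 - x))%C.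
Proof.
  intros Hx; assert (H : (1 - x)%C <> 0) by (intro E; apply Hx; symmetry; now apply Ceq_minus).
  induction n.
  - rewrite sum_O; simpl; field; auto.
  - rewrite sum_Sn_C, IHn; simpl; field; auto.
Qed.

(** Deduced from the Taylor series: subtracting [n + 1] terms of the geometric series from the
    Cauchy kernel leaves a factor [(a / zeta) ^ (n + 1)], so both the integral and [f a] differ from
    the same partial sum by a multiple of [(Cmod a / r) ^ (n + 1)]. *)
Theorem cauchy_formula_0 (f : C -> C) (a : C) (r : R) : holo f -> Cmod a < r ->
  (2 * PI * f a)%C = CI (fun t => (f (r * cis t) * (r * cis t) / (r * cis t - a))%C) 0 (2 * PI).
Proof.
  intros Hf Ha.
  assert (Hr : 0 < r) by (pose proof (Cmod_ge_0 a); lra).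
  assert (HPI := PI_RGT_0).
  destruct (circle_bounded f 0 r Hf) as [M HM].
  assert (HM' : forall t, Cmod (f (r * cis t)%C) <= M)
    by (intros t; specialize (HM t); rewrite Cplus_0_l in HM; auto).
  assert (HM0 : 0 <= M) by (pose proof (Cmod_ge_0 (f (r * cis 0)%C)); specialize (HM' 0); lra).
  assert (Hm : forall t, Cmod (r * cis t) = r).
  { intros t; rewrite Cmod_mult, Cmod_cis, Cmod_R, Rabs_right; lra. }
  assert (Hg0 : forall t, (r * cis t)%C <> 0) by (intros t E; apply f_equal with (f := Cmod) in E; rewrite Hm, Cmod_0 in E; lra).
  assert (Hga : forall t, (r * cis t - a)%C <> 0).
  { intros t E; assert (E' : (r * cis t)%C = a) by now apply Ceq_minus.
    apply f_equal with (f := Cmod) in E'; rewrite Hm in E'; lra. }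
  assert (Hfc : forall t, continuous (fun t => f (r * cis t)%C) t).
  { intros t; apply (continuous_ext (fun t => f (0 + r * cis t)%C)); [intros; now rewrite Cplus_0_l |].
    apply continuous_circle, holo_continuous; auto. }
  assert (Hgc : forall t, continuous (fun t => (r * cis t)%C) t).
  { intros t; apply continuous_Cmult; [apply continuous_const | apply continuous_cis, continuous_id]. }
  assert (Hic : forall t, continuous (fun t => (f (r * cis t) * (r * cis t) / (r * cis t - a))%C) t).
  { intros t; apply continuous_Cmult; [now apply continuous_Cmult |].
    apply continuous_Cinv; [| apply Hga].
    apply continuous_Cminus; auto; apply continuous_const. }
  assert (Hq : 0 <= Cmod a / r < 1).
  { split; [apply Rdiv_le_0_compat; auto; apply Cmod_ge_0 |].
    apply -> Rdiv_lt_1; auto. }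
  apply Ceq_minus, Cmod_eq_0, Rle_antisym; [| apply Cmod_ge_0].
  set (K := 2 * PI * (2 * (M / (1 - Cmod a / r)))).
  assert (Key : forall n, Cmod (2 * PI * f a
     - CI (fun t => (f (r * cis t) * (r * cis t) / (r * cis t - a))%C) 0 (2 * PI)) <= K * (Cmod a / r) ^ S n).
  { intros n.
    assert (Hterm : forall k t, continuous (fun t => (f (r * cis t) * (a / (r * cis t)) ^ k)%C) t).
    { intros k t; apply continuous_Cmult; auto; apply continuous_Cpow.
      apply continuous_Cmult; [apply continuous_const | apply continuous_Cinv; auto]. }
    assert (E1 : (2 * PI * sum_n (fun k => (tcoef f k * a ^ k)%C) n)%C =
      CI (fun t => sum_n (fun k => (f (r * cis t) * (a / (r * cis t)) ^ k)%C) n) 0 (2 * PI)).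
    { rewrite CI_sum_n by auto; rewrite <- sum_n_Cmult_l; apply sum_n_ext; intros k.
      assert (Ec := circle_coef_tcoef f k r Hf Hr).
      assert (Hrk : (r ^ k)%C <> 0) by (apply Cpow_nz, RtoC_neq; lra).
      transitivity (a ^ k / r ^ k * circle_coef f 0 (Z.of_nat k) r)%C.
      - rewrite Ec; match goal with |- @eq _ ?x ?y => change (@eq C x y) end; field; auto.
      - unfold circle_coef; rewrite <- CI_Cmult_l by now apply ex_circle_coef.
        apply CI_ext; intros t _; rewrite Cplus_0_l, <- INR_IZR_INZ, cis_opp, cis_INR_mult.
        unfold Cdiv; rewrite Cpow_mult_l, Cpow_inv, Cpow_mult_l by auto.
        assert ((cis t ^ k)%C <> 0) by apply Cpow_nz, cis_neq_0.
        field; auto. }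
    assert (E2 : (CI (fun t => (f (r * cis t) * (r * cis t) / (r * cis t - a))%C) 0 (2 * PI)
       - 2 * PI * sum_n (fun k => (tcoef f k * a ^ k)%C) n)%C =
      CI (fun t => (f (r * cis t) * (a / (r * cis t)) ^ S n * ((r * cis t) / (r * cis t - a)))%C) 0 (2 * PI)).
    { rewrite E1, <- CI_minus.
      - apply CI_ext; intros t _.
        assert (Hx : (a / (r * cis t))%C <> 1).
        { intro E; apply (Hga t); generalize (Hg0 t), E; generalize (r * cis t)%C; intros g Hg Eg.
          transitivity (g - a / g * g)%C; [field; auto | rewrite Eg; ring]. }
        rewrite sum_n_Cmult_l, sum_n_geometric by auto.
        assert (H1x : (1 - a / (r * cis t))%C <> 0) by (intro E; apply Hx; symmetry; now apply Ceq_minus).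
        replace (r * cis t / (r * cis t - a))%C with (/ (1 - a / (r * cis t)))%C.
        2: { generalize (Hga t), (Hg0 t); generalize (r * cis t)%C; intros; field; repeat split; auto. }
        replace (f (r * cis t) * (r * cis t) / (r * cis t - a))%C with (f (r * cis t) * / (1 - a / (r * cis t)))%C.
        2: { generalize (Hga t), (Hg0 t); generalize (r * cis t)%C; intros; field; repeat split; auto. }
        generalize (a / (r * cis t))%C, H1x; intros x Hx1; simpl; field; auto.
      - apply ex_CI_continuous; auto.
      - apply ex_CI_continuous; intros t _.
        apply (continuous_ext (fun t => (f (r * cis t) * sum_n (fun k => (a / (r * cis t)) ^ k)%C n)%C)).
        + intros s; now rewrite sum_n_Cmult_l.
        + apply continuous_Cmult; auto; clear -Hgc Hg0; induction n.
          * apply (continuous_ext (fun _ => RtoC 1)); [intros; now rewrite sum_O | apply continuous_const].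
          * apply (continuous_ext (fun t => (sum_n (fun k => (a / (r * cis t)) ^ k)%C n + (a / (r * cis t)) ^ S n)%C)).
            { intros; now rewrite sum_Sn_C. }
            apply continuous_Cplus; auto; apply continuous_Cpow.
            apply continuous_Cmult; [apply continuous_const | apply continuous_Cinv; auto]. }
    replace (2 * PI * f a - CI (fun t => (f (r * cis t) * (r * cis t) / (r * cis t - a))%C) 0 (2 * PI))%C
      with (2 * PI * (f a - sum_n (fun k => (tcoef f k * a ^ k)%C) n)
        - (CI (fun t => (f (r * cis t) * (r * cis t) / (r * cis t - a))%C) 0 (2 * PI)
       - 2 * PI * sum_n (fun k => (tcoef f k * a ^ k)%C) n))%C by ring.
    apply Rle_trans with (1 := Cmod_triangle_minus _ _).
    rewrite E2.
    assert (T := proj2 (taylor_remainder f a r M Hf Ha HM') n).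
    assert (B : Cmod (CI (fun t => (f (r * cis t) * (a / (r * cis t)) ^ S n * ((r * cis t) / (r * cis t - a)))%C) 0 (2 * PI))
      <= (2 * PI - 0) * (M * (Cmod a / r) ^ S n * / (1 - Cmod a / r))).
    { apply Cmod_CI_le_const; [lra | |].
      - apply ex_CI_continuous; intros t _; apply continuous_Cmult; [apply continuous_Cmult |]; auto.
        + apply continuous_Cpow, continuous_Cmult; [apply continuous_const | apply continuous_Cinv; auto].
        + apply continuous_Cmult; auto; apply continuous_Cinv; auto.
          apply continuous_Cminus; auto; apply continuous_const.
      - intros t _; rewrite !Cmod_mult, Cmod_pow, Cmod_div, Hm by auto.
        rewrite Cmod_div, Hm by auto.
        assert (Hd : r - Cmod a <= Cmod (r * cis t - a)).
        { pose proof (Cmod_triangle_rev (r * cis t) a); rewrite Hm in *; lra. }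
        apply Rmult_le_compat.
        + apply Rmult_le_pos; [apply Cmod_ge_0 | apply pow_le; lra].
        + apply Rdiv_le_0_compat; lra.
        + apply Rmult_le_compat_r; [apply pow_le; lra | auto].
        + apply Rle_trans with (r / (r - Cmod a)).
          * unfold Rdiv; apply Rmult_le_compat_l; [lra |]; apply Rinv_le_contravar; lra.
          * right; field; split; lra. }
    rewrite !Cmod_mult, !Cmod_R, !Rabs_right by lra.
    apply Rmult_le_compat_l with (r := 2 * PI) in T; [| lra].
    apply Rle_trans with (1 := Rplus_le_compat _ _ _ _ T B).
    right; unfold K; field; split; lra. }
  apply (is_lim_seq_le (fun _ => Cmod (2 * PI * f a
     - CI (fun t => (f (r * cis t) * (r * cis t) / (r * cis t - a))%C) 0 (2 * PI)))
     (fun n => K * (Cmod a / r) ^ S n) _ 0 Key (is_lim_seq_const _)).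
  replace (Finite 0) with (Rbar_mult K 0) by (simpl; f_equal; ring).
  apply is_lim_seq_scal_l.
  apply (is_lim_seq_incr_1 (fun n => (Cmod a / r) ^ n)), is_lim_seq_geom; rewrite Rabs_right; lra.
Qed.

(** * Mellin integrals *)

Lemma MVT_is_derive (f df : R -> R) (a b : R) : a <= b ->
  (forall x, a <= x <= b -> is_derive f x (df x)) ->
  exists c, a <= c <= b /\ f b - f a = df c * (b - a).
Proof.
  intros Hab H; destruct (MVT_gen f a b df) as [c [Hc E]].
  - intros x Hx; rewrite Rmin_left, Rmax_right in Hx by auto; apply H; lra.
  - intros x Hx; rewrite Rmin_left, Rmax_right in Hx by auto.
    apply continuity_pt_filterlim, (ex_derive_continuous (V := R_NormedModule)).
    exists (df x); auto.
  - rewrite Rmin_left, Rmax_right in Hc by auto; exists c; auto.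
Qed.

Lemma atan_le_id x : 0 <= x -> atan x <= x.
Proof.
  intros Hx; destruct (MVT_is_derive (fun x => x - atan x) (fun x => 1 - / (1 + x ^ 2)) 0 x) as [c [Hc E]]; auto.
  - intros y _; auto_derive; auto; simpl; field; nra.
  - rewrite atan_0 in E.
    assert (/ (1 + c ^ 2) <= 1).
    { rewrite <- Rinv_1; apply Rinv_le_contravar; [lra |]; pose proof (pow2_ge_0 c); lra. }
    nra.
Qed.

Definition GI (f : R -> C) (l : C) : Prop :=
  is_RInt_gen (V := C_R_NormedModule) f (at_right 0) (Rbar_locally p_infty) l.

Definition RGI (f : R -> R) (l : R) : Prop :=
  is_RInt_gen (V := R_NormedModule) f (at_right 0) (Rbar_locally p_infty) l.

Lemma filter_prod_0_infty (P : R * R -> Prop) :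
  filter_prod (at_right 0) (Rbar_locally p_infty) P <->
  exists d T, 0 < d /\ forall a b, 0 < a < d -> T < b -> P (a, b).
Proof.
  split.
  - intros [Q S [d Hd] [T HT] H]; exists d, T; split; [apply cond_pos |].
    intros a b Ha Hb; apply H; [apply Hd; [| lra] | auto].
    unfold ball; simpl; unfold AbsRing_ball, abs, minus, plus, opp; simpl.
    rewrite Ropp_0, Rplus_0_r, Rabs_right; lra.
  - intros [d [T [Hd H]]].
    exists (fun a => 0 < a < d) (fun b => T < b); auto.
    + exists (mkposreal d Hd); intros a Ha H0.
      unfold ball in Ha; simpl in Ha; unfold AbsRing_ball, abs, minus, plus, opp in Ha; simpl in Ha.
      rewrite Ropp_0, Rplus_0_r, Rabs_right in Ha; lra.
    + exists T; auto.
Qed.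

Lemma GI_eps (f : R -> C) (l : C) :
  (forall a b, 0 < a <= b -> ex_CI f a b) ->
  (GI f l <-> forall eps, 0 < eps -> exists d T, 0 < d /\
     forall a b, 0 < a < d -> T < b -> a <= b -> Cmod (CI f a b - l) < eps).
Proof.
  intros Hex; split.
  - intros H eps Heps.
    assert (He : 0 < eps / 2) by lra.
    assert (Hb : locally (T := C_UniformSpace) l (fun z => Cmod (z - l) < eps))
      by (apply locally_C_Cmod; exists eps; auto).
    specialize (H _ Hb); apply filter_prod_0_infty in H.
    destruct H as [d [T [Hd H]]]; exists d, T; split; auto.
    intros a b Ha HT Hab; destruct (H a b Ha HT) as [y [Hy1 Hy2]]; simpl in Hy1.
    rewrite (CI_unique _ _ _ _ Hy1); auto.
  - intros H P HP; apply locally_C_Cmod in HP; destruct HP as [eps [Heps HP]].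
    destruct (H eps Heps) as [d [T [Hd HT]]].
    apply filter_prod_0_infty; exists d, (Rmax T d); split; auto.
    intros a b Ha Hb; exists (CI f a b); simpl.
    pose proof (Rmax_l T d); pose proof (Rmax_r T d).
    split; [apply CI_correct, Hex; lra | apply HP, HT; lra].
Qed.

Lemma GI_unique (f : R -> C) (l m : C) : GI f l -> GI f m -> l = m.
Proof.
  intros H1 H2.
  transitivity (RInt_gen (V := C_R_CompleteNormedModule) f (at_right 0) (Rbar_locally p_infty)).
  - symmetry; exact (is_RInt_gen_unique (V := C_R_CompleteNormedModule) f l H1).
  - exact (is_RInt_gen_unique (V := C_R_CompleteNormedModule) f m H2).
Qed.

Lemma GI_RInt_gen (f : R -> C) (l : C) : GI f l ->
  RInt_gen (V := C_R_CompleteNormedModule) f (at_right 0) (Rbar_locally p_infty) = l.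
Proof. exact (is_RInt_gen_unique (V := C_R_CompleteNormedModule) f l). Qed.

Lemma GI_minus (f g : R -> C) (l m : C) : GI f l -> GI g m -> GI (fun t => (f t - g t)%C) (l - m)%C.
Proof. exact (is_RInt_gen_minus (V := C_R_NormedModule) f g l m). Qed.

Lemma GI_ext (f g : R -> C) (l : C) : (forall t, 0 < t -> f t = g t) -> GI f l -> GI g l.
Proof.
  intros H; apply is_RInt_gen_ext.
  apply filter_prod_0_infty; exists 1, 1; split; [lra |].
  intros a b Ha Hb x Hx; simpl in Hx; apply H.
  rewrite Rmin_left in Hx by lra; lra.
Qed.

Lemma RGI_ext (f g : R -> R) (l : R) : (forall t, 0 < t -> f t = g t) -> RGI f l -> RGI g l.
Proof.
  intros H; apply is_RInt_gen_ext.
  apply filter_prod_0_infty; exists 1, 1; split; [lra |].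
  intros a b Ha Hb x Hx; simpl in Hx; apply H.
  rewrite Rmin_left in Hx by lra; lra.
Qed.

Lemma GI_Cmult_l (c : C) (f : R -> C) (l : C) : GI f l -> GI (fun t => (c * f t)%C) (c * l)%C.
Proof.
  intros H P HP.
  assert (Hc : continuous (fun z : C => (c * z)%C) l).
  { apply continuous_Cmult; [apply continuous_const | apply continuous_id]. }
  specialize (H _ (Hc P HP)); revert H; unfold filtermapi, filtermap; apply filter_imp.
  intros [a b] [y [H1 H2]]; exists (c * y)%C; split; auto.
  now apply is_CI_Cmult_l.
Qed.

Lemma GI_Re (f : R -> C) (l : C) : GI f l -> RGI (fun t => Re (f t)) (Re l).
Proof.
  intros H P HP.
  assert (Hc : continuous (fun z : C => Re z) l) by apply continuous_Re, continuous_id.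
  specialize (H _ (Hc P HP)); revert H; unfold filtermapi, filtermap; apply filter_imp.
  intros [a b] [y [H1 H2]]; exists (Re y); split; auto.
  exact (is_RInt_fct_extend_fst (U := R_NormedModule) (V := R_NormedModule) _ _ _ _ H1).
Qed.

Lemma GI_norm (f : R -> C) (g : R -> R) (l : C) (m : R) : GI f l -> RGI g m ->
  (forall t, 0 < t -> Cmod (f t) <= g t) -> Cmod l <= m.
Proof.
  intros Hf Hg H; rewrite <- norm_C_R.
  refine (RInt_gen_norm (V := C_R_CompleteNormedModule) f g l m _ _ Hf Hg).
  - apply filter_prod_0_infty; exists 1, 1; split; [lra |]; intros; simpl; lra.
  - apply filter_prod_0_infty; exists 1, 1; split; [lra |]; intros a b Ha Hb x Hx; simpl in Hx.
    refine (Rle_trans _ _ _ _ (H x ltac:(lra))); right; apply norm_C_R.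
Qed.

Lemma RGI_le (f g : R -> R) (l m : R) : RGI f l -> RGI g m ->
  (forall t, 0 < t -> f t <= g t) -> l <= m.
Proof.
  intros Hf Hg H.
  refine (@filterlim_le _ (filter_prod (at_right 0) (Rbar_locally p_infty)) _
    (fun ab => RInt f (fst ab) (snd ab)) (fun ab => RInt g (fst ab) (snd ab)) l m _ _ _).
  - assert (K1 := Hf _ (filter_true)); assert (K2 := Hg _ (filter_true)).
    apply filter_prod_0_infty in K1; apply filter_prod_0_infty in K2.
    destruct K1 as [d1 [T1 [Hd1 K1]]], K2 as [d2 [T2 [Hd2 K2]]].
    apply filter_prod_0_infty; exists (Rmin d1 d2), (Rmax (Rmax T1 T2) d1).
    split; [apply Rmin_glb_lt; auto |].
    pose proof (Rmin_l d1 d2); pose proof (Rmin_r d1 d2).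
    pose proof (Rmax_l (Rmax T1 T2) d1); pose proof (Rmax_r (Rmax T1 T2) d1).
    pose proof (Rmax_l T1 T2); pose proof (Rmax_r T1 T2).
    intros a b Ha Hb; simpl.
    destruct (K1 a b) as [y1 [Y1 _]]; try lra; destruct (K2 a b) as [y2 [Y2 _]]; try lra.
    apply RInt_le; [lra | now exists y1 | now exists y2 | intros; apply H; lra].
  - intros P HP; specialize (Hf P HP); revert Hf; unfold filtermapi, filtermap; apply filter_imp.
    intros [a b] [y [H1 H2]]; now rewrite (is_RInt_unique _ _ _ _ H1).
  - intros P HP; specialize (Hg P HP); revert Hg; unfold filtermapi, filtermap; apply filter_imp.
    intros [a b] [y [H1 H2]]; now rewrite (is_RInt_unique _ _ _ _ H1).
Qed.

Lemma GI_FTC_0 (F f : R -> C) :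
  (forall t, 0 < t ->
     is_derive (fun t => Re (F t)) t (Re (f t)) /\ is_derive (fun t => Im (F t)) t (Im (f t))) ->
  (forall t, 0 < t -> continuous f t) ->
  (forall eps, 0 < eps -> exists d T, 0 < d /\
     (forall t, 0 < t < d -> Cmod (F t) < eps) /\ forall t, T < t -> Cmod (F t) < eps) ->
  GI f 0.
Proof.
  intros HF Hf Hlim; apply GI_eps.
  - intros a b Hab; apply ex_CI_continuous; intros t Ht; apply Hf.
    rewrite Rmin_left in Ht; lra.
  - intros eps Heps; destruct (Hlim (eps / 2)) as [d [T [Hd [H1 H2]]]]; [lra |].
    exists d, T; split; auto; intros a b Ha Hb Hab.
    rewrite (CI_FTC F).
    + replace (F b - F a - 0)%C with (F b - F a)%C by ring.
      apply Rle_lt_trans with (1 := Cmod_triangle_minus _ _).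
      specialize (H1 a Ha); specialize (H2 b Hb); lra.
    + intros t Ht; apply HF; rewrite Rmin_left in Ht; lra.
    + intros t Ht; apply Hf; rewrite Rmin_left in Ht; lra.
Qed.

(** * Dominated integrals over the half-line *)

Definition pcosh (r t : R) : R := Rpower t r + Rpower t (- r).

Lemma pcosh_pos r t : 0 < pcosh r t.
Proof. unfold pcosh, Rpower; pose proof (exp_pos (r * ln t)); pose proof (exp_pos (- r * ln t)); lra. Qed.

(** An envelope of size [t ^ (r - 1)] at [0] and [t ^ (- r - 1)] at infinity, chosen for its
    elementary primitive [atan (t ^ r) / r]: total mass and tails are explicit. *)
Definition env (r t : R) : R := / (t * pcosh r t).

Lemma env_pos r t : 0 < t -> 0 < env r t.
Proof. intros; apply Rinv_0_lt_compat, Rmult_lt_0_compat; auto; apply pcosh_pos. Qed.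

Definition env_prim (r t : R) : R := atan (Rpower t r) / r.

Lemma is_derive_env_prim r t : 0 < r -> 0 < t -> is_derive (env_prim r) t (env r t).
Proof.
  intros Hr Ht; unfold env_prim, env, pcosh, Rpower; auto_derive; auto.
  replace (- r * ln t) with (- (r * ln t)) by ring; rewrite exp_Ropp.
  pose proof (exp_pos (r * ln t)).
  field; repeat split; apply Rgt_not_eq; nra.
Qed.

Lemma continuous_env r t : 0 < t -> continuous (env r) t.
Proof.
  intros Ht; apply (ex_derive_continuous (V := R_NormedModule)).
  unfold env, pcosh, Rpower; auto_derive; repeat split; auto.
  apply Rgt_not_eq, Rmult_lt_0_compat; auto; apply (pcosh_pos r t).
Qed.

Lemma RInt_env r a b : 0 < r -> 0 < a <= b -> RInt (env r) a b = env_prim r b - env_prim r a.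
Proof.
  intros Hr Hab; apply is_RInt_unique, (is_RInt_derive (V := R_CompleteNormedModule) (env_prim r)).
  - intros t Ht; rewrite Rmin_left in Ht by lra; apply is_derive_env_prim; lra.
  - intros t Ht; rewrite Rmin_left in Ht by lra; apply continuous_env; lra.
Qed.

Lemma ex_RInt_env r a b : 0 < a <= b -> ex_RInt (env r) a b.
Proof.
  intros Hab; apply (ex_RInt_continuous (V := R_CompleteNormedModule)); intros t Ht.
  rewrite Rmin_left in Ht by lra; apply continuous_env; lra.
Qed.

Lemma env_prim_bounds r t : 0 < r -> 0 < env_prim r t < PI / 2 / r.
Proof.
  intros Hr; unfold env_prim.
  assert (0 < atan (Rpower t r)).
  { rewrite <- atan_0; apply atan_increasing; unfold Rpower; apply exp_pos. }
  pose proof (proj2 (atan_bound (Rpower t r))).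
  split; [now apply Rdiv_lt_0_compat |].
  apply Rmult_lt_compat_r; auto; now apply Rinv_0_lt_compat.
Qed.

Lemma env_prim_le r s t : 0 < r -> 0 < s <= t -> env_prim r s <= env_prim r t.
Proof.
  intros Hr Hst.
  assert (H := RInt_env r s t Hr Hst).
  assert (0 <= RInt (env r) s t).
  { apply RInt_ge_0; [lra | now apply ex_RInt_env |].
    intros x Hx; left; apply env_pos; lra. }
  lra.
Qed.

Lemma env_prim_lim r eps : 0 < r -> 0 < eps -> exists d T, 0 < d < T /\
  (forall t, 0 < t <= d -> env_prim r t <= eps) /\ (forall t, T <= t -> PI / 2 / r - eps <= env_prim r t).
Proof.
  intros Hr He.
  assert (A : forall x, 0 < x -> atan x <= x) by (intros; apply atan_le_id; lra).
  set (x := eps * r / (1 + eps * r)).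
  assert (Her : 0 < eps * r) by nra.
  assert (Hx : 0 < x < 1).
  { unfold x; split; [apply Rdiv_lt_0_compat; lra |].
    apply -> Rdiv_lt_1; lra. }
  assert (Hxe : x <= eps * r).
  { unfold x; apply Rmult_le_reg_r with (1 + eps * r); [lra |].
    replace (eps * r / (1 + eps * r) * (1 + eps * r)) with (eps * r) by (field; lra); nra. }
  set (d := Rpower x (/ r)); set (T := Rpower (/ x) (/ r)).
  assert (Ed : Rpower d r = x) by (unfold d; rewrite Rpower_mult, Rinv_l by lra; apply Rpower_1; lra).
  assert (Hix : 0 < / x) by (apply Rinv_0_lt_compat; lra).
  assert (ET : Rpower T r = / x) by (unfold T; rewrite Rpower_mult, Rinv_l by lra; apply Rpower_1; lra).
  assert (Hd : 0 < d) by (unfold d, Rpower; apply exp_pos).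
  assert (HT : 0 < T) by (unfold T, Rpower; apply exp_pos).
  assert (Hlt : 1 < / x) by (rewrite <- Rinv_1; apply Rinv_lt_contravar; lra).
  assert (Hmono : forall s t, 0 < s <= t -> env_prim r s <= env_prim r t) by (intros; now apply env_prim_le).
  assert (Pd : env_prim r d <= eps).
  { unfold env_prim; rewrite Ed; apply Rmult_le_reg_r with r; auto.
    replace (atan x / r * r) with (atan x) by (field; lra).
    apply Rle_trans with (2 := Hxe), A; lra. }
  assert (PT : PI / 2 / r - eps <= env_prim r T).
  { unfold env_prim; rewrite ET; rewrite atan_inv by lra.
    replace ((PI / 2 - atan x) / r) with (PI / 2 / r - atan x / r) by (field; lra).
    apply Rplus_le_compat_l, Ropp_le_contravar.
    unfold env_prim in Pd; rewrite Ed in Pd; auto. }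
  exists d, T; repeat split; auto.
  - unfold d, T, Rpower; apply exp_increasing, Rmult_lt_compat_l; [apply Rinv_0_lt_compat; auto |].
    apply ln_increasing; lra.
  - intros t Ht; apply Rle_trans with (2 := Pd); apply Hmono; lra.
  - intros t Ht; apply Rle_trans with (1 := PT); apply Hmono; lra.
Qed.

Section Dominated.
Variables (f : R -> C) (K r : R).
Hypothesis Hr : 0 < r.
Hypothesis Hf : forall t, 0 < t -> continuous f t.
Hypothesis Hdom : forall t, 0 < t -> Cmod (f t) <= K * env r t.

Lemma ex_CI_dom a b : 0 < a <= b -> ex_CI f a b.
Proof.
  intros Hab; apply ex_CI_continuous; intros t Ht; apply Hf; rewrite Rmin_left in Ht; lra.
Qed.

Lemma dom_const_nonneg : 0 <= K.
Proof.
  specialize (Hdom 1 Rlt_0_1); pose proof (Cmod_ge_0 (f 1)); pose proof (env_pos r 1 Rlt_0_1); nra.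
Qed.

Lemma Cmod_CI_dom a b : 0 < a <= b -> Cmod (CI f a b) <= K * (env_prim r b - env_prim r a).
Proof.
  intros Hab; rewrite <- RInt_env by auto.
  rewrite <- (RInt_scal (V := R_CompleteNormedModule) (env r)) by now apply ex_RInt_env.
  apply Cmod_CI_le; [lra | now apply ex_CI_dom | |].
  - apply (ex_RInt_scal (V := R_NormedModule)), ex_RInt_env; auto.
  - intros t Ht; apply Hdom; lra.
Qed.

Lemma Cmod_CI_dom_diff a b a' b' : 0 < a' <= a -> a <= b <= b' ->
  Cmod (CI f a' b' - CI f a b) <= K * (env_prim r a + (PI / 2 / r - env_prim r b)).
Proof.
  intros Ha Hb.
  rewrite <- (CI_Chasles f a' a b'), <- (CI_Chasles f a b b'); try (apply ex_CI_dom; lra).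
  replace (CI f a' a + (CI f a b + CI f b b') - CI f a b)%C with (CI f a' a + CI f b b')%C by ring.
  apply Rle_trans with (1 := Cmod_triangle _ _).
  pose proof (Cmod_CI_dom a' a ltac:(lra)); pose proof (Cmod_CI_dom b b' ltac:(lra)).
  pose proof (env_prim_bounds r a' Hr); pose proof (env_prim_bounds r b' Hr).
  pose proof dom_const_nonneg; nra.
Qed.

(** The integrals over [[1 / (n + 1), n + 1]] are Cauchy with rate [e], the envelope mass outside;
    any other exhaustion of the half-line differs from them by at most that mass. *)
Lemma GI_dom : exists l, GI f l /\ Cmod l <= K * (PI / 2 / r).
Proof.
  assert (HK := dom_const_nonneg).
  set (a := fun n => / INR (S n)); set (b := fun n => INR (S n)).
  assert (Hb1 : forall n, 1 <= b n) by (intros; unfold b; rewrite S_INR; pose proof (pos_INR n); lra).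
  assert (Ha0 : forall n, 0 < a n) by (intros n; apply Rinv_0_lt_compat; specialize (Hb1 n); unfold b in Hb1; lra).
  assert (Ha1 : forall n, a n <= 1).
  { intros n; unfold a; rewrite <- Rinv_1; apply Rinv_le_contravar; [lra | apply Hb1]. }
  assert (Hbm : forall n m, (n <= m)%nat -> b n <= b m) by (intros; apply le_INR; lia).
  assert (Ham : forall n m, (n <= m)%nat -> a m <= a n).
  { intros n m Hnm; apply Rinv_le_contravar; [specialize (Hb1 n); unfold b in Hb1; lra | now apply Hbm]. }
  set (e := fun n => K * (env_prim r (a n) + (PI / 2 / r - env_prim r (b n)))).
  assert (He : is_lim_seq e 0).
  { apply is_lim_seq_spec; intros eps; simpl.
    destruct (env_prim_lim r (eps / (2 * (K + 1)) / 2)) as [d [T [HdT [H1 H2]]]]; auto.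
    { pose proof (cond_pos eps); repeat apply Rdiv_lt_0_compat; lra. }
    destruct (nfloor_ex (Rmax T (/ d))) as [N [HN1 HN2]].
    { apply Rle_trans with (2 := Rmax_l _ _); lra. }
    exists N; intros n Hn; rewrite Rminus_0_r.
    assert (HbT : Rmax T (/ d) <= b n).
    { apply Rle_trans with (b N); [unfold b; rewrite S_INR; lra | apply Hbm; lia]. }
    assert (X1 : env_prim r (a n) <= eps / (2 * (K + 1)) / 2).
    { apply H1; split; auto; unfold a; rewrite <- (Rinv_inv d).
      apply Rinv_le_contravar; [apply Rinv_0_lt_compat; lra |].
      apply Rle_trans with (2 := HbT), Rmax_r. }
    assert (X2 := H2 (b n) (Rle_trans _ _ _ (Rmax_l _ _) HbT)).
    pose proof (env_prim_bounds r (a n) Hr); pose proof (env_prim_bounds r (b n) Hr).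
    unfold e; rewrite Rabs_right by (apply Rle_ge, Rmult_le_pos; lra).
    apply Rle_lt_trans with (K * (eps / (2 * (K + 1)))).
    - apply Rmult_le_compat_l; lra.
    - pose proof (cond_pos eps).
      replace (K * (eps / (2 * (K + 1)))) with (eps * (K / (2 * (K + 1)))) by (field; lra).
      rewrite <- (Rmult_1_r eps) at 2; apply Rmult_lt_compat_l; auto.
      apply -> Rdiv_lt_1; lra. }
  assert (Hcau : forall n m, (n <= m)%nat -> Cmod (CI f (a m) (b m) - CI f (a n) (b n)) <= e n).
  { intros n m Hnm; specialize (Ham n m Hnm); specialize (Hbm n m Hnm).
    pose proof (Ha0 m); pose proof (Ha1 n); pose proof (Hb1 n).
    apply Cmod_CI_dom_diff; lra. }
  set (l := (real (Lim_seq (fun n => Re (CI f (a n) (b n)))), real (Lim_seq (fun n => Im (CI f (a n) (b n))))) : C).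
  assert (Hl : forall n, Cmod (l - CI f (a n) (b n)) <= 2 * e n).
  { intros n; apply Rle_trans with (1 := Cmod_le_Re_Im _).
    assert (B1 := cauchy_seq_lim (fun n => Re (CI f (a n) (b n))) e He
      (fun n m H => Rle_trans _ _ _ (Re_le_Cmod (CI f (a m) (b m) - CI f (a n) (b n))) (Hcau n m H)) n).
    assert (B2 := cauchy_seq_lim (fun n => Im (CI f (a n) (b n))) e He
      (fun n m H => Rle_trans _ _ _ (Im_le_Cmod (CI f (a m) (b m) - CI f (a n) (b n))) (Hcau n m H)) n).
    replace (2 * e n) with (e n + e n) by ring.
    apply Rplus_le_compat; [exact B1 | exact B2]. }
  exists l; split.
  - apply GI_eps; [apply ex_CI_dom |]; intros eps Heps.
    apply is_lim_seq_spec in He; destruct (He (mkposreal (eps / 3) ltac:(lra))) as [N HN]; simpl in HN.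
    specialize (HN N (Nat.le_refl N)); rewrite Rminus_0_r in HN.
    apply Rle_lt_trans with (1 := Rle_abs _) in HN.
    exists (a N), (b N); split; auto; intros x y Hx Hy Hxy.
    replace (CI f x y - l)%C with ((CI f x y - CI f (a N) (b N)) - (l - CI f (a N) (b N)))%C by ring.
    apply Rle_lt_trans with (1 := Cmod_triangle_minus _ _).
    pose proof (Ha1 N); pose proof (Hb1 N).
    assert (D := Cmod_CI_dom_diff (a N) (b N) x y ltac:(lra) ltac:(lra)).
    specialize (Hl N); fold (e N) in D; lra.
  - apply Rle_plus_epsilon; intros eps Heps.
    apply is_lim_seq_spec in He; destruct (He (mkposreal (eps / 2) ltac:(lra))) as [N HN]; simpl in HN.
    specialize (HN N (Nat.le_refl N)); rewrite Rminus_0_r in HN.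
    apply Rle_lt_trans with (1 := Rle_abs _) in HN.
    replace l with ((l - CI f (a N) (b N)) + CI f (a N) (b N))%C by ring.
    apply Rle_trans with (1 := Cmod_triangle _ _).
    pose proof (Ha1 N); pose proof (Hb1 N); pose proof (Ha0 N).
    assert (D := Cmod_CI_dom (a N) (b N) ltac:(lra)).
    pose proof (env_prim_bounds r (a N) Hr); pose proof (env_prim_bounds r (b N) Hr).
    specialize (Hl N).
    assert (K * (env_prim r (b N) - env_prim r (a N)) <= K * (PI / 2 / r)) by (apply Rmult_le_compat_l; lra).
    lra.
Qed.

End Dominated.

Lemma RCpow_plus (t : R) (a b : C) : RCpow t (a + b) = (RCpow t a * RCpow t b)%C.
Proof. unfold RCpow; rewrite <- Cexp_plus; f_equal; ring. Qed.

Lemma Cmod_RCpow (t : R) (z : C) : Cmod (RCpow t z) = Rpower t (Re z).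
Proof. unfold RCpow; rewrite Cmod_Cexp, re_scal_r; reflexivity. Qed.

Lemma RCpow_components (t : R) (x y : R) :
  RCpow t (x, y) = (Rpower t x * cis (y * ln t))%C.
Proof. unfold RCpow, Rpower; rewrite <- Cexp_cis; f_equal; apply C_ext; simpl; ring. Qed.

Lemma continuous_ln t : 0 < t -> continuous ln t.
Proof. intros; apply (ex_derive_continuous (V := R_NormedModule)); auto_derive; auto. Qed.

Lemma continuous_RCpow (z : C) (t : R) : 0 < t -> continuous (fun t => RCpow t z) t.
Proof.
  intros Ht; apply continuous_Cexp, continuous_Cmult; [apply continuous_const |].
  apply continuous_RtoC, continuous_ln; auto.
Qed.

Lemma pcosh_ge x t : 0 <= x -> exp (x * Rabs (ln t)) <= pcosh x t.
Proof.
  intros Hx; unfold pcosh, Rpower.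
  pose proof (exp_pos (x * ln t)); pose proof (exp_pos (- x * ln t)).
  unfold Rabs; destruct Rcase_abs; [replace (x * - ln t) with (- x * ln t) by ring |]; lra.
Qed.

(** Differentiating [t ^ s] produces factors [ln t], which [pcosh r t] dominates. Since
    [pcosh r t ^ 2 <= 2 * pcosh (2 * r) t], they cost half of the exponent of the envelope. *)
Lemma env_pcosh r t : 0 < t -> pcosh r t * env (2 * r) t <= 2 * env r t.
Proof.
  intros Ht; unfold env; rewrite !Rinv_mult.
  assert (P := pcosh_pos r t); assert (Q := pcosh_pos (2 * r) t).
  assert (It : 0 < / t) by now apply Rinv_0_lt_compat.
  assert (H : pcosh r t * pcosh r t <= 2 * pcosh (2 * r) t).
  { unfold pcosh.
    replace (Rpower t (2 * r)) with (Rpower t r * Rpower t r) by (rewrite <- Rpower_plus; f_equal; ring).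
    replace (Rpower t (- (2 * r))) with (Rpower t (- r) * Rpower t (- r)) by (rewrite <- Rpower_plus; f_equal; ring).
    pose proof (pow2_ge_0 (Rpower t r - Rpower t (- r))); simpl in H; lra. }
  replace (pcosh r t * (/ t * / pcosh (2 * r) t)) with (/ t * (pcosh r t / pcosh (2 * r) t)) by (field; split; lra).
  replace (2 * (/ t * / pcosh r t)) with (/ t * (2 / pcosh r t)) by (field; split; lra).
  apply Rmult_le_compat_l; [lra |].
  apply Rmult_le_reg_r with (pcosh (2 * r) t * pcosh r t); [now apply Rmult_lt_0_compat |].
  replace (pcosh r t / pcosh (2 * r) t * (pcosh (2 * r) t * pcosh r t)) with (pcosh r t * pcosh r t) by (field; lra).
  replace (2 / pcosh r t * (pcosh (2 * r) t * pcosh r t)) with (2 * pcosh (2 * r) t) by (field; lra).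
  auto.
Qed.

Lemma sq_le_2exp x : 0 <= x -> x ^ 2 <= 2 * exp x.
Proof.
  intros Hx; assert (H := exp_ineq1_le (x / 3)).
  replace (exp x) with (exp (x / 3) ^ 3).
  2: { simpl; rewrite Rmult_1_r, <- !exp_plus; f_equal; field. }
  assert (B := pow_incr (1 + x / 3) (exp (x / 3)) 3 ltac:(lra)).
  assert (Q := Rmult_le_pos x ((x - 9 / 4) ^ 2) Hx (pow2_ge_0 _)).
  nra.
Qed.

Lemma id_le_exp x : x <= exp x.
Proof. assert (H := exp_ineq1_le x); lra. Qed.

Lemma exp_le_compat x y : x <= y -> exp x <= exp y.
Proof. intros [H|H]; [left; now apply exp_increasing | right; now rewrite H]. Qed.

Lemma ln_le_compat x y : 0 < x -> x <= y -> ln x <= ln y.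
Proof. intros Hx [H|H]; [left; now apply ln_increasing | right; now rewrite H]. Qed.

(** The derivative is the same integral with a factor [ln t]. The error at [s + h] is the integral
    of [t ^ s * phi t * (exp (h ln t) - 1 - h ln t)], of order [Cmod h ^ 2] by [Cexp_remainder]. *)
Theorem mellin_cdiff (phi : R -> C) (F : C -> C) (s : C) (K r d : R) : 0 < r -> 0 < d ->
  (forall t, 0 < t -> continuous phi t) ->
  (forall t, 0 < t -> Cmod (phi t) * Rpower t (Re s) <= K * env (2 * r) t) ->
  (forall h, Cmod h < d -> GI (fun t => (RCpow t (s + h) * phi t)%C) (F (s + h)%C)) ->
  exists l, cdiff F s l.
Proof.
  intros Hr Hd Hphi Hdom HF.
  assert (Hg : forall t, 0 < t -> continuous (fun t => (RCpow t s * phi t)%C) t).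
  { intros t Ht; apply continuous_Cmult; auto; now apply continuous_RCpow. }
  assert (Hl : forall t, 0 < t -> continuous (fun t => RtoC (ln t)) t)
    by (intros; apply continuous_RtoC, continuous_ln; auto).
  assert (Habs : forall t, 0 < t -> Rabs (ln t) <= / r * pcosh r t).
  { intros t Ht; apply Rmult_le_reg_l with r; auto.
    replace (r * (/ r * pcosh r t)) with (pcosh r t) by (field; lra).
    apply Rle_trans with (1 := id_le_exp _), pcosh_ge; lra. }
  destruct (GI_dom (fun t => (ln t * (RCpow t s * phi t))%C) (2 * K / r) r Hr) as [l [Hl1 _]].
  { intros t Ht; apply continuous_Cmult; auto. }
  { intros t Ht; rewrite !Cmod_mult, Cmod_R, Cmod_RCpow, (Rmult_comm (Rpower _ _)).
    specialize (Hdom t Ht); specialize (Habs t Ht); assert (E := env_pcosh r t Ht).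
    assert (HK : 0 <= K * env (2 * r) t).
    { apply Rle_trans with (2 := Hdom); apply Rmult_le_pos; [apply Cmod_ge_0 | left; apply exp_pos]. }
    apply Rle_trans with (/ r * pcosh r t * (K * env (2 * r) t)).
    - apply Rmult_le_compat; auto; [apply Rabs_pos |].
      apply Rmult_le_pos; [apply Cmod_ge_0 | left; apply exp_pos].
    - assert (HK0 : 0 <= K) by (pose proof (env_pos (2 * r) t Ht); nra).
      replace (/ r * pcosh r t * (K * env (2 * r) t)) with (K / r * (pcosh r t * env (2 * r) t)) by (field; lra).
      replace (2 * K / r * env r t) with (K / r * (2 * env r t)) by (field; lra).
      apply Rmult_le_compat_l; auto; apply Rdiv_le_0_compat; auto. }
  exists l.
  (* With [Cmod h < r / 2] the exponential in the remainder uses half of the available exponent [r];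
     the other half absorbs the square of the logarithm. *)
  assert (Hd' : 0 < Rmin d (r / 2)) by (apply Rmin_glb_lt; lra).
  apply cdiff_of_quadratic with (d := Rmin d (r / 2)) (M := 16 * K / r ^ 2 * (PI / 2 / r)); auto.
  intros w Hw; set (h := (w - s)%C) in *.
  assert (Hhd : Cmod h < d) by (apply Rlt_le_trans with (1 := Hw), Rmin_l).
  assert (Hhr : Cmod h < r / 2) by (apply Rlt_le_trans with (1 := Hw), Rmin_r).
  assert (HF0 := HF 0%C ltac:(rewrite Cmod_0; auto)); rewrite Cplus_0_r in HF0.
  assert (HFh := HF h Hhd); replace w with (s + h)%C by (unfold h; ring).
  assert (G := GI_minus _ _ _ _ (GI_minus _ _ _ _ HFh HF0) (GI_Cmult_l h _ _ Hl1)).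
  simpl in G.
  destruct (GI_dom (fun t => (RCpow t s * phi t * (Cexp (h * ln t) - 1 - h * ln t))%C)
    (16 * K / r ^ 2 * Cmod h ^ 2) r Hr) as [l' [Hl' Bl']].
  { intros t Ht; apply continuous_Cmult; auto.
    assert (continuous (fun t : R => (h * ln t)%C) t) by (apply continuous_Cmult; auto; apply continuous_const).
    apply continuous_Cminus; auto; apply continuous_Cminus; [| apply continuous_const].
    now apply continuous_Cexp. }
  { intros t Ht; rewrite !Cmod_mult, Cmod_RCpow, (Rmult_comm (Rpower _ _)).
    specialize (Hdom t Ht); assert (E := env_pcosh r t Ht).
    assert (B := Cexp_remainder (h * ln t)); rewrite Cmod_mult, Cmod_R in B.
    set (u := Rabs (ln t)) in *; assert (Hu : 0 <= u) by apply Rabs_pos.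
    assert (Hc := Cmod_ge_0 h).
    assert (B2 : (Cmod h * u) ^ 2 * exp (Cmod h * u) <= Cmod h ^ 2 * (8 / r ^ 2 * pcosh r t)).
    { assert (X1 := sq_le_2exp (r / 2 * u) ltac:(nra)).
      assert (X2 : exp (Cmod h * u) <= exp (r / 2 * u)) by (apply exp_le_compat; nra).
      assert (X3 := pcosh_ge r t ltac:(lra)); fold u in X3.
      rewrite Rpow_mult_distr, Rmult_assoc; apply Rmult_le_compat_l; [apply pow2_ge_0 |].
      apply Rle_trans with (8 / r ^ 2 * exp (r * u)).
      2: { apply Rmult_le_compat_l; auto; apply Rdiv_le_0_compat; [lra | apply pow_lt; auto]. }
      replace (r * u) with (r / 2 * u + r / 2 * u) by field; rewrite exp_plus.
      replace (u ^ 2) with (4 / r ^ 2 * (r / 2 * u) ^ 2) by (field; lra).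
      replace (8 / r ^ 2 * (exp (r / 2 * u) * exp (r / 2 * u))) with
        (4 / r ^ 2 * (2 * exp (r / 2 * u)) * exp (r / 2 * u)) by (field; lra).
      apply Rmult_le_compat; auto.
      - apply Rmult_le_pos; [| apply pow2_ge_0]; apply Rdiv_le_0_compat; [lra | apply pow_lt; auto].
      - left; apply exp_pos.
      - apply Rmult_le_compat_l; auto; apply Rdiv_le_0_compat; [lra | apply pow_lt; auto]. }
    apply Rle_trans with (K * env (2 * r) t * (Cmod h ^ 2 * (8 / r ^ 2 * pcosh r t))).
    - apply Rmult_le_compat; auto; [| apply Cmod_ge_0 | lra].
      apply Rmult_le_pos; [apply Cmod_ge_0 | left; apply exp_pos].
    - assert (HK : 0 <= K * env (2 * r) t).
      { apply Rle_trans with (2 := Hdom); apply Rmult_le_pos; [apply Cmod_ge_0 | left; apply exp_pos]. }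
      assert (HK0 : 0 <= K) by (pose proof (env_pos (2 * r) t Ht); nra).
      replace (K * env (2 * r) t * (Cmod h ^ 2 * (8 / r ^ 2 * pcosh r t))) with
        (Cmod h ^ 2 * (8 * K / r ^ 2) * (pcosh r t * env (2 * r) t)) by (field; lra).
      replace (16 * K / r ^ 2 * Cmod h ^ 2 * env r t) with
        (Cmod h ^ 2 * (8 * K / r ^ 2) * (2 * env r t)) by (field; lra).
      apply Rmult_le_compat_l; auto; apply Rmult_le_pos; [apply pow2_ge_0 |].
      apply Rdiv_le_0_compat; [lra | apply pow_lt; auto]. }
  assert (El : (F (s + h)%C - F s - h * l)%C = l').
  { apply (GI_unique (fun t => (RCpow t (s + h) * phi t - RCpow t s * phi t - h * (ln t * (RCpow t s * phi t)))%C)).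
    - exact G.
    - revert Hl'; apply GI_ext; intros t Ht; rewrite RCpow_plus.
      change (RCpow t h) with (Cexp (h * ln t)); ring. }
  rewrite El; apply Rle_trans with (1 := Bl'); right; ring.
Qed.

(** * The Gamma function *)

(** From [ln u <= u] at [u = t / (y + 1)]; the shift by one keeps the logarithm meaningful at
    [y = 0]. *)
Lemma Rpower_exp_le y t : 0 <= y -> 0 < t -> Rpower t y * exp (- t) <= exp (y * ln (y + 1)).
Proof.
  intros Hy Ht; unfold Rpower; rewrite <- exp_plus; apply exp_le_compat.
  assert (H : ln (t / (y + 1)) <= t / (y + 1)).
  { assert (P : 0 < t / (y + 1)) by (apply Rdiv_lt_0_compat; lra).
    rewrite <- (exp_ln (t / (y + 1))) at 2 by auto; apply id_le_exp. }
  unfold Rdiv in H; rewrite ln_mult, ln_Rinv in H; try lra; [| apply Rinv_0_lt_compat; lra].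
  assert (y * (t * / (y + 1)) <= t).
  { apply Rmult_le_reg_r with (y + 1); [lra |].
    replace (y * (t * / (y + 1)) * (y + 1)) with (y * t) by (field; lra); nra. }
  nra.
Qed.

Definition gamma_integrand (z : C) (t : R) : C := (RCpow t (z - 1) * exp (- t))%C.

Lemma gamma_dom x r : 0 < r <= x -> exists K, forall t, 0 < t ->
  Rpower t (x - 1) * exp (- t) <= K * env r t.
Proof.
  intros Hr; exists (exp ((x + r) * ln (x + r + 1)) + exp ((x - r) * ln (x - r + 1))).
  intros t Ht; unfold env.
  assert (P := pcosh_pos r t).
  apply Rmult_le_reg_r with (t * pcosh r t); [now apply Rmult_lt_0_compat |].
  rewrite Rmult_assoc, (Rmult_assoc _ (/ _)), Rinv_l by (apply Rgt_not_eq, Rmult_lt_0_compat; auto).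
  rewrite Rmult_1_r.
  assert (A := Rpower_exp_le (x + r) t ltac:(lra) Ht).
  assert (B := Rpower_exp_le (x - r) t ltac:(lra) Ht).
  replace (Rpower t (x - 1) * (exp (- t) * (t * pcosh r t))) with
    (Rpower t (x + r) * exp (- t) + Rpower t (x - r) * exp (- t)); [lra |].
  unfold pcosh; replace (x + r) with (x - 1 + (1 + r)) by ring; replace (x - r) with (x - 1 + (1 + - r)) by ring.
  rewrite !Rpower_plus, Rpower_1 by auto; ring.
Qed.

Lemma Cmod_gamma_integrand z t : Cmod (gamma_integrand z t) = Rpower t (Re z - 1) * exp (- t).
Proof.
  unfold gamma_integrand; rewrite Cmod_mult, Cmod_RCpow, Cmod_R, Rabs_right by (left; apply exp_pos).
  reflexivity.
Qed.

Lemma continuous_exp_opp t : continuous (fun t => exp (- t)) t.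
Proof. apply (ex_derive_continuous (V := R_NormedModule)); auto_derive; auto. Qed.

Lemma continuous_gamma_integrand z t : 0 < t -> continuous (gamma_integrand z) t.
Proof.
  intros; apply continuous_Cmult; [now apply continuous_RCpow |].
  apply continuous_RtoC, continuous_exp_opp.
Qed.

Lemma GI_gamma z : 0 < Re z -> GI (gamma_integrand z) (CGamma z).
Proof.
  intros Hz; destruct (gamma_dom (Re z) (Re z)) as [K HK]; [lra |].
  destruct (GI_dom (gamma_integrand z) K (Re z) Hz) as [l [Hl _]].
  - intros; now apply continuous_gamma_integrand.
  - intros; rewrite Cmod_gamma_integrand; auto.
  - replace (CGamma z) with l; auto.
    symmetry; exact (GI_RInt_gen _ _ Hl).
Qed.

Lemma CGamma_cdiff z : 0 < Re z -> exists l, cdiff CGamma z l.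
Proof.
  intros Hz; destruct (gamma_dom (Re z) (Re z)) as [K HK]; [lra |].
  destruct (mellin_cdiff (fun t => RtoC (exp (- t))) (fun s => CGamma (s + 1)%C) (z - 1)%C K (Re z / 2) (Re z))
    as [l Hl]; try lra.
  - intros; apply continuous_RtoC, continuous_exp_opp.
  - intros t Ht; replace (2 * (Re z / 2)) with (Re z) by field.
    rewrite Cmod_R, Rabs_right by (left; apply exp_pos); rewrite Rmult_comm.
    exact (HK t Ht).
  - intros h Hh.
    assert (Hp : 0 < Re (z - 1 + h + 1)).
    { assert (B := Re_le_Cmod h); apply Rabs_le_between in B; unfold Re in *; simpl in *; lra. }
    generalize (GI_gamma _ Hp); apply GI_ext; intros t Ht; unfold gamma_integrand.
    do 2 f_equal; ring.
  - exists (l * (1 - 0))%C.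
    apply (cdiff_ext (fun w => CGamma (w - 1 + 1)%C)); [intros; f_equal; ring |].
    apply (cdiff_comp (fun w => CGamma (w + 1)%C) (fun w => (w - 1)%C)); auto.
    apply cdiff_minus; [apply cdiff_id | apply cdiff_const].
Qed.

(** Integration by parts: the difference of the two integrands has the primitive
    [- t ^ z * exp (- t)], which vanishes at both ends. *)
Lemma CGamma_plus_1 z : 0 < Re z -> CGamma (z + 1) = (z * CGamma z)%C.
Proof.
  intros Hz.
  assert (Hz1 : 0 < Re (z + 1)) by (simpl; unfold Re in *; lra).
  assert (G := GI_minus _ _ _ _ (GI_gamma _ Hz1) (GI_Cmult_l z _ _ (GI_gamma _ Hz))).
  apply Ceq_minus, (GI_unique _ _ _ G).
  apply GI_FTC_0 with (F := fun t => (- (RCpow t z * exp (- t)))%C).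
  - intros t Ht.
    assert (E1 : forall t, 0 < t -> gamma_integrand (z + 1) t = (RCpow t z * exp (- t))%C)
      by (intros; unfold gamma_integrand; do 2 f_equal; ring).
    assert (E2 : forall t, 0 < t -> gamma_integrand z t = (RCpow t z * / t * exp (- t))%C).
    { intros s Hs; unfold gamma_integrand; do 2 f_equal.
      replace (RCpow s z) with (RCpow s (z - 1) * RCpow s 1)%C by (rewrite <- RCpow_plus; f_equal; ring).
      replace (RCpow s 1) with (RtoC s).
      - field; apply RtoC_neq; lra.
      - unfold RCpow; rewrite Cmult_1_l, Cexp_RtoC, exp_ln; auto. }
    rewrite E1, E2 by auto; clear E1 E2 G.
    destruct z as [x y]; split; rewrite RCpow_components, <- RtoC_inv by lra.
    + apply (is_derive_ext (fun t => - (Rpower t x * cos (y * ln t) * exp (- t)))).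
      { intros u; rewrite RCpow_components; simpl; ring. }
      simpl; unfold Rpower; auto_derive; repeat split; auto; unfold Rminus; field; lra.
    + apply (is_derive_ext (fun t => - (Rpower t x * sin (y * ln t) * exp (- t)))).
      { intros u; rewrite RCpow_components; simpl; ring. }
      simpl; unfold Rpower; auto_derive; repeat split; auto; unfold Rminus; field; lra.
  - intros t Ht; apply continuous_Cminus; [now apply continuous_gamma_integrand |].
    apply continuous_Cmult; [apply continuous_const | now apply continuous_gamma_integrand].
  - intros eps Heps; set (x := Re z) in *.
    assert (Hm : forall t, Cmod (- (RCpow t z * exp (- t))) = Rpower t x * exp (- t)).
    { intros t; rewrite Cmod_opp, Cmod_mult, Cmod_RCpow, Cmod_R, Rabs_right; auto; left; apply exp_pos. }
    set (K := exp ((x + 1) * ln (x + 1 + 1))); assert (HK : 0 < K) by apply exp_pos.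
    exists (Rpower eps (/ x)), (K / eps).
    assert (P : 0 < Rpower eps (/ x)) by apply exp_pos.
    split; auto; split; intros t Ht; rewrite Hm.
    + assert (Rpower t x < eps).
      { replace eps with (Rpower (Rpower eps (/ x)) x) by (rewrite Rpower_mult, Rinv_l by lra; now apply Rpower_1).
        unfold Rpower at 1 2; apply exp_increasing, Rmult_lt_compat_l; auto; apply ln_increasing; lra. }
      assert (exp (- t) < 1) by (rewrite <- exp_0; apply exp_increasing; lra).
      pose proof (exp_pos (- t)); assert (0 < Rpower t x) by apply exp_pos; nra.
    + assert (Htp : 0 < t) by (apply Rlt_trans with (2 := Ht), Rdiv_lt_0_compat; auto).
      assert (B := Rpower_exp_le (x + 1) t ltac:(lra) Htp); fold K in B.
      rewrite Rpower_plus, Rpower_1 in B by auto.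
      apply Rmult_lt_reg_r with t; auto.
      apply Rle_lt_trans with K; [lra |].
      apply Rmult_lt_compat_r with (r := eps) in Ht; auto.
      replace (K / eps * eps) with K in Ht by (field; lra); lra.
Qed.

Definition rgamma (x : R) : R := Re (CGamma x).

Lemma RGI_rgamma x : 0 < x -> RGI (fun t => Rpower t (x - 1) * exp (- t)) (rgamma x).
Proof.
  intros Hx; assert (G := GI_Re _ _ (GI_gamma x Hx)); revert G; apply RGI_ext.
  intros t Ht; unfold gamma_integrand; rewrite <- RtoC_minus.
  change (RtoC (x - 1)) with ((x - 1, 0) : C); rewrite RCpow_components, Rmult_0_l, cis_0; simpl; ring.
Qed.

Lemma rgamma_plus_1 x : 0 < x -> rgamma (x + 1) = x * rgamma x.
Proof.
  intros Hx; unfold rgamma; rewrite RtoC_plus, CGamma_plus_1 by auto; apply re_scal_l.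
Qed.

Lemma Cmod_CGamma_le z : 0 < Re z -> Cmod (CGamma z) <= rgamma (Re z).
Proof.
  intros Hz; apply (GI_norm _ _ _ _ (GI_gamma z Hz) (RGI_rgamma _ Hz)).
  intros t Ht; rewrite Cmod_gamma_integrand; lra.
Qed.

Lemma rgamma_nonneg x : 0 < x -> 0 <= rgamma x.
Proof. intros Hx; apply Rle_trans with (2 := Cmod_CGamma_le x Hx), Cmod_ge_0. Qed.

Lemma rgamma_1 : rgamma 1 = 1.
Proof.
  assert (HD : forall t, Derive (fun t => - exp (- t)) t = exp (- t)).
  { intros t; apply is_derive_unique; auto_derive; auto; ring. }
  assert (G : RGI (Derive (fun t => - exp (- t))) (0 - - 1)).
  { apply is_RInt_gen_Derive.
    - apply filter_forall; intros ab x _; auto_derive; auto.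
    - apply filter_forall; intros ab x _.
      apply (continuous_ext (fun t => exp (- t))); [intros; now rewrite HD | apply continuous_exp_opp].
    - assert (C0 : continuous (fun t => - exp (- t)) 0).
      { apply (ex_derive_continuous (V := R_NormedModule)); auto_derive; auto. }
      unfold continuous in C0; rewrite Ropp_0, exp_0 in C0.
      intros P HP; generalize (C0 P HP); unfold filtermap, at_right, within.
      apply filter_imp; auto.
    - replace 0 with (- 0) at 1 by ring.
      assert (L : is_lim (fun t => - exp (- t)) p_infty (Rbar_opp 0)).
      { apply is_lim_opp, (is_lim_comp exp Ropp p_infty 0 m_infty).
        - apply is_lim_exp_m.
        - apply is_lim_opp', is_lim_id || (apply (is_lim_opp (fun t => t) p_infty p_infty), is_lim_id).
        - exists 0; intros; discriminate. }
      exact L. }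
  assert (G2 := RGI_rgamma 1 Rlt_0_1).
  transitivity (0 - - 1); [| ring].
  assert (G3 : RGI (fun t => Rpower t (1 - 1) * exp (- t)) (0 - - 1)).
  { revert G; apply RGI_ext; intros t Ht; rewrite HD, Rminus_diag, Rpower_O by auto; ring. }
  transitivity (RInt_gen (V := R_CompleteNormedModule) (fun t => Rpower t (1 - 1) * exp (- t)) (at_right 0) (Rbar_locally p_infty)).
  - symmetry; exact (is_RInt_gen_unique (V := R_CompleteNormedModule) _ _ G2).
  - exact (is_RInt_gen_unique (V := R_CompleteNormedModule) _ _ G3).
Qed.

Lemma RGI_plus f g l m : RGI f l -> RGI g m -> RGI (fun t => f t + g t) (l + m).
Proof. exact (is_RInt_gen_plus (V := R_NormedModule) f g l m). Qed.

Lemma RGI_scal c f l : RGI f l -> RGI (fun t => c * f t) (c * l).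
Proof. exact (is_RInt_gen_scal (V := R_NormedModule) f c l). Qed.

(** For these [x] one has [t - t ^ 2 / 4 <= t ^ (x - 1) <= 1 + t]; integrating against [exp (- t)]
    leaves the values of Gamma at [1], [2] and [3]. *)
Lemma rgamma_bounds_1_2 x : 1 <= x <= 2 -> / 2 <= rgamma x <= 2.
Proof.
  intros Hx.
  assert (G1 := rgamma_1).
  assert (G2 : rgamma 2 = 1) by (replace 2 with (1 + 1) by ring; rewrite rgamma_plus_1; lra).
  assert (G3 : rgamma 3 = 2) by (replace 3 with (2 + 1) by ring; rewrite rgamma_plus_1; lra).
  assert (I1 := RGI_rgamma 1 ltac:(lra)); assert (I2 := RGI_rgamma 2 ltac:(lra)).
  assert (I3 := RGI_rgamma 3 ltac:(lra)); assert (Ix := RGI_rgamma x ltac:(lra)).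
  rewrite G1 in I1; rewrite G2 in I2; rewrite G3 in I3.
  assert (P1 : forall t, 0 < t -> Rpower t (1 - 1) = 1) by (intros; now rewrite Rminus_diag, Rpower_O).
  assert (P2 : forall t, 0 < t -> Rpower t (2 - 1) = t) by (intros; replace (2 - 1) with 1 by ring; now apply Rpower_1).
  assert (P3 : forall t, 0 < t -> Rpower t (3 - 1) = t * t).
  { intros; replace (3 - 1) with (1 + 1) by ring; now rewrite Rpower_plus, Rpower_1. }
  assert (Hmono : forall t, 0 < t -> (t <= 1 -> t <= Rpower t (x - 1) <= 1) /\ (1 <= t -> 1 <= Rpower t (x - 1) <= t)).
  { intros t Ht; split; intros H1.
    - assert (L : ln t <= 0) by (rewrite <- ln_1; now apply ln_le_compat).
      split.
      + apply Rle_trans with (exp (ln t)); [rewrite exp_ln; lra | unfold Rpower; apply exp_le_compat; nra].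
      + apply Rle_trans with (exp 0); [unfold Rpower; apply exp_le_compat; nra | rewrite exp_0; lra].
    - assert (L : 0 <= ln t) by (rewrite <- ln_1; apply ln_le_compat; lra).
      split.
      + apply Rle_trans with (exp 0); [rewrite exp_0; lra | unfold Rpower; apply exp_le_compat; nra].
      + apply Rle_trans with (exp (ln t)); [unfold Rpower; apply exp_le_compat; nra | rewrite exp_ln; lra]. }
  split.
  - replace (/ 2) with (1 + - / 4 * 2) by field.
    apply (RGI_le _ _ _ _ (RGI_plus _ _ _ _ I2 (RGI_scal (- / 4) _ _ I3)) Ix).
    intros t Ht; rewrite P2, P3 by auto; pose proof (exp_pos (- t)).
    destruct (Hmono t Ht) as [A B].
    assert (t - / 4 * (t * t) <= Rpower t (x - 1)).
    { destruct (Rle_lt_dec t 1) as [H1|H1]; [specialize (A H1); nra |].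
      specialize (B ltac:(lra)); pose proof (pow2_ge_0 (t - 2)); simpl in *; nra. }
    nra.
  - replace 2 with (1 + 1) by ring.
    apply (RGI_le _ _ _ _ Ix (RGI_plus _ _ _ _ I1 I2)).
    intros t Ht; rewrite P1, P2 by auto; pose proof (exp_pos (- t)).
    destruct (Hmono t Ht) as [A B].
    assert (Rpower t (x - 1) <= 1 + t).
    { destruct (Rle_lt_dec t 1) as [H1|H1]; [specialize (A H1); lra | specialize (B ltac:(lra)); lra]. }
    nra.
Qed.

Lemma Cmod_cis_minus a b : Cmod (cis a - cis b) <= Rabs (a - b).
Proof.
  assert (K : forall a b, a <= b -> Cmod (cis b - cis a) <= b - a).
  { clear; intros a b Hab.
    replace (cis b - cis a)%C with (CI (fun t => (Ci * cis t)%C) a b).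
    - rewrite <- (Rmult_1_r (b - a)); apply Cmod_CI_le_const; auto.
      + apply ex_CI_continuous; intros; apply continuous_Cmult; [apply continuous_const |].
        apply continuous_cis, continuous_id.
      + intros; rewrite Cmod_mult, Cmod_Ci, Cmod_cis; lra.
    - apply CI_FTC.
      + intros t _; unfold cis; simpl; split; auto_derive; auto; ring.
      + intros; apply continuous_Cmult; [apply continuous_const |].
        apply continuous_cis, continuous_id. }
  destruct (Rle_lt_dec a b) as [H|H].
  - rewrite Cmod_minus_sym, Rabs_minus_sym, (Rabs_right (b - a)) by lra; auto.
  - rewrite Rabs_right by lra; apply K; lra.
Qed.

Lemma sq_le_cosh x : x ^ 2 <= exp x + exp (- x) - 2.
Proof.
  assert (K1 : forall x, 0 <= x -> 0 <= exp x - exp (- x) - 2 * x).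
  { intros y Hy; destruct (MVT_is_derive (fun x => exp x - exp (- x) - 2 * x)
      (fun x => exp x + exp (- x) - 2) 0 y) as [c [Hc E]]; auto.
    - intros t _; auto_derive; auto; ring.
    - rewrite Ropp_0, exp_0 in E.
      assert (0 <= exp c + exp (- c) - 2).
      { rewrite exp_Ropp; pose proof (exp_pos c).
        replace (exp c + / exp c - 2) with ((exp c - 1) ^ 2 / exp c) by (field; lra).
        apply Rdiv_le_0_compat; auto; apply pow2_ge_0. }
      nra. }
  assert (K2 : forall x, 0 <= x -> x ^ 2 <= exp x + exp (- x) - 2).
  { intros y Hy; destruct (MVT_is_derive (fun x => exp x + exp (- x) - 2 - x ^ 2)
      (fun x => exp x - exp (- x) - 2 * x) 0 y) as [c [Hc E]]; auto.
    - intros t _; auto_derive; auto; ring.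
    - rewrite Ropp_0, exp_0 in E; specialize (K1 c ltac:(lra)); nra. }
  destruct (Rle_lt_dec 0 x) as [H|H]; auto.
  specialize (K2 (- x) ltac:(lra)); rewrite Ropp_involutive in K2; simpl in *; lra.
Qed.

(** With [u = ln t - ln X], this is [2 |u| <= k u ^ 2 + 1 / k] and [u ^ 2 <= 2 cosh u - 2]. The
    right side is a combination of [t], [1] and [1 / t], so its Gamma integral is explicit. *)
Lemma ln_ratio_bound t X k : 0 < t -> 0 < X -> 0 < k ->
  Rabs (ln t - ln X) <= / 2 * (k * (t / X - 2 + X / t) + / k).
Proof.
  intros Ht HX Hk; set (u := ln t - ln X).
  assert (B := sq_le_cosh u).
  replace (exp u) with (t / X) in B.
  2: { unfold u, Rminus; rewrite exp_plus, exp_Ropp, !exp_ln by auto; reflexivity. }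
  replace (exp (- u)) with (X / t) in B.
  2: { unfold u; replace (- (ln t - ln X)) with (ln X + - ln t) by ring.
       rewrite exp_plus, exp_Ropp, !exp_ln by auto; reflexivity. }
  assert (S : Rabs u <= / 2 * (k * u ^ 2 + / k)).
  { assert (Q := pow2_ge_0 (k * Rabs u - 1)).
    assert (E : u ^ 2 = Rabs u ^ 2) by (unfold Rabs; destruct Rcase_abs; ring).
    rewrite E; apply Rmult_le_reg_l with (2 * k); [lra |].
    replace (2 * k * (/ 2 * (k * Rabs u ^ 2 + / k))) with (k ^ 2 * Rabs u ^ 2 + 1) by (field; lra).
    nra. }
  apply Rle_trans with (1 := S); nra.
Qed.

Lemma rgamma_minus_1 x : 1 < x -> (x - 1) * rgamma (x - 1) = rgamma x.
Proof. intros Hx; rewrite <- rgamma_plus_1 by lra; f_equal; ring. Qed.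

(** The mass of the Gamma integrand sits at distance about [sqrt X] from [X], where [t ^ (i y)]
    hardly turns if [y] is small against [sqrt X]. Freezing it at [t = X] costs on average [|y| / k]
    by [ln_ratio_bound] with [k = sqrt (X - 1)]. *)
Lemma CGamma_lower (X y : R) : 1 < X ->
  rgamma X * (1 - Rabs y / sqrt (X - 1)) <= Cmod (CGamma (X, y)).
Proof.
  intros HX; set (k := sqrt (X - 1)).
  assert (Hk : 0 < k) by (apply sqrt_lt_R0; lra).
  assert (Hkk : k * k = X - 1) by (apply sqrt_sqrt; lra).
  assert (G := GI_minus _ _ _ _ (GI_gamma (X, y) ltac:(simpl; lra))
     (GI_Cmult_l (cis (y * ln X)) _ _ (GI_gamma X ltac:(simpl; lra)))).
  assert (R0 := RGI_rgamma X ltac:(lra)); assert (R1 := RGI_rgamma (X + 1) ltac:(lra)).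
  assert (R2 := RGI_rgamma (X - 1) ltac:(lra)).
  assert (RG := RGI_scal (Rabs y * / 2) _ _ (RGI_plus _ _ _ _ (RGI_scal (k / X) _ _ R1)
     (RGI_plus _ _ _ _ (RGI_scal (- 2 * k + / k) _ _ R0) (RGI_scal (k * X) _ _ R2)))).
  assert (B := GI_norm _ _ _ _ G RG); simpl in B.
  assert (E2 : rgamma (X - 1) = rgamma X / (X - 1)).
  { rewrite <- (rgamma_minus_1 X) by auto; field; lra. }
  rewrite rgamma_plus_1, E2 in B by lra.
  assert (Hg := rgamma_nonneg X ltac:(lra)).
  assert (Ht : Cmod (CGamma (X, y) - cis (y * ln X) * CGamma X) <= rgamma X * (Rabs y / k)).
  { apply Rle_trans with (Rabs y * / 2 *
      (k / X * (X * rgamma X) + ((- 2 * k + / k) * rgamma X + k * X * (rgamma X / (X - 1))))).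
    2: { right; rewrite <- Hkk; replace X with (k * k + 1) by lra; field; split; nra. }
    apply B; clear B; intros t Ht.
    assert (E : (gamma_integrand (X, y) t - cis (y * ln X) * gamma_integrand X t)%C
      = ((Rpower t (X - 1) * exp (- t))%R * (cis (y * ln t) - cis (y * ln X)))%C).
    { unfold gamma_integrand.
      replace ((X, y) - 1)%C with ((X - 1, y) : C) by (apply C_ext; simpl; ring).
      replace (X - 1)%C with ((X - 1, 0) : C) by (apply C_ext; simpl; ring).
      rewrite !RCpow_components, Rmult_0_l, cis_0, RtoC_mult; ring. }
    rewrite E, Cmod_mult, Cmod_R, Rabs_right.
    2: { apply Rle_ge, Rmult_le_pos; left; apply exp_pos. }
    assert (P : 0 < Rpower t (X - 1) * exp (- t)) by (apply Rmult_lt_0_compat; apply exp_pos).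
    apply Rle_trans with (Rpower t (X - 1) * exp (- t) * (Rabs y * (/ 2 * (k * (t / X - 2 + X / t) + / k)))).
    - apply Rmult_le_compat_l; [lra |].
      apply Rle_trans with (1 := Cmod_cis_minus _ _).
      rewrite <- Rmult_minus_distr_l, Rabs_mult; apply Rmult_le_compat_l; [apply Rabs_pos |].
      apply ln_ratio_bound; lra.
    - right; replace (X + 1 - 1) with (X - 1 + 1) by ring; replace (X - 1 - 1) with (X - 1 + - (1)) by ring.
      rewrite !Rpower_plus, Rpower_Ropp, Rpower_1 by auto; field; repeat split; lra. }
  assert (Hr : rgamma X <= Cmod (cis (y * ln X) * CGamma X)).
  { rewrite Cmod_mult, Cmod_cis, Rmult_1_l.
    apply Rle_trans with (1 := Rle_abs _), Re_le_Cmod. }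
  assert (T := Cmod_triangle_rev (cis (y * ln X) * CGamma X) (CGamma (X, y))).
  assert (T2 := Cmod_triangle_rev (cis (y * ln X) * CGamma X) (cis (y * ln X) * CGamma X - CGamma (X, y))).
  replace (cis (y * ln X) * CGamma X - (cis (y * ln X) * CGamma X - CGamma (X, y)))%C
    with (CGamma (X, y)) in T2 by ring.
  rewrite (Cmod_minus_sym _ (CGamma (X, y))) in T2; lra.
Qed.

(** The real part of [(s - 1/2) log s - s] at [s = x + i y]; the constant [ln (2 pi) / 2] is left in
    the error. *)
Definition stirling (x y : R) : R := (x - / 2) * (ln (x ^ 2 + y ^ 2) / 2) - y * atan (y / x) - x.

Lemma sq_sum_pos x y : 0 < x -> 0 < x ^ 2 + y ^ 2.
Proof. intros; pose proof (pow2_ge_0 y); pose proof (pow_lt x 2 H); lra. Qed.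

(* The step [stirling (x + 1) y - stirling x y] is the trapezoidal rule for
   [ln |x + u + i y|] on [0 <= u <= 1], plus [ln |x + i y|]. *)
Lemma stirling_step x y : 1 <= x ->
  Rabs (stirling (x + 1) y - stirling x y - ln (x ^ 2 + y ^ 2) / 2) <= / x ^ 2.
Proof.
  intros Hx.
  set (phi := fun u => ln ((x + u) ^ 2 + y ^ 2) / 2).
  set (phi1 := fun u => (x + u) / ((x + u) ^ 2 + y ^ 2)).
  set (phi2 := fun u => (y ^ 2 - (x + u) ^ 2) / ((x + u) ^ 2 + y ^ 2) ^ 2).
  assert (Hp : forall u, 0 <= u -> 0 < (x + u) ^ 2 + y ^ 2) by (intros; apply sq_sum_pos; lra).
  assert (D1 : forall u, 0 <= u -> is_derive phi u (phi1 u)).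
  { intros u Hu; specialize (Hp u Hu); unfold phi, phi1; auto_derive; auto; field; lra. }
  assert (D2 : forall u, 0 <= u -> is_derive phi1 u (phi2 u)).
  { intros u Hu; specialize (Hp u Hu); unfold phi1, phi2; auto_derive; [lra | field; lra]. }
  assert (B2 : forall u, 0 <= u -> Rabs (phi2 u) <= / x ^ 2).
  { intros u Hu; specialize (Hp u Hu); unfold phi2, Rdiv.
    rewrite Rabs_mult, Rabs_inv, (Rabs_right (_ ^ 2)) by (apply Rle_ge, pow2_ge_0).
    assert (Hxp : 0 < x ^ 2) by (apply pow_lt; lra).
    assert (A : Rabs (y ^ 2 - (x + u) ^ 2) <= (x + u) ^ 2 + y ^ 2).
    { pose proof (pow2_ge_0 y); pose proof (pow2_ge_0 (x + u)); apply Rabs_le; lra. }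
    apply Rle_trans with (((x + u) ^ 2 + y ^ 2) * / ((x + u) ^ 2 + y ^ 2) ^ 2).
    - apply Rmult_le_compat_r; auto; left; apply Rinv_0_lt_compat, pow_lt; auto.
    - replace (((x + u) ^ 2 + y ^ 2) * / ((x + u) ^ 2 + y ^ 2) ^ 2) with (/ ((x + u) ^ 2 + y ^ 2)) by (field; lra).
      apply Rinv_le_contravar; auto; pose proof (pow2_ge_0 y); nra. }
  (* The trapezoidal error with the right endpoint as a variable. Its derivative contains only [phi]
     and [phi1], and two more mean value steps reduce it to [phi2]. *)
  set (E := fun u => stirling (x + u) y - stirling x y + / 2 * (phi u - phi 0) - u / 2 * (phi u + phi 0)).
  destruct (MVT_is_derive E (fun u => / 2 * (phi u - phi 0 - u * phi1 u)) 0 1) as [c [Hc EE]]; [lra | |].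
  { intros u Hu; specialize (Hp u (proj1 Hu)).
    assert (Hxu : x + u <> 0) by lra.
    unfold E, stirling, phi, phi1; auto_derive; repeat split; auto; try (simpl in *; nra); try lra.
    change ((x + u) * ((x + u) * 1)) with ((x + u) ^ 2).
    change ((x + 0) * ((x + 0) * 1)) with ((x + 0) ^ 2).
    change (y * (y * 1)) with (y ^ 2).
    field; repeat split; try lra; simpl in *; nra. }
  destruct (MVT_is_derive phi phi1 0 c) as [c1 [Hc1 E1]]; [lra | intros; apply D1; lra |].
  destruct (MVT_is_derive phi1 phi2 c1 c) as [c2 [Hc2 E2]]; [lra | intros; apply D2; lra |].
  assert (E0 : E 0 = 0) by (unfold E; rewrite Rplus_0_r; field).
  assert (P0 : phi 0 = ln (x ^ 2 + y ^ 2) / 2) by (unfold phi; now rewrite Rplus_0_r).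
  replace (stirling (x + 1) y - stirling x y - ln (x ^ 2 + y ^ 2) / 2) with (E 1).
  2: { unfold E; rewrite P0; field. }
  replace (E 1) with (/ 2 * (c * - (phi2 c2 * (c - c1)))) by (rewrite <- E2; nra).
  specialize (B2 c2 ltac:(lra)).
  rewrite !Rabs_mult, Rabs_Ropp, Rabs_mult, (Rabs_right (/ 2)), (Rabs_right c), (Rabs_right (c - c1)) by lra.
  pose proof (Rabs_pos (phi2 c2)).
  assert (Rabs (phi2 c2) * (c - c1) <= Rabs (phi2 c2)) by nra.
  assert (0 <= Rabs (phi2 c2) * (c - c1)) by nra.
  nra.
Qed.

Lemma CGamma_step x y : 0 < x -> CGamma (x + 1, y) = ((x, y) * CGamma (x, y))%C.
Proof.
  intros Hx; rewrite <- CGamma_plus_1 by auto; f_equal; apply C_ext; simpl; ring.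
Qed.

Lemma ln_Cmod x y : 0 < x -> ln (Cmod (x, y)) = ln (x ^ 2 + y ^ 2) / 2.
Proof.
  intros Hx; assert (H := sq_sum_pos x y Hx).
  unfold Cmod; simpl fst; simpl snd.
  rewrite <- (sqrt_sqrt (x ^ 2 + y ^ 2)) at 2 by lra.
  rewrite ln_mult by (apply sqrt_lt_R0; auto); field.
Qed.

Lemma Cmod_pair_pos x y : 0 < x -> 0 < Cmod (x, y).
Proof. intros Hx; apply Cmod_gt_0; intro E; apply (f_equal Re) in E; simpl in E; lra. Qed.

Lemma rgamma_pos x : 1 <= x -> 0 < rgamma x.
Proof.
  intros Hx; destruct (nfloor_ex (x - 1)) as [n [Hn1 Hn2]]; [lra |].
  assert (K : forall m x, INR m <= x - 1 < INR m + 1 -> 0 < rgamma x).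
  { clear; induction m; intros x H.
    - simpl in H; pose proof (rgamma_bounds_1_2 x ltac:(lra)); lra.
    - rewrite S_INR in H; pose proof (pos_INR m).
      rewrite <- rgamma_minus_1 by lra; apply Rmult_lt_0_compat; [lra |]; apply IHm; lra. }
  apply (K n); lra.
Qed.

(** By the functional equation a zero would persist under [x -> x + 1], but [CGamma_lower] excludes
    zeros once [x] exceeds [4 * y ^ 2 + 1]. *)
Lemma CGamma_pos x y : 1 <= x -> 0 < Cmod (CGamma (x, y)).
Proof.
  intros Hx.
  destruct (nfloor_ex (4 * y ^ 2)) as [n [Hn1 Hn2]]; [pose proof (pow2_ge_0 y); lra |].
  assert (K : forall m x, 1 <= x -> 4 * y ^ 2 + 1 < x + INR m -> 0 < Cmod (CGamma (x, y))).
  { clear; induction m; intros x Hx H.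
    - simpl in H; rewrite Rplus_0_r in H.
      destruct (Req_dec x 1) as [E|E]; [exfalso; pose proof (pow2_ge_0 y); simpl in *; lra |].
      assert (B := CGamma_lower x y ltac:(lra)).
      apply Rlt_le_trans with (2 := B), Rmult_lt_0_compat; [apply rgamma_pos; auto |].
      assert (Hs : 0 < sqrt (x - 1)) by (apply sqrt_lt_R0; lra).
      assert (Rabs y / sqrt (x - 1) < 1); [| lra].
      apply -> Rdiv_lt_1; auto.
      apply Rsqr_incrst_0; [| apply Rabs_pos | lra].
      rewrite Rsqr_sqrt, <- Rsqr_abs by lra; unfold Rsqr; simpl in H; nra.
    - rewrite S_INR in H; specialize (IHm (x + 1) ltac:(lra) ltac:(lra)).
      rewrite CGamma_step, Cmod_mult in IHm by lra.
      pose proof (Cmod_pair_pos x y ltac:(lra)); pose proof (Cmod_ge_0 (CGamma (x, y))); nra. }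
  apply (K (S n)); auto; rewrite S_INR; lra.
Qed.

Definition stirling_error (x y : R) : R := ln (Cmod (CGamma (x, y))) - stirling x y.

(** The functional equation turns each unit step into [stirling_step]; its error [1 / X ^ 2] is at
    most [2 / X - 2 / (X + 1)], so the sum telescopes. *)
Lemma stirling_error_shift x y n : 1 <= x ->
  Rabs (stirling_error (x + INR n) y - stirling_error x y) <= 2 * (/ x - / (x + INR n)).
Proof.
  intros Hx; induction n.
  - simpl; rewrite Rplus_0_r, Rminus_diag, Rabs_R0; lra.
  - rewrite S_INR, <- Rplus_assoc; pose proof (pos_INR n); set (X := x + INR n) in *.
    assert (HX : 1 <= X) by (unfold X; lra).
    assert (St := stirling_step X y HX).
    assert (E : stirling_error (X + 1) y = stirling_error X y
      - (stirling (X + 1) y - stirling X y - ln (X ^ 2 + y ^ 2) / 2)).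
    { unfold stirling_error; rewrite CGamma_step, Cmod_mult, ln_mult, ln_Cmod; try lra.
      - apply Cmod_pair_pos; lra.
      - apply CGamma_pos; auto. }
    rewrite E.
    replace (stirling_error X y - (stirling (X + 1) y - stirling X y - ln (X ^ 2 + y ^ 2) / 2) - stirling_error x y)
      with ((stirling_error X y - stirling_error x y) + - (stirling (X + 1) y - stirling X y - ln (X ^ 2 + y ^ 2) / 2)) by ring.
    apply Rle_trans with (1 := Rabs_triang _ _); rewrite Rabs_Ropp.
    assert (/ X ^ 2 <= 2 * (/ X - / (X + 1))).
    { replace (2 * (/ X - / (X + 1))) with (2 * / (X * (X + 1))) by (field; split; lra).
      apply Rmult_le_reg_r with (X ^ 2 * (X + 1)); [apply Rmult_lt_0_compat; [apply pow_lt |]; lra |].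
      replace (/ X ^ 2 * (X ^ 2 * (X + 1))) with (X + 1) by (field; lra).
      replace (2 * / (X * (X + 1)) * (X ^ 2 * (X + 1))) with (2 * X) by (field; split; lra); lra. }
    lra.
Qed.

Lemma stirling_error_real X : 1 <= X -> Rabs (stirling_error X 0) <= 7.
Proof.
  intros HX; destruct (nfloor_ex (X - 1)) as [n [Hn1 Hn2]]; [lra |].
  set (x := X - INR n); assert (Hx : 1 <= x < 2) by (unfold x; lra).
  assert (S := stirling_error_shift x 0 n ltac:(lra)).
  replace (x + INR n) with X in S by (unfold x; ring).
  assert (0 < / X) by (apply Rinv_0_lt_compat; lra).
  assert (/ x <= 1) by (rewrite <- Rinv_1; apply Rinv_le_contravar; lra).
  assert (B : Rabs (stirling_error x 0) <= 5).
  { unfold stirling_error, stirling.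
    assert (G := rgamma_bounds_1_2 x ltac:(lra)).
    assert (EG : Cmod (CGamma (x, 0)) = rgamma x).
    { apply Rle_antisym; [apply (Cmod_CGamma_le (x, 0)); simpl; lra |].
      apply Rle_trans with (1 := Rle_abs _), Re_le_Cmod. }
    rewrite EG; unfold Rdiv at 2; rewrite Rmult_0_l.
    assert (L2 : ln 2 <= 1).
    { rewrite <- (ln_exp 1); apply ln_le_compat; [lra |]; pose proof (exp_ineq1_le 1); lra. }
    assert (L1 : ln (rgamma x) <= 1) by (apply Rle_trans with (2 := L2), ln_le_compat; lra).
    assert (L3 : -1 <= ln (rgamma x)).
    { apply Rle_trans with (ln (/ 2)); [rewrite ln_Rinv; lra | apply ln_le_compat; lra]. }
    assert (L4 : 0 <= ln (x ^ 2 + 0 ^ 2) <= 2).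
    { replace (x ^ 2 + 0 ^ 2) with (x * x) by ring; rewrite ln_mult by lra.
      assert (0 <= ln x) by (rewrite <- ln_1; apply ln_le_compat; lra).
      assert (ln x <= ln 2) by (apply ln_le_compat; lra); lra. }
    apply Rabs_le; split; nra. }
  replace (stirling_error X 0) with ((stirling_error X 0 - stirling_error x 0) + stirling_error x 0) by ring.
  apply Rle_trans with (1 := Rabs_triang _ _); lra.
Qed.

(** The abscissa is pushed beyond [4 * y ^ 2 + 2], at a cost of at most [2]; there [CGamma_lower]
    allows replacing [y] by [0], at a cost of [3], and the real case contributes [7]. *)
Theorem gamma_stirling x y : 1 <= x -> Rabs (stirling_error x y) <= 12.
Proof.
  intros Hx.
  destruct (nfloor_ex (4 * y ^ 2 + 1)) as [n [Hn1 Hn2]]; [pose proof (pow2_ge_0 y); lra |].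
  set (X := x + INR (S n)).
  assert (HX : 4 * y ^ 2 + 2 <= X) by (unfold X; rewrite S_INR; lra).
  assert (Y := pow2_ge_0 y).
  assert (S := stirling_error_shift x y (S n) Hx); fold X in S.
  assert (0 < / X) by (apply Rinv_0_lt_compat; lra).
  assert (/ x <= 1) by (rewrite <- Rinv_1; apply Rinv_le_contravar; lra).
  assert (R0 := stirling_error_real X ltac:(lra)).
  assert (EG : Cmod (CGamma (X, 0)) = rgamma X).
  { apply Rle_antisym; [apply (Cmod_CGamma_le (X, 0)); simpl; lra |].
    apply Rle_trans with (1 := Rle_abs _), Re_le_Cmod. }
  assert (D : Rabs (stirling_error X y - stirling_error X 0) <= 3).
  { unfold stirling_error; rewrite EG.
    assert (Hs : 0 < sqrt (X - 1)) by (apply sqrt_lt_R0; lra).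
    assert (Hy : Rabs y / sqrt (X - 1) <= / 2).
    { apply Rmult_le_reg_r with (sqrt (X - 1)); auto.
      replace (Rabs y / sqrt (X - 1) * sqrt (X - 1)) with (Rabs y) by (field; lra).
      apply Rsqr_incr_0; [| apply Rabs_pos | lra].
      rewrite Rsqr_mult, Rsqr_sqrt, <- Rsqr_abs by lra; unfold Rsqr; simpl in HX; nra. }
    assert (Hg := rgamma_pos X ltac:(lra)).
    assert (U := Cmod_CGamma_le (X, y) ltac:(simpl; lra)); simpl in U.
    assert (L := CGamma_lower X y ltac:(lra)).
    assert (L' : rgamma X * / 2 <= Cmod (CGamma (X, y))) by nra.
    assert (U1 : ln (Cmod (CGamma (X, y))) <= ln (rgamma X)) by (apply ln_le_compat; auto; apply CGamma_pos; lra).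
    assert (L1 : ln (rgamma X) - 1 <= ln (Cmod (CGamma (X, y)))).
    { apply Rle_trans with (ln (rgamma X * / 2)); [| apply ln_le_compat; lra].
      rewrite ln_mult, ln_Rinv by lra.
      assert (ln 2 <= 1); [| lra].
      rewrite <- (ln_exp 1); apply ln_le_compat; [lra |]; pose proof (exp_ineq1_le 1); lra. }
    assert (Q := sq_sum_pos X y ltac:(lra)).
    unfold stirling; replace (X ^ 2 + 0 ^ 2) with (X ^ 2) by ring.
    assert (HX2 : 0 < X ^ 2) by (apply pow_lt; lra).
    assert (Lr : 0 <= ln (X ^ 2 + y ^ 2) - ln (X ^ 2) <= y ^ 2 / X ^ 2).
    { split; [assert (ln (X ^ 2) <= ln (X ^ 2 + y ^ 2)) by (apply ln_le_compat; lra); lra |].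
      replace (X ^ 2 + y ^ 2) with (X ^ 2 * (1 + y ^ 2 / X ^ 2)) by (field; lra).
      assert (0 <= y ^ 2 / X ^ 2) by (apply Rdiv_le_0_compat; auto).
      rewrite ln_mult by lra.
      assert (ln (1 + y ^ 2 / X ^ 2) <= y ^ 2 / X ^ 2); [| lra].
      rewrite <- (ln_exp (y ^ 2 / X ^ 2)) at 2; apply ln_le_compat; [lra | apply exp_ineq1_le]. }
    assert (Q1 : y ^ 2 / X <= 1).
    { apply Rmult_le_reg_r with X; [lra |]; replace (y ^ 2 / X * X) with (y ^ 2) by (field; lra); lra. }
    assert (M1 : 0 <= (X - / 2) * ((ln (X ^ 2 + y ^ 2) - ln (X ^ 2)) / 2) <= 1).
    { split; [apply Rmult_le_pos; lra |].
      apply Rle_trans with (X * (y ^ 2 / X ^ 2)); [apply Rmult_le_compat; lra |].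
      replace (X * (y ^ 2 / X ^ 2)) with (y ^ 2 / X) by (field; lra); auto. }
    assert (M2 : 0 <= y * atan (y / X) <= 1).
    { assert (K : forall v, 0 <= v -> 0 <= v * atan (v / X) <= v ^ 2 / X).
      { intros v Hv; assert (0 <= v / X) by (apply Rdiv_le_0_compat; lra).
        assert (0 <= atan (v / X)).
        { rewrite <- atan_0; destruct H1 as [H1|H1]; [left; now apply atan_increasing | right; now rewrite <- H1]. }
        split; [nra |].
        replace (v ^ 2 / X) with (v * (v / X)) by (field; lra).
        apply Rmult_le_compat_l; auto; now apply atan_le_id. }
      destruct (Rle_lt_dec 0 y) as [Hy0|Hy0].
      - specialize (K y Hy0); lra.
      - specialize (K (- y) ltac:(lra)).
        replace (- y / X) with (- (y / X)) in K by (field; lra); rewrite atan_opp in K.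
        replace ((- y) ^ 2) with (y ^ 2) in K by ring; lra. }
    unfold Rdiv at 4; rewrite !Rmult_0_l.
    apply Rabs_le; split; nra. }
  replace (stirling_error x y) with
    (- (stirling_error X y - stirling_error x y) + ((stirling_error X y - stirling_error X 0) + stirling_error X 0)) by ring.
  apply Rle_trans with (1 := Rabs_triang _ _); rewrite Rabs_Ropp.
  pose proof (Rabs_triang (stirling_error X y - stirling_error X 0) (stirling_error X 0)); lra.
Qed.

(** * The zeta function *)

(* Half the periodic second Bernoulli polynomial, up to a constant. *)
Definition bern (t : R) : R := (frac_part t * (frac_part t - 1)) / 2.

Lemma bern_near (k : Z) (t : R) : Rabs (t - IZR k) < 1 ->
  bern t = Rabs (t - IZR k) * (Rabs (t - IZR k) - 1) / 2.
Proof.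
  intros H; apply Rabs_lt_between in H; unfold bern, frac_part.
  destruct (Rle_lt_dec (IZR k) t) as [Hk|Hk].
  - rewrite <- (Int_part_spec t k) by lra; rewrite Rabs_right by lra; auto.
  - rewrite <- (Int_part_spec t (k - 1)) by (rewrite minus_IZR; lra).
    rewrite minus_IZR, Rabs_left by lra; field.
Qed.

Lemma continuous_bern t : continuous bern t.
Proof.
  set (k := Int_part t); destruct (base_Int_part t) as [H1 H2]; fold k in H1, H2.
  apply (continuous_ext_loc (T := R_UniformSpace) _
    (fun t => Rabs (t - IZR k) * (Rabs (t - IZR k) - 1) / 2)).
  - assert (He : 0 < 1 - Rabs (t - IZR k)) by (rewrite Rabs_right; lra).
    exists (mkposreal _ He); intros u Hu; symmetry; apply bern_near.
    unfold ball in Hu; simpl in Hu; unfold AbsRing_ball, abs, minus, plus, opp in Hu; simpl in Hu.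
    replace (u - IZR k) with ((u + - t) + (t - IZR k)) by ring.
    apply Rle_lt_trans with (1 := Rabs_triang _ _); lra.
  - assert (C0 : continuous (fun t => Rabs (t - IZR k)) t).
    { apply (continuous_comp (fun t => t - IZR k) Rabs); [| apply continuous_Rabs].
      apply (ex_derive_continuous (V := R_NormedModule)); auto_derive; auto. }
    apply (continuous_real_comp (fun t => Rabs (t - IZR k)) (fun d => d * (d - 1) / 2)); auto.
    auto_derive; auto.
Qed.

Lemma bern_bound t : Rabs (bern t) <= 1.
Proof.
  unfold bern; destruct (base_fp t) as [H1 H2]; apply Rabs_le; split; nra.
Qed.

(** Extended by [0] below [1], where [bern] vanishes, so that the Euler-Maclaurin integral from [1]
    becomes a Mellin integral of a continuous function. *)
Definition bern1 (t : R) : R := bern (Rmax 1 t).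

Lemma bern_IZR (k : Z) : bern (IZR k) = 0.
Proof. rewrite (bern_near k); rewrite Rminus_diag, Rabs_R0; lra. Qed.

Lemma bern1_ge t : 1 <= t -> bern1 t = bern t.
Proof. intros; unfold bern1; now rewrite Rmax_right. Qed.

Lemma bern1_le t : t <= 1 -> bern1 t = 0.
Proof. intros; unfold bern1; rewrite Rmax_left by auto; apply (bern_IZR 1). Qed.

Lemma continuous_bern1 t : continuous bern1 t.
Proof.
  apply (continuous_comp (fun t => Rmax 1 t) bern); [| apply continuous_bern].
  apply (continuous_ext (fun t => (1 + t + Rabs (1 - t)) / 2)).
  { intros u; unfold Rmax; match goal with |- @eq _ ?a ?b => change (@eq R a b) end.
    destruct Rle_dec; [rewrite Rabs_left1 by lra | rewrite Rabs_right by lra]; field. }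
  apply (continuous_real_comp (fun t => 1 + t + Rabs (1 - t)) (fun x => x / 2)); [| auto_derive; auto].
  apply (continuous_plus (V := R_NormedModule)).
  - apply (ex_derive_continuous (V := R_NormedModule)); auto_derive; auto.
  - apply (continuous_comp (fun t => 1 - t) Rabs); [| apply continuous_Rabs].
    apply (ex_derive_continuous (V := R_NormedModule)); auto_derive; auto.
Qed.

Lemma bern1_dom x r t : 0 < r <= - x - 1 -> 0 < t -> Rabs (bern1 t) * Rpower t x <= 2 * env r t.
Proof.
  intros Hr Ht; assert (HE := env_pos r t Ht).
  destruct (Rle_lt_dec t 1) as [H|H].
  - rewrite bern1_le, Rabs_R0 by auto; lra.
  - unfold bern1; apply Rle_trans with (Rpower t x).
    { rewrite <- (Rmult_1_l (Rpower t x)) at 2; apply Rmult_le_compat_r; [left; apply exp_pos | apply bern_bound]. }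
    unfold env; assert (P := pcosh_pos r t).
    apply Rmult_le_reg_r with (t * pcosh r t); [now apply Rmult_lt_0_compat |].
    rewrite Rmult_assoc, Rinv_l, Rmult_1_r by (apply Rgt_not_eq, Rmult_lt_0_compat; auto).
    rewrite <- (Rpower_1 t) at 2 by auto; unfold pcosh.
    rewrite <- Rmult_assoc, <- Rpower_plus, Rmult_plus_distr_l, <- !Rpower_plus.
    assert (L : 0 < ln t) by (rewrite <- ln_1; apply ln_increasing; lra).
    assert (K : forall y, y <= 0 -> Rpower t y <= 1).
    { intros y Hy; rewrite <- exp_0; unfold Rpower; apply exp_le_compat; nra. }
    pose proof (K (x + 1 + r) ltac:(lra)); pose proof (K (x + 1 + - r) ltac:(lra)); lra.
Qed.

Definition bern_mellin (u : C) : C :=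
  RInt_gen (V := C_R_CompleteNormedModule) (fun t => (RCpow t u * bern1 t)%C)
    (at_right 0) (Rbar_locally p_infty).

Lemma GI_bern_mellin u : Re u < - 1 ->
  GI (fun t => (RCpow t u * bern1 t)%C) (bern_mellin u) /\
  Cmod (bern_mellin u) <= 2 * (PI / 2 / (- Re u - 1)).
Proof.
  intros Hu; destruct (GI_dom (fun t => (RCpow t u * bern1 t)%C) 2 (- Re u - 1)) as [l [Hl Bl]]; try lra.
  - intros t Ht; apply continuous_Cmult; [now apply continuous_RCpow |].
    apply continuous_RtoC, continuous_bern1.
  - intros t Ht; rewrite Cmod_mult, Cmod_RCpow, Cmod_R, Rmult_comm; apply bern1_dom; lra.
  - assert (E : bern_mellin u = l) by exact (GI_RInt_gen _ _ Hl).
    rewrite E; auto.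
Qed.

Lemma bern_mellin_cdiff u : Re u < - 1 -> exists l, cdiff bern_mellin u l.
Proof.
  intros Hu.
  apply (mellin_cdiff (fun t => RtoC (bern1 t)) bern_mellin u 2 ((- Re u - 1) / 2) (- Re u - 1)); try lra.
  - intros; apply continuous_RtoC, continuous_bern1.
  - intros t Ht; rewrite Cmod_R; apply bern1_dom; lra.
  - intros h Hh; apply GI_bern_mellin.
    assert (B := Re_le_Cmod h); apply Rabs_le_between in B; unfold Re in *; simpl in *; lra.
Qed.

(** * Euler-Maclaurin summation of the Dirichlet series *)

Definition rderiv (F : R -> C) (t : R) (l : C) : Prop :=
  is_derive (fun t => Re (F t)) t (Re l) /\ is_derive (fun t => Im (F t)) t (Im l).

Lemma rderiv_plus F G t l m : rderiv F t l -> rderiv G t m -> rderiv (fun t => (F t + G t)%C) t (l + m)%C.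
Proof. intros [A B] [D E]; split; simpl; apply (is_derive_plus (V := R_NormedModule)); auto. Qed.

Lemma rderiv_mult F G t l m : rderiv F t l -> rderiv G t m ->
  rderiv (fun t => (F t * G t)%C) t (l * G t + F t * m)%C.
Proof.
  intros [A B] [D E]; split; simpl.
  - replace (fst l * fst (G t) - snd l * snd (G t) + (fst (F t) * fst m - snd (F t) * snd m)) with
      ((Re l * Re (G t) + Re (F t) * Re m) - (Im l * Im (G t) + Im (F t) * Im m)) by (unfold Re, Im; ring).
    apply (is_derive_minus (V := R_NormedModule)); apply (is_derive_mult (K := R_AbsRing)); auto; intros; apply Rmult_comm.
  - replace (fst l * snd (G t) + snd l * fst (G t) + (fst (F t) * snd m + snd (F t) * fst m)) with
      ((Re l * Im (G t) + Re (F t) * Im m) + (Im l * Re (G t) + Im (F t) * Re m)) by (unfold Re, Im; ring).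
    apply (is_derive_plus (V := R_NormedModule)); apply (is_derive_mult (K := R_AbsRing)); auto; intros; apply Rmult_comm.
Qed.

Lemma rderiv_const c t : rderiv (fun _ => c) t 0.
Proof. split; simpl; apply (is_derive_const (V := R_NormedModule)). Qed.

Lemma rderiv_RtoC f t l : is_derive f t l -> rderiv (fun t => RtoC (f t)) t l.
Proof. intros H; split; simpl; auto; apply (is_derive_const (V := R_NormedModule)). Qed.

Lemma RCpow_1 t : 0 < t -> RCpow t 1 = t.
Proof. intros Ht; unfold RCpow; rewrite Cmult_1_l, Cexp_RtoC, exp_ln; auto. Qed.

Lemma RCpow_minus_1 t z : 0 < t -> RCpow t (z - 1) = (RCpow t z / t)%C.
Proof.
  intros Ht; replace (RCpow t z) with (RCpow t (z - 1) * RCpow t 1)%C by (rewrite <- RCpow_plus; f_equal; ring).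
  rewrite RCpow_1 by auto; field; apply RtoC_neq; lra.
Qed.

Lemma rderiv_RCpow z t : 0 < t -> rderiv (fun t => RCpow t z) t (z * RCpow t (z - 1))%C.
Proof.
  intros Ht; rewrite RCpow_minus_1 by auto; destruct z as [x y]; unfold Cdiv.
  rewrite RCpow_components, <- RtoC_inv by lra; split.
  - apply (is_derive_ext (fun t => Rpower t x * cos (y * ln t))).
    { intros u; rewrite RCpow_components; simpl; ring. }
    simpl; unfold Rpower; auto_derive; repeat split; auto; unfold Rminus; field; lra.
  - apply (is_derive_ext (fun t => Rpower t x * sin (y * ln t))).
    { intros u; rewrite RCpow_components; simpl; ring. }
    simpl; unfold Rpower; auto_derive; repeat split; auto; unfold Rminus; field; lra.
Qed.

Lemma rderiv_eq F t l m : rderiv F t l -> l = m -> rderiv F t m.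
Proof. now intros H <-. Qed.

Lemma RCpow_1_l z : RCpow 1 z = 1.
Proof. unfold RCpow; rewrite ln_1, Cmult_0_r; apply Cexp_0. Qed.

(** Euler-Maclaurin on one unit interval. [W] is the primitive found by integrating by parts twice;
    [B] vanishes at both ends, so only the trapezoid and the integral of [t ^ (- s)] remain. *)
Lemma trapezoid_RCpow (s : C) (k : nat) : s <> 1 ->
  (s * (s + 1) * CI (fun t => (RCpow t (- s - 2) * bern1 t)%C) (INR (S k)) (INR (S (S k))))%C
  = (- / 2 * (RCpow (INR (S (S k))) (- s) + RCpow (INR (S k)) (- s))
     - (RCpow (INR (S (S k))) (1 - s) - RCpow (INR (S k)) (1 - s)) / (s - 1))%C.
Proof.
  intros Hs1; set (a := INR (S k)).
  assert (Hs : (s - 1)%C <> 0) by now apply Cminus_eq_contra.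
  assert (Ha : 1 <= a) by (unfold a; rewrite S_INR; pose proof (pos_INR k); lra).
  rewrite (S_INR (S k)); fold a.
  assert (Hc : forall t, a <= t -> continuous (fun t => (RCpow t (- s - 2) * bern1 t)%C) t).
  { intros t Ht; apply continuous_Cmult; [apply continuous_RCpow; lra |].
    apply continuous_RtoC, continuous_bern1. }
  rewrite <- CI_Cmult_l.
  2: { apply ex_CI_continuous; intros t Ht; rewrite Rmin_left in Ht by lra; apply Hc; lra. }
  set (B := fun t => (t - a) * (t - a - 1) / 2).
  set (W := fun t : R => (B t * (- s * RCpow t (- s - 1)) + ((t - a - / 2)%R * (- (1) * RCpow t (- s))
     + - / (s - 1) * RCpow t (1 - s)))%C).
  rewrite (CI_ext _ (fun t => (s * (s + 1) * (RCpow t (- s - 2) * B t))%C)).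
  2: { intros t Ht; rewrite Rmin_left, Rmax_right in Ht by lra.
       rewrite bern1_ge by lra; do 3 f_equal.
       assert (Ek : a = IZR (Z.of_nat (S k))) by apply INR_IZR_INZ.
       rewrite (bern_near (Z.of_nat (S k))); rewrite <- Ek, Rabs_right by lra; auto; lra. }
  rewrite (CI_FTC W).
  - unfold W, B; rewrite !Rminus_diag.
    replace (a + 1 - a) with 1 by ring.
    replace (1 * (1 - 1) / 2) with 0 by field; replace (0 * (0 - 1) / 2) with 0 by field.
    replace (1 - / 2) with (/ 2) by field; replace (0 - / 2) with (- / 2) by field.
    rewrite RtoC_opp, RtoC_inv by lra; field; auto.
  - intros t Ht; rewrite Rmin_left in Ht by lra.
    assert (Htp : 0 < t) by lra.
    assert (HB : is_derive (fun t => (t - a) * (t - a - 1) / 2) t (t - a - / 2)) by (auto_derive; auto; field).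
    apply (rderiv_eq W t ((t - a - / 2)%R * (- s * RCpow t (- s - 1))
      + B t * (0 * RCpow t (- s - 1) + - s * ((- s - 1) * RCpow t (- s - 1 - 1)))
      + (((RtoC 1) * (- (1) * RCpow t (- s)) + (t - a - / 2)%R * (0 * RCpow t (- s) + - (1) * (- s * RCpow t (- s - 1))))
         + (0 * RCpow t (1 - s) + - / (s - 1) * ((1 - s) * RCpow t (1 - s - 1)))))%C).
    + assert (HL : is_derive (fun t => t - a - / 2) t 1) by (auto_derive; auto; ring).
      unfold W; apply (rderiv_plus (fun t => (B t * (- s * RCpow t (- s - 1)))%C));
        [apply (rderiv_mult (fun t => RtoC (B t))) |
         apply (rderiv_plus (fun t => ((t - a - / 2)%R * (- (1) * RCpow t (- s)))%C));
         [apply (rderiv_mult (fun t => RtoC (t - a - / 2))) |]].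
      * apply (rderiv_RtoC B); exact HB.
      * apply rderiv_mult; [apply rderiv_const | now apply rderiv_RCpow].
      * apply (rderiv_RtoC (fun t => t - a - / 2)); exact HL.
      * apply rderiv_mult; [apply rderiv_const | now apply rderiv_RCpow].
      * apply rderiv_mult; [apply rderiv_const | now apply rderiv_RCpow].
    + replace (1 - s - 1)%C with (- s)%C by ring; replace (- s - 1 - 1)%C with (- s - 2)%C by ring.
      field; auto.
  - intros t Ht; rewrite Rmin_left in Ht by lra.
    apply continuous_Cmult; [apply continuous_const |].
    apply continuous_Cmult; [apply continuous_RCpow; lra |].
    apply continuous_RtoC, (ex_derive_continuous (V := R_NormedModule)); unfold B; auto_derive; auto.
Qed.

Definition zeta_term (s : C) (k : nat) : C := RCpow (INR (S k)) (- s).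

Lemma zeta_partial_sum (s : C) (n : nat) : s <> 1 ->
  sum_n (zeta_term s) n = (/ 2 * (1 + RCpow (INR (S n)) (- s)) + (1 - RCpow (INR (S n)) (1 - s)) / (s - 1)
    - s * (s + 1) * CI (fun t => (RCpow t (- s - 2) * bern1 t)%C) 1 (INR (S n)))%C.
Proof.
  intros Hs1; assert (Hs : (s - 1)%C <> 0) by now apply Cminus_eq_contra.
  induction n.
  - rewrite sum_O; unfold zeta_term; simpl INR; unfold CI; rewrite RInt_point.
    rewrite !RCpow_1_l; change (@zero (CompleteNormedModule.AbelianMonoid _ C_R_CompleteNormedModule)) with (RtoC 0).
    match goal with |- @eq _ ?a ?b => change (@eq C a b) end; field; auto.
  - rewrite sum_Sn_C, IHn.
    assert (H1 : 1 <= INR (S n)) by (rewrite S_INR; pose proof (pos_INR n); lra).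
    assert (H2 : INR (S n) <= INR (S (S n))) by (rewrite (S_INR (S n)); lra).
    assert (Hc : forall t, 1 <= t -> continuous (fun t => (RCpow t (- s - 2) * bern1 t)%C) t).
    { intros t Ht; apply continuous_Cmult; [apply continuous_RCpow; lra |].
      apply continuous_RtoC, continuous_bern1. }
    rewrite <- (CI_Chasles _ 1 (INR (S n)) (INR (S (S n)))).
    + rewrite (Cmult_plus_distr_l (s * (s + 1))), trapezoid_RCpow by auto.
      unfold zeta_term; match goal with |- @eq _ ?a ?b => change (@eq C a b) end; field; auto.
    + apply ex_CI_continuous; intros t Ht; rewrite Rmin_left in Ht by lra; apply Hc; lra.
    + apply ex_CI_continuous; intros t Ht; rewrite Rmin_left in Ht by lra; apply Hc; lra.
Qed.

(** The limit of [zeta_partial_sum]: zeta continued to [Re s > -1], where the Mellin integral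
    converges, apart from the pole at [1]. *)
Definition zeta_reg (s : C) : C := (/ 2 + / (s - 1) - s * (s + 1) * bern_mellin (- s - 2))%C.

Lemma RCpow_INR_lim z eps : Re z < 0 -> 0 < eps -> exists N, forall n, (N <= n)%nat ->
  Cmod (RCpow (INR (S n)) z) < eps.
Proof.
  intros Hz He; set (x := Re z) in *.
  destruct (nfloor_ex (Rpower eps (/ x))) as [N [HN1 HN2]]; [left; apply exp_pos |].
  exists N; intros n Hn; rewrite Cmod_RCpow; fold x.
  assert (P : 0 < Rpower eps (/ x)) by apply exp_pos.
  assert (H : Rpower eps (/ x) < INR (S n)).
  { apply Rlt_le_trans with (1 := HN2); rewrite <- S_INR; apply le_INR; lia. }
  replace eps with (Rpower (Rpower eps (/ x)) x).
  - unfold Rpower at 1 2; apply exp_increasing.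
    assert (ln (Rpower eps (/ x)) < ln (INR (S n))) by (apply ln_increasing; auto); nra.
  - rewrite Rpower_mult, Rinv_l by lra; now apply Rpower_1.
Qed.

Lemma zeta_sum_lim (s : C) eps : 1 < Re s -> 0 < eps -> exists N, forall n, (N <= n)%nat ->
  Cmod (sum_n (zeta_term s) n - zeta_reg s) < eps.
Proof.
  intros Hs He.
  assert (Hs1 : s <> 1) by (intros ->; simpl in Hs; lra).
  assert (Hsm : (s - 1)%C <> 0) by now apply Cminus_eq_contra.
  assert (Hsp := proj1 (Cmod_gt_0 _) Hsm).
  set (A := Cmod (s * (s + 1)) + 1).
  assert (HA : 0 < A) by (unfold A; pose proof (Cmod_ge_0 (s * (s + 1))); lra).
  destruct (GI_bern_mellin (- s - 2)%C) as [G _]; [unfold Re in *; simpl in *; lra |].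
  assert (Hc : forall t, 0 < t -> continuous (fun t => (RCpow t (- s - 2) * bern1 t)%C) t).
  { intros t Ht; apply continuous_Cmult; [apply continuous_RCpow; lra |].
    apply continuous_RtoC, continuous_bern1. }
  assert (Hex : forall a b, 0 < a <= b -> ex_CI (fun t => (RCpow t (- s - 2) * bern1 t)%C) a b).
  { intros a b Hab; apply ex_CI_continuous; intros t Ht; rewrite Rmin_left in Ht by lra; apply Hc; lra. }
  apply GI_eps with (eps := eps / (3 * A)) in G; auto; [| apply Rdiv_lt_0_compat; lra].
  destruct G as [d [T [Hd G]]].
  destruct (RCpow_INR_lim (- s) (eps / 3)) as [N1 HN1]; [unfold Re in *; simpl in *; lra | lra |].
  destruct (RCpow_INR_lim (1 - s) (eps / 3 * Cmod (s - 1))) as [N2 HN2]; [unfold Re in *; simpl in *; lra | nra |].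
  destruct (nfloor_ex (Rmax 0 T)) as [N3 [_ HN3]]; [apply Rmax_l |].
  exists (N1 + N2 + N3)%nat; intros n Hn.
  specialize (HN1 n ltac:(lia)); specialize (HN2 n ltac:(lia)).
  assert (Hb : T < INR (S n)).
  { apply Rle_lt_trans with (1 := Rmax_r 0 T), Rlt_le_trans with (1 := HN3).
    rewrite <- S_INR; apply le_INR; lia. }
  assert (H1 : 1 <= INR (S n)) by (rewrite S_INR; pose proof (pos_INR n); lra).
  set (a := Rmin (d / 2) 1).
  assert (Ha : 0 < a <= 1) by (split; [apply Rmin_glb_lt; lra | apply Rmin_r]).
  assert (Had : a < d) by (apply Rle_lt_trans with (1 := Rmin_l _ _); lra).
  specialize (G a (INR (S n)) ltac:(lra) Hb ltac:(lra)).
  rewrite <- (CI_Chasles _ a 1) in G; auto; try (apply Hex; lra).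
  rewrite (CI_ext _ (fun _ => RtoC 0) a 1), CI_const, Cmult_0_r, Cplus_0_l in G.
  2: { intros t Ht; rewrite Rmin_left, Rmax_right in Ht by lra; rewrite bern1_le by lra; ring. }
  rewrite zeta_partial_sum by auto; unfold zeta_reg.
  set (I := CI (fun t => (RCpow t (- s - 2) * bern1 t)%C) 1 (INR (S n))) in *.
  replace (/ 2 * (1 + RCpow (INR (S n)) (- s)) + (1 - RCpow (INR (S n)) (1 - s)) / (s - 1) -
    s * (s + 1) * I - (/ 2 + / (s - 1) - s * (s + 1) * bern_mellin (- s - 2)))%C with
    (/ 2 * RCpow (INR (S n)) (- s) - RCpow (INR (S n)) (1 - s) / (s - 1)
     - s * (s + 1) * (I - bern_mellin (- s - 2)))%C by (field; auto).
  apply Rle_lt_trans with (1 := Cmod_triangle_minus _ _).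
  assert (T2 := Cmod_triangle_minus (/ 2 * RCpow (INR (S n)) (- s)) (RCpow (INR (S n)) (1 - s) / (s - 1))).
  assert (X1 : Cmod (/ 2 * RCpow (INR (S n)) (- s)) = / 2 * Cmod (RCpow (INR (S n)) (- s)))
    by (rewrite Cmod_mult, <- RtoC_inv, Cmod_R, Rabs_right by lra; auto).
  rewrite Cmod_div in T2 by auto; rewrite (Cmod_mult (s * (s + 1))).
  assert (X2 : Cmod (RCpow (INR (S n)) (1 - s)) / Cmod (s - 1) < eps / 3).
  { apply Rmult_lt_reg_r with (Cmod (s - 1)); auto.
    replace (Cmod (RCpow (INR (S n)) (1 - s)) / Cmod (s - 1) * Cmod (s - 1)) with (Cmod (RCpow (INR (S n)) (1 - s))) by (field; lra); auto. }
  assert (X3 : Cmod (s * (s + 1)) * Cmod (I - bern_mellin (- s - 2)) <= eps / 3).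
  { apply Rle_trans with (A * (eps / (3 * A))); [| right; field; lra].
    apply Rmult_le_compat; try apply Cmod_ge_0; [unfold A; lra | lra]. }
  lra.
Qed.

Lemma Re_sum_n (a : nat -> C) n : Re (sum_n a n) = sum_n (fun k => Re (a k)) n.
Proof.
  induction n; [now rewrite !sum_O |].
  rewrite sum_Sn_C, sum_Sn, re_plus, IHn; reflexivity.
Qed.

Lemma Im_sum_n (a : nat -> C) n : Im (sum_n a n) = sum_n (fun k => Im (a k)) n.
Proof.
  induction n; [now rewrite !sum_O |].
  rewrite sum_Sn_C, sum_Sn, im_plus, IHn; reflexivity.
Qed.

Lemma Czeta_reg s : 1 < Re s -> Czeta s = zeta_reg s.
Proof.
  intros Hs; apply C_ext.
  - change (Series (fun k => Re (zeta_term s k)) = Re (zeta_reg s)); apply is_series_unique.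
    change (is_lim_seq (sum_n (fun k => Re (zeta_term s k))) (Re (zeta_reg s))).
    apply (is_lim_seq_ext (fun n => Re (sum_n (zeta_term s) n))); [intros; apply Re_sum_n |].
    apply is_lim_seq_spec; intros eps.
    destruct (zeta_sum_lim s eps Hs (cond_pos eps)) as [N HN]; exists N; intros n Hn.
    apply Rle_lt_trans with (2 := HN n Hn), (Re_le_Cmod (sum_n (zeta_term s) n - zeta_reg s)).
  - change (Series (fun k => Im (zeta_term s k)) = Im (zeta_reg s)); apply is_series_unique.
    change (is_lim_seq (sum_n (fun k => Im (zeta_term s k))) (Im (zeta_reg s))).
    apply (is_lim_seq_ext (fun n => Im (sum_n (zeta_term s) n))); [intros; apply Im_sum_n |].
    apply is_lim_seq_spec; intros eps.
    destruct (zeta_sum_lim s eps Hs (cond_pos eps)) as [N HN]; exists N; intros n Hn.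
    apply Rle_lt_trans with (2 := HN n Hn), (Im_le_Cmod (sum_n (zeta_term s) n - zeta_reg s)).
Qed.

(** The terms after the first add up to at most [/ 2], since [1 / (a + 1) ^ 3] is at most half of
    [1 / a - 1 / (a + 1)]. This is why lower bounds for [f] start at real part [5 / 2]. *)
Lemma Cmod_Czeta_lower s : 3 <= Re s -> / 2 <= Cmod (Czeta s) <= 3 / 2.
Proof.
  intros Hs; rewrite Czeta_reg by lra.
  assert (K : forall n, Cmod (sum_n (zeta_term s) n - 1) <= / 2 * (1 - / INR (S n))).
  { induction n.
    - rewrite sum_O; unfold zeta_term; simpl INR; rewrite RCpow_1_l.
      replace (1 - 1)%C with (RtoC 0) by ring; rewrite Cmod_0; lra.
    - rewrite sum_Sn_C.
      replace (sum_n (zeta_term s) n + zeta_term s (S n) - 1)%C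
        with (sum_n (zeta_term s) n - 1 + zeta_term s (S n))%C by ring.
      apply Rle_trans with (1 := Cmod_triangle _ _).
      unfold zeta_term at 2; rewrite Cmod_RCpow.
      rewrite (S_INR (S n)); set (a := INR (S n)) in *.
      assert (Ha : 1 <= a) by (unfold a; rewrite S_INR; pose proof (pos_INR n); lra).
      assert (B : Rpower (a + 1) (Re (- s)) <= / (a + 1) ^ 3).
      { rewrite <- Rpower_pow, <- Rpower_Ropp by lra; unfold Rpower; apply exp_le_compat.
        assert (0 < ln (a + 1)) by (rewrite <- ln_1; apply ln_increasing; lra).
        simpl INR; unfold Re in *; simpl; nra. }
      assert (/ (a + 1) ^ 3 <= / 2 * (/ a - / (a + 1))).
      { replace (/ 2 * (/ a - / (a + 1))) with (/ (2 * a * (a + 1))) by (field; lra).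
        apply Rinv_le_contravar; [nra |]; simpl; nra. }
      lra. }
  assert (L : Cmod (zeta_reg s - 1) <= / 2).
  { apply Rle_plus_epsilon; intros eps He.
    destruct (zeta_sum_lim s eps ltac:(lra) He) as [N HN]; specialize (HN N (Nat.le_refl N)); specialize (K N).
    replace (zeta_reg s - 1)%C with ((sum_n (zeta_term s) N - 1) - (sum_n (zeta_term s) N - zeta_reg s))%C by ring.
    apply Rle_trans with (1 := Cmod_triangle_minus _ _).
    assert (0 < / INR (S N)) by (apply Rinv_0_lt_compat, lt_0_INR; lia); lra. }
  pose proof (Cmod_triangle_rev 1 (1 - zeta_reg s)) as T1.
  pose proof (Cmod_triangle (zeta_reg s - 1) 1) as T2.
  replace (1 - (1 - zeta_reg s))%C with (zeta_reg s) in T1 by ring.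
  replace (zeta_reg s - 1 + 1)%C with (zeta_reg s) in T2 by ring.
  rewrite (Cmod_minus_sym 1), Cmod_1 in T1; rewrite Cmod_1 in T2; lra.
Qed.

Lemma Czeta_real_neq_0 (x : R) : 1 < x -> Czeta x <> 0.
Proof.
  intros Hx E; rewrite Czeta_reg in E by auto.
  destruct (zeta_sum_lim x (/ 2) ltac:(auto) ltac:(lra)) as [N HN]; specialize (HN N (Nat.le_refl N)).
  rewrite E in HN; assert (K : forall n, 1 <= Re (sum_n (zeta_term x) n)).
  { assert (T : forall k, Re (zeta_term x k) = Rpower (INR (S k)) (- x)).
    { intros k; unfold zeta_term; rewrite <- RtoC_opp.
      change (RtoC (- x)) with ((- x, 0) : C); rewrite RCpow_components, Rmult_0_l, cis_0; simpl; ring. }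
    induction n.
    - rewrite sum_O; unfold zeta_term; simpl INR; rewrite RCpow_1_l; simpl; lra.
    - rewrite sum_Sn_C, re_plus, T; assert (0 < Rpower (INR (S (S n))) (- x)) by apply exp_pos; lra. }
  specialize (K N); assert (B := Re_le_Cmod (sum_n (zeta_term x) N - 0)); apply Rabs_le_between in B.
  unfold Re in *; simpl in *; lra.
Qed.

(* [(s - 1) zeta s], in a form valid for [Re s > -1]. *)
Definition zeta_pole_free (s : C) : C := ((s + 1) / 2 - (s - 1) * s * (s + 1) * bern_mellin (- s - 2))%C.

Lemma zeta_pole_free_eq s : 1 < Re s -> ((s - 1) * Czeta s)%C = zeta_pole_free s.
Proof.
  intros Hs; rewrite Czeta_reg by auto; unfold zeta_reg, zeta_pole_free.
  assert (Hsm : (s - 1)%C <> 0).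
  { apply Cminus_eq_contra; intros ->; simpl in Hs; lra. }
  field; auto.
Qed.

Lemma zeta_pole_free_cdiff s : - 1 < Re s -> exists l, cdiff zeta_pole_free s l.
Proof.
  intros Hs; destruct (bern_mellin_cdiff (- s - 2)%C) as [l Hl]; [unfold Re in *; simpl in *; lra |].
  eexists; unfold zeta_pole_free.
  apply cdiff_minus.
  - apply cdiff_mult; [apply cdiff_plus; [apply cdiff_id | apply cdiff_const] | apply cdiff_const].
  - apply cdiff_mult.
    + apply cdiff_mult; [apply cdiff_mult |].
      * apply cdiff_minus; [apply cdiff_id | apply cdiff_const].
      * apply cdiff_id.
      * apply cdiff_plus; [apply cdiff_id | apply cdiff_const].
    + apply (cdiff_comp bern_mellin (fun s => (- s - 2)%C)); [exact Hl |].
      apply cdiff_minus; [apply cdiff_opp, cdiff_id | apply cdiff_const].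
Qed.

Lemma zeta_pole_free_bound s : 0 <= Re s -> Cmod (zeta_pole_free s) <= 5 * (Cmod s + 1) ^ 3.
Proof.
  intros Hs; destruct (GI_bern_mellin (- s - 2)%C) as [_ B]; [unfold Re in *; simpl in *; lra |].
  assert (B' : Cmod (bern_mellin (- s - 2)) <= 4).
  { apply Rle_trans with (1 := B).
    assert (H1 : 1 <= - Re (- s - 2) - 1) by (unfold Re in *; simpl in *; lra).
    assert (HPI : PI <= 4) by apply PI_4.
    assert (0 < PI) by apply PI_RGT_0.
    assert (/ (- Re (- s - 2) - 1) <= 1) by (rewrite <- Rinv_1; apply Rinv_le_contravar; lra).
    assert (0 < / (- Re (- s - 2) - 1)) by (apply Rinv_0_lt_compat; lra).
    unfold Rdiv; nra. }
  unfold zeta_pole_free; apply Rle_trans with (1 := Cmod_triangle_minus _ _).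
  set (m := Cmod s + 1); assert (Hm : 1 <= m) by (unfold m; pose proof (Cmod_ge_0 s); lra).
  assert (C1 : Cmod (s + 1) <= m) by (unfold m; rewrite <- Cmod_1 at 2; apply Cmod_triangle).
  assert (C2 : Cmod (s - 1) <= m) by (unfold m; rewrite <- Cmod_1 at 2; apply Cmod_triangle_minus).
  assert (C3 : Cmod s <= m) by (unfold m; lra).
  rewrite Cmod_div by (apply RtoC_neq; lra); rewrite !Cmod_mult, Cmod_R, Rabs_right by lra.
  assert (Cmod (s + 1) / 2 <= m ^ 3) by (simpl; pose proof (Cmod_ge_0 (s + 1)); nra).
  assert (Cmod (s - 1) * Cmod s * Cmod (s + 1) * Cmod (bern_mellin (- s - 2)) <= m ^ 3 * 4).
  { apply Rmult_le_compat; auto; try apply Cmod_ge_0.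
    - repeat apply Rmult_le_pos; apply Cmod_ge_0.
    - simpl; rewrite Rmult_1_r, <- Rmult_assoc.
      apply Rmult_le_compat; auto; try apply Cmod_ge_0; [apply Rmult_le_pos; apply Cmod_ge_0 |].
      apply Rmult_le_compat; auto; apply Cmod_ge_0. }
  lra.
Qed.

(** * Growth of the xi function *)

(** The factor [s / 2] is absorbed in Gamma and [s - 1] in zeta, so that every factor is regular for
    [Re s > -1] and bounds for the product are bounds for the factors. *)
Definition xi_half (s : C) : C := (RCpow PI (- (s / 2)) * CGamma (s / 2 + 1) * zeta_pole_free s)%C.

Lemma RCpow_const_cdiff x u : exists l, cdiff (fun s => RCpow x s) u l.
Proof.
  eexists; unfold RCpow; apply (cdiff_comp Cexp (fun s => (s * ln x)%C)); [apply cdiff_Cexp |].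
  apply cdiff_mult; [apply cdiff_id | apply cdiff_const].
Qed.

Lemma Re_div_2 (s : C) : Re (s / 2) = Re s / 2.
Proof. unfold Cdiv; rewrite <- RtoC_inv, re_scal_r by lra; reflexivity. Qed.

Lemma Im_div_2 (s : C) : Im (s / 2) = Im s / 2.
Proof. unfold Cdiv; rewrite <- RtoC_inv, im_scal_r by lra; reflexivity. Qed.

Lemma xi_half_cdiff s : - 1 < Re s -> exists l, cdiff xi_half s l.
Proof.
  intros Hs.
  destruct (zeta_pole_free_cdiff s Hs) as [lz Hlz].
  destruct (CGamma_cdiff (s / 2 + 1)%C) as [lg Hlg].
  { rewrite re_plus, Re_div_2; simpl; lra. }
  destruct (RCpow_const_cdiff PI (- (s / 2))%C) as [lp Hlp].
  assert (Hh : cdiff (fun s => (s / 2)%C) s (1 * / 2 + s * 0)%C)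
    by (apply (cdiff_mult (fun s => s) (fun _ => (/ 2)%C)); [apply cdiff_id | apply cdiff_const]).
  eexists; unfold xi_half; apply cdiff_mult; [apply cdiff_mult |].
  - apply (cdiff_comp (fun s => RCpow PI s) (fun s => (- (s / 2))%C)); [exact Hlp |].
    apply cdiff_opp; exact Hh.
  - apply (cdiff_comp CGamma (fun s => (s / 2 + 1)%C)); [exact Hlg |].
    apply cdiff_plus; [exact Hh | apply cdiff_const].
  - exact Hlz.
Qed.

Section RiemannXi.
Variable xi : C -> C.
Hypothesis Hxi : is_riemann_xi xi.

Lemma xi_eq_half_right s : 1 < Re s -> xi s = xi_half s.
Proof.
  intros Hs; rewrite (xi_formula xi Hxi) by auto; unfold xi_half.
  rewrite CGamma_plus_1, <- zeta_pole_free_eq by (rewrite ?Re_div_2; lra).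
  field.
Qed.

(* The circle centred at [2 + i Im s] through [s] stays in the half-plane, and near its centre
   the two functions agree, so all Fourier coefficients of the difference vanish. *)
Theorem xi_eq_half s : 0 < Re s -> xi s = xi_half s.
Proof.
  intros Hs; destruct (Rlt_le_dec 1 (Re s)) as [H1|H1]; [now apply xi_eq_half_right |].
  set (c := (2, Im s) : C); set (r := 2 - Re s).
  assert (Hr : / 2 <= r) by (unfold r; lra).
  set (d := fun w => (xi w - xi_half w)%C).
  assert (Hd : forall w, Cmod (w - c) <= r -> exists l, cdiff d w l).
  { intros w Hw; assert (B := Re_le_Cmod (w - c)); apply Rabs_le_between in B.
    destruct (holo_of_entire xi (xi_entire xi Hxi) w) as [l1 Hl1].
    destruct (xi_half_cdiff w) as [l2 Hl2]; [unfold r, Re in *; simpl in *; lra |].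
    exists (l1 - l2)%C; now apply cdiff_minus. }
  assert (Hmod : forall t, Cmod (c + r * cis t - c) = r) by (intros; apply Cmod_circle; lra).
  assert (Hz : forall t, d (c + r * cis t)%C = 0).
  { apply fourier_unique.
    - intros t; apply continuous_circle; destruct (Hd (c + r * cis t)%C) as [l Hl]; [rewrite Hmod; lra |].
      now apply cdiff_continuous with l.
    - intros t; now rewrite cis_period.
    - intros m.
      (* The circle of radius [/ 2] has real parts at least [3 / 2], where the product formula
         holds. *)
      assert (E := circle_coef_radius d c m (/ 2) r ltac:(lra) Hd).
      assert (Z0 : circle_coef d c m (/ 2) = 0).
      { unfold circle_coef; rewrite (CI_ext _ (fun _ => RtoC 0)).
        - rewrite CI_const; ring.
        - intros t _; unfold d; rewrite xi_eq_half_right; [ring |].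
          assert (B := Re_le_Cmod (c + (/ 2)%R * cis t - c)); rewrite Cmod_circle in B by lra.
          apply Rabs_le_between in B; unfold Re in *; simpl in *; lra. }
      rewrite Z0, Cmult_0_l in E.
      assert (P := exp_pos (- IZR m * ln r)).
      transitivity (circle_coef d c m r * exp (- IZR m * ln r) / exp (- IZR m * ln r))%C.
      + unfold circle_coef; field; apply RtoC_neq; lra.
      + rewrite <- E; field; apply RtoC_neq; lra. }
  (* The radius was chosen as [2 - Re s], so the leftmost point of the large circle is [s]. *)
  specialize (Hz PI); unfold d in Hz; apply Ceq_minus in Hz.
  replace (c + r * cis PI)%C with s in Hz; auto.
  unfold cis; rewrite cos_PI, sin_PI; unfold r, c; apply C_ext; simpl; ring.
Qed.

End RiemannXi.

Lemma quarter_le_sin x : 0 <= x <= PI / 2 -> x / 4 <= sin x.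
Proof.
  intros Hx; assert (HPI := PI_RGT_0); assert (HP4 := PI_4).
  destruct (Rle_lt_dec x (PI / 3)) as [H|H].
  - destruct (MVT_is_derive sin cos 0 x) as [c [Hc E]]; [lra | |].
    + intros t _; apply is_derive_sin.
    + rewrite sin_0 in E.
      assert (cos (PI / 3) <= cos c) by (apply cos_decr_1; lra).
      rewrite cos_PI3 in H0; nra.
  - assert (sin (PI / 3) <= sin x) by (apply sin_incr_1; lra).
    rewrite sin_PI3 in H0.
    assert (1 <= sqrt 3) by (rewrite <- sqrt_1; apply sqrt_le_1_alt; lra).
    lra.
Qed.

(* The increment of the argument when [r e^{i al}] is translated to the right by [c]. *)
Lemma arg_shift (r al c : R) : 0 < r -> - (PI / 2) <= al <= PI / 2 -> 0 < c ->
  Rabs (r * sin al * (al - atan (r * sin al / (r * cos al + c)))) <= 4 * c.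
Proof.
  intros Hr Hal Hc.
  assert (K : forall al, 0 <= al <= PI / 2 ->
    0 <= r * sin al * (al - atan (r * sin al / (r * cos al + c))) <= 4 * c).
  { clear al Hal; intros al Hal; assert (HPI := PI_RGT_0).
    set (p := r * cos al); set (q := r * sin al).
    assert (Hp : 0 <= p) by (apply Rmult_le_pos; [lra | apply cos_ge_0; lra]).
    assert (Hq : 0 <= q) by (apply Rmult_le_pos; [lra | apply sin_ge_0; lra]).
    assert (Hpq : p ^ 2 + q ^ 2 = r ^ 2).
    { unfold p, q; pose proof (sin2_cos2 al) as H; unfold Rsqr in H; simpl; nra. }
    set (X := p + c) in *; assert (HX : 0 < X) by (unfold X; lra).
    set (be := atan (q / X)).
    assert (Hqx : 0 <= q / X) by (apply Rdiv_le_0_compat; lra).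
    assert (Hbe : 0 <= be < PI / 2).
    { unfold be; split; [| apply atan_bound].
      rewrite <- atan_0; destruct Hqx as [H|H]; [left; now apply atan_increasing | right; now rewrite <- H]. }
    set (rho := sqrt (X ^ 2 + q ^ 2)).
    assert (HXq : 0 < X ^ 2 + q ^ 2) by now apply sq_sum_pos.
    assert (Hrho : 0 < rho) by now apply sqrt_lt_R0.
    assert (Hrr : rho * rho = X ^ 2 + q ^ 2) by (apply sqrt_sqrt; lra).
    assert (Hr_rho : r <= rho).
    { apply Rsqr_incr_0; try lra; unfold Rsqr; rewrite Hrr; unfold X; nra. }
    assert (Es : sqrt (1 + Rsqr (q / X)) = rho / X).
    { apply sqrt_lem_1; [pose proof (Rle_0_sqr (q / X)); lra | apply Rdiv_le_0_compat; lra |].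
      unfold Rsqr; replace (rho / X * (rho / X)) with (rho * rho / X ^ 2) by (field; lra).
      rewrite Hrr; field; lra. }
    assert (Cb : cos be = X / rho) by (unfold be; rewrite cos_atan, Es; field; lra).
    assert (Sb : sin be = q / rho) by (unfold be; rewrite sin_atan, Es; field; lra).
    (* The cross product of the directions [(p, q)] and [(X, q)]. With [q ^ 2 <= r * rho] it bounds
       [q * sin (al - be)] by [c], and [quarter_le_sin] returns to the angle. *)
    assert (Sd : sin (al - be) = c * q / (r * rho)).
    { rewrite sin_minus, Cb, Sb.
      replace (sin al) with (q / r) by (unfold q; field; lra).
      replace (cos al) with (p / r) by (unfold p; field; lra).
      unfold X; field; lra. }
    assert (Sd0 : 0 <= sin (al - be)) by (rewrite Sd; apply Rdiv_le_0_compat; nra).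
    assert (Hd : 0 <= al - be).
    { apply Rnot_lt_le; intro H; assert (sin (al - be) < 0) by (apply sin_lt_0_var; lra); lra. }
    assert (J := quarter_le_sin (al - be) ltac:(lra)).
    split; [apply Rmult_le_pos; auto |].
    apply Rle_trans with (q * (4 * sin (al - be))); [apply Rmult_le_compat_l; lra |].
    rewrite Sd; replace (q * (4 * (c * q / (r * rho)))) with (4 * c * (q ^ 2 / (r * rho))) by (field; lra).
    rewrite <- (Rmult_1_r (4 * c)) at 2; apply Rmult_le_compat_l; [lra |].
    apply Rmult_le_reg_r with (r * rho); [nra |].
    replace (q ^ 2 / (r * rho) * (r * rho)) with (q ^ 2) by (field; lra); nra. }
  destruct (Rle_lt_dec 0 al) as [H|H].
  - specialize (K al ltac:(lra)); rewrite Rabs_right; lra.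
  - specialize (K (- al) ltac:(lra)).
    rewrite sin_neg, cos_neg in K.
    replace (r * - sin al / (r * cos al + c)) with (- (r * sin al / (r * cos al + c))) in K.
    + rewrite atan_opp in K; rewrite Rabs_right; lra.
    + assert (0 <= cos al) by (apply cos_ge_0; lra).
      field; nra.
Qed.

(** The exponent governing [ln |f (rho e^{i al})|] for [f = xi (1/2 + .)]. *)
Definition Psi (rho al : R) : R :=
  rho / 2 * (cos al * (ln (rho / (2 * PI)) - 1) - al * sin al).

Definition gamma_factor (w : C) : C :=
  (RCpow PI (- ((/ 2 + w) / 2)) * CGamma ((/ 2 + w) / 2 + 1))%C.

(** Gamma is taken at [w / 2 + 5 / 4]. The shift by [5 / 4] changes the modulus and, by [arg_shift],
    the angle term only by bounded amounts; the exponent [X - 1 / 2 = p + 3 / 4] produces the term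
    [3 / 4 * ln rho]. *)
Lemma gamma_factor_bound : exists A, forall rho al, 1 <= rho -> - (PI / 2) <= al <= PI / 2 ->
  0 < Cmod (gamma_factor (rho * cis al)) /\
  Rabs (ln (Cmod (gamma_factor (rho * cis al))) - (Psi rho al + 3 / 4 * ln rho)) <= A.
Proof.
  exists (40 + Rabs (ln PI)).
  intros rho al Hrho Hal; assert (HPI := PI_RGT_0).
  set (r := rho / 2); assert (Hr : / 2 <= r) by (unfold r; lra).
  set (p := r * cos al); set (q := r * sin al).
  assert (Hcos : 0 <= cos al) by (apply cos_ge_0; lra).
  assert (Hp : 0 <= p) by (apply Rmult_le_pos; lra).
  assert (Hpr : p <= r) by (unfold p; pose proof (COS_bound al); nra).
  assert (Hpq : p ^ 2 + q ^ 2 = r ^ 2).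
  { unfold p, q; pose proof (sin2_cos2 al) as H; unfold Rsqr in H; simpl; nra. }
  set (X := p + 5 / 4).
  assert (Earg : ((/ 2 + rho * cis al) / 2 + 1)%C = ((X, q) : C)).
  { rewrite <- RtoC_inv by lra; apply C_ext.
    - rewrite re_plus, Re_div_2; unfold cis, X, p, r; simpl; field.
    - rewrite im_plus, Im_div_2; unfold cis, q, r; simpl; field. }
  assert (GP : 0 < Cmod (CGamma (X, q))) by (apply CGamma_pos; unfold X; lra).
  assert (EG : Cmod (gamma_factor (rho * cis al)) = Rpower PI (- (/ 4 + p)) * Cmod (CGamma (X, q))).
  { unfold gamma_factor; rewrite Cmod_mult, Cmod_RCpow, Earg; do 2 f_equal.
    rewrite re_opp, Re_div_2, <- RtoC_inv by lra; unfold cis, p, r; simpl; field. }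
  assert (RP : 0 < Rpower PI (- (/ 4 + p))) by apply exp_pos.
  rewrite EG; split; [apply Rmult_lt_0_compat; auto |].
  rewrite ln_mult by auto; unfold Rpower at 1; rewrite ln_exp.
  assert (St := gamma_stirling X q ltac:(unfold X; lra)).
  unfold stirling_error, stirling in St.
  set (Q := X ^ 2 + q ^ 2) in *.
  assert (HQ : Q = r ^ 2 + 5 / 2 * p + 25 / 16) by (unfold Q, X; nra).
  assert (HQ0 : 0 < r ^ 2) by (apply pow_lt; lra).
  assert (Elnr : ln (r ^ 2) = 2 * ln r).
  { simpl; rewrite Rmult_1_r, ln_mult by lra; ring. }
  assert (L : 0 <= ln Q / 2 - ln r <= 5 / 4 * / r).
  { split.
    - assert (ln (r ^ 2) <= ln Q) by (apply ln_le_compat; lra); lra.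
    - assert (Q <= (r * (1 + 5 / 4 * / r)) ^ 2).
      { replace (r * (1 + 5 / 4 * / r)) with (r + 5 / 4) by (field; lra); nra. }
      assert (I : 0 < 5 / 4 * / r) by (apply Rmult_lt_0_compat; [lra | apply Rinv_0_lt_compat; lra]).
      assert (LQ : ln Q <= ln ((r * (1 + 5 / 4 * / r)) ^ 2)) by (apply ln_le_compat; lra).
      simpl in LQ; rewrite Rmult_1_r, !ln_mult in LQ by (try apply Rmult_lt_0_compat; lra).
      assert (ln (1 + 5 / 4 * / r) <= 5 / 4 * / r); [| lra].
      rewrite <- (ln_exp (5 / 4 * / r)) at 2; apply ln_le_compat; [lra | apply exp_ineq1_le]. }
  assert (L2 : 0 <= (X - / 2) * (ln Q / 2 - ln r) <= 4).
  { split; [apply Rmult_le_pos; unfold X; lra |].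
    assert (I : 0 < / r) by (apply Rinv_0_lt_compat; lra).
    apply Rle_trans with ((r + 3 / 4) * (5 / 4 * / r)); [apply Rmult_le_compat; unfold X; lra |].
    replace ((r + 3 / 4) * (5 / 4 * / r)) with (5 / 4 + 15 / 16 * / r) by (field; lra).
    assert (/ r <= 2) by (rewrite <- (Rinv_inv 2); apply Rinv_le_contravar; lra); lra. }
  assert (AS := arg_shift r al (5 / 4) ltac:(lra) Hal ltac:(lra)).
  fold p q in AS; fold X in AS.
  assert (EP : Psi rho al = p * (ln r - ln PI - 1) - q * al).
  { unfold Psi; replace (rho / (2 * PI)) with (r / PI) by (unfold r; field; lra).
    unfold Rdiv at 2; rewrite ln_mult, ln_Rinv by (try apply Rinv_0_lt_compat; lra).
    unfold p, q, r; ring. }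
  assert (Elr : ln rho = ln r + ln 2).
  { rewrite <- ln_mult by lra; f_equal; unfold r; field. }
  assert (Hl2 : 0 <= ln 2 <= 1).
  { split; [rewrite <- ln_1; apply ln_le_compat; lra |].
    rewrite <- (ln_exp 1); apply ln_le_compat; [lra |]; pose proof (exp_ineq1_le 1); lra. }
  rewrite EP, Elr.
  apply Rabs_le_between in St; apply Rabs_le_between in AS.
  assert (LP := Rle_abs (ln PI)); assert (LP2 := Rle_abs (- ln PI)); rewrite Rabs_Ropp in LP2.
  replace ((X - / 2) * (ln Q / 2)) with ((X - / 2) * (ln Q / 2 - ln r) + (p + 3 / 4) * ln r) in St
    by (unfold X; field).
  unfold X in *; apply Rabs_le; split; nra.
Qed.

(** The interface through which all asymptotics pass. The power [7 / 4] is [3 / 4] from Gamma and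
    [1] from [s - 1], zeta being of size one there; [4] rounds up [3 / 4 + 3] and comes from the
    crude cubic bound on [zeta_pole_free]. *)
Record xi_like (f : C -> C) (A : R) : Prop := {
  xl_holo : holo f;
  xl_even : forall w, f (- w)%C = f w;
  xl_upper : forall rho al, 1 <= rho -> - (PI / 2) <= al <= PI / 2 ->
    Cmod (f (rho * cis al)%C) <= exp (A + 4 * ln rho + Psi rho al);
  xl_upper_right : forall rho al, 1 <= rho -> - (PI / 2) <= al <= PI / 2 -> 5 / 2 <= rho * cos al ->
    Cmod (f (rho * cis al)%C) <= exp (A + 7 / 4 * ln rho + Psi rho al);
  xl_lower_right : forall rho al, 1 <= rho -> - (PI / 2) <= al <= PI / 2 -> 5 / 2 <= rho * cos al ->
    exp (- A + 7 / 4 * ln rho + Psi rho al) <= Cmod (f (rho * cis al)%C);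
  xl_neq_0 : forall x : R, / 2 <= x -> f x <> 0 }.

Lemma Cmod_rho_cis rho al : 0 <= rho -> Cmod (rho * cis al) = rho.
Proof. intros; rewrite Cmod_mult, Cmod_cis, Cmod_R, Rabs_right; lra. Qed.

Theorem shifted_xi_like (xi : C -> C) : is_riemann_xi xi -> exists A, 0 <= A /\ xi_like (shifted_xi xi) A.
Proof.
  intros Hxi; destruct gamma_factor_bound as [B HB].
  assert (HPI := PI_RGT_0).
  assert (Ef : forall w, 0 <= Re w -> shifted_xi xi w = (gamma_factor w * zeta_pole_free (/ 2 + w))%C).
  { intros w Hw; unfold shifted_xi; rewrite (xi_eq_half xi Hxi); [reflexivity |].
    rewrite <- RtoC_inv by lra; simpl; unfold Re in *; lra. }
  assert (Hre : forall rho al, 0 <= rho -> - (PI / 2) <= al <= PI / 2 -> 0 <= Re (rho * cis al)).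
  { intros rho al H1 H2; rewrite re_scal_l; simpl; apply Rmult_le_pos; auto; apply cos_ge_0; lra. }
  assert (HG : forall rho al, 1 <= rho -> - (PI / 2) <= al <= PI / 2 ->
    exp (- B + (Psi rho al + 3 / 4 * ln rho)) <= Cmod (gamma_factor (rho * cis al))
    <= exp (B + (Psi rho al + 3 / 4 * ln rho))).
  { intros rho al H1 H2; destruct (HB rho al H1 H2) as [P K]; apply Rabs_le_between in K.
    rewrite <- (exp_ln (Cmod (gamma_factor (rho * cis al)))) by auto.
    split; apply exp_le_compat; lra. }
  assert (Hzc : forall rho al, 1 <= rho -> - (PI / 2) <= al <= PI / 2 -> 5 / 2 <= rho * cos al ->
    rho / 4 <= Cmod (zeta_pole_free (/ 2 + rho * cis al)) <= 4 * rho).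
  { intros rho al H1 H2 H3; set (s := (/ 2 + rho * cis al)%C).
    assert (Hs : 3 <= Re s).
    { unfold s; rewrite <- RtoC_inv by lra; simpl; unfold Re; simpl; lra. }
    rewrite <- zeta_pole_free_eq, Cmod_mult by lra.
    assert (Z := Cmod_Czeta_lower s Hs).
    assert (D : rho / 2 <= Cmod (s - 1) <= 2 * rho).
    { assert (E : (s - 1)%C = (rho * cis al - / 2)%C) by (unfold s; field; apply RtoC_neq; lra).
      rewrite E; assert (Hm := Cmod_rho_cis rho al ltac:(lra)).
      assert (H2' : Cmod (/ 2) = / 2) by (rewrite <- RtoC_inv, Cmod_R, Rabs_right; lra).
      pose proof (Cmod_triangle_rev (rho * cis al) (/ 2)); pose proof (Cmod_triangle_minus (rho * cis al) (/ 2)).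
      rewrite Hm, H2' in *; lra. }
    split; nra. }
  assert (Hln : forall k : nat, forall rho, 1 <= rho -> rho ^ k = exp (INR k * ln rho))
    by (intros; rewrite exp_INR_ln; lra).
  exists (Rabs B + 200); split; [pose proof (Rabs_pos B); lra |].
  assert (RB := Rle_abs B); assert (RB2 := Rle_abs (- B)); rewrite Rabs_Ropp in RB2.
  assert (E5 : 1 + 199 <= exp 199) by (apply exp_ineq1_le).
  split.
  - intros w; destruct (holo_of_entire xi (xi_entire xi Hxi) (/ 2 + w)%C) as [l Hl].
    exists (l * (0 + 1))%C; unfold shifted_xi.
    apply (cdiff_comp xi (fun w => (/ 2 + w)%C)); auto.
    apply cdiff_plus; [apply cdiff_const | apply cdiff_id].
  - intros w; unfold shifted_xi; rewrite (xi_reflection xi Hxi); f_equal; field; apply RtoC_neq; lra.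
  - intros rho al H1 H2; rewrite Ef by (apply Hre; lra); rewrite Cmod_mult.
    assert (L0 : 0 <= ln rho) by (rewrite <- ln_1; apply ln_le_compat; lra).
    assert (Z := zeta_pole_free_bound (/ 2 + rho * cis al)).
    assert (Hz : Cmod (zeta_pole_free (/ 2 + rho * cis al)) <= 200 * rho ^ 3).
    { apply Rle_trans with (5 * (Cmod (/ 2 + rho * cis al) + 1) ^ 3).
      - apply Z; rewrite <- RtoC_inv by lra; rewrite re_plus; pose proof (Hre rho al ltac:(lra) H2); simpl in *; lra.
      - assert (Cmod (/ 2 + rho * cis al) + 1 <= 5 / 2 * rho).
        { apply Rle_trans with (Cmod (/ 2) + Cmod (rho * cis al) + 1).
          - pose proof (Cmod_triangle (/ 2) (rho * cis al)); lra.
          - rewrite Cmod_rho_cis, <- RtoC_inv, Cmod_R, Rabs_right by lra; lra. }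
        assert (P := pow_incr (Cmod (/ 2 + rho * cis al) + 1) (5 / 2 * rho) 3
          ltac:(split; [pose proof (Cmod_ge_0 (/ 2 + rho * cis al)) |]; lra)).
        rewrite Rpow_mult_distr in P; assert (0 < rho ^ 3) by (apply pow_lt; lra); simpl in *; lra. }
    apply Rle_trans with (exp (B + (Psi rho al + 3 / 4 * ln rho)) * (exp 199 * exp (3 * ln rho))).
    + apply Rmult_le_compat; try apply Cmod_ge_0; [apply HG; auto |].
      rewrite Hln in Hz by auto; simpl INR in Hz.
      replace (1 + 1 + 1) with 3 in Hz by ring.
      apply Rle_trans with (1 := Hz), Rmult_le_compat_r; [left; apply exp_pos | lra].
    + rewrite <- !exp_plus; apply exp_le_compat; lra.
  - intros rho al H1 H2 H3; rewrite Ef by (apply Hre; lra); rewrite Cmod_mult.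
    destruct (Hzc rho al H1 H2 H3) as [_ Z].
    apply Rle_trans with (exp (B + (Psi rho al + 3 / 4 * ln rho)) * (exp 199 * exp (ln rho))).
    + apply Rmult_le_compat; try apply Cmod_ge_0; [apply HG; auto |].
      rewrite exp_ln by lra; apply Rle_trans with (1 := Z), Rmult_le_compat_r; lra.
    + rewrite <- !exp_plus; apply exp_le_compat; lra.
  - intros rho al H1 H2 H3; rewrite Ef by (apply Hre; lra); rewrite Cmod_mult.
    destruct (Hzc rho al H1 H2 H3) as [Z _].
    apply Rle_trans with (exp (- B + (Psi rho al + 3 / 4 * ln rho)) * (exp (- (199)) * exp (ln rho))).
    + rewrite <- !exp_plus; apply exp_le_compat; lra.
    + apply Rmult_le_compat; [left; apply exp_pos | | apply HG; auto |].
      * apply Rmult_le_pos; left; apply exp_pos.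
      * rewrite exp_ln by lra; apply Rle_trans with (2 := Z).
        rewrite exp_Ropp; assert (/ exp 199 <= / 4) by (apply Rinv_le_contravar; lra).
        apply Rle_trans with (/ 4 * rho); [apply Rmult_le_compat_r; lra | lra].
  - intros x Hx; rewrite Ef by (simpl; lra).
    apply Cmult_neq_0.
    + unfold gamma_factor; apply Cmult_neq_0; [apply Cexp_neq_0 |].
      assert (E : ((/ 2 + x) / 2 + 1)%C = ((x / 2 + 5 / 4, 0) : C)).
      { rewrite <- RtoC_inv by lra; apply C_ext.
        - rewrite re_plus, Re_div_2; simpl; field.
        - rewrite im_plus, Im_div_2; simpl; field. }
      rewrite E; apply Cmod_gt_0, CGamma_pos; lra.
    + rewrite <- RtoC_inv, <- RtoC_plus by lra.
      (* At [s = 1] the series is out of reach, but [zeta_pole_free] has the value [1], the residue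
         of zeta. *)
      destruct (Req_dec x (/ 2)) as [->|Hx2].
      * replace (/ 2 + / 2) with 1 by field; unfold zeta_pole_free.
        replace ((1 + 1) / 2 - (1 - 1) * 1 * (1 + 1) * bern_mellin (- (1) - 2))%C with (RtoC 1) by field.
        apply C1_nz.
      * rewrite <- zeta_pole_free_eq by (simpl; lra); apply Cmult_neq_0.
        -- rewrite <- RtoC_minus; apply RtoC_neq; lra.
        -- apply Czeta_real_neq_0; lra.
Qed.

(** * The saddle point *)

Lemma holo_shift (f : C -> C) (v : C) : holo f -> holo (fun w => f (v + w)%C).
Proof.
  intros Hf w; destruct (Hf (v + w)%C) as [l Hl]; exists (l * (0 + 1))%C.
  apply (cdiff_comp f (fun w => (v + w)%C)); auto.
  apply cdiff_plus; [apply cdiff_const | apply cdiff_id].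
Qed.

Lemma C_derive_shift (f : C -> C) (v : C) : holo f -> C_derive (fun w => f (v + w)%C) 0 = C_derive f v.
Proof.
  intros Hf; apply C_derive_cdiff.
  apply (cdiff_eq _ _ (C_derive f v * (0 + 1))%C); [| ring].
  apply (cdiff_comp f (fun w => (v + w)%C)).
  - rewrite Cplus_0_r; now apply holo_cdiff.
  - apply cdiff_plus; [apply cdiff_const | apply cdiff_id].
Qed.

Lemma C_derive_tcoef_1 (f : C -> C) : holo f -> C_derive f 0 = tcoef f 1.
Proof.
  intros Hf; rewrite <- (C_derive_n_tcoef f 1 Hf); simpl; field.
Qed.

Lemma cauchy_deriv_bound (f : C -> C) (v : C) (r M : R) : holo f -> 0 < r ->
  (forall u, Cmod (u - v) <= r -> Cmod (f u) <= M) -> Cmod (C_derive f v) <= M / r.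
Proof.
  intros Hf Hr HM; rewrite <- C_derive_shift, C_derive_tcoef_1 by (auto; now apply holo_shift).
  assert (B := tcoef_bound (fun w => f (v + w)%C) 1 r M (holo_shift f v Hf) Hr).
  apply Rmult_le_reg_r with r; auto.
  replace (M / r * r) with M by (field; lra); rewrite pow_1 in B; apply B.
  intros t; apply HM; rewrite Cmod_circle; lra.
Qed.

Lemma cauchy_lipschitz (f : C -> C) (u : C) (r M : R) : holo f -> 0 < r ->
  (forall u, Cmod u <= r -> Cmod (f u) <= M) -> Cmod u <= r / 2 -> Cmod (f u - f 0) <= 2 * M / r * Cmod u.
Proof.
  intros Hf Hr HM Hu; assert (HPI := PI_RGT_0).
  assert (Hu' : Cmod u < r) by lra.
  assert (H0 : Cmod 0 < r) by (rewrite Cmod_0; lra).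
  assert (Hm := fun t => Cmod_rho_cis r t (Rlt_le _ _ Hr)).
  assert (Hne : forall a, Cmod a < r -> forall t, (r * cis t - a)%C <> 0).
  { intros a Ha t E; apply Ceq_minus in E; apply (f_equal Cmod) in E; rewrite Hm in E; lra. }
  assert (Hc : forall a, Cmod a < r -> forall t,
    continuous (fun t => (f (r * cis t) * (r * cis t) / (r * cis t - a))%C) t).
  { intros a Ha t.
    assert (Hgc : continuous (fun t => (r * cis t)%C) t).
    { apply continuous_Cmult; [apply continuous_const | apply continuous_cis, continuous_id]. }
    apply continuous_Cmult; [apply continuous_Cmult; auto |].
    - apply (continuous_comp (fun t => (r * cis t)%C) f); auto; now apply holo_continuous.
    - apply continuous_Cinv; auto; apply continuous_Cminus; auto; apply continuous_const. }
  assert (E : (2 * PI * (f u - f 0))%C = CI (fun t => (f (r * cis t) * (r * cis t) / (r * cis t - u)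
     - f (r * cis t) * (r * cis t) / (r * cis t - 0))%C) 0 (2 * PI)).
  { rewrite CI_minus by (apply ex_CI_continuous; auto).
    rewrite <- !cauchy_formula_0 by auto; ring. }
  assert (B : Cmod (2 * PI * (f u - f 0)) <= (2 * PI - 0) * (2 * M / r * Cmod u)).
  { rewrite E; apply Cmod_CI_le_const; [lra | |].
    - apply ex_CI_continuous; intros; apply continuous_Cminus; auto.
    - intros t _.
      assert (N0 := Hne 0%C H0 t); assert (Nu := Hne u Hu' t).
      assert (Ng : (r * cis t)%C <> 0).
      { intro Eg; apply N0; rewrite Eg; ring. }
      replace (f (r * cis t) * (r * cis t) / (r * cis t - u) - f (r * cis t) * (r * cis t) / (r * cis t - 0))%C
        with (f (r * cis t) * (u / (r * cis t - u)))%C.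
      2: { generalize (f (r * cis t)%C); revert N0 Nu Ng; generalize (r * cis t)%C; intros; field; auto. }
      rewrite Cmod_mult, Cmod_div by auto.
      assert (Hd : r / 2 <= Cmod (r * cis t - u)).
      { pose proof (Cmod_triangle_rev (r * cis t) u); rewrite Hm in *; lra. }
      assert (HMt : Cmod (f (r * cis t)%C) <= M) by (apply HM; rewrite Hm; lra).
      apply Rle_trans with (M * (Cmod u * (2 / r))).
      + apply Rmult_le_compat; auto; [apply Cmod_ge_0 | |].
        * apply Rdiv_le_0_compat; [apply Cmod_ge_0 | lra].
        * unfold Rdiv at 1; apply Rmult_le_compat_l; [apply Cmod_ge_0 |].
          replace (2 / r) with (/ (r / 2)) by (field; lra); apply Rinv_le_contravar; lra.
      + right; field; lra. }
  rewrite !Cmod_mult, !Cmod_R, !Rabs_right in B by lra.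
  apply Rmult_le_reg_l with (2 * PI); lra.
Qed.

Lemma Cexp_polar (l : R) (u : C) : (l * Cexp u)%C = ((l * exp (Re u))%R * cis (Im u))%C.
Proof. destruct u; rewrite Cexp_cis, RtoC_mult; simpl; ring. Qed.

Section XiLike.
Variables (f : C -> C) (A : R).
Hypothesis Hf : xi_like f A.

Definition loglam (l : R) : R := ln (l / (2 * PI)).

(* [(l e^u / 2) log (l e^u / (2 pi e)) + (7/4) u], normalised to vanish at [u = 0]. *)
Definition expo (l : R) (u : C) : C :=
  (l / 2 * Cexp u * (loglam l + u - 1) - l / 2 * (loglam l - 1) + 7 / 4 * u)%C.

(* The ratio of [f (l e^u) / f l] to its Stirling prediction. *)
Definition Fnorm (l : R) (u : C) : C := (f (l * Cexp u) / f l * Cexp (- expo l u))%C.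

Definition bound_M : R := exp (2 * A).

Lemma xi_like_at_real (l : R) : / 2 <= l -> f l <> 0.
Proof. apply (xl_neq_0 f A Hf). Qed.

Lemma expo_cdiff l u : cdiff (expo l) u (l / 2 * Cexp u * (loglam l + u) + 7 / 4)%C.
Proof.
  unfold expo; eapply cdiff_eq.
  - apply cdiff_plus; [apply cdiff_minus; [| apply cdiff_const] |].
    + apply cdiff_mult.
      * apply cdiff_mult; [apply cdiff_const | apply cdiff_Cexp].
      * apply cdiff_minus; [apply cdiff_plus; [apply cdiff_const | apply cdiff_id] | apply cdiff_const].
    + apply cdiff_mult; [apply cdiff_const | apply cdiff_id].
  - simpl; ring.
Qed.

Lemma Fnorm_cdiff l u : cdiff (Fnorm l) u
  (Cexp (- expo l u) * (l * Cexp u * C_derive f (l * Cexp u) / f l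
     - f (l * Cexp u) / f l * (l / 2 * Cexp u * (loglam l + u) + 7 / 4)))%C.
Proof.
  unfold Fnorm; eapply cdiff_eq.
  - apply cdiff_mult.
    + apply cdiff_mult; [| apply cdiff_const].
      apply (cdiff_comp f (fun u => (l * Cexp u)%C)); [apply holo_cdiff, (xl_holo f A Hf) |].
      apply cdiff_mult; [apply cdiff_const | apply cdiff_Cexp].
    + apply (cdiff_comp Cexp (fun u => (- expo l u)%C)); [apply cdiff_Cexp |].
      apply cdiff_opp, expo_cdiff.
  - simpl; unfold Cdiv; ring.
Qed.

Lemma holo_Fnorm l : holo (Fnorm l).
Proof. intros u; eexists; apply Fnorm_cdiff. Qed.

Lemma expo_0 l : expo l 0 = 0.
Proof. unfold expo; rewrite Cexp_0; unfold Cdiv; ring. Qed.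

Lemma Fnorm_0 l : / 2 <= l -> Fnorm l 0 = 1.
Proof.
  intros Hl; assert (N := xi_like_at_real l Hl).
  unfold Fnorm; rewrite expo_0, Cexp_0, Cmult_1_r.
  replace (- 0)%C with (RtoC 0) by ring; rewrite Cexp_0; field; auto.
Qed.

Lemma cos_ge_1_minus t : 1 - Rabs t <= cos t.
Proof.
  assert (B := Cmod_cis_minus t 0); rewrite cis_0, Rminus_0_r in B.
  assert (B2 := Re_le_Cmod (cis t - 1)); apply Rabs_le_between in B2; unfold Re in B2; simpl in B2; lra.
Qed.

Lemma PI_gt_3 : 3 < PI.
Proof. pose proof PI2_3_2; lra. Qed.

Lemma Psi_0 l : Psi l 0 = l / 2 * (loglam l - 1).
Proof. unfold Psi, loglam; rewrite cos_0, sin_0; ring. Qed.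

Lemma xi_like_real_lower l : 5 / 2 <= l -> exp (- A + 7 / 4 * ln l + Psi l 0) <= Cmod (f l).
Proof.
  intros Hl; assert (HP := PI_gt_3).
  replace (f l) with (f (l * cis 0)%C) by (rewrite cis_0; f_equal; ring).
  apply (xl_lower_right f A Hf); rewrite ?cos_0; lra.
Qed.

Lemma Re_expo l u : 0 < l ->
  Re (expo l u) = Psi (l * exp (Re u)) (Im u) - Psi l 0 + 7 / 4 * Re u.
Proof.
  intros Hl; assert (HP := PI_gt_3); rewrite Psi_0; unfold Psi.
  replace (ln (l * exp (Re u) / (2 * PI))) with (loglam l + Re u).
  2: { unfold loglam; replace (l * exp (Re u) / (2 * PI)) with (l / (2 * PI) * exp (Re u)) by (field; lra).
       rewrite ln_mult, ln_exp; auto; [apply Rdiv_lt_0_compat; lra | apply exp_pos]. }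
  unfold expo; destruct u as [a b]; rewrite Cexp_cis.
  unfold Cdiv; rewrite <- !RtoC_inv, <- !RtoC_mult by lra; unfold cis; simpl; field.
Qed.

(** For these [l] and [u] the point [l e^u] has real part at least [5 / 2], where the upper bound
    has the same power [7 / 4] as the lower bound at [l]. All growth cancels, leaving [A - (- A)] in
    the exponent. *)
Lemma Fnorm_bound l u : 10 <= l -> Cmod u <= / 2 -> Cmod (Fnorm l u) <= bound_M.
Proof.
  intros Hl Hu; assert (HP := PI_gt_3).
  assert (Ba := Re_le_Cmod u); assert (Bb := Im_le_Cmod u).
  assert (N := xi_like_at_real l ltac:(lra)).
  assert (L := xi_like_real_lower l ltac:(lra)).
  unfold Fnorm; rewrite Cmod_mult, Cmod_div, Cmod_Cexp, re_opp, Re_expo, Cexp_polar by (auto; lra).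
  set (a := Re u) in *; set (b := Im u) in *.
  assert (Ea : / 2 <= exp a).
  { pose proof (exp_ineq1_le a); apply Rabs_le_between in Ba; lra. }
  assert (Eb : / 2 <= cos b) by (pose proof (cos_ge_1_minus b); lra).
  apply Rabs_le_between in Bb.
  assert (U : Cmod (f ((l * exp a)%R * cis b)%C) <= exp (A + 7 / 4 * ln (l * exp a) + Psi (l * exp a) b)).
  { apply (xl_upper_right f A Hf); [nra | lra |].
    apply Rle_trans with (l * / 2 * / 2); [lra |].
    apply Rmult_le_compat; nra. }
  rewrite ln_mult, ln_exp in U by (try apply exp_pos; lra).
  apply Rle_trans with (exp (A + 7 / 4 * (ln l + a) + Psi (l * exp a) b)
     / exp (- A + 7 / 4 * ln l + Psi l 0) * exp (- (Psi (l * exp a) b - Psi l 0 + 7 / 4 * a))).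
  - apply Rmult_le_compat_r; [left; apply exp_pos |].
    unfold Rdiv; apply Rmult_le_compat; auto; [apply Cmod_ge_0 | |].
    + left; apply Rinv_0_lt_compat; apply Cmod_gt_0; auto.
    + apply Rinv_le_contravar; auto; apply exp_pos.
  - unfold Rdiv; rewrite <- exp_Ropp, <- !exp_plus; unfold bound_M; apply exp_le_compat; lra.
Qed.

Lemma Fnorm_minus_1 l u : 10 <= l -> Cmod u <= / 4 -> Cmod (Fnorm l u - 1) <= 4 * bound_M * Cmod u.
Proof.
  intros Hl Hu; rewrite <- (Fnorm_0 l) by lra.
  replace (4 * bound_M * Cmod u) with (2 * bound_M / (/ 2) * Cmod u) by field.
  apply cauchy_lipschitz; [apply holo_Fnorm | lra | intros; now apply Fnorm_bound | lra].
Qed.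

Lemma Fnorm_deriv_bound l u : 10 <= l -> Cmod u <= / 4 -> Cmod (C_derive (Fnorm l) u) <= 4 * bound_M.
Proof.
  intros Hl Hu; replace (4 * bound_M) with (bound_M / (/ 4)) by field.
  apply cauchy_deriv_bound; [apply holo_Fnorm | lra |].
  intros v Hv; apply Fnorm_bound; auto.
  replace v with ((v - u) + u)%C by ring; apply Rle_trans with (1 := Cmod_triangle _ _); lra.
Qed.

Lemma Fnorm_deriv_lipschitz l u : 10 <= l -> Cmod u <= / 8 ->
  Cmod (C_derive (Fnorm l) u - C_derive (Fnorm l) 0) <= 32 * bound_M * Cmod u.
Proof.
  intros Hl Hu; replace (32 * bound_M * Cmod u) with (2 * (4 * bound_M) / (/ 4) * Cmod u) by field.
  apply cauchy_lipschitz; [apply holo_C_derive, holo_Fnorm | lra | | lra].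
  intros; now apply Fnorm_deriv_bound.
Qed.

Lemma is_scaling_eq n l : is_scaling f n l -> (1 <= n)%nat ->
  / 2 < l /\ (l * C_derive f l)%C = (2 * INR n * f l)%C.
Proof.
  intros [Hl H] Hn; split; auto.
  assert (N := xi_like_at_real l ltac:(lra)).
  assert (Hn0 : RtoC (INR n) <> 0) by (apply RtoC_neq, not_0_INR; lia).
  transitivity ((2 - (2 - l / INR n * (C_derive f l / f l))) * INR n * f l)%C; [field; auto |].
  rewrite H; ring.
Qed.

Lemma Fnorm_deriv_0 n l : / 2 < l -> (l * C_derive f l)%C = (2 * INR n * f l)%C ->
  C_derive (Fnorm l) 0 = (2 * INR n - (l / 2 * loglam l + 7 / 4))%R.
Proof.
  intros Hl H; assert (N := xi_like_at_real l ltac:(lra)).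
  rewrite (C_derive_cdiff _ _ _ (Fnorm_cdiff l 0)), expo_0, Cexp_0, !Cmult_1_r.
  replace (- 0)%C with (RtoC 0) by ring; rewrite Cexp_0, H.
  rewrite RtoC_minus, RtoC_plus, !RtoC_mult, RtoC_div, RtoC_div by lra.
  field; auto.
Qed.

(** The saddle equation turns the derivative of [Fnorm l] at [0] into this difference, and Cauchy's
    estimate bounds that derivative. So [n] is about [l L / 4]. *)
Lemma two_n_bound n l : 10 <= l -> (l * C_derive f l)%C = (2 * INR n * f l)%C ->
  Rabs (2 * INR n - (l / 2 * loglam l + 7 / 4)) <= 4 * bound_M.
Proof.
  intros Hl H; rewrite <- Cmod_R, <- (Fnorm_deriv_0 n l) by (auto; lra).
  apply Fnorm_deriv_bound; auto; rewrite Cmod_0; lra.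
Qed.

Lemma cont_real_of_C (h : C -> C) (x : R) : continuous h (RtoC x) ->
  continuity_pt (fun x : R => Cmod (h x)) x.
Proof.
  intros Hh; apply continuity_pt_filterlim.
  apply (continuous_Cmod (fun x : R => h x)), (continuous_comp RtoC h); auto.
  apply (continuous_RtoC (fun x : R => x)), continuous_id.
Qed.

(** On a compact interval of the real line [f] has no zero, so [l f' / f] is bounded there and
    cannot equal [2 n] for large [n]. *)
Lemma scaling_unbounded B : exists n0 : nat, forall n l, (n0 <= n)%nat ->
  / 2 < l -> (l * C_derive f l)%C = (2 * INR n * f l)%C -> B < l.
Proof.
  set (B' := Rmax B 1); assert (HB1 : 1 <= B') by apply Rmax_r.
  assert (HBB : B <= B') by apply Rmax_l.
  destruct (continuity_ab_min (fun x : R => Cmod (f x)) (/ 2) B') as [xm [Hm Hxm]]; [lra | |].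
  { intros; apply cont_real_of_C, holo_continuous, (xl_holo f A Hf). }
  destruct (continuity_ab_maj (fun x : R => Cmod (C_derive f x)) (/ 2) B') as [xM [HM HxM]]; [lra | |].
  { intros; apply cont_real_of_C, holo_continuous, holo_C_derive, (xl_holo f A Hf). }
  set (c := Cmod (f xm)) in *; set (D := Cmod (C_derive f xM)) in *.
  assert (Hc : 0 < c) by (apply Cmod_gt_0, xi_like_at_real; lra).
  assert (HD : 0 <= D) by apply Cmod_ge_0.
  destruct (nfloor_ex (B' * D / c)) as [n0 [_ Hn0]]; [apply Rdiv_le_0_compat; nra |].
  exists (S n0); intros n l Hn Hl E.
  apply Rnot_le_lt; intro HlB.
  assert (Hl' : / 2 <= l <= B') by lra.
  specialize (Hm l Hl'); specialize (HM l Hl').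
  apply (f_equal Cmod) in E; rewrite !Cmod_mult, !Cmod_R, !Rabs_right in E
    by (try apply Rle_ge; try apply pos_INR; lra).
  assert (Hn1 : INR n0 + 1 <= INR n) by (rewrite <- S_INR; apply le_INR; auto).
  assert (X : l * Cmod (C_derive f l) <= B' * D) by (apply Rmult_le_compat; try apply Cmod_ge_0; lra).
  assert (Y : INR n * c <= INR n * Cmod (f l)) by (apply Rmult_le_compat_l; [apply pos_INR | auto]).
  assert (Z : B' * D < INR n * c).
  { apply Rmult_lt_reg_r with (/ c); [apply Rinv_0_lt_compat; auto |].
    replace (INR n * c * / c) with (INR n) by (field; lra); unfold Rdiv in Hn0; lra. }
  assert (0 <= INR n * Cmod (f l)) by (apply Rmult_le_pos; [apply pos_INR | apply Cmod_ge_0]).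
  lra.
Qed.

End XiLike.

Lemma exp_eighth : exp (/ 8) <= 2.
Proof.
  assert (H := exp_ineq1_le (- / 8)); rewrite exp_Ropp in H.
  assert (P := exp_pos (/ 8)).
  assert (exp (/ 8) * (1 + - / 8) <= 1).
  { apply Rle_trans with (exp (/ 8) * / exp (/ 8)); [apply Rmult_le_compat_l; lra | right; field; lra]. }
  lra.
Qed.

Lemma cis_remainder_2 t : Rabs t <= / 8 -> Cmod (cis t - 1 - Ci * t) <= 2 * t ^ 2.
Proof.
  intros Ht; assert (H := Cexp_remainder (0, t)).
  rewrite Cexp_cis, exp_0 in H.
  replace (1 * cis t - 1 - (0, t))%C with (cis t - 1 - Ci * t)%C in H by (apply C_ext; simpl; ring).
  assert (E : Cmod (0, t) = Rabs t).
  { replace ((0, t) : C) with (Ci * t)%C by (apply C_ext; simpl; ring).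
    rewrite Cmod_mult, Cmod_Ci, Cmod_R; ring. }
  rewrite E in H; apply Rle_trans with (1 := H).
  assert (Es : Rabs t ^ 2 = t ^ 2) by (unfold Rabs; destruct Rcase_abs; ring).
  rewrite Es; assert (exp (Rabs t) <= 2) by (apply Rle_trans with (2 := exp_eighth), exp_le_compat; auto).
  pose proof (pow2_ge_0 t); nra.
Qed.

Lemma cis_remainder_3 t : Rabs t <= / 8 -> Cmod (cis t - 1 - Ci * t + t * t / 2) <= 2 * Rabs t ^ 3.
Proof.
  intros Ht.
  set (F := fun t : R => (cis t - 1 - Ci * t + t * t / 2)%C).
  set (F' := fun t : R => (Ci * (cis t - 1 - Ci * t))%C).
  assert (HD : forall x, is_derive (fun t => Re (F t)) x (Re (F' x)) /\ is_derive (fun t => Im (F t)) x (Im (F' x))).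
  { intros x; unfold F, F', Cdiv; rewrite <- RtoC_inv by lra; unfold cis; simpl; split; auto_derive; auto; field. }
  assert (HC : forall x, continuous F' x).
  { intros x; apply continuous_Cmult; [apply continuous_const |].
    apply continuous_Cminus; [apply continuous_Cminus; [apply continuous_cis, continuous_id | apply continuous_const] |].
    apply continuous_Cmult; [apply continuous_const | apply continuous_RtoC, continuous_id]. }
  assert (F0 : F 0 = 0) by (unfold F; rewrite cis_0; unfold Cdiv; ring).
  assert (K : forall a b, a <= b -> (forall x, a <= x <= b -> Rabs x <= Rabs t) ->
    Cmod (F b - F a) <= (b - a) * (2 * Rabs t ^ 2)).
  { intros a b Hab Hx; rewrite <- (CI_FTC F F') by auto.
    apply Cmod_CI_le_const; auto; [apply ex_CI_continuous; auto |].
    intros x Hxx; specialize (Hx x Hxx); unfold F'; rewrite Cmod_mult, Cmod_Ci, Rmult_1_l.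
    apply Rle_trans with (1 := cis_remainder_2 x ltac:(lra)).
    apply Rmult_le_compat_l; [lra |].
    replace (x ^ 2) with (Rabs x ^ 2) by (unfold Rabs; destruct Rcase_abs; ring).
    apply pow_incr; split; auto; apply Rabs_pos. }
  change (Cmod (F t) <= 2 * Rabs t ^ 3).
  destruct (Rle_lt_dec 0 t) as [H|H].
  - specialize (K 0 t H).
    rewrite F0 in K; replace (F t - 0)%C with (F t) in K by ring.
    rewrite (Rabs_right t) in * by lra.
    apply Rle_trans with ((t - 0) * (2 * t ^ 2)); [apply K; intros; rewrite Rabs_right; lra | right; ring].
  - specialize (K t 0 ltac:(lra)).
    rewrite F0 in K; replace (0 - F t)%C with (- F t)%C in K by ring; rewrite Cmod_opp in K.
    rewrite (Rabs_left t) in * by lra.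
    apply Rle_trans with ((0 - t) * (2 * (- t) ^ 2)); [apply K; intros; rewrite Rabs_left1; lra | right; ring].
Qed.

Lemma one_minus_cos_lower t : - (PI / 2) <= t <= PI / 2 -> t ^ 2 / 32 <= 1 - cos t.
Proof.
  intros Ht.
  assert (K : forall t, 0 <= t <= PI / 2 -> t ^ 2 / 32 <= 1 - cos t).
  { clear; intros t Ht.
    replace (cos t) with (1 - 2 * sin (t / 2) * sin (t / 2)).
    - assert (J := quarter_le_sin (t / 2) ltac:(lra)); nra.
    - replace t with (2 * (t / 2)) at 3 by field; rewrite cos_2a_sin; ring. }
  destruct (Rle_lt_dec 0 t); [apply K; lra |].
  specialize (K (- t) ltac:(lra)); rewrite cos_neg in K; simpl in *; lra.
Qed.

Lemma CI_half_periods (h : R -> C) : (forall t, continuous h t) -> (forall t, h (t + PI) = h t) ->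
  CI h 0 (2 * PI) = (2 * CI h (- (PI / 2)) (PI / 2))%C.
Proof.
  intros Hc Hp.
  assert (Hex : forall a b, ex_CI h a b) by (intros; apply ex_CI_continuous; auto).
  assert (E1 : CI h (- (PI / 2)) (PI / 2) = CI h 0 PI).
  { replace (PI / 2) with (- (PI / 2) + PI) at 2 by field; now apply CI_period_shift. }
  assert (E2 : CI h PI (2 * PI) = CI h 0 PI).
  { replace (2 * PI) with (PI + PI) by ring; now apply CI_period_shift. }
  rewrite E1, <- (CI_Chasles h 0 PI (2 * PI)), E2 by auto; ring.
Qed.

Lemma cis_PI : cis PI = (- (1))%C.
Proof. unfold cis; rewrite cos_PI, sin_PI; apply C_ext; simpl; ring. Qed.

Section XiLike.
Variables (f : C -> C) (A : R).
Hypothesis Hf : xi_like f A.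

Lemma continuous_xi_circle l t : continuous (fun t => f (l * cis t)%C) t.
Proof.
  apply (continuous_comp (fun t : R => (l * cis t)%C) f).
  - apply continuous_Cmult; [apply continuous_const | apply continuous_cis, continuous_id].
  - apply holo_continuous, (xl_holo f A Hf).
Qed.

Lemma xi_circle_half_turn l t : f (l * cis (t + PI))%C = f (l * cis t)%C.
Proof.
  rewrite cis_plus, cis_PI, <- (xl_even f A Hf (l * cis t)%C); f_equal; ring.
Qed.

Lemma even_circle_coef l (m : Z) :
  circle_coef f 0 (2 * m) l =
  (2 * CI (fun t => (f (l * cis t) * cis (- (2 * IZR m * t)))%C) (- (PI / 2)) (PI / 2))%C.
Proof.
  unfold circle_coef; rewrite <- CI_half_periods.
  - apply CI_ext; intros t _; rewrite Cplus_0_l, mult_IZR; auto.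
  - intros t; apply continuous_Cmult; [apply continuous_xi_circle |].
    apply continuous_cis, (continuous_opp (V := R_NormedModule)), continuous_Rmult_const, continuous_id.
  - intros t; rewrite xi_circle_half_turn; f_equal.
    replace (- (2 * IZR m * (t + PI))) with (- (2 * IZR m * t) + - (IZR m * (2 * PI))) by ring.
    rewrite cis_plus, (cis_opp (IZR m * (2 * PI))), cis_2PI_mult; field.
Qed.

(** A half turn leaves [f] unchanged and reverses an odd character, so the two half circles
    cancel. *)
Lemma odd_tcoef k : tcoef f (2 * k + 1) = 0.
Proof.
  unfold tcoef.
  set (h := fun t => (f (0 + 1 * cis t) * cis (- (IZR (Z.of_nat (2 * k + 1)) * t)))%C).
  assert (Hc : forall t, continuous h t).
  { intros t; apply continuous_mult_cis, continuous_circle, holo_continuous, (xl_holo f A Hf). }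
  assert (Hex : forall a b, ex_CI h a b) by (intros; apply ex_CI_continuous; auto).
  assert (Hs : forall t, h (t + PI) = (- h t)%C).
  { intros t; unfold h; rewrite !Cplus_0_l, xi_circle_half_turn.
    replace (- (IZR (Z.of_nat (2 * k + 1)) * (t + PI))) with
      (- (IZR (Z.of_nat (2 * k + 1)) * t) + - (IZR (Z.of_nat k) * (2 * PI) + PI)).
    - rewrite cis_plus, (cis_opp (_ + PI)), cis_plus, cis_2PI_mult, cis_PI.
      assert (/ (1 * - (1)) = - (1))%C as -> by field.
      ring.
    - rewrite Nat2Z.inj_add, Nat2Z.inj_mul, plus_IZR, mult_IZR; simpl; ring. }
  assert (E : CI h PI (2 * PI) = (- CI h 0 PI)%C).
  { transitivity (CI (fun t => h (1 * t + PI)) 0 PI).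
    - unfold CI.
      replace (2 * PI) with (1 * PI + PI) by ring; replace PI with (1 * 0 + PI) at 1 by ring.
      rewrite <- (RInt_comp_lin (V := C_R_CompleteNormedModule) h 1 PI 0 PI) by apply Hex.
      apply CI_ext; intros t _; transitivity (1 * h (1 * t + PI)%R)%C; [apply scal_R_Cmult | ring].
    - transitivity (CI (fun t => (- (1) * h t)%C) 0 PI).
      + apply CI_ext; intros t _; rewrite Rmult_1_l, Hs; ring.
      + rewrite CI_Cmult_l by auto; ring. }
  unfold circle_coef; fold h.
  rewrite <- (CI_Chasles h 0 PI (2 * PI)), E by auto; unfold Cdiv; ring.
Qed.

Lemma taylor_poly_even n z : taylor_poly f (2 * n) z = sum_n (fun k => (tcoef f (2 * k) * z ^ (2 * k))%C) n.
Proof.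
  rewrite (taylor_poly_tcoef f _ z (xl_holo f A Hf)); induction n.
  - now rewrite !sum_O.
  - replace (2 * S n)%nat with (S (S (2 * n))) by lia.
    rewrite !sum_Sn_C, IHn.
    replace (S (2 * n))%nat with (2 * n + 1)%nat by lia; rewrite odd_tcoef.
    replace (S (2 * n + 1))%nat with (2 * S n)%nat by lia; Cring.
Qed.

(** * Taylor coefficients at the saddle radius *)

Section Saddle.
Variables (n : nat) (l : R).
Hypothesis Hl : 10 <= l.
Hypothesis HL : 2 <= loglam l.
Hypothesis Hscal : (l * C_derive f l)%C = (2 * INR n * f l)%C.

Definition gfun (t : R) : C := (f (l * cis t) / f l * cis (- (2 * INR n * t)))%C.

Let Hfl : f l <> 0.
Proof. apply (xi_like_at_real f A Hf); lra. Qed.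

Lemma continuous_gfun t : continuous gfun t.
Proof.
  apply continuous_Cmult; [apply continuous_Cmult; [apply continuous_xi_circle | apply continuous_const] |].
  apply continuous_cis, (continuous_opp (V := R_NormedModule)), continuous_Rmult_const, continuous_id.
Qed.

Definition scaled_coef (k : nat) : C := (tcoef f (2 * k) * l ^ (2 * k) / f l)%C.

Definition gmoment (m : Z) : C := CI (fun t => (gfun t * cis (- (2 * IZR m * t)))%C) (- (PI / 2)) (PI / 2).

Lemma gmoment_eq (m : Z) :
  (2 * gmoment m)%C = (circle_coef f 0 (2 * (Z.of_nat n + m)) l / f l)%C.
Proof.
  rewrite even_circle_coef; unfold gmoment, Cdiv.
  rewrite <- !Cmult_assoc; f_equal; rewrite Cmult_comm, <- CI_Cmult_l.
  - apply CI_ext; intros t _; unfold gfun.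
    replace (- (2 * IZR (Z.of_nat n + m) * t)) with (- (2 * INR n * t) + - (2 * IZR m * t)).
    + rewrite cis_plus; unfold Cdiv; ring.
    + rewrite plus_IZR, <- INR_IZR_INZ; ring.
  - apply ex_CI_continuous; intros t _; apply continuous_Cmult; [apply continuous_xi_circle |].
    apply continuous_cis, (continuous_opp (V := R_NormedModule)), continuous_Rmult_const, continuous_id.
Qed.

Lemma gmoment_coef (k : nat) : gmoment (Z.of_nat k - Z.of_nat n) = (PI * scaled_coef k)%C.
Proof.
  assert (E := gmoment_eq (Z.of_nat k - Z.of_nat n)).
  replace (2 * (Z.of_nat n + (Z.of_nat k - Z.of_nat n)))%Z with (Z.of_nat (2 * k)) in E by lia.
  rewrite (circle_coef_tcoef f _ l (xl_holo f A Hf)) in E by lra.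
  transitivity (/ 2 * (2 * gmoment (Z.of_nat k - Z.of_nat n)))%C; [field; apply RtoC_neq; lra |].
  rewrite E; unfold scaled_coef; field; auto.
Qed.

Lemma gmoment_neg (m : Z) : (m < - Z.of_nat n)%Z -> gmoment m = 0.
Proof.
  intros Hm; assert (E := gmoment_eq m).
  rewrite (circle_coef_neg f _ l (xl_holo f A Hf)) in E by (lra || lia).
  transitivity (/ 2 * (2 * gmoment m))%C; [field; apply RtoC_neq; lra |].
  rewrite E; unfold Cdiv; ring.
Qed.

(* Wide compared with the Gaussian width [kappa ^ (-1/2)], yet with [l * loglam l * tau ^ 3] still small. *)
Definition tau : R := Rpower l (- (2 / 5)).
(** Minus the coefficient of [t ^ 2] in the expansion of [expo l (i t)]. *)
Definition kappa : R := l / 4 * (loglam l + 1).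
(** The bound of [gfun_global] at [t = tau], where the Gaussian window ends. *)
Definition tail_eps : R := exp (2 * A + 4 * ln l - l * loglam l * tau ^ 2 / 128).

Hypothesis Htau : tau <= / 8.
Hypothesis Hsmall : l * loglam l * tau ^ 3 + 8 * bound_M A * tau <= / 8.

Let tau_pos : 0 < tau.
Proof. apply exp_pos. Qed.

(** In [expo l (i t)] the linear term meets the frequency [2 n] and cancels up to the bounded [dl],
    the quadratic term is the Gaussian, and the cubic rest is small by the choice of [tau]. *)
Lemma gfun_near t : Rabs t <= tau -> Cmod (gfun t * exp (kappa * t ^ 2) - 1) <= / 2.
Proof.
  intros Ht.
  set (M := bound_M A) in *; assert (HM : 0 < M) by apply exp_pos.
  set (L := loglam l) in *.
  set (dl := 2 * INR n - (l / 2 * L + 7 / 4)).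
  assert (Hdl : Rabs dl <= 4 * M) by (apply (two_n_bound f A Hf); auto).
  set (u := (Ci * t)%C).
  assert (Hu : Cmod u = Rabs t) by (unfold u; rewrite Cmod_mult, Cmod_Ci, Cmod_R; ring).
  assert (Ecis : Cexp u = cis t).
  { replace u with ((0, t) : C) by (unfold u; apply C_ext; simpl; ring).
    rewrite Cexp_cis, exp_0; ring. }
  set (r2 := (cis t - 1 - Ci * t)%C); set (r3 := (cis t - 1 - Ci * t + t * t / 2)%C).
  assert (Hr2 : Cmod r2 <= 2 * Rabs t ^ 2).
  { replace (Rabs t ^ 2) with (t ^ 2) by (unfold Rabs; destruct Rcase_abs; ring).
    apply cis_remainder_2; lra. }
  assert (Hr3 : Cmod r3 <= 2 * Rabs t ^ 3) by (apply cis_remainder_3; lra).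
  set (rem := (l / 2 * ((L - 1)%R * r3 + Ci * t * r2))%C).
  assert (Hrem : Cmod rem <= l * L * tau ^ 3).
  { apply Rle_trans with (l * L * Rabs t ^ 3).
    - unfold rem; rewrite Cmod_mult, Cmod_div, !Cmod_R, !Rabs_right by (try apply RtoC_neq; lra).
      apply Rle_trans with (l / 2 * ((L - 1) * (2 * Rabs t ^ 3) + Rabs t * (2 * Rabs t ^ 2))); [| right; field].
      apply Rmult_le_compat_l; [lra |].
      apply Rle_trans with (1 := Cmod_triangle _ _), Rplus_le_compat.
      + rewrite Cmod_mult, Cmod_R, Rabs_right by lra; apply Rmult_le_compat_l; lra.
      + rewrite !Cmod_mult, Cmod_Ci, Cmod_R, Rmult_1_l; apply Rmult_le_compat_l; auto; apply Rabs_pos.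
    - apply Rmult_le_compat_l; [nra |]; apply pow_incr; split; auto; apply Rabs_pos. }
  (* Everything that is neither Gaussian nor in [Fnorm]: the third-order remainder and the mismatch
     of the linear terms. [Hsmall] is exactly what bounds it by [/ 8]. *)
  set (eta := (rem - Ci * t * dl)%C).
  assert (Heta : Cmod eta <= / 8).
  { apply Rle_trans with (1 := Cmod_triangle_minus _ _).
    rewrite !Cmod_mult, Cmod_Ci, !Cmod_R, Rmult_1_l.
    assert (Rabs t * Rabs dl <= tau * (4 * M)) by (apply Rmult_le_compat; auto; apply Rabs_pos).
    apply Rle_trans with (2 := Hsmall), Rplus_le_compat; auto; nra. }
  assert (Eg : (gfun t * exp (kappa * t ^ 2))%C = (Fnorm f l u * Cexp eta)%C).
  { rewrite <- Cexp_RtoC; unfold Fnorm, gfun; rewrite Ecis.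
    assert (Ec : cis (- (2 * INR n * t)) = Cexp (- (2 * INR n) * u)%C).
    { replace (- (2 * INR n) * u)%C with ((0, - (2 * INR n * t)) : C) by (unfold u; apply C_ext; simpl; ring).
      rewrite Cexp_cis, exp_0; ring. }
    rewrite Ec, <- !Cmult_assoc; f_equal; rewrite <- !Cexp_plus; f_equal.
    unfold eta, rem, dl, expo; rewrite Ecis; fold L.
    replace (cis t) with (r2 + 1 + Ci * t)%C by (unfold r2; ring).
    unfold r3; replace (cis t) with (r2 + 1 + Ci * t)%C by (unfold r2; ring).
    unfold kappa, u; fold L.
    assert (HC : (Ci * Ci = - (1))%C) by (apply C_ext; simpl; ring).
    apply C_ext; destruct r2 as [x y]; unfold Cdiv; rewrite <- !RtoC_inv by lra; simpl; field. }
  rewrite Eg.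
  assert (HF : Cmod (Fnorm f l u - 1) <= / 16).
  { apply Rle_trans with (4 * M * Cmod u); [apply (Fnorm_minus_1 f A Hf); auto; lra |].
    rewrite Hu.
    assert (0 <= l * L * tau ^ 3) by (apply Rmult_le_pos; [nra | apply pow_le; lra]).
    assert (M * Rabs t <= M * tau) by (apply Rmult_le_compat_l; lra).
    clear - H H0 Hsmall; lra. }
  assert (He : Cmod (Cexp eta - 1) <= 5 / 32).
  { replace (Cexp eta - 1)%C with ((Cexp eta - 1 - eta) + eta)%C by ring.
    apply Rle_trans with (1 := Cmod_triangle _ _).
    assert (B := Cexp_remainder eta).
    assert (exp (Cmod eta) <= 2) by (apply Rle_trans with (2 := exp_eighth), exp_le_compat; auto).
    assert (Cmod eta ^ 2 * exp (Cmod eta) <= (/ 8) ^ 2 * 2).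
    { apply Rmult_le_compat; auto; [apply pow2_ge_0 | left; apply exp_pos |].
      apply pow_incr; split; auto; apply Cmod_ge_0. }
    lra. }
  replace (Fnorm f l u * Cexp eta - 1)%C with
    ((Fnorm f l u - 1) * (Cexp eta - 1) + (Fnorm f l u - 1) + (Cexp eta - 1))%C by ring.
  apply Rle_trans with (1 := Cmod_triangle _ _).
  assert (T := Cmod_triangle ((Fnorm f l u - 1) * (Cexp eta - 1)) (Fnorm f l u - 1)).
  rewrite Cmod_mult in T.
  pose proof (Cmod_ge_0 (Fnorm f l u - 1)); pose proof (Cmod_ge_0 (Cexp eta - 1)); nra.
Qed.

Let kappa_pos : 0 < kappa.
Proof. unfold kappa; nra. Qed.

Lemma gfun_near_lower t : Rabs t <= tau -> exp (- (kappa * t ^ 2)) / 2 <= Re (gfun t).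
Proof.
  intros Ht; assert (B := gfun_near t Ht).
  assert (P := exp_pos (kappa * t ^ 2)).
  assert (R1 := Re_le_Cmod (gfun t * exp (kappa * t ^ 2) - 1)); apply Rabs_le_between in R1.
  unfold Cminus in B, R1; rewrite re_plus, re_scal_r in R1.
  change (Re (- (1))%C) with (- (1)) in R1.
  rewrite exp_Ropp; apply Rmult_le_reg_r with (exp (kappa * t ^ 2)); auto.
  replace (/ exp (kappa * t ^ 2) / 2 * exp (kappa * t ^ 2)) with (/ 2) by (field; lra); lra.
Qed.

Lemma gfun_near_upper t : Rabs t <= tau -> Cmod (gfun t) <= 2.
Proof.
  intros Ht; assert (B := gfun_near t Ht).
  assert (P : 1 <= exp (kappa * t ^ 2)).
  { rewrite <- exp_0; apply exp_le_compat; pose proof (pow2_ge_0 t); nra. }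
  assert (T := Cmod_triangle_rev (gfun t * exp (kappa * t ^ 2)) 1).
  rewrite Cmod_mult, Cmod_R, Cmod_1, Rabs_right in T by lra.
  pose proof (Cmod_ge_0 (gfun t)); nra.
Qed.

(** [Psi l t - Psi l 0] equals [- l / 2 * ((L - 1) * (1 - cos t) + t * sin t)], and both terms in
    the bracket are nonnegative. The powers of [l] in the crude bounds remain, which is harmless
    beyond [tau]. *)
Lemma gfun_global t : - (PI / 2) <= t <= PI / 2 ->
  Cmod (gfun t) <= exp (2 * A + 4 * ln l - l * loglam l * t ^ 2 / 128).
Proof.
  intros Ht; unfold gfun; rewrite Cmod_mult, Cmod_cis, Rmult_1_r, Cmod_div by auto.
  assert (HP := PI_gt_3).
  assert (Lo := xi_like_real_lower f A Hf l ltac:(lra)).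
  assert (Up := xl_upper f A Hf l t ltac:(lra) Ht).
  assert (L0 : 0 <= ln l) by (rewrite <- ln_1; apply ln_le_compat; lra).
  apply Rle_trans with (exp (A + 4 * ln l + Psi l t) / exp (- A + 7 / 4 * ln l + Psi l 0)).
  - unfold Rdiv; apply Rmult_le_compat; auto; [apply Cmod_ge_0 | |].
    + left; apply Rinv_0_lt_compat, Cmod_gt_0; auto.
    + apply Rinv_le_contravar; auto; apply exp_pos.
  - unfold Rdiv; rewrite <- exp_Ropp, <- exp_plus; apply exp_le_compat.
    rewrite Psi_0; unfold Psi; fold (loglam l).
    assert (C1 := one_minus_cos_lower t Ht).
    assert (S1 : 0 <= t * sin t).
    { destruct (Rle_lt_dec 0 t) as [H|H].
      - apply Rmult_le_pos; auto; apply sin_ge_0; lra.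
      - assert (0 <= sin (- t)) by (apply sin_ge_0; lra); rewrite sin_neg in H0; nra. }
    assert (X : l * loglam l * t ^ 2 / 128 <= l / 2 * (loglam l - 1) * (1 - cos t)).
    { apply Rle_trans with (l / 2 * (loglam l / 2) * (t ^ 2 / 32)); [right; field |].
      apply Rmult_le_compat; nra. }
    assert (0 <= l / 2 * (t * sin t)) by (apply Rmult_le_pos; lra).
    lra.
Qed.

Lemma gfun_far t : - (PI / 2) <= t <= PI / 2 -> tau <= Rabs t -> Cmod (gfun t) <= tail_eps.
Proof.
  intros Ht Hta; apply Rle_trans with (1 := gfun_global t Ht); unfold tail_eps; apply exp_le_compat.
  assert (tau ^ 2 <= t ^ 2).
  { replace (t ^ 2) with (Rabs t ^ 2) by (unfold Rabs; destruct Rcase_abs; ring).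
    apply pow_incr; lra. }
  assert (0 <= l * loglam l) by nra; nra.
Qed.

Lemma gfun_integral_bound (K : R -> C) (B1 B2 : R) : (forall t, continuous K t) ->
  (forall t, Rabs t <= tau -> Cmod (K t) <= B1) ->
  (forall t, - (PI / 2) <= t <= PI / 2 -> Cmod (K t) <= B2) ->
  Cmod (CI (fun t => (gfun t * K t)%C) (- (PI / 2)) (PI / 2)) <= 4 * tau * B1 + 4 * tail_eps * B2.
Proof.
  intros HK H1 H2; assert (HP := PI_gt_3).
  assert (Hc : forall t, continuous (fun t => (gfun t * K t)%C) t) by (intros; apply continuous_Cmult; auto; apply continuous_gfun).
  assert (Hex : forall a b, ex_CI (fun t => (gfun t * K t)%C) a b) by (intros; apply ex_CI_continuous; auto).
  assert (HB1 : 0 <= B1) by (apply Rle_trans with (2 := H1 0 ltac:(rewrite Rabs_R0; lra)), Cmod_ge_0).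
  assert (HB2 : 0 <= B2) by (apply Rle_trans with (2 := H2 0 ltac:(lra)), Cmod_ge_0).
  assert (He : 0 < tail_eps) by apply exp_pos.
  rewrite <- (CI_Chasles _ (- (PI / 2)) (- tau)), <- (CI_Chasles _ (- tau) tau (PI / 2)) by auto.
  assert (I1 : Cmod (CI (fun t => (gfun t * K t)%C) (- (PI / 2)) (- tau)) <= (- tau - - (PI / 2)) * (tail_eps * B2)).
  { apply Cmod_CI_le_const; auto; [lra |]; intros t Ht; rewrite Cmod_mult.
    apply Rmult_le_compat; try apply Cmod_ge_0; [apply gfun_far; [lra |]; rewrite Rabs_left1; lra | apply H2; lra]. }
  assert (I2 : Cmod (CI (fun t => (gfun t * K t)%C) (- tau) tau) <= (tau - - tau) * (2 * B1)).
  { apply Cmod_CI_le_const; auto; [lra |]; intros t Ht; rewrite Cmod_mult.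
    assert (Rabs t <= tau) by (apply Rabs_le; lra).
    apply Rmult_le_compat; try apply Cmod_ge_0; [now apply gfun_near_upper | auto]. }
  assert (I3 : Cmod (CI (fun t => (gfun t * K t)%C) tau (PI / 2)) <= (PI / 2 - tau) * (tail_eps * B2)).
  { apply Cmod_CI_le_const; auto; [lra |]; intros t Ht; rewrite Cmod_mult.
    apply Rmult_le_compat; try apply Cmod_ge_0; [apply gfun_far; [lra |]; rewrite Rabs_right; lra | apply H2; lra]. }
  apply Rle_trans with (1 := Cmod_triangle _ _).
  pose proof (Cmod_triangle (CI (fun t => (gfun t * K t)%C) (- tau) tau) (CI (fun t => (gfun t * K t)%C) tau (PI / 2))).
  assert (0 <= tail_eps * B2) by nra.
  pose proof PI_4.
  assert ((PI - 2 * tau) * (tail_eps * B2) <= 4 * (tail_eps * B2)) by (apply Rmult_le_compat_r; lra).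
  nra.
Qed.

Lemma scaled_coef_upper k : Cmod (scaled_coef k) <= 4 * tau + 4 * tail_eps.
Proof.
  assert (HP := PI_gt_3).
  assert (B : Cmod (gmoment (Z.of_nat k - Z.of_nat n)) <= 4 * tau * 1 + 4 * tail_eps * 1).
  { apply gfun_integral_bound.
    - intros t; apply continuous_cis, (continuous_opp (V := R_NormedModule)), continuous_Rmult_const, continuous_id.
    - intros; rewrite Cmod_cis; lra.
    - intros; rewrite Cmod_cis; lra. }
  rewrite gmoment_coef, Cmod_mult, Cmod_R, Rabs_right in B by lra.
  pose proof (Cmod_ge_0 (scaled_coef k)); nra.
Qed.

(** Only [|t| <= 1 / sqrt kappa] is counted, where the Gaussian is at least [1 / 3]; the hypothesis
    puts this interval inside [|t| <= tau], and on the rest of the latter the real part is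
    nonnegative. *)
Lemma scaled_coef_lower : 4 <= l * loglam l * tau ^ 2 ->
  / (3 * sqrt kappa) - 4 * tail_eps <= PI * Cmod (scaled_coef n).
Proof.
  intros H4; assert (HP := PI_gt_3).
  assert (Es : Cmod (gmoment 0) = PI * Cmod (scaled_coef n)).
  { replace 0%Z with (Z.of_nat n - Z.of_nat n)%Z by lia.
    rewrite gmoment_coef, Cmod_mult, Cmod_R, Rabs_right; lra. }
  rewrite <- Es; apply Rle_trans with (Re (gmoment 0)).
  2: { apply Rle_trans with (1 := Rle_abs _), Re_le_Cmod. }
  assert (Eg : gmoment 0 = CI gfun (- (PI / 2)) (PI / 2)).
  { apply CI_ext; intros t _; rewrite Rmult_0_r, Rmult_0_l, Ropp_0, cis_0; ring. }
  rewrite Eg, Re_CI by (apply ex_CI_continuous; intros; apply continuous_gfun).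
  assert (Hc : forall t, continuous (fun t => Re (gfun t)) t) by (intros; apply continuous_Re, continuous_gfun).
  assert (Hex : forall a b, ex_RInt (fun t => Re (gfun t)) a b)
    by (intros; apply (ex_RInt_continuous (V := R_CompleteNormedModule)); auto).
  set (s := / sqrt kappa).
  assert (Hsq : 0 < sqrt kappa) by now apply sqrt_lt_R0.
  assert (Hss : sqrt kappa * sqrt kappa = kappa) by (apply sqrt_sqrt; lra).
  assert (Hs : 0 < s) by (apply Rinv_0_lt_compat; auto).
  assert (Hst : s <= tau).
  { apply Rmult_le_reg_l with (sqrt kappa); auto; unfold s; rewrite Rinv_r by lra.
    apply Rsqr_incr_0; [| lra | nra].
    unfold Rsqr; replace (sqrt kappa * tau * (sqrt kappa * tau)) with (sqrt kappa * sqrt kappa * tau ^ 2) by ring.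
    rewrite Hss; unfold kappa; assert (0 <= l * tau ^ 2) by (apply Rmult_le_pos; [lra | apply pow2_ge_0]); nra. }
  rewrite <- (RInt_Chasles _ (- (PI / 2)) (- tau)), <- (RInt_Chasles _ (- tau) (- s) (PI / 2)),
    <- (RInt_Chasles _ (- s) s (PI / 2)), <- (RInt_Chasles _ s tau (PI / 2)) by auto.
  match goal with |- ?x <= plus ?a (plus ?b (plus ?c (plus ?d ?e))) => change (x <= a + (b + (c + (d + e)))) end.
  assert (He : 0 < tail_eps) by apply exp_pos.
  assert (I1 : (- tau - - (PI / 2)) * (- tail_eps) <= RInt (fun t => Re (gfun t)) (- (PI / 2)) (- tau)).
  { replace ((- tau - - (PI / 2)) * - tail_eps) with (RInt (fun _ => - tail_eps) (- (PI / 2)) (- tau))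
      by (rewrite RInt_const; reflexivity).
    apply RInt_le; auto; [lra | apply ex_RInt_const |]; intros t Ht.
    assert (B := gfun_far t ltac:(lra) ltac:(rewrite Rabs_left1; lra)).
    assert (B2 := Re_le_Cmod (gfun t)); apply Rabs_le_between in B2; lra. }
  assert (I5 : (PI / 2 - tau) * (- tail_eps) <= RInt (fun t => Re (gfun t)) tau (PI / 2)).
  { replace ((PI / 2 - tau) * - tail_eps) with (RInt (fun _ => - tail_eps) tau (PI / 2))
      by (rewrite RInt_const; reflexivity).
    apply RInt_le; auto; [lra | apply ex_RInt_const |]; intros t Ht.
    assert (B := gfun_far t ltac:(lra) ltac:(rewrite Rabs_right; lra)).
    assert (B2 := Re_le_Cmod (gfun t)); apply Rabs_le_between in B2; lra. }
  assert (Hnn : forall t, Rabs t <= tau -> 0 <= Re (gfun t)).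
  { intros t Ht; apply Rle_trans with (2 := gfun_near_lower t Ht).
    pose proof (exp_pos (- (kappa * t ^ 2))); lra. }
  assert (I2 : 0 <= RInt (fun t => Re (gfun t)) (- tau) (- s)).
  { apply RInt_ge_0; auto; [lra |]; intros t Ht; apply Hnn, Rabs_le; lra. }
  assert (I4 : 0 <= RInt (fun t => Re (gfun t)) s tau).
  { apply RInt_ge_0; auto; intros t Ht; apply Hnn, Rabs_le; lra. }
  assert (I3 : (s - - s) * (/ 6) <= RInt (fun t => Re (gfun t)) (- s) s).
  { replace ((s - - s) * / 6) with (RInt (fun _ => / 6) (- s) s) by (rewrite RInt_const; reflexivity).
    apply RInt_le; auto; [lra | apply ex_RInt_const |]; intros t Ht.
    apply Rle_trans with (2 := gfun_near_lower t ltac:(apply Rabs_le; lra)).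
    assert (/ 3 <= exp (- (kappa * t ^ 2))); [| lra].
    apply Rle_trans with (exp (- (1))).
    - rewrite exp_Ropp; apply Rinv_le_contravar; [apply exp_pos | apply exp_le_3].
    - apply exp_le_compat, Ropp_le_contravar.
      assert (t ^ 2 <= s ^ 2) by nra.
      replace 1 with (kappa * s ^ 2); [nra |].
      transitivity (sqrt kappa * sqrt kappa * s ^ 2); [now rewrite Hss | unfold s; field; lra]. }
  replace (/ (3 * sqrt kappa)) with (s / 3) by (unfold s; field; lra).
  pose proof PI_4.
  assert (PI * tail_eps <= 4 * tail_eps) by (apply Rmult_le_compat_r; lra).
  assert (0 <= tau * tail_eps) by (apply Rmult_le_pos; lra).
  lra.
Qed.

(** The difference of the two characters is at most [2 j |t|], which on the window gains one more
    factor [tau] over the size of the coefficients. *)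
Lemma scaled_coef_ratio (j : nat) : Cmod (PI * (scaled_coef (n + j) - scaled_coef n)) <= INR j * (8 * tau ^ 2 + 16 * tail_eps).
Proof.
  assert (HP := PI_gt_3); assert (HP4 := PI_4).
  replace (PI * (scaled_coef (n + j) - scaled_coef n))%C with (PI * scaled_coef (n + j) - PI * scaled_coef n)%C by ring.
  rewrite <- !gmoment_coef, Nat2Z.inj_add, Z.sub_diag, Z.add_simpl_l; unfold gmoment.
  assert (Hcc : forall m : Z, forall t, continuous (fun t => cis (- (2 * IZR m * t))) t).
  { intros m t; apply continuous_cis, (continuous_opp (V := R_NormedModule)), continuous_Rmult_const, continuous_id. }
  rewrite <- CI_minus by (apply ex_CI_continuous; intros; apply continuous_Cmult; auto; apply continuous_gfun).
  rewrite (CI_ext _ (fun t => (gfun t * (cis (- (2 * IZR (Z.of_nat j) * t)) - cis (- (2 * 0 * t))))%C))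
    by (intros; ring).
  rewrite <- INR_IZR_INZ.
  assert (Hj := pos_INR j).
  assert (B : forall t, Cmod (cis (- (2 * INR j * t)) - cis (- (2 * 0 * t))) <= 2 * INR j * Rabs t).
  { intros t; apply Rle_trans with (1 := Cmod_cis_minus _ _).
    replace (- (2 * INR j * t) - - (2 * 0 * t)) with (- (2 * INR j) * t) by ring.
    rewrite Rabs_mult, Rabs_Ropp, Rabs_right; lra. }
  replace (INR j * (8 * tau ^ 2 + 16 * tail_eps)) with (4 * tau * (2 * INR j * tau) + 4 * tail_eps * (2 * INR j * 2)) by ring.
  apply gfun_integral_bound.
  - intros t; apply continuous_Cminus; [rewrite INR_IZR_INZ; apply Hcc | apply (Hcc 0%Z)].
  - intros t Ht; apply Rle_trans with (1 := B t), Rmult_le_compat_l; lra.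
  - intros t Ht; apply Rle_trans with (1 := B t), Rmult_le_compat_l; [lra |]; apply Rabs_le; lra.
Qed.

Lemma Cmod_sum_n_le (a : nat -> C) (b : nat -> R) m : (forall k, Cmod (a k) <= b k) ->
  Cmod (sum_n a m) <= sum_n b m.
Proof.
  intros H; induction m; [rewrite !sum_O; auto |].
  rewrite sum_Sn_C, sum_Sn; apply Rle_trans with (1 := Cmod_triangle _ _).
  apply Rplus_le_compat; auto.
Qed.

(** For [Cmod om = 1] the terms do not decay, so coefficientwise comparison fails. Instead the sum
    is one integral of [gfun] against a finite geometric series [K]: in [(1 - om) * K] the term [1]
    yields the middle coefficient, the last power yields a coefficient of negative index, and the
    rest has a factor [t]. *)
Lemma scaled_sum_outside (om : C) : Cmod om <= 1 -> om <> 1 ->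
  Cmod (PI * ((1 - om) * sum_n (fun j => (scaled_coef (n - j) * om ^ j)%C) n - scaled_coef n))
  <= 8 * tau ^ 2 * (4 / Cmod (1 - om) + (INR n + 1) * (4 * tau / Cmod (1 - om)) ^ 4)
     + 16 * tail_eps * (INR n + 1).
Proof.
  intros Hom1 Hom; assert (HP := PI_gt_3); assert (HP4 := PI_4).
  assert (Hd0 : (1 - om)%C <> 0) by (apply Cminus_eq_contra; auto).
  set (dl := Cmod (1 - om)); assert (Hdl : 0 < dl) by (apply Cmod_gt_0; auto).
  set (K := fun t => sum_n (fun j => ((om * cis (2 * t)) ^ j)%C) n).
  assert (Hcc : forall m : R, forall t, continuous (fun t => cis (m * t)) t).
  { intros m t; apply continuous_cis, continuous_Rmult_const, continuous_id. }
  assert (Hkc : forall k t, continuous (fun t => ((om * cis (2 * t)) ^ k)%C) t).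
  { intros k t; apply continuous_Cpow, continuous_Cmult; [apply continuous_const | apply Hcc]. }
  assert (HcK : forall t, continuous K t).
  { assert (forall m t, continuous (fun t => sum_n (fun j => ((om * cis (2 * t)) ^ j)%C) m) t); [| intros; apply H].
    induction m; intros t.
    - apply (continuous_ext (fun t => ((om * cis (2 * t)) ^ 0)%C)); [intros; now rewrite sum_O | apply Hkc].
    - apply (continuous_ext (fun t => (sum_n (fun j => ((om * cis (2 * t)) ^ j)%C) m + (om * cis (2 * t)) ^ S m)%C)).
      + intros; now rewrite sum_Sn_C.
      + apply continuous_Cplus; auto. }
  assert (Hone : forall t, Cmod (om * cis (2 * t)) <= 1) by (intros; rewrite Cmod_mult, Cmod_cis; lra).
  assert (KB : forall t, Cmod (K t) <= INR n + 1).
  { intros t; apply Rle_trans with (sum_n (fun _ => 1) n).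
    - apply Cmod_sum_n_le; intros k; rewrite Cmod_pow, <- (pow1 k); apply pow_incr; split; auto; apply Cmod_ge_0.
    - rewrite sum_n_const, S_INR; lra. }
  assert (KT : forall t, ((1 - om) * K t)%C = (1 - (om * cis (2 * t)) ^ S n + om * (cis (2 * t) - 1) * K t)%C).
  { intros t; unfold K.
    assert (G : forall x : C, ((1 - x) * sum_n (fun j => (x ^ j)%C) n)%C = (1 - x ^ S n)%C).
    { intros x; clear; induction n; [rewrite sum_O; simpl; Cring |].
      rewrite sum_Sn_C, Cmult_plus_distr_l, IHn0; simpl; ring. }
    rewrite <- (G (om * cis (2 * t))%C); ring. }
  assert (Hc2 : forall t, Cmod (cis (2 * t) - 1) <= 2 * Rabs t).
  { intros t; rewrite <- cis_0; apply Rle_trans with (1 := Cmod_cis_minus _ _).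
    rewrite Rminus_0_r, Rabs_mult, Rabs_right; lra. }
  (* For [4 |t| <= dl] the ratio of the series stays away from [1]; otherwise only the number of
     terms is known. The fourth power, at least [1] in that case, makes this second bound small for
     [|t| <= tau]. *)
  assert (KN : forall t, Cmod (K t) <= 4 / dl + (INR n + 1) * (4 * Rabs t / dl) ^ 4).
  { intros t; assert (Hn := pos_INR n); assert (Ht := Rabs_pos t).
    assert (Q : 0 <= 4 * Rabs t / dl) by (apply Rdiv_le_0_compat; lra).
    destruct (Rle_lt_dec (4 * Rabs t / dl) 1) as [H|H].
    - assert (0 <= (INR n + 1) * (4 * Rabs t / dl) ^ 4) by (apply Rmult_le_pos; [lra | apply pow_le; auto]).
      assert (Cmod (K t) <= 4 / dl); [| lra].
      assert (B : 2 * Rabs t <= dl / 2).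
      { apply Rmult_le_compat_r with (r := dl) in H; [| lra].
        replace (4 * Rabs t / dl * dl) with (4 * Rabs t) in H by (field; lra); lra. }
      assert (X : dl * Cmod (K t) <= 2 + dl / 2 * Cmod (K t)).
      { unfold dl at 1; rewrite <- Cmod_mult, KT.
        apply Rle_trans with (1 := Cmod_triangle _ _), Rplus_le_compat.
        - apply Rle_trans with (1 := Cmod_triangle_minus _ _); rewrite Cmod_1, Cmod_pow.
          assert (Cmod (om * cis (2 * t)) ^ S n <= 1 ^ S n) by (apply pow_incr; split; auto; apply Cmod_ge_0).
          rewrite pow1 in *; lra.
        - rewrite !Cmod_mult; apply Rmult_le_compat_r; [apply Cmod_ge_0 |].
          specialize (Hc2 t); pose proof (Cmod_ge_0 om); pose proof (Cmod_ge_0 (cis (2 * t) - 1)); nra. }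
      apply Rmult_le_reg_l with (dl / 2); [lra |].
      replace (dl / 2 * (4 / dl)) with 2 by (field; lra); lra.
    - apply Rle_trans with (1 := KB t).
      assert (1 ^ 4 <= (4 * Rabs t / dl) ^ 4) by (apply pow_incr; lra).
      rewrite pow1 in H0; assert (0 < 4 / dl) by (apply Rdiv_lt_0_compat; lra); nra. }
  assert (ES : (PI * sum_n (fun j => (scaled_coef (n - j) * om ^ j)%C) n)%C
    = CI (fun t => (gfun t * K t)%C) (- (PI / 2)) (PI / 2)).
  { transitivity (CI (fun t => sum_n (fun j => (gfun t * (om * cis (2 * t)) ^ j)%C) n) (- (PI / 2)) (PI / 2)).
    - rewrite CI_sum_n by (intros; apply continuous_Cmult; auto; apply continuous_gfun).
      rewrite <- sum_n_Cmult_l; apply sum_n_ext_loc; intros j Hj.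
      transitivity (om ^ j * gmoment (Z.of_nat (n - j) - Z.of_nat n))%C; [rewrite gmoment_coef; Cring |].
      unfold gmoment; rewrite <- CI_Cmult_l.
      + apply CI_ext; intros t _; rewrite Cpow_mult_l, <- cis_INR_mult.
        replace (- (2 * IZR (Z.of_nat (n - j) - Z.of_nat n) * t)) with (INR j * (2 * t)); [ring |].
        rewrite Nat2Z.inj_sub by auto.
        replace (Z.of_nat n - Z.of_nat j - Z.of_nat n)%Z with (- Z.of_nat j)%Z by lia.
        rewrite opp_IZR, <- INR_IZR_INZ; ring.
      + apply ex_CI_continuous; intros t _; apply continuous_Cmult; [apply continuous_gfun |].
        apply continuous_cis, (continuous_opp (V := R_NormedModule)), continuous_Rmult_const, continuous_id.
    - apply CI_ext; intros t _; apply sum_n_Cmult_l. }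
  assert (ET : (PI * ((1 - om) * sum_n (fun j => (scaled_coef (n - j) * om ^ j)%C) n - scaled_coef n))%C
    = CI (fun t => (gfun t * (om * (cis (2 * t) - 1) * K t))%C) (- (PI / 2)) (PI / 2)).
  { assert (Hg := continuous_gfun).
    (* This moment belongs to the Fourier coefficient of [f] of index [-2]. *)
    assert (Z1 : CI (fun t => (gfun t * cis (INR (S n) * (2 * t)))%C) (- (PI / 2)) (PI / 2) = 0).
    { rewrite <- (gmoment_neg (- Z.of_nat (S n))) by lia; apply CI_ext; intros t _; do 2 f_equal.
      rewrite opp_IZR, <- INR_IZR_INZ; ring. }
    assert (Z2 : CI gfun (- (PI / 2)) (PI / 2) = (PI * scaled_coef n)%C).
    { rewrite <- gmoment_coef, Z.sub_diag; apply CI_ext; intros t _; rewrite Rmult_0_r, Rmult_0_l, Ropp_0, cis_0; ring. }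
    transitivity ((1 - om) * (PI * sum_n (fun j => (scaled_coef (n - j) * om ^ j)%C) n) - PI * scaled_coef n
       + om ^ S n * 0)%C; [ring |].
    assert (Hcs : forall t, continuous (fun t => cis (INR (S n) * (2 * t))) t).
    { intros t; apply (continuous_ext (fun t => cis ((INR (S n) * 2) * t))); [intros; f_equal; apply Rmult_assoc | apply Hcc]. }
    assert (Ha : forall t, continuous (fun t => (gfun t * K t)%C) t) by (intros; apply continuous_Cmult; auto).
    assert (Hb : forall t, continuous (fun t => (gfun t * cis (INR (S n) * (2 * t)))%C) t) by (intros; apply continuous_Cmult; auto).
    assert (Hca : forall t, continuous (fun t => ((1 - om) * (gfun t * K t))%C) t)
      by (intros; apply continuous_Cmult; auto; apply continuous_const).
    assert (Hcb : forall t, continuous (fun t => (om ^ S n * (gfun t * cis (INR (S n) * (2 * t))))%C) t)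
      by (intros; apply continuous_Cmult; auto; apply continuous_const).
    rewrite ES, <- Z2; rewrite <- Z1 at 1.
    rewrite <- (CI_Cmult_l (1 - om)%C), <- (CI_Cmult_l (om ^ S n)%C) by (apply ex_CI_continuous; auto).
    rewrite <- (CI_minus (fun t => ((1 - om) * (gfun t * K t))%C)) by (apply ex_CI_continuous; auto).
    rewrite <- (CI_plus (fun t => ((1 - om) * (gfun t * K t) - gfun t)%C))
      by (apply ex_CI_continuous; intros; try apply continuous_Cminus; auto).
    apply CI_ext; intros t _; rewrite cis_INR_mult.
    transitivity (gfun t * ((1 - om) * K t) - gfun t + gfun t * (om * cis (2 * t)) ^ S n)%C.
    - rewrite Cpow_mult_l; ring.
    - rewrite KT; ring. }
  rewrite ET.
  replace (8 * tau ^ 2 * (4 / dl + (INR n + 1) * (4 * tau / dl) ^ 4) + 16 * tail_eps * (INR n + 1)) with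
    (4 * tau * (2 * tau * (4 / dl + (INR n + 1) * (4 * tau / dl) ^ 4)) + 4 * tail_eps * (4 * (INR n + 1))) by ring.
  assert (KM : forall t, Cmod (om * (cis (2 * t) - 1) * K t) <= 2 * Rabs t * Cmod (K t)).
  { intros t; rewrite !Cmod_mult; apply Rmult_le_compat_r; [apply Cmod_ge_0 |].
    specialize (Hc2 t); pose proof (Cmod_ge_0 om); pose proof (Cmod_ge_0 (cis (2 * t) - 1)); nra. }
  apply gfun_integral_bound.
  - intros t; apply continuous_Cmult; auto; apply continuous_Cmult; [apply continuous_const |].
    apply continuous_Cminus; [apply Hcc | apply continuous_const].
  - intros t Ht; apply Rle_trans with (1 := KM t).
    assert (Hn := pos_INR n).
    apply Rmult_le_compat; [pose proof (Rabs_pos t); lra | apply Cmod_ge_0 | lra |].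
    apply Rle_trans with (1 := KN t), Rplus_le_compat_l, Rmult_le_compat_l; [lra |].
    apply pow_incr; split; [apply Rdiv_le_0_compat; auto; pose proof (Rabs_pos t); lra |].
    unfold Rdiv; apply Rmult_le_compat_r; [left; now apply Rinv_0_lt_compat | lra].
  - intros t Ht; apply Rle_trans with (1 := KM t).
    assert (Rabs t <= 2) by (apply Rabs_le; lra).
    apply Rmult_le_compat; [pose proof (Rabs_pos t); lra | apply Cmod_ge_0 | lra | apply KB].
Qed.

End Saddle.
End XiLike.

(** * The size of the phase *)

Lemma ln_le_eventually (c C : R) : 0 < c -> exists l0, 1 <= l0 /\ forall l, l0 <= l -> C + 4 * ln l <= c * l.
Proof.
  intros Hc; set (s0 := (8 + Rabs C) / c + 1).
  assert (HC := Rabs_pos C); assert (HC2 := Rle_abs C).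
  assert (Q : 0 <= (8 + Rabs C) / c) by (apply Rdiv_le_0_compat; lra).
  assert (Hs0 : 1 <= s0) by (unfold s0; lra).
  exists (s0 ^ 2); split; [nra |]; intros l Hl.
  assert (Hl1 : 1 <= l) by nra.
  assert (Hs := sqrt_sqrt l ltac:(lra)).
  assert (Hsp : 0 <= sqrt l) by apply sqrt_pos.
  assert (Hss : s0 <= sqrt l).
  { apply Rsqr_incr_0; unfold Rsqr; [simpl in Hl; lra | lra | auto]. }
  assert (L1 : ln l <= 2 * sqrt l).
  { rewrite <- Hs at 1; rewrite ln_mult by lra.
    assert (ln (sqrt l) <= sqrt l); [| lra].
    rewrite <- (exp_ln (sqrt l)) at 2 by lra; apply id_le_exp. }
  assert (E : 8 + Rabs C <= c * sqrt l).
  { apply Rle_trans with (c * s0); [| apply Rmult_le_compat_l; lra].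
    unfold s0; replace (c * ((8 + Rabs C) / c + 1)) with (8 + Rabs C + c) by (field; lra); lra. }
  assert ((8 + Rabs C) * sqrt l <= c * l) by (rewrite <- Hs at 2; rewrite <- Rmult_assoc; apply Rmult_le_compat_r; auto).
  nra.
Qed.

Lemma loglam_eventually (K : R) : exists l0, 1 <= l0 /\ forall l, l0 <= l -> K <= loglam l.
Proof.
  assert (HP := PI_gt_3).
  exists (Rmax 1 (2 * PI * exp K)); split; [apply Rmax_l |]; intros l Hl.
  assert (H1 := Rle_trans _ _ _ (Rmax_r _ _) Hl); assert (HE := exp_pos K).
  unfold loglam; rewrite <- (ln_exp K) at 1; apply ln_le_compat; auto.
  apply Rmult_le_reg_r with (2 * PI); [lra |].
  replace (l / (2 * PI) * (2 * PI)) with l by (field; lra); lra.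
Qed.

(** As [loglam l] tends to infinity, a positive [A] outweighs any [B]; if [A = 0] then [B] decides.
    Part of the linear growth is given up to absorb constants and [ln l]. *)
Lemma exponent_growth (A B C : R) : 0 < A \/ (A = 0 /\ 0 < B) ->
  exists c l0, 0 < c /\ 1 <= l0 /\ forall l, l0 <= l -> c * l + C + 4 * ln l <= l / 2 * (loglam l * A + B).
Proof.
  intros H.
  assert (K : exists b l1, 0 < b /\ 1 <= l1 /\ forall l, l1 <= l -> b <= loglam l * A + B).
  { destruct H as [H|[-> H]].
    - destruct (loglam_eventually ((1 - B) / A)) as [l1 [Hl1 H1]].
      exists 1, l1; repeat split; auto; [lra |]; intros l Hl; specialize (H1 l Hl).
      apply (Rmult_le_compat_r A) in H1; [| lra].
      replace ((1 - B) / A * A) with (1 - B) in H1 by (field; lra); lra.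
    - exists B, 1; repeat split; auto; intros; lra. }
  destruct K as [b [l1 [Hb [Hl1 K]]]].
  destruct (ln_le_eventually (b / 4) C ltac:(lra)) as [l2 [Hl2 K2]].
  exists (b / 4), (Rmax l1 l2); split; [lra |]; split; [apply Rle_trans with (1 := Hl1), Rmax_l |].
  intros l Hl; assert (Ha := Rle_trans _ _ _ (Rmax_l _ _) Hl); assert (Hb' := Rle_trans _ _ _ (Rmax_r _ _) Hl).
  specialize (K l Ha); specialize (K2 l Hb').
  assert (l / 2 * b <= l / 2 * (loglam l * A + B)) by (apply Rmult_le_compat_l; lra); lra.
Qed.

Lemma increasing_from_0 (F dF : R -> R) (x : R) : 0 <= x ->
  (forall t, 0 <= t <= x -> is_derive F t (dF t)) -> (forall t, 0 <= t <= x -> 0 <= dF t) -> F 0 <= F x.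
Proof.
  intros Hx HD Hp; destruct (MVT_is_derive F dF 0 x Hx HD) as [c [Hc E]].
  specialize (Hp c Hc); nra.
Qed.

Lemma exp_opp_upper k : 0 <= k -> exp (- k) <= 1 - k + k ^ 2 / 2.
Proof.
  intros Hk.
  assert (H := increasing_from_0 (fun k => 1 - k + k ^ 2 / 2 - exp (- k)) (fun k => -1 + k + exp (- k)) k Hk).
  cbv beta in H; rewrite Ropp_0, exp_0 in H.
  assert (1 - 0 + 0 ^ 2 / 2 - 1 <= 1 - k + k ^ 2 / 2 - exp (- k)); [| lra].
  apply H.
  - intros t _; auto_derive; auto; field.
  - intros t _; pose proof (exp_ineq1_le (- t)); lra.
Qed.

(** Squaring the weak inequality at [k / 2] leaves a surplus of [k ^ 3 / 8 - k ^ 4 / 64]. *)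
Lemma exp_opp_upper_strict k : 0 < k <= 1 -> exp (- k) < 1 - k + k ^ 2 / 2.
Proof.
  intros Hk; assert (H := exp_opp_upper (k / 2) ltac:(lra)).
  replace (- k) with (- (k / 2) + - (k / 2)) by field; rewrite exp_plus.
  assert (P := exp_pos (- (k / 2))).
  apply Rle_lt_trans with ((1 - k / 2 + (k / 2) ^ 2 / 2) * (1 - k / 2 + (k / 2) ^ 2 / 2)); [apply Rmult_le_compat; lra |].
  assert (0 < k ^ 3 * (16 - 2 * k)) by (apply Rmult_lt_0_compat; [apply pow_lt |]; lra); nra.
Qed.

Lemma exp_lower_3 h : 0 <= h -> 1 + h + h ^ 2 / 2 + h ^ 3 / 6 <= exp h.
Proof.
  intros Hh.
  assert (H2 : forall t, 0 <= t -> 1 + t + t ^ 2 / 2 <= exp t).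
  { intros t Ht; assert (H := increasing_from_0 (fun k => exp k - (1 + k + k ^ 2 / 2)) (fun k => exp k - (1 + k)) t Ht).
    cbv beta in H; rewrite exp_0 in H.
    assert (1 - (1 + 0 + 0 ^ 2 / 2) <= exp t - (1 + t + t ^ 2 / 2)); [| lra].
    apply H; [intros s _; auto_derive; auto; field | intros s _; pose proof (exp_ineq1_le s); lra]. }
  assert (H := increasing_from_0 (fun k => exp k - (1 + k + k ^ 2 / 2 + k ^ 3 / 6)) (fun k => exp k - (1 + k + k ^ 2 / 2)) h Hh).
  cbv beta in H; rewrite exp_0 in H.
  assert (1 - (1 + 0 + 0 ^ 2 / 2 + 0 ^ 3 / 6) <= exp h - (1 + h + h ^ 2 / 2 + h ^ 3 / 6)); [| lra].
  apply H; [intros s _; auto_derive; auto; field | intros s Hs; pose proof (H2 s ltac:(lra)); lra].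
Qed.

Lemma mul_cos_le_sin s : 0 <= s <= PI / 2 -> s * cos s <= sin s.
Proof.
  intros Hs; assert (HP := PI_gt_3).
  assert (H' := increasing_from_0 (fun s => sin s - s * cos s) (fun s => s * sin s) s ltac:(lra)).
  cbv beta in H'; rewrite sin_0, Rmult_0_l, Rminus_0_r in H'.
  assert (0 <= sin s - s * cos s); [| lra].
  apply H'.
  - intros u _; auto_derive; auto; ring.
  - intros u Hu; apply Rmult_le_pos; [lra | apply sin_ge_0; lra].
Qed.

Lemma mul_sin_le t : - (PI / 2) <= t <= PI / 2 -> t * sin t <= 2 * (1 - cos t).
Proof.
  assert (HP := PI_gt_3).
  assert (K : forall t, 0 <= t <= PI / 2 -> t * sin t <= 2 * (1 - cos t)).
  { clear t; intros t Ht.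
    assert (H := increasing_from_0 (fun s => 2 * (1 - cos s) - s * sin s) (fun s => sin s - s * cos s) t ltac:(lra)).
    cbv beta in H; rewrite cos_0, Rmult_0_l in H.
    assert (2 * (1 - 1) - 0 <= 2 * (1 - cos t) - t * sin t); [| lra].
    apply H.
    - intros s _; auto_derive; auto; ring.
    - intros s Hs; pose proof (mul_cos_le_sin s ltac:(lra)); lra. }
  intros Ht; destruct (Rle_lt_dec 0 t); [apply K; lra |].
  specialize (K (- t) ltac:(lra)); rewrite cos_neg, sin_neg in K; lra.
Qed.

Lemma sin_sq_le_mul t : - (PI / 2) <= t <= PI / 2 -> sin t ^ 2 <= t * sin t.
Proof.
  assert (HP := PI_gt_3).
  assert (K : forall t, 0 <= t <= PI / 2 -> sin t ^ 2 <= t * sin t).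
  { clear t; intros t Ht.
    assert (0 <= sin t) by (apply sin_ge_0; lra).
    assert (sin t <= t); [| nra].
    assert (H' := increasing_from_0 (fun s => s - sin s) (fun s => 1 - cos s) t ltac:(lra)).
    cbv beta in H'; rewrite sin_0, Rminus_0_r in H'.
    assert (0 <= t - sin t); [| lra].
    apply H'; [intros u _; auto_derive; auto; ring | intros u _; pose proof (COS_bound u); lra]. }
  intros Ht; destruct (Rle_lt_dec 0 t); [apply K; lra |].
  specialize (K (- t) ltac:(lra)); rewrite sin_neg in K; simpl in *; lra.
Qed.

Definition phase_A (r t : R) : R := ln r + 1 - r * cos t.
Definition phase_B (r t : R) : R := r * cos t - 1 - r * cos t * ln r + r * sin t * t.

(* On the critical curve [ln r = r cos t - 1] the second-order term decides the sign, which is that of [r cos t - 1]. *)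
Lemma phase_B_sign r t : 0 < r -> - (PI / 2) <= t <= PI / 2 -> 0 < r * cos t -> phase_A r t = 0 ->
  (r * cos t < 1 -> phase_B r t < 0) /\ (1 < r * cos t -> 0 < phase_B r t).
Proof.
  unfold phase_A, phase_B; intros Hr Ht Hx HA.
  set (x := r * cos t) in *.
  assert (El : ln r = x - 1) by lra.
  assert (Er : r = exp (x - 1)) by (rewrite <- El, exp_ln; auto).
  rewrite El; split; intros H1.
  (* With [ln r = x - 1], [phase_B r t] is [r t sin t - (x - 1) ^ 2]. For [x < 1] the first term is
     at most [2 (r - x)], and [r = exp (x - 1)] stays below [x + (1 - x) ^ 2 / 2]. *)
  - assert (S := mul_sin_le t Ht).
    assert (S' : r * sin t * t <= 2 * (r - x)).
    { unfold x; apply (Rmult_le_compat_l r) in S; lra. }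
    assert (E := exp_opp_upper_strict (1 - x) ltac:(lra)).
    replace (- (1 - x)) with (x - 1) in E by ring; rewrite <- Er in E; nra.
  (* For [x > 1] it suffices that [r ^ 2 - x ^ 2 > h ^ 2 r]. This holds with the cubic Taylor
     polynomial [p] in place of [r], and [u ^ 2 - h ^ 2 u] increases for [u >= p]. *)
  - assert (S := sin_sq_le_mul t Ht).
    set (h := x - 1) in *; assert (Hh : 0 < h) by (unfold h; lra).
    assert (E := exp_lower_3 h ltac:(lra)); rewrite <- Er in E.
    assert (S' : r ^ 2 - x ^ 2 <= r * (r * sin t * t)).
    { unfold x; assert (P := sin2_cos2 t); unfold Rsqr in P.
      apply (Rmult_le_compat_l (r ^ 2)) in S; [| apply pow2_ge_0].
      replace (r ^ 2) with (r ^ 2 * (sin t * sin t + cos t * cos t)) at 1 by (rewrite P; ring); simpl in *; lra. }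
    assert (Ex : x = 1 + h) by (unfold h; ring).
    set (p := 1 + h + h ^ 2 / 2 + h ^ 3 / 6) in *.
    assert (Hp : 0 < h ^ 2) by (apply pow_lt; auto).
    assert (Hp3 : 0 < h ^ 3) by (apply pow_lt; auto).
    assert (Q : h ^ 2 * p < p ^ 2 - x ^ 2).
    { rewrite Ex; assert (p ^ 2 - (1 + h) ^ 2 - h ^ 2 * p = h ^ 3 / 3 + h ^ 4 / 12 + h ^ 6 / 36) by (unfold p; field).
      assert (0 < h ^ 4) by (apply pow_lt; auto); assert (0 < h ^ 6) by (apply pow_lt; auto); lra. }
    assert (Q2 : h ^ 2 * r < r ^ 2 - x ^ 2).
    { assert (0 < p) by (unfold p; lra).
      assert (0 <= (r - p) * (r + p - h ^ 2)); [| nra].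
      apply Rmult_le_pos; [lra |]; unfold p in *; nra. }
    assert (h ^ 2 < r * sin t * t) by (apply Rmult_lt_reg_l with r; lra).
    rewrite Ex; nra.
Qed.

Section XiLike.
Variables (f : C -> C) (A : R).
Hypothesis Hf : xi_like f A.

Lemma phase_exponent l r t : 0 < l -> 0 < r ->
  l / 2 * loglam l * ln r + Psi l 0 - Psi (l * r) t = l / 2 * (loglam l * phase_A r t + phase_B r t).
Proof.
  intros Hl Hr; assert (HP := PI_gt_3).
  unfold phase_A, phase_B; rewrite Psi_0; unfold Psi.
  replace (ln (l * r / (2 * PI))) with (loglam l + ln r); [field |].
  unfold loglam; rewrite <- ln_mult; auto; [f_equal; field; lra | apply Rdiv_lt_0_compat; lra].
Qed.

Lemma power_exponent n l r : 10 <= l -> (l * C_derive f l)%C = (2 * INR n * f l)%C -> 0 < r ->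
  Rabs (ln (r ^ (2 * n)) - l / 2 * loglam l * ln r) <= (4 * bound_M A + 2) * Rabs (ln r).
Proof.
  intros Hl Hs Hr.
  rewrite ln_pow, mult_INR by auto.
  replace (INR 2) with 2 by (simpl; ring).
  replace (2 * INR n * ln r - l / 2 * loglam l * ln r) with ((2 * INR n - l / 2 * loglam l) * ln r) by ring.
  rewrite Rabs_mult; apply Rmult_le_compat_r; [apply Rabs_pos |].
  assert (B := two_n_bound f A Hf n l Hl Hs); apply Rabs_le_between in B; apply Rabs_le; lra.
Qed.

(** At the point [l z] only the upper Stirling bound is used, hence the closed range of [t], with
    the imaginary axis included. *)
Lemma phase_large r t : 0 < r -> - (PI / 2) <= t <= PI / 2 ->
  0 < phase_A r t \/ (phase_A r t = 0 /\ 0 < phase_B r t) ->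
  exists c l0, 0 < c /\ 10 <= l0 /\ forall n l, l0 <= l -> (l * C_derive f l)%C = (2 * INR n * f l)%C ->
    exp (c * l) * Cmod (f (l * (r * cis t))%C) <= r ^ (2 * n) * Cmod (f l).
Proof.
  intros Hr Ht HAB.
  set (C0 := 2 * A + (4 * bound_M A + 6) * Rabs (ln r)).
  destruct (exponent_growth _ _ C0 HAB) as [c [l1 [Hc [Hl1 H1]]]].
  exists c, (Rmax 10 (Rmax l1 (/ r))); split; auto; split; [apply Rmax_l |]; intros n l Hl Hs.
  assert (Ha := Rle_trans _ _ _ (Rmax_l _ _) Hl); assert (Hb := Rle_trans _ _ _ (Rmax_r _ _) Hl).
  assert (Hb1 := Rle_trans _ _ _ (Rmax_l _ _) Hb); assert (Hb2 := Rle_trans _ _ _ (Rmax_r _ _) Hb).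
  assert (Hlr : 1 <= l * r).
  { apply Rmult_le_reg_r with (/ r); [now apply Rinv_0_lt_compat |].
    replace (l * r * / r) with l by (field; lra); lra. }
  assert (U := xl_upper f A Hf (l * r) t Hlr Ht).
  assert (Lo := xi_like_real_lower f A Hf l ltac:(lra)).
  assert (P := power_exponent n l r Ha Hs Hr); apply Rabs_le_between in P.
  assert (E := phase_exponent l r t ltac:(lra) Hr).
  specialize (H1 l Hb1).
  replace (l * (r * cis t))%C with ((l * r)%R * cis t)%C by (rewrite RtoC_mult; ring).
  apply Rle_trans with (exp (c * l) * exp (A + 4 * ln (l * r) + Psi (l * r) t)).
  { apply Rmult_le_compat_l; auto; left; apply exp_pos. }
  apply Rle_trans with (exp (ln (r ^ (2 * n))) * exp (- A + 7 / 4 * ln l + Psi l 0)).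
  2: { rewrite exp_ln by (apply pow_lt; auto); apply Rmult_le_compat_l; auto; apply pow_le; lra. }
  rewrite <- !exp_plus; apply exp_le_compat; rewrite ln_mult by lra.
  assert (0 <= ln l) by (rewrite <- ln_1; apply ln_le_compat; lra).
  pose proof (Rle_abs (ln r)); unfold C0 in H1; lra.
Qed.

(** The opposite sign calls for a lower bound at [l z]; because [r * cos t > 0] the point reaches
    real part [5 / 2] for large [l]. *)
Lemma phase_small r t : 0 < r -> - (PI / 2) <= t <= PI / 2 -> 0 < r * cos t ->
  phase_A r t < 0 \/ (phase_A r t = 0 /\ phase_B r t < 0) ->
  exists l0, forall n l, l0 <= l -> (l * C_derive f l)%C = (2 * INR n * f l)%C ->
    r ^ (2 * n) * Cmod (f l) <= Cmod (f (l * (r * cis t))%C).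
Proof.
  intros Hr Ht Hx HAB.
  set (C0 := 2 * A + (4 * bound_M A + 6) * Rabs (ln r)).
  destruct (exponent_growth (- phase_A r t) (- phase_B r t) C0) as [c [l1 [Hc [Hl1 H1]]]].
  { destruct HAB as [H|[H1 H2]]; [left; lra | right; lra]. }
  assert (HP := PI_gt_3).
  set (x := r * cos t) in *.
  exists (Rmax 10 (Rmax l1 (Rmax (/ r) (5 / 2 / x)))); intros n l Hl Hs.
  assert (Ha := Rle_trans _ _ _ (Rmax_l _ _) Hl); assert (Hb := Rle_trans _ _ _ (Rmax_r _ _) Hl).
  assert (Hb1 := Rle_trans _ _ _ (Rmax_l _ _) Hb); assert (Hb2 := Rle_trans _ _ _ (Rmax_r _ _) Hb).
  assert (Hb3 := Rle_trans _ _ _ (Rmax_l _ _) Hb2); assert (Hb4 := Rle_trans _ _ _ (Rmax_r _ _) Hb2).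
  assert (Hlr : 1 <= l * r).
  { apply Rmult_le_reg_r with (/ r); [now apply Rinv_0_lt_compat |].
    replace (l * r * / r) with l by (field; lra); lra. }
  assert (Hlx : 5 / 2 <= l * r * cos t).
  { rewrite Rmult_assoc; fold x; apply (Rmult_le_compat_r x) in Hb4; [| lra].
    replace (5 / 2 / x * x) with (5 / 2) in Hb4 by (field; lra); lra. }
  assert (Lo := xl_lower_right f A Hf (l * r) t Hlr Ht Hlx).
  assert (U := xl_upper f A Hf l 0 ltac:(lra) ltac:(lra)).
  rewrite cis_0, Cmult_1_r in U.
  assert (P := power_exponent n l r Ha Hs Hr); apply Rabs_le_between in P.
  assert (E := phase_exponent l r t ltac:(lra) Hr).
  specialize (H1 l Hb1).
  replace (l * (r * cis t))%C with ((l * r)%R * cis t)%C by (rewrite RtoC_mult; ring).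
  apply Rle_trans with (2 := Lo).
  apply Rle_trans with (exp (ln (r ^ (2 * n))) * exp (A + 4 * ln l + Psi l 0)).
  { rewrite exp_ln by (apply pow_lt; auto); apply Rmult_le_compat_l; auto; apply pow_le; lra. }
  rewrite <- !exp_plus; apply exp_le_compat; rewrite ln_mult by lra.
  assert (0 <= ln l) by (rewrite <- ln_1; apply ln_le_compat; lra).
  assert (0 < c * l) by (apply Rmult_lt_0_compat; lra).
  pose proof (Rabs_maj2 (ln r)); pose proof (Rabs_pos (ln r)); unfold C0 in H1; lra.
Qed.

End XiLike.

(** * The Taylor polynomials *)

Section XiLike.
Variables (f : C -> C) (A : R).
Hypothesis Hf : xi_like f A.

(** With [l = q ^ 10] every size is compared with an integer power of [q]: [tau = q ^ -4],
    [sqrt kappa <= q ^ 6], [n + 1 <= q ^ 11], tails below [q ^ -20]. What matters is that the middle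
    coefficient is at least of order [q ^ -6] while its variation is of order [q ^ -8]. *)
Lemma saddle_scale : exists q0, 2 <= q0 /\ forall q, q0 <= q -> forall n, let l := q ^ 10 in
  (l * C_derive f l)%C = (2 * INR n * f l)%C ->
  (forall k, Cmod (scaled_coef f l k) <= 5 / q ^ 4) /\
  / (16 * q ^ 6) <= Cmod (scaled_coef f l n) /\
  (forall j, Cmod (scaled_coef f l (n + j) - scaled_coef f l n) <= INR j * (10 / q ^ 8)) /\
  (forall om, Cmod om <= 1 -> om <> 1 ->
    Cmod ((1 - om) * sum_n (fun j => (scaled_coef f l (n - j) * om ^ j)%C) n - scaled_coef f l n)
    <= 8 / q ^ 8 * (4 / Cmod (1 - om) + 256 / Cmod (1 - om) ^ 4 + 2)).
Proof.
  assert (HM : 0 < bound_M A) by apply exp_pos.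
  assert (HP := PI_gt_3); assert (HP4 := PI_4).
  (* The first entry serves the comparison of powers of [q], the second the term of [bound_M A] in
     the saddle hypothesis, the third the constant inside [tail_eps]. *)
  exists (Rmax 768 (Rmax (128 * bound_M A) (256 * Rabs A))).
  split; [apply Rle_trans with 768; [lra | apply Rmax_l] |].
  intros q Hq n l Hs.
  assert (Hq1 := Rle_trans _ _ _ (Rmax_l _ _) Hq); assert (Hq' := Rle_trans _ _ _ (Rmax_r _ _) Hq).
  assert (Hq2 := Rle_trans _ _ _ (Rmax_l _ _) Hq'); assert (Hq3 := Rle_trans _ _ _ (Rmax_r _ _) Hq').
  assert (HA := Rle_abs A); clear Hq Hq'.
  assert (Hpw : forall k, 0 < q ^ k) by (intros; apply pow_lt; lra).
  assert (Hp1 : forall k, 1 <= q ^ k) by (intros; apply pow_R1_Rle; lra).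
  assert (Hl : 0 < l) by apply Hpw.
  assert (Eln : ln l = 10 * ln q) by (unfold l; rewrite ln_pow by lra; simpl; ring).
  assert (Hlq0 : 0 <= ln q) by (rewrite <- ln_1; apply ln_le_compat; lra).
  assert (Hlq : 10 * ln q <= q).
  { assert (S := sq_le_2exp (q / 10) ltac:(lra)).
    assert (q <= exp (q / 10)) by nra.
    assert (ln q <= q / 10); [| lra].
    rewrite <- (ln_exp (q / 10)); apply ln_le_compat; lra. }
  assert (Etau : tau l = / q ^ 4).
  { unfold tau, Rpower; rewrite Eln; replace (- (2 / 5) * (10 * ln q)) with (- (4 * ln q)) by field.
    rewrite exp_Ropp; f_equal; replace (4 * ln q) with (ln (q ^ 4)) by (rewrite ln_pow by lra; simpl; ring).
    apply exp_ln, Hpw. }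
  assert (Hl10 : 768 ^ 2 <= l).
  { apply Rle_trans with (q ^ 2); [apply pow_incr; lra |].
    unfold l; replace (q ^ 10) with (q ^ 2 * q ^ 8) by ring; specialize (Hp1 8%nat); specialize (Hpw 2%nat); nra. }
  assert (EL : loglam l = ln l - ln (2 * PI)) by (unfold loglam; rewrite ln_div; lra).
  assert (HL2 : 0 <= ln (2 * PI)) by (rewrite <- ln_1; apply ln_le_compat; lra).
  assert (HLq : loglam l <= q) by lra.
  assert (HL : 2 <= loglam l).
  { unfold loglam; rewrite <- (ln_exp 2) at 1; apply ln_le_compat; [apply exp_pos |].
    apply Rmult_le_reg_r with (2 * PI); [lra |].
    replace (l / (2 * PI) * (2 * PI)) with l by (field; lra).
    replace 2 with (1 + 1) at 1 by ring; rewrite exp_plus.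
    assert (E3 := exp_le_3); assert (E0 := exp_pos 1).
    assert (exp 1 * exp 1 <= 3 * 3) by (apply Rmult_le_compat; lra).
    assert (exp 1 * exp 1 * (2 * PI) <= 3 * 3 * (2 * PI)) by (apply Rmult_le_compat_r; lra); lra. }
  assert (HT : tau l <= / 8).
  { rewrite Etau; apply Rinv_le_contravar; [lra |].
    apply Rle_trans with (q ^ 1); [lra | apply Rle_pow; [lra | lia]]. }
  assert (Hsm : l * loglam l * tau l ^ 3 + 8 * bound_M A * tau l <= / 8).
  { rewrite Etau; unfold l.
    replace (q ^ 10 * loglam (q ^ 10) * (/ q ^ 4) ^ 3) with (loglam (q ^ 10) / q ^ 2) by (field; lra).
    assert (loglam (q ^ 10) / q ^ 2 <= / 16).
    { apply Rmult_le_reg_r with (q ^ 2); auto; fold l.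
      replace (loglam l / q ^ 2 * q ^ 2) with (loglam l) by (field; lra).
      assert (768 * q <= q ^ 2) by (simpl; rewrite Rmult_1_r; apply Rmult_le_compat_r; lra); lra. }
    assert (8 * bound_M A * / q ^ 4 <= / 16); [| lra].
    apply Rmult_le_reg_r with (q ^ 4); auto.
    rewrite Rmult_assoc, Rinv_l by (specialize (Hpw 4%nat); lra).
    assert (q ^ 1 <= q ^ 4) by (apply Rle_pow; [lra | lia]); rewrite pow_1 in *; lra. }
  assert (H4 : 4 <= l * loglam l * tau l ^ 2).
  { rewrite Etau; unfold l.
    replace (q ^ 10 * loglam (q ^ 10) * (/ q ^ 4) ^ 2) with (loglam (q ^ 10) * q ^ 2) by (field; lra).
    fold l; specialize (Hp1 2%nat); assert (2 <= q ^ 2) by nra; nra. }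
  assert (He : tail_eps A l <= / q ^ 20).
  { unfold tail_eps; rewrite Etau.
    replace (/ q ^ 20) with (exp (- (20 * ln q))).
    2: { rewrite exp_Ropp; f_equal; replace (20 * ln q) with (ln (q ^ 20)) by (rewrite ln_pow by lra; simpl; ring).
         apply exp_ln, Hpw. }
    apply exp_le_compat; rewrite Eln.
    replace (l * loglam l * (/ q ^ 4) ^ 2 / 128) with (loglam l * q ^ 2 / 128) by (unfold l; field; lra).
    nra. }
  assert (He0 : 0 < tail_eps A l) by apply exp_pos.
  assert (Hn : INR n + 1 <= q ^ 11).
  { assert (B := two_n_bound f A Hf n l ltac:(lra) Hs); apply Rabs_le_between in B.
    replace (q ^ 11) with (l * q) by (unfold l; ring).
    assert (l * loglam l <= l * q) by (apply Rmult_le_compat_l; lra).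
    assert (768 ^ 2 * q <= l * q) by (apply Rmult_le_compat_r; lra); lra. }
  assert (Hdom : forall a b, (a <= b)%nat -> / q ^ b <= / q ^ a).
  { intros a b Hab; apply Rinv_le_contravar; auto; apply Rle_pow; [lra | auto]. }
  assert (Hl' : 10 <= l) by lra.
  split; [| split; [| split]].
  - intros k; apply Rle_trans with (1 := scaled_coef_upper f A Hf n l Hl' HL Hs HT Hsm k).
    rewrite Etau; unfold Rdiv; assert (D := Hdom 5%nat 20%nat ltac:(lia)).
    assert (/ q ^ 5 <= / q ^ 4 / 4); [| lra].
    replace (q ^ 5) with (q ^ 4 * q) by ring; rewrite Rinv_mult.
    apply Rmult_le_compat_l; [left; now apply Rinv_0_lt_compat | apply Rinv_le_contravar; lra].
  - assert (B := scaled_coef_lower f A Hf n l Hl' HL Hs HT Hsm H4).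
    assert (Hk : sqrt (kappa l) <= q ^ 6).
    { rewrite <- (sqrt_pow2 (q ^ 6)) by (left; auto); apply sqrt_le_1_alt; unfold kappa.
      apply Rle_trans with (l * q).
      { replace (l / 4 * (loglam l + 1)) with (l * ((loglam l + 1) / 4)) by field; apply Rmult_le_compat_l; lra. }
      unfold l; replace ((q ^ 6) ^ 2) with (q ^ 10 * (q * q)) by ring.
      apply Rmult_le_compat_l; [left; apply Hpw | nra]. }
    assert (Hk0 : 0 < sqrt (kappa l)) by (apply sqrt_lt_R0; unfold kappa; nra).
    assert (Hi : / (3 * q ^ 6) <= / (3 * sqrt (kappa l))) by (apply Rinv_le_contravar; lra).
    rewrite Rinv_mult in Hi.
    assert (D := Hdom 7%nat 20%nat ltac:(lia)).
    assert (/ q ^ 7 <= / q ^ 6 / 768).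
    { replace (q ^ 7) with (q ^ 6 * q) by ring; rewrite Rinv_mult.
      apply Rmult_le_compat_l; [left; now apply Rinv_0_lt_compat | apply Rinv_le_contravar; lra]. }
    rewrite Rinv_mult; assert (0 < / q ^ 6) by (apply Rinv_0_lt_compat; auto).
    assert (PI * Cmod (scaled_coef f l n) <= 4 * Cmod (scaled_coef f l n))
      by (apply Rmult_le_compat_r; [apply Cmod_ge_0 | auto]).
    lra.
  - intros j; assert (B := scaled_coef_ratio f A Hf n l Hl' HL Hs HT Hsm j).
    rewrite Cmod_mult, Cmod_R, Rabs_right in B by lra.
    assert (Hj := pos_INR j).
    apply Rle_trans with (PI * Cmod (scaled_coef f l (n + j) - scaled_coef f l n)).
    { pose proof (Cmod_ge_0 (scaled_coef f l (n + j) - scaled_coef f l n)); nra. }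
    apply Rle_trans with (1 := B), Rmult_le_compat_l; auto.
    rewrite Etau; replace ((/ q ^ 4) ^ 2) with (/ q ^ 8) by (field; lra).
    assert (D := Hdom 9%nat 20%nat ltac:(lia)).
    assert (/ q ^ 9 <= / q ^ 8 / 768); [| unfold Rdiv in *; lra].
    replace (q ^ 9) with (q ^ 8 * q) by ring; rewrite Rinv_mult.
    apply Rmult_le_compat_l; [left; now apply Rinv_0_lt_compat | apply Rinv_le_contravar; lra].
  - intros om Ho1 Ho; assert (B := scaled_sum_outside f A Hf n l Hl' HL Hs HT Hsm om Ho1 Ho).
    rewrite Cmod_mult, Cmod_R, Rabs_right in B by lra.
    set (X := Cmod ((1 - om) * sum_n (fun j => (scaled_coef f l (n - j) * om ^ j)%C) n - scaled_coef f l n)) in *.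
    assert (HX : 0 <= X) by apply Cmod_ge_0.
    apply Rle_trans with (PI * X); [nra |]; apply Rle_trans with (1 := B).
    set (d := Cmod (1 - om)).
    assert (Hd : 0 < d) by (apply Cmod_gt_0, Cminus_eq_contra; auto).
    assert (Hd4 : 0 < d ^ 4) by (apply pow_lt; auto).
    rewrite Etau; replace ((/ q ^ 4) ^ 2) with (/ q ^ 8) by (field; lra).
    replace ((4 * / q ^ 4 / d) ^ 4) with (256 / d ^ 4 * / q ^ 16) by (field; lra).
    assert (W1 : (INR n + 1) * (256 / d ^ 4 * / q ^ 16) <= 256 / d ^ 4).
    { apply Rle_trans with (q ^ 11 * (256 / d ^ 4 * / q ^ 16)).
      - apply Rmult_le_compat_r; auto; apply Rmult_le_pos; [apply Rdiv_le_0_compat; lra | left; now apply Rinv_0_lt_compat].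
      - replace (q ^ 11 * (256 / d ^ 4 * / q ^ 16)) with (256 / d ^ 4 * / q ^ 5) by (field; lra).
        rewrite <- (Rmult_1_r (256 / d ^ 4)) at 2; apply Rmult_le_compat_l; [apply Rdiv_le_0_compat; lra |].
        rewrite <- Rinv_1; apply Rinv_le_contravar; [lra | auto]. }
    assert (W2 : 16 * tail_eps A l * (INR n + 1) <= 8 / q ^ 8 * 2).
    { apply Rle_trans with (16 * / q ^ 20 * q ^ 11).
      - apply Rmult_le_compat; [lra | pose proof (pos_INR n); lra | lra | auto].
      - replace (16 * / q ^ 20 * q ^ 11) with (16 * / q ^ 9) by (field; lra).
        assert (D := Hdom 8%nat 9%nat ltac:(lia)); unfold Rdiv; lra. }
    assert (0 < / q ^ 8) by (apply Rinv_0_lt_compat; auto).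
    apply Rle_trans with (8 * / q ^ 8 * (4 / d + 256 / d ^ 4) + 8 / q ^ 8 * 2); [| right; field; lra].
    apply Rplus_le_compat; auto; apply Rmult_le_compat_l; [lra |]; apply Rplus_le_compat_l, W1.
Qed.

End XiLike.

Lemma tenth_root (q0 : R) : exists l0, 10 <= l0 /\ forall l, l0 <= l -> exists q, q0 <= q /\ l = q ^ 10.
Proof.
  exists (Rmax 10 (Rmax 1 q0 ^ 10)); split; [apply Rmax_l |]; intros l Hl.
  assert (H1 := Rle_trans _ _ _ (Rmax_l _ _) Hl); assert (H2 := Rle_trans _ _ _ (Rmax_r _ _) Hl).
  assert (HR : 1 <= Rmax 1 q0) by apply Rmax_l.
  exists (Rpower l (/ 10)); split.
  - apply Rle_trans with (1 := Rmax_r 1 q0).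
    replace (Rmax 1 q0) with (Rpower (Rmax 1 q0 ^ 10) (/ 10)).
    + apply Rle_Rpower_l; [lra | split; [apply pow_lt; lra | auto]].
    + rewrite <- Rpower_pow, Rpower_mult by lra.
      replace (INR 10 * / 10) with 1 by (simpl; field); apply Rpower_1; lra.
  - rewrite <- Rpower_pow by apply exp_pos; rewrite Rpower_mult.
    replace (/ 10 * INR 10) with 1 by (simpl; field); rewrite Rpower_1; lra.
Qed.

Lemma sum_n_rev_C (a : nat -> C) n : sum_n a n = sum_n (fun j => a (n - j)%nat) n.
Proof.
  induction n; [now rewrite !sum_O |].
  rewrite sum_Sn_C, IHn; symmetry; unfold sum_n at 1.
  rewrite sum_Sn_m, <- sum_n_m_S by lia.
  rewrite Nat.sub_0_r; exact (Cplus_comm _ _).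
Qed.

Lemma sum_n_geom_le r m : 0 <= r < 1 -> sum_n (fun j => r ^ j) m <= / (1 - r).
Proof.
  intros Hr; apply Rmult_le_reg_r with (1 - r); [lra |]; rewrite Rinv_l by lra.
  assert (E : sum_n (fun j => r ^ j) m * (1 - r) = 1 - r ^ S m).
  { induction m; [rewrite sum_O; simpl; ring |].
    rewrite sum_Sn; change plus with Rplus; rewrite Rmult_plus_distr_r, IHm; simpl; ring. }
  rewrite E; pose proof (pow_le r (S m) (proj1 Hr)); lra.
Qed.

Lemma sum_n_geom_deriv_le r m : 0 <= r < 1 -> sum_n (fun j => INR (S j) * r ^ j) m <= / (1 - r) ^ 2.
Proof.
  intros Hr; assert (H2 : 0 < (1 - r) ^ 2) by (apply pow_lt; lra).
  apply Rmult_le_reg_r with ((1 - r) ^ 2); auto; rewrite Rinv_l by lra.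
  assert (E : sum_n (fun j => INR (S j) * r ^ j) m * (1 - r) ^ 2
    = 1 - r ^ S m * (INR (S m) * (1 - r) + 1)).
  { induction m; [rewrite sum_O; simpl; ring |].
    rewrite sum_Sn; change plus with Rplus; rewrite Rmult_plus_distr_r, IHm, (S_INR (S m)); simpl pow; ring. }
  rewrite E.
  assert (0 <= r ^ S m * (INR (S m) * (1 - r) + 1)); [| lra].
  apply Rmult_le_pos; [now apply pow_le |]; pose proof (pos_INR (S m)); nra.
Qed.

Section XiLike.
Variables (f : C -> C) (A : R).
Hypothesis Hf : xi_like f A.

Lemma taylor_poly_scaled n l z : / 2 <= l ->
  taylor_poly f (2 * n) (l * z) = (f l * sum_n (fun k => scaled_coef f l k * (z ^ 2) ^ k) n)%C.
Proof.
  intros Hl; rewrite (taylor_poly_even f A Hf), <- sum_n_Cmult_l; apply sum_n_ext; intros k.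
  unfold scaled_coef; rewrite Cpow_mult_l, <- Cpow_mult_r.
  match goal with |- @eq _ ?a ?b => change (@eq C a b) end; field; now apply (xl_neq_0 f A Hf).
Qed.

Lemma taylor_poly_lim w eta : 0 < eta -> exists N, forall m, (N <= m)%nat -> Cmod (f w - taylor_poly f m w) <= eta.
Proof.
  intros He.
  assert (Hh := xl_holo f A Hf).
  assert (Hw := Cmod_ge_0 w).
  destruct (circle_bounded f 0 (Cmod w + 1) Hh) as [M HM].
  assert (HM' : forall t, Cmod (f ((Cmod w + 1)%R * cis t)%C) <= M).
  { intros t; specialize (HM t); now rewrite Cplus_0_l in HM. }
  destruct (taylor_remainder f w (Cmod w + 1) M Hh ltac:(lra) HM') as [_ B].
  assert (Hq : 0 <= Cmod w / (Cmod w + 1) < 1).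
  { split; [apply Rdiv_le_0_compat; lra |].
    apply Rmult_lt_reg_r with (Cmod w + 1); [lra |].
    replace (Cmod w / (Cmod w + 1) * (Cmod w + 1)) with (Cmod w) by (field; lra); lra. }
  assert (L := is_lim_geom_tail M _ Hq).
  apply is_lim_seq_spec in L; destruct (L (mkposreal _ He)) as [N HN].
  exists N; intros m Hm; rewrite (taylor_poly_tcoef f m w Hh).
  apply Rle_trans with (1 := B m); specialize (HN m Hm); simpl in HN.
  rewrite Rminus_0_r in HN; apply Rle_trans with (1 := Rle_abs _); left; auto.
Qed.

(** The tail is cut at a finite [m] with an error below any [eta], so that bounds on finite sums,
    uniform in [m], become bounds on the tail. *)
Lemma taylor_tail n l z eta : / 2 <= l -> 0 < eta -> exists m,
  Cmod (f (l * z)%C - taylor_poly f (2 * n) (l * z)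
    - f l * (z ^ 2) ^ n * sum_n (fun j => scaled_coef f l (n + S j) * (z ^ 2) ^ S j)%C m) <= eta.
Proof.
  intros Hl He; destruct (taylor_poly_lim (l * z)%C eta He) as [N HN].
  exists N; specialize (HN (2 * (n + S N))%nat ltac:(lia)).
  apply Rle_trans with (2 := HN); right; f_equal.
  rewrite !taylor_poly_scaled by auto.
  assert (E : forall m, sum_n (fun k => scaled_coef f l k * (z ^ 2) ^ k)%C (n + S m)
    = (sum_n (fun k => scaled_coef f l k * (z ^ 2) ^ k) n +
      (z ^ 2) ^ n * sum_n (fun j => scaled_coef f l (n + S j) * (z ^ 2) ^ S j) m)%C).
  { induction m.
    - rewrite Nat.add_1_r, sum_Sn_C, sum_O, !Nat.add_1_r, Cpow_S; simpl Cpow; Cring.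
    - rewrite Nat.add_succ_r, sum_Sn_C, IHm, sum_Sn_C, <- Nat.add_succ_r, Cpow_add_r; Cring. }
  rewrite E; Cring.
Qed.

Lemma taylor_tail_le n l z b : / 2 <= l ->
  (forall m, Cmod (sum_n (fun j => scaled_coef f l (n + S j) * (z ^ 2) ^ S j)%C m) <= b) ->
  Cmod (taylor_poly f (2 * n) (l * z) - f (l * z)%C) <= b * (Cmod z ^ (2 * n) * Cmod (f l)).
Proof.
  intros Hl Hb; apply le_epsilon; intros eta He.
  destruct (taylor_tail n l z eta Hl He) as [m Hm]; specialize (Hb m).
  set (S := sum_n (fun j => scaled_coef f l (n + S j) * (z ^ 2) ^ S j)%C m) in *.
  rewrite Cmod_minus_sym.
  assert (T := Cmod_triangle_rev (f (l * z)%C - taylor_poly f (2 * n) (l * z)) (f l * (z ^ 2) ^ n * S)).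
  rewrite !Cmod_mult, !Cmod_pow, <- pow_mult in T.
  assert (Cmod S * (Cmod z ^ (2 * n) * Cmod (f l)) <= b * (Cmod z ^ (2 * n) * Cmod (f l))); [| lra].
  apply Rmult_le_compat_r; auto; apply Rmult_le_pos; [apply pow_le |]; apply Cmod_ge_0.
Qed.

Lemma taylor_tail_ge n l z b : / 2 <= l ->
  (forall m, b <= Cmod (sum_n (fun j => scaled_coef f l (n + S j) * (z ^ 2) ^ S j)%C m)) ->
  b * (Cmod z ^ (2 * n) * Cmod (f l)) <= Cmod (taylor_poly f (2 * n) (l * z) - f (l * z)%C).
Proof.
  intros Hl Hb; apply le_epsilon; intros eta He.
  destruct (taylor_tail n l z eta Hl He) as [m Hm]; specialize (Hb m).
  set (S := sum_n (fun j => scaled_coef f l (n + S j) * (z ^ 2) ^ S j)%C m) in *.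
  rewrite (Cmod_minus_sym (taylor_poly _ _ _)).
  rewrite Cmod_minus_sym in Hm.
  assert (T := Cmod_triangle_rev (f l * (z ^ 2) ^ n * S) (f (l * z)%C - taylor_poly f (2 * n) (l * z))).
  rewrite !Cmod_mult, !Cmod_pow, <- pow_mult in T.
  assert (b * (Cmod z ^ (2 * n) * Cmod (f l)) <= Cmod S * (Cmod z ^ (2 * n) * Cmod (f l))); [| lra].
  apply Rmult_le_compat_r; auto; apply Rmult_le_pos; [apply pow_le |]; apply Cmod_ge_0.
Qed.

Lemma Cmod_sq_lt_1 z : Cmod z < 1 -> 0 <= Cmod z ^ 2 < 1.
Proof. intros Hz; pose proof (Cmod_ge_0 z); split; [apply pow2_ge_0 | nra]. Qed.

(** All scaled coefficients are below [5 / q ^ 4], and the powers of [z ^ 2] beyond the common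
    factor form a convergent geometric series. *)
Theorem tail_upper z eps : Cmod z < 1 -> 0 < eps -> exists l0, 10 <= l0 /\ forall n l, l0 <= l ->
  (l * C_derive f l)%C = (2 * INR n * f l)%C ->
  Cmod (taylor_poly f (2 * n) (l * z) - f (l * z)%C) <= eps * (Cmod z ^ (2 * n) * Cmod (f l)).
Proof.
  intros Hz He; assert (Hr := Cmod_sq_lt_1 z Hz); set (r := Cmod z ^ 2) in *.
  destruct (saddle_scale f A Hf) as [q0 [Hq0 HS]].
  destruct (tenth_root (Rmax q0 (5 / (eps * (1 - r))))) as [l0 [Hl0 Hroot]].
  exists l0; split; auto; intros n l Hl Hs.
  destruct (Hroot l Hl) as [q [Hq ->]].
  assert (Hq1 := Rle_trans _ _ _ (Rmax_l _ _) Hq); assert (Hq2 := Rle_trans _ _ _ (Rmax_r _ _) Hq).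
  destruct (HS q Hq1 n Hs) as [HU _].
  apply taylor_tail_le; [lra |]; intros m.
  assert (H4 : 5 / q ^ 4 * / (1 - r) <= eps).
  { apply (Rmult_le_compat_r (eps * (1 - r))) in Hq2; [| apply Rmult_le_pos; lra].
    replace (5 / (eps * (1 - r)) * (eps * (1 - r))) with 5 in Hq2 by (field; lra).
    assert (q <= q ^ 4) by (rewrite <- (pow_1 q) at 1; apply Rle_pow; [lra | lia]).
    apply Rmult_le_reg_r with (q ^ 4 * (1 - r)); [apply Rmult_lt_0_compat; lra |].
    replace (5 / q ^ 4 * / (1 - r) * (q ^ 4 * (1 - r))) with 5 by (field; split; lra).
    assert (q * (eps * (1 - r)) <= q ^ 4 * (eps * (1 - r))) by (apply Rmult_le_compat_r; auto; apply Rmult_le_pos; lra).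
    lra. }
  apply Rle_trans with (2 := H4).
  apply Rle_trans with (sum_n (fun j => 5 / q ^ 4 * r ^ j) m).
  - apply Cmod_sum_n_le; intros j; rewrite Cmod_mult, !Cmod_pow; fold r.
    apply Rmult_le_compat; auto; [apply Cmod_ge_0 | apply pow_le; lra |].
    simpl; rewrite <- (Rmult_1_l (r ^ j)) at 2; apply Rmult_le_compat_r; [apply pow_le |]; lra.
  - rewrite (sum_n_mult_l (K := R_Ring)); change mult with Rmult.
    apply Rmult_le_compat_l; [apply Rdiv_le_0_compat; [lra | apply pow_lt; lra] | now apply sum_n_geom_le].
Qed.

Lemma scaled_sum_rev n (l : R) (z : C) : / 2 <= l -> z <> 0 ->
  taylor_poly f (2 * n) (l * z) =
  (f l * (z ^ 2) ^ n * sum_n (fun j => scaled_coef f l (n - j) * (/ z ^ 2) ^ j) n)%C.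
Proof.
  intros Hl Hz; rewrite taylor_poly_scaled, sum_n_rev_C, <- Cmult_assoc by auto; f_equal.
  rewrite <- sum_n_Cmult_l; apply sum_n_ext_loc; intros j Hj.
  assert (Hz2 : (z ^ 2)%C <> 0) by (apply Cpow_nz; auto).
  replace ((z ^ 2) ^ n)%C with ((z ^ 2) ^ (n - j) * (z ^ 2) ^ j)%C by (rewrite <- Cpow_add_r; f_equal; lia).
  rewrite Cpow_inv by auto; assert (((z ^ 2) ^ j)%C <> 0) by (apply Cpow_nz; auto).
  set (a := ((z ^ 2) ^ (n - j))%C); set (b := ((z ^ 2) ^ j)%C) in *.
  match goal with |- @eq _ ?a ?b => change (@eq C a b) end; field; auto.
Qed.

Theorem poly_upper z eps : 1 < Cmod z -> 0 < eps -> exists l0, 10 <= l0 /\ forall n l, l0 <= l ->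
  (l * C_derive f l)%C = (2 * INR n * f l)%C ->
  Cmod (taylor_poly f (2 * n) (l * z)) <= eps * (Cmod z ^ (2 * n) * Cmod (f l)).
Proof.
  intros Hz He.
  assert (Hz0 : z <> 0) by (apply Cmod_gt_0; lra).
  assert (Hz2 : (z ^ 2)%C <> 0) by (apply Cpow_nz; auto).
  set (r := Cmod (/ z ^ 2)).
  assert (Hr : 0 <= r < 1).
  { unfold r; split; [apply Cmod_ge_0 |]; rewrite Cmod_inv, Cmod_pow by auto.
    rewrite <- Rinv_1; apply Rinv_lt_contravar; nra. }
  destruct (saddle_scale f A Hf) as [q0 [Hq0 HS]].
  destruct (tenth_root (Rmax q0 (5 / (eps * (1 - r))))) as [l0 [Hl0 Hroot]].
  exists l0; split; auto; intros n l Hl Hs.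
  destruct (Hroot l Hl) as [q [Hq ->]].
  assert (Hq1 := Rle_trans _ _ _ (Rmax_l _ _) Hq); assert (Hq2 := Rle_trans _ _ _ (Rmax_r _ _) Hq).
  destruct (HS q Hq1 n Hs) as [HU _].
  assert (H4 : 5 / q ^ 4 * / (1 - r) <= eps).
  { apply (Rmult_le_compat_r (eps * (1 - r))) in Hq2; [| apply Rmult_le_pos; lra].
    replace (5 / (eps * (1 - r)) * (eps * (1 - r))) with 5 in Hq2 by (field; lra).
    assert (q <= q ^ 4) by (rewrite <- (pow_1 q) at 1; apply Rle_pow; [lra | lia]).
    apply Rmult_le_reg_r with (q ^ 4 * (1 - r)); [apply Rmult_lt_0_compat; lra |].
    replace (5 / q ^ 4 * / (1 - r) * (q ^ 4 * (1 - r))) with 5 by (field; split; lra).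
    assert (q * (eps * (1 - r)) <= q ^ 4 * (eps * (1 - r))) by (apply Rmult_le_compat_r; auto; apply Rmult_le_pos; lra).
    lra. }
  rewrite scaled_sum_rev, !Cmod_mult, !Cmod_pow, <- pow_mult by (auto; lra).
  assert (B : Cmod (sum_n (fun j => scaled_coef f (q ^ 10) (n - j) * (/ z ^ 2) ^ j)%C n) <= eps).
  { apply Rle_trans with (2 := H4).
    apply Rle_trans with (sum_n (fun j => 5 / q ^ 4 * r ^ j) n).
    - apply Cmod_sum_n_le; intros j; rewrite Cmod_mult, Cmod_pow; fold r.
      apply Rmult_le_compat_r; auto; apply pow_le; lra.
    - rewrite (sum_n_mult_l (K := R_Ring)); change mult with Rmult.
      apply Rmult_le_compat_l; [apply Rdiv_le_0_compat; [lra | apply pow_lt; lra] | now apply sum_n_geom_le]. }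
  rewrite (Rmult_comm (Cmod (f _))), Rmult_comm; apply Rmult_le_compat_r; auto.
  apply Rmult_le_pos; [apply pow_le |]; apply Cmod_ge_0.
Qed.

(** Weakens the natural loss [q ^ -6] to [q ^ -10 = 1 / l], so that the lower bounds can be stated
    in [l] alone. *)
Lemma inv_pow_6_ge q c : 1 <= q -> 0 <= c -> c / q ^ 10 <= c / q ^ 6.
Proof.
  intros Hq Hc; apply Rmult_le_compat_l; auto; apply Rinv_le_contravar; [apply pow_lt; lra | apply Rle_pow; auto; lia].
Qed.

(** The coefficients after the middle one are replaced by it, which leaves an explicit geometric sum
    of order [q ^ -6]. The replacement costs [10 (j + 1) / q ^ 8] at step [j], summable against
    powers of [r]. *)
Theorem tail_lower (z : C) : z <> 0 -> Cmod z < 1 -> exists c l0, 0 < c /\ 10 <= l0 /\ forall n l, l0 <= l ->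
  (l * C_derive f l)%C = (2 * INR n * f l)%C ->
  c / l * (Cmod z ^ (2 * n) * Cmod (f l)) <= Cmod (taylor_poly f (2 * n) (l * z) - f (l * z)%C).
Proof.
  intros Hz0 Hz; assert (Hr := Cmod_sq_lt_1 z Hz); set (r := Cmod z ^ 2) in *.
  assert (Hr0 : 0 < r) by (apply pow_lt, Cmod_gt_0; auto).
  set (w := (z ^ 2)%C); assert (Hw : Cmod w = r) by apply Cmod_pow.
  assert (Hw1 : w <> 1) by (intros E; rewrite E, Cmod_1 in Hw; lra).
  destruct (saddle_scale f A Hf) as [q0 [Hq0 HS]].
  set (D := r * (1 - r) ^ 3); assert (HD : 0 < D) by (apply Rmult_lt_0_compat; auto; apply pow_lt; lra).
  assert (H1r : 0 < (1 - r) ^ 2) by (apply pow_lt; lra).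
  destruct (tenth_root (Rmax q0 (640 / D))) as [l0 [Hl0 Hroot]].
  (* Half of the constant of the main term, [r (1 - r) / 32]; the other half pays for the
     replacement error. *)
  set (c := r * (1 - r) / 64); assert (Hc : 0 < c) by (unfold c; nra).
  exists c, l0; split; auto; split; auto; intros n l Hl Hs.
  destruct (Hroot l Hl) as [q [Hq ->]].
  assert (Hq1 := Rle_trans _ _ _ (Rmax_l _ _) Hq); assert (Hq2 := Rle_trans _ _ _ (Rmax_r _ _) Hq).
  destruct (HS q Hq1 n Hs) as [_ [HLo [HR _]]].
  set (sc := scaled_coef f (q ^ 10)) in *.
  apply taylor_tail_ge; [lra |]; intros m; fold w; fold sc.
  apply Rle_trans with (1 := inv_pow_6_ge q c ltac:(lra) ltac:(lra)).
  assert (P6 : 0 < q ^ 6) by (apply pow_lt; lra); assert (P8 : 0 < q ^ 8) by (apply pow_lt; lra).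
  assert (E : sum_n (fun j => sc (n + S j)%nat * w ^ S j)%C m
    = (sc n * (w * ((1 - w ^ S m) / (1 - w))) - - sum_n (fun j => (sc (n + S j)%nat - sc n) * w ^ S j) m)%C).
  { rewrite <- (sum_n_geometric w m Hw1); clear.
    induction m; [rewrite !sum_O; simpl; Cring | rewrite !sum_Sn_C, IHm; simpl; Cring]. }
  rewrite E; apply Rle_trans with (2 := Cmod_triangle_rev _ _).
  assert (B2 : Cmod (- sum_n (fun j => (sc (n + S j)%nat - sc n) * w ^ S j)%C m) <= 10 / q ^ 8 * / (1 - r) ^ 2).
  { rewrite Cmod_opp; apply Rle_trans with (sum_n (fun j => 10 / q ^ 8 * (INR (S j) * r ^ j)) m).
    - apply Cmod_sum_n_le; intros j; rewrite Cmod_mult, Cmod_pow, Hw, <- Rmult_assoc, (Rmult_comm (10 / q ^ 8)).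
      apply Rmult_le_compat; auto; [apply Cmod_ge_0 | apply pow_le; lra |].
      simpl; rewrite <- (Rmult_1_l (r ^ j)) at 2; apply Rmult_le_compat_r; [apply pow_le |]; lra.
    - rewrite (sum_n_mult_l (K := R_Ring)); change mult with Rmult.
      apply Rmult_le_compat_l; [apply Rdiv_le_0_compat; lra | now apply sum_n_geom_deriv_le]. }
  assert (B1 : / (16 * q ^ 6) * (r * ((1 - r) / 2)) <= Cmod (sc n * (w * ((1 - w ^ S m) / (1 - w))))).
  { assert (Hd0 : (1 - w)%C <> 0) by (apply Cminus_eq_contra; auto).
    rewrite !Cmod_mult, Hw, Cmod_div by auto.
    assert (U1 : Cmod (1 - w) <= 2).
    { apply Rle_trans with (1 := Cmod_triangle_minus _ _); rewrite Cmod_1; lra. }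
    assert (U0 : 0 < Cmod (1 - w)) by now apply Cmod_gt_0.
    assert (U2 : 1 - r <= Cmod (1 - w ^ S m)).
    { apply Rle_trans with (2 := Cmod_triangle_rev _ _); rewrite Cmod_1, Cmod_pow, Hw.
      assert (r ^ m <= 1) by (rewrite <- (pow1 m); apply pow_incr; lra).
      simpl; nra. }
    apply Rmult_le_compat; auto; [left; apply Rinv_0_lt_compat; lra | nra |].
    apply Rmult_le_compat_l; [lra |]; unfold Rdiv.
    apply Rmult_le_compat; auto; [lra | lra |].
    apply Rinv_le_contravar; auto. }
  assert (Q : 10 / q ^ 8 * / (1 - r) ^ 2 <= c / q ^ 6).
  { apply (Rmult_le_compat_r D) in Hq2; [| lra].
    replace (640 / D * D) with 640 in Hq2 by (field; lra).
    assert (q * D <= q ^ 2 * D) by (apply Rmult_le_compat_r; [lra |]; nra).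
    replace (10 / q ^ 8 * / (1 - r) ^ 2) with (640 * (/ (64 * (1 - r) ^ 2) / q ^ 8)) by (field; repeat split; lra).
    replace (c / q ^ 6) with (q ^ 2 * D * (/ (64 * (1 - r) ^ 2) / q ^ 8)) by (unfold c, D; field; lra).
    apply Rmult_le_compat_r; [| lra]; apply Rdiv_le_0_compat; [left; apply Rinv_0_lt_compat; lra | auto]. }
  replace (/ (16 * q ^ 6) * (r * ((1 - r) / 2))) with (2 * (c / q ^ 6)) in B1 by (unfold c; field; lra).
  lra.
Qed.

(** Read from the top degree down, the polynomial is a sum in powers of [om = / z ^ 2] with
    [Cmod om <= 1], and [scaled_sum_outside] compares [1 - om] times it with the middle
    coefficient. *)
Theorem poly_lower z : 1 <= Cmod z -> (z ^ 2)%C <> 1 -> exists c l0, 0 < c /\ 10 <= l0 /\ forall n l, l0 <= l ->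
  (l * C_derive f l)%C = (2 * INR n * f l)%C ->
  c / l * (Cmod z ^ (2 * n) * Cmod (f l)) <= Cmod (taylor_poly f (2 * n) (l * z)).
Proof.
  intros Hz Hz1.
  assert (Hz0 : z <> 0) by (apply Cmod_gt_0; lra).
  assert (Hz2 : (z ^ 2)%C <> 0) by (apply Cpow_nz; auto).
  set (om := (/ z ^ 2)%C).
  assert (Ho : Cmod om <= 1).
  { unfold om; rewrite Cmod_inv, Cmod_pow by auto; rewrite <- Rinv_1; apply Rinv_le_contravar; nra. }
  assert (Ho1 : om <> 1).
  { intros E; apply Hz1; transitivity (/ om)%C; [unfold om; field; auto | rewrite E; field]. }
  assert (Hd0 : (1 - om)%C <> 0) by (apply Cminus_eq_contra; auto).
  set (d := Cmod (1 - om)); assert (Hd : 0 < d) by now apply Cmod_gt_0.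
  assert (Hd2 : d <= 2).
  { unfold d; apply Rle_trans with (1 := Cmod_triangle_minus _ _); rewrite Cmod_1; lra. }
  set (K := 4 / d + 256 / d ^ 4 + 2).
  destruct (saddle_scale f A Hf) as [q0 [Hq0 HS]].
  destruct (tenth_root (Rmax q0 (256 * K))) as [l0 [Hl0 Hroot]].
  exists (/ 64), l0; split; [lra |]; split; auto; intros n l Hl Hs.
  destruct (Hroot l Hl) as [q [Hq ->]].
  assert (Hq1 := Rle_trans _ _ _ (Rmax_l _ _) Hq); assert (Hq2 := Rle_trans _ _ _ (Rmax_r _ _) Hq).
  destruct (HS q Hq1 n Hs) as [_ [HLo [_ HR]]].
  specialize (HR om Ho Ho1); fold d in HR; fold K in HR.
  assert (P6 : 0 < q ^ 6) by (apply pow_lt; lra); assert (P8 : 0 < q ^ 8) by (apply pow_lt; lra).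
  rewrite scaled_sum_rev, !Cmod_mult, !Cmod_pow, <- pow_mult by (auto; lra).
  fold om; set (S := sum_n (fun j => (scaled_coef f (q ^ 10) (n - j) * om ^ j)%C) n) in *.
  assert (B : / 64 / q ^ 6 <= Cmod S).
  { assert (T := Cmod_triangle_rev (scaled_coef f (q ^ 10) n) ((1 - om) * S)).
    rewrite (Cmod_minus_sym (scaled_coef _ _ _)), Cmod_mult in T; fold d in T.
    assert (Q : 8 / q ^ 8 * K <= / (32 * q ^ 6)).
    { replace (8 / q ^ 8 * K) with (256 * K * (/ 32 / q ^ 8)) by (field; lra).
      replace (/ (32 * q ^ 6)) with (q ^ 2 * (/ 32 / q ^ 8)) by (field; lra).
      apply Rmult_le_compat_r; [apply Rdiv_le_0_compat; lra | nra]. }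
    assert (d * Cmod S <= 2 * Cmod S) by (apply Rmult_le_compat_r; auto; apply Cmod_ge_0).
    replace (/ 64 / q ^ 6) with ((/ (16 * q ^ 6) - / (32 * q ^ 6)) / 2) by (field; lra); lra. }
  assert (I := inv_pow_6_ge q (/ 64) ltac:(lra) ltac:(lra)).
  rewrite (Rmult_comm (Cmod (f _))), (Rmult_comm _ (Cmod S)); apply Rmult_le_compat_r; [| lra].
  apply Rmult_le_pos; [apply pow_le |]; apply Cmod_ge_0.
Qed.

End XiLike.

(** * Spacing of the scaling points *)

Lemma loglam_ratio l l' : 0 < l -> 0 < l' -> loglam l' - loglam l = ln (l' / l).
Proof.
  intros Hl Hl'; assert (HP := PI_gt_3); unfold loglam.
  rewrite !ln_div by lra; ring.
Qed.

Lemma ln_ratio_bounds l l' : 0 < l -> Rabs (l' - l) <= l / 2 -> Rabs (ln (l' / l)) <= 2 * Rabs (l' - l) / l.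
Proof.
  intros Hl H; assert (Hb := H); apply Rabs_le_between in Hb.
  assert (Hx : / 2 <= l' / l) by (apply Rmult_le_reg_r with l; auto; replace (l' / l * l) with l' by (field; lra); lra).
  set (x := l' / l) in *.
  assert (E : Rabs (l' - l) = l * Rabs (x - 1)).
  { rewrite <- (Rabs_right l) at 2 by lra; rewrite <- Rabs_mult; f_equal; unfold x; field; lra. }
  rewrite E; replace (2 * (l * Rabs (x - 1)) / l) with (2 * Rabs (x - 1)) by (field; lra).
  assert (up : forall y, 0 < y -> ln y <= y - 1).
  { intros y Hy; pose proof (exp_ineq1_le (ln y)); rewrite exp_ln in *; lra. }
  assert (U1 := up x ltac:(lra)).
  assert (U2 := up (/ x) ltac:(apply Rinv_0_lt_compat; lra)).
  rewrite ln_Rinv in U2 by lra.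
  assert (U3 : / x - 1 <= 2 * Rabs (x - 1)).
  { replace (/ x - 1) with ((1 - x) * / x) by (field; lra).
    apply Rle_trans with (Rabs (x - 1) * 2); [| lra].
    apply Rle_trans with (Rabs (x - 1) * / x).
    - apply Rmult_le_compat_r; [left; apply Rinv_0_lt_compat; lra |]; rewrite Rabs_minus_sym; apply Rle_abs.
    - apply Rmult_le_compat_l; [apply Rabs_pos |]; replace 2 with (/ / 2) by field; apply Rinv_le_contravar; lra. }
  pose proof (Rle_abs (x - 1)); pose proof (Rabs_pos (x - 1)); apply Rabs_le; lra.
Qed.

Lemma phi_MVT l l' : 0 < l -> 0 < l' -> exists c, Rmin l l' <= c <= Rmax l l' /\
  l' / 2 * loglam l' - l / 2 * loglam l = (loglam c + 1) / 2 * (l' - l).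
Proof.
  intros Hl Hl'; assert (HP := PI_gt_3).
  assert (K : forall a b, 0 < a -> a <= b -> exists c, a <= c <= b /\
    b / 2 * loglam b - a / 2 * loglam a = (loglam c + 1) / 2 * (b - a)).
  { intros a b Ha Hab; apply (MVT_is_derive (fun l => l / 2 * loglam l) (fun l => (loglam l + 1) / 2) a b Hab).
    intros x Hx; unfold loglam; auto_derive; [apply Rdiv_lt_0_compat; lra | unfold Rdiv; field; lra]. }
  destruct (Rle_lt_dec l l') as [H|H].
  - rewrite Rmin_left, Rmax_right by auto; apply K; auto.
  - rewrite Rmin_right, Rmax_left by lra.
    destruct (K l' l Hl' ltac:(lra)) as [c [Hc E]]; exists c; split; auto; lra.
Qed.

Section XiLike.
Variables (f : C -> C) (A : R).
Hypothesis Hf : xi_like f A.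

(** [two_n_bound] alone has an error of order one, too coarse to separate consecutive points. Here
    the error shrinks with [l' / l]: at [u = ln (l' / l)] the derivative of [Fnorm l] is
    [Fnorm l u * X'], and both that derivative and [Fnorm l] are Lipschitz near [0]. *)
Lemma scaling_defect n n' l l' : 10 <= l -> 10 <= l' -> Rabs (ln (l' / l)) <= / 8 ->
  (l * C_derive f l)%C = (2 * INR n * f l)%C -> (l' * C_derive f l')%C = (2 * INR n' * f l')%C ->
  Rabs ((2 * INR n' - l' / 2 * loglam l') - (2 * INR n - l / 2 * loglam l))
  <= (32 * bound_M A + 16 * bound_M A ^ 2) * Rabs (ln (l' / l)).
Proof.
  intros Hl Hl' Hu Hs Hs'.
  set (u := ln (l' / l)) in *; set (M := bound_M A) in *; assert (HM : 0 < M) by apply exp_pos.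
  set (X := 2 * INR n - (l / 2 * loglam l + 7 / 4)).
  set (X' := 2 * INR n' - (l' / 2 * loglam l' + 7 / 4)).
  assert (HX' : Rabs X' <= 4 * M) by (apply (two_n_bound f A Hf); auto).
  assert (Nl := xl_neq_0 f A Hf l ltac:(lra)).
  assert (El : (l * Cexp u)%C = l').
  { rewrite Cexp_RtoC; unfold u; rewrite exp_ln by (apply Rdiv_lt_0_compat; lra).
    rewrite <- RtoC_mult; f_equal; field; lra. }
  assert (EX : C_derive (Fnorm f l) 0 = X) by (apply (Fnorm_deriv_0 f A Hf); auto; lra).
  assert (EX' : C_derive (Fnorm f l) u = (Fnorm f l u * X')%C).
  { rewrite (C_derive_cdiff _ _ _ (Fnorm_cdiff f A Hf l u)); unfold Fnorm; rewrite !El, Hs'.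
    assert (EL : (loglam l + u)%C = loglam l').
    { rewrite <- RtoC_plus; f_equal; unfold u; rewrite <- loglam_ratio by lra; ring. }
    rewrite <- (Cmult_assoc (l / 2)), (Cmult_comm (Cexp u)), EL.
    replace (l / 2 * (loglam l' * Cexp u))%C with (l' / 2 * loglam l')%C by (rewrite <- El; unfold Cdiv; ring).
    unfold X'; rewrite RtoC_minus, RtoC_plus, !RtoC_mult, !RtoC_div by lra; field; auto. }
  assert (B1 := Fnorm_minus_1 f A Hf l u Hl ltac:(rewrite Cmod_R; lra)).
  assert (B2 := Fnorm_deriv_lipschitz f A Hf l u Hl ltac:(rewrite Cmod_R; lra)).
  rewrite EX, EX' in B2; rewrite Cmod_R in B1, B2; fold M in B1, B2.
  replace (2 * INR n' - l' / 2 * loglam l' - (2 * INR n - l / 2 * loglam l)) with (X' - X) by (unfold X, X'; ring).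
  rewrite <- Cmod_R.
  replace (RtoC (X' - X)) with ((Fnorm f l u * X' - X) - (Fnorm f l u - 1) * X')%C by (rewrite RtoC_minus; ring).
  apply Rle_trans with (1 := Cmod_triangle_minus _ _).
  rewrite Cmod_mult, Cmod_R.
  assert (Cmod (Fnorm f l u - 1) * Rabs X' <= 4 * M * Rabs u * (4 * M)).
  { apply Rmult_le_compat; auto; [apply Cmod_ge_0 | apply Rabs_pos]. }
  lra.
Qed.

(** [two_n_bound] first gives the crude closeness of [l] and [l']; then [scaling_defect] makes
    [2 (n' - n)] equal to [(L + 1) / 2 * (l' - l)] up to a small fraction of [l' - l]. The [+ 1]
    absorbs these errors in the upper bound for the spacing. *)
Lemma scaling_spacing : exists l0, 10 <= l0 /\ forall n n' l l', l0 <= l -> l0 <= l' ->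
  (l * C_derive f l)%C = (2 * INR n * f l)%C -> (l' * C_derive f l')%C = (2 * INR n' * f l')%C ->
  Rabs (INR n' - INR n) <= l / 1000 ->
  Rabs (l' - l) * loglam l <= 4 * Rabs (INR n' - INR n) /\
  2 * Rabs (INR n' - INR n) <= Rabs (l' - l) * loglam l /\ Rabs (l' - l) <= l / 100.
Proof.
  set (M := bound_M A); assert (HM : 0 < M) by apply exp_pos.
  destruct (loglam_eventually 3) as [l1 [Hl1 H1]].
  set (K := 32 * M + 16 * M ^ 2); assert (HK : 0 < K) by (unfold K; nra).
  exists (Rmax (Rmax 10 l1) (Rmax (8000 * M) (100 * K))); split.
  { apply Rle_trans with (Rmax 10 l1); apply Rmax_l. }
  intros n n' l l' Hl Hl' Hs Hs' HD; set (D := INR n' - INR n) in *.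
  assert (Q : forall x, Rmax (Rmax 10 l1) (Rmax (8000 * M) (100 * K)) <= x ->
    10 <= x /\ l1 <= x /\ 8000 * M <= x /\ 100 * K <= x).
  { intros x Hx.
    assert (a := Rle_trans _ _ _ (Rmax_l _ _) Hx); assert (b := Rle_trans _ _ _ (Rmax_r _ _) Hx).
    assert (a1 := Rle_trans _ _ _ (Rmax_l _ _) a); assert (a2 := Rle_trans _ _ _ (Rmax_r _ _) a).
    assert (b1 := Rle_trans _ _ _ (Rmax_l _ _) b); assert (b2 := Rle_trans _ _ _ (Rmax_r _ _) b); auto. }
  destruct (Q l Hl) as [Ha [Hb [Hc Hd]]]; destruct (Q l' Hl') as [Ha' [Hb' [_ _]]].
  destruct (phi_MVT l l' ltac:(lra) ltac:(lra)) as [c [Hcc Ec]].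
  assert (Hlc : 3 <= loglam c).
  { apply H1; apply Rle_trans with (2 := proj1 Hcc); apply Rmin_glb; auto. }
  assert (B := two_n_bound f A Hf n l Ha Hs); assert (B' := two_n_bound f A Hf n' l' Ha' Hs').
  fold M in B, B'; apply Rabs_le_between in B; apply Rabs_le_between in B'.
  assert (HDb := Rabs_le_between D (Rabs D)); destruct HDb as [HDb _]; specialize (HDb (Rle_refl _)).
  assert (Hdiff : Rabs (l' - l) <= l / 100).
  { assert (X : Rabs ((loglam c + 1) / 2 * (l' - l)) <= 2 * Rabs D + 8 * M).
    { rewrite <- Ec; apply Rabs_le; unfold D in *; lra. }
    rewrite Rabs_mult, (Rabs_right ((loglam c + 1) / 2)) in X by lra.
    pose proof (Rabs_pos (l' - l)); nra. }
  assert (Hu := ln_ratio_bounds l l' ltac:(lra) ltac:(lra)).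
  set (d := Rabs (l' - l)) in *.
  assert (Hd0 : 0 <= d) by apply Rabs_pos.
  assert (Hu1 : Rabs (ln (l' / l)) <= / 50).
  { apply Rle_trans with (1 := Hu); apply Rmult_le_reg_r with l; [lra |].
    replace (2 * d / l * l) with (2 * d) by (field; lra); lra. }
  assert (Hdef := scaling_defect n n' l l' Ha Ha' ltac:(lra) Hs Hs'); fold M in Hdef; fold K in Hdef.
  assert (Hdef2 : K * Rabs (ln (l' / l)) <= d / 50).
  { apply Rle_trans with (K * (2 * d / l)); [apply Rmult_le_compat_l; lra |].
    apply Rmult_le_reg_r with l; [lra |].
    replace (K * (2 * d / l) * l) with (2 * K * d) by (field; lra); nra. }
  assert (Hcl : Rabs (c - l) <= l / 100).
  { apply Rle_trans with (2 := Hdiff); unfold d, Rmin, Rmax in *; destruct (Rle_dec l l');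
      [rewrite !Rabs_right | rewrite !Rabs_left1]; lra. }
  assert (Hu2 := ln_ratio_bounds l c ltac:(lra) ltac:(lra)).
  assert (Hu3 : Rabs (loglam c - loglam l) <= / 50).
  { assert (0 < c) by (apply Rabs_le_between in Hcl; lra).
    rewrite loglam_ratio by lra; apply Rle_trans with (1 := Hu2); apply Rmult_le_reg_r with l; [lra |].
    replace (2 * Rabs (c - l) / l * l) with (2 * Rabs (c - l)) by (field; lra); lra. }
  assert (Hm : Rabs ((loglam c + 1) / 2 * (l' - l)) = (loglam c + 1) / 2 * d).
  { rewrite Rabs_mult, (Rabs_right ((loglam c + 1) / 2)) by lra; reflexivity. }
  assert (Hf2 : Rabs (2 * D - (loglam c + 1) / 2 * (l' - l)) <= d / 50).
  { rewrite <- Ec; apply Rle_trans with (2 := Hdef2), Rle_trans with (2 := Hdef); right; f_equal; unfold D; ring. }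
  assert (T1 := Rabs_triang_inv (2 * D) ((loglam c + 1) / 2 * (l' - l))).
  assert (T2 := Rabs_triang_inv ((loglam c + 1) / 2 * (l' - l)) (2 * D)).
  rewrite (Rabs_minus_sym _ (2 * D)) in T2.
  rewrite Hm in T1, T2; rewrite (Rabs_mult 2), (Rabs_right 2) in T1, T2 by lra.
  apply Rabs_le_between in Hu3.
  split; [| split]; auto; nra.
Qed.

End XiLike.

(** * Newton interpolation *)

Section Interpolation.
Variables (c : C) (r : R).
Hypothesis Hr : 0 < r.

(** For [h t = f zeta * (zeta - c)] on the circle, [zeta = c + r cis t], this is [2 * PI * f x].
    Dividing [h] by [zeta - nu] then gives the divided difference with node [nu], without any
    singularity at the node. *)
Definition cauchy_transform (h : R -> C) (x : C) : C :=
  CI (fun t => (h t / (c + r * cis t - x))%C) 0 (2 * PI).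

Definition node_prod (x : C) (ns : list C) : C := fold_right (fun nu p => ((x - nu) * p)%C) (RtoC 1) ns.

Lemma circle_minus_inside x t : Cmod (x - c) < r -> (c + r * cis t - x)%C <> 0.
Proof.
  intros Hx; apply Cmod_gt_0.
  replace (c + r * cis t - x)%C with (r * cis t - (x - c))%C by ring.
  apply Rlt_le_trans with (2 := Cmod_triangle_rev _ _); rewrite Cmod_rho_cis; lra.
Qed.

Lemma continuous_circle_minus x t : continuous (fun t => (c + r * cis t - x)%C) t.
Proof.
  apply continuous_Cminus; [apply continuous_Cplus; [apply continuous_const |] | apply continuous_const].
  apply continuous_Cmult; [apply continuous_const | apply continuous_cis, continuous_id].
Qed.

Lemma continuous_div_circle h x t : (forall t, continuous h t) -> Cmod (x - c) < r ->
  continuous (fun t => (h t / (c + r * cis t - x))%C) t.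
Proof.
  intros Hh Hx; apply continuous_Cmult; auto.
  apply (continuous_Cinv (fun t => (c + r * cis t - x)%C));
    [apply continuous_circle_minus | apply circle_minus_inside; auto].
Qed.

(** One step of Newton's scheme: [1 / (zeta - x) = 1 / (zeta - nu) + (x - nu) / ((zeta - nu) (zeta -
    x))]. *)
Lemma cauchy_transform_diff h x nu : (forall t, continuous h t) -> Cmod (x - c) < r -> Cmod (nu - c) < r ->
  cauchy_transform h x = (cauchy_transform h nu
    + (x - nu) * cauchy_transform (fun t => h t / (c + r * cis t - nu)) x)%C.
Proof.
  intros Hh Hx Hn; unfold cauchy_transform.
  assert (Hc := fun x t Hx => continuous_div_circle h x t Hh Hx).
  assert (Hc2 : forall t, continuous (fun t => (h t / (c + r * cis t - nu) / (c + r * cis t - x))%C) t).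
  { intros t; apply continuous_div_circle; auto. }
  rewrite <- CI_Cmult_l by (apply ex_CI_continuous; auto).
  rewrite <- CI_plus.
  - apply CI_ext; intros t _.
    assert (N1 := circle_minus_inside x t Hx); assert (N2 := circle_minus_inside nu t Hn); field; auto.
  - apply ex_CI_continuous; auto.
  - apply ex_CI_continuous; intros; apply continuous_Cmult; auto; apply continuous_const.
Qed.

(** Removing a node replaces [h] by its divided difference, whose values at the other nodes are at
    most [2 * eps / delta]; the factor [c - nu] in front is at most [W]. So each node multiplies the
    error by [2 * W / delta] at most. *)
Lemma newton_bound (delta W : R) : 0 < delta -> delta <= 2 * W -> W < r ->
  forall ns h eps, (forall t, continuous h t) -> 0 <= eps ->
  (forall nu, In nu ns -> Cmod (nu - c) <= W /\ Cmod (cauchy_transform h nu) <= eps) ->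
  ForallOrdPairs (fun a b => delta <= Cmod (b - a)) ns ->
  Cmod (cauchy_transform h c) <= eps * (INR (length ns) * (2 * W / delta) ^ length ns)
    + Cmod (node_prod c ns) * Cmod (cauchy_transform (fun t => h t / node_prod (c + r * cis t) ns)%C c).
Proof.
  intros Hd HdW HWr; set (q := 2 * W / delta).
  assert (Hq : 1 <= q).
  { apply Rmult_le_reg_r with delta; auto; unfold q; replace (2 * W / delta * delta) with (2 * W) by (field; lra); lra. }
  assert (Hcc : Cmod (c - c) < r) by (replace (c - c)%C with (RtoC 0) by ring; rewrite Cmod_0; auto).
  induction ns as [|nu ns IH]; intros h eps Hh He Hns Hsep.
  - simpl; rewrite Cmod_1, Rmult_0_l, Rmult_0_r, Rplus_0_l, Rmult_1_l; right; f_equal.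
    apply CI_ext; intros t _; assert (N := circle_minus_inside c t Hcc); field; auto.
  - inversion Hsep as [|? ? Hnu Hsep']; subst; rewrite Forall_forall in Hnu.
    destruct (Hns nu (or_introl eq_refl)) as [Hn1 Hn2].
    set (h' := fun t => (h t / (c + r * cis t - nu))%C).
    assert (Hh' : forall t, continuous h' t) by (intros; apply continuous_div_circle; auto; lra).
    assert (IH' := IH h' (2 * eps / delta) Hh').
    assert (IHc : Cmod (cauchy_transform h' c) <= 2 * eps / delta * (INR (length ns) * q ^ length ns)
      + Cmod (node_prod c ns) * Cmod (cauchy_transform (fun t => h' t / node_prod (c + r * cis t) ns)%C c)).
    { apply IH'; auto; [apply Rdiv_le_0_compat; lra |].
      intros mu Hmu; destruct (Hns mu (or_intror Hmu)) as [Hm1 Hm2]; split; auto.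
      specialize (Hnu mu Hmu).
      assert (E : cauchy_transform h mu = (cauchy_transform h nu + (mu - nu) * cauchy_transform h' mu)%C)
        by (apply cauchy_transform_diff; auto; lra).
      assert (E2 : ((mu - nu) * cauchy_transform h' mu = cauchy_transform h mu - cauchy_transform h nu)%C) by (rewrite E; ring).
      apply (f_equal Cmod) in E2; rewrite Cmod_mult in E2.
      assert (T := Cmod_triangle_minus (cauchy_transform h mu) (cauchy_transform h nu)).
      apply Rmult_le_reg_l with delta; auto.
      replace (delta * (2 * eps / delta)) with (2 * eps) by (field; lra).
      apply Rle_trans with (Cmod (mu - nu) * Cmod (cauchy_transform h' mu)); [| lra].
      apply Rmult_le_compat_r; auto; apply Cmod_ge_0. }
    assert (Ec : cauchy_transform h c = (cauchy_transform h nu + (c - nu) * cauchy_transform h' c)%C)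
      by (apply cauchy_transform_diff; auto; lra).
    rewrite Ec.
    apply Rle_trans with (1 := Cmod_triangle _ _); rewrite Cmod_mult.
    assert (Hcn : Cmod (c - nu) <= W) by (rewrite Cmod_minus_sym; auto).
    assert (Eh : cauchy_transform (fun t => (h t / node_prod (c + r * cis t) (nu :: ns))%C) c
       = cauchy_transform (fun t => (h' t / node_prod (c + r * cis t) ns)%C) c).
    { apply CI_ext; intros t _; unfold h'; simpl node_prod.
      assert (N1 := circle_minus_inside nu t ltac:(lra)).
      assert (N2 : node_prod (c + r * cis t) ns <> 0).
      { assert (Hin : forall mu, In mu ns -> Cmod (mu - c) < r) by (intros mu Hmu; destruct (Hns mu (or_intror Hmu)); lra).
        clear - Hr Hin; induction ns as [|mu ns IHn]; [apply C1_nz |].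
        simpl; apply Cmult_neq_0; [apply circle_minus_inside, Hin; now left | apply IHn; intros; apply Hin; now right]. }
      assert (N := circle_minus_inside c t Hcc); field; auto. }
    rewrite Eh; simpl node_prod; rewrite Cmod_mult; simpl length; rewrite S_INR, <- tech_pow_Rmult.
    set (P := Cmod (node_prod c ns)) in *.
    set (Y := Cmod (cauchy_transform (fun t => (h' t / node_prod (c + r * cis t) ns)%C) c)) in *.
    set (m := length ns) in *; assert (Hm := pos_INR m).
    assert (Hqm : 1 <= q ^ m) by (apply pow_R1_Rle; auto).
    assert (S1 : Cmod (c - nu) * Cmod (cauchy_transform h' c) <=
      Cmod (c - nu) * (2 * eps / delta * (INR m * q ^ m)) + Cmod (c - nu) * P * Y).
    { rewrite Rmult_assoc, <- Rmult_plus_distr_l; apply Rmult_le_compat_l; auto; apply Cmod_ge_0. }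
    assert (S2 : Cmod (c - nu) * (2 * eps / delta * (INR m * q ^ m)) <= eps * (INR m * (q * q ^ m))).
    { replace (eps * (INR m * (q * q ^ m))) with (W * (2 * eps / delta * (INR m * q ^ m))) by (unfold q; field; lra).
      apply Rmult_le_compat_r; auto; apply Rmult_le_pos; [apply Rdiv_le_0_compat; lra | apply Rmult_le_pos; lra]. }
    assert (S3 : eps <= eps * (q * q ^ m)) by (assert (1 <= q * q ^ m) by nra; nra).
    lra.
Qed.

Lemma interpolation_bound (f : C -> C) (ns : list C) (eps delta W B : R) : holo f ->
  0 < delta -> delta <= 2 * W -> W < r -> 0 <= eps ->
  (forall nu, In nu ns -> Cmod (nu - c) <= W /\ Cmod (f nu) <= eps) ->
  ForallOrdPairs (fun a b => delta <= Cmod (b - a)) ns ->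
  (forall t, Cmod (f (c + r * cis t)%C) <= B) ->
  Cmod (f c) <= eps * (INR (length ns) * (2 * W / delta) ^ length ns)
    + Cmod (node_prod c ns) * (B / (r - W) ^ length ns).
Proof.
  intros Hf Hd HdW HWr He Hns Hsep HB; assert (HP := PI_gt_3).
  set (h := fun t => (f (c + r * cis t) * (r * cis t))%C).
  assert (Hcg : forall t, continuous (fun t => (c + r * cis t)%C) t).
  { intros t; apply continuous_Cplus; [apply continuous_const |].
    apply continuous_Cmult; [apply continuous_const | apply continuous_cis, continuous_id]. }
  assert (Hh : forall t, continuous h t).
  { intros t; apply continuous_Cmult.
    - apply (continuous_comp (fun t => (c + r * cis t)%C) f); auto; now apply holo_continuous.
    - apply continuous_Cmult; [apply continuous_const | apply continuous_cis, continuous_id]. }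
  assert (Hcf : forall x, Cmod (x - c) < r -> cauchy_transform h x = (2 * PI * f x)%C).
  { intros x Hx.
    assert (E := cauchy_formula_0 (fun w => f (c + w)%C) (x - c)%C r (holo_shift f c Hf) Hx).
    replace (f x) with (f (c + (x - c))%C) by (f_equal; ring); rewrite E.
    apply CI_ext; intros t _; unfold h.
    replace (r * cis t - (x - c))%C with (c + r * cis t - x)%C by ring; reflexivity. }
  assert (Hcc : Cmod (c - c) < r) by (replace (c - c)%C with (RtoC 0) by ring; rewrite Cmod_0; auto).
  assert (E2 : forall x, Cmod (2 * PI * x) = 2 * PI * Cmod x).
  { intros x; rewrite !Cmod_mult, !Cmod_R, !Rabs_right by lra; auto. }
  assert (N := newton_bound delta W Hd HdW HWr ns h (2 * PI * eps) Hh ltac:(apply Rmult_le_pos; lra)).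
  rewrite Hcf, E2 in N by auto.
  assert (NB : 2 * PI * Cmod (f c) <= 2 * PI * eps * (INR (length ns) * (2 * W / delta) ^ length ns) +
    Cmod (node_prod c ns) * Cmod (cauchy_transform (fun t => (h t / node_prod (c + r * cis t) ns)%C) c)).
  { apply N; auto; intros nu Hnu; destruct (Hns nu Hnu) as [H1 H2]; split; auto.
    rewrite Hcf, E2 by lra; apply Rmult_le_compat_l; lra. }
  clear N.
  assert (Hrw : 0 < (r - W) ^ length ns) by (apply pow_lt; lra).
  assert (Hprod : forall t, (r - W) ^ length ns <= Cmod (node_prod (c + r * cis t) ns)).
  { intros t; assert (Hin : forall nu, In nu ns -> Cmod (nu - c) <= W) by (intros; now apply Hns).
    clear - Hr HWr Hin; induction ns as [|nu ns IH]; [simpl; rewrite Cmod_1; lra |].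
    simpl; rewrite Cmod_mult; apply Rmult_le_compat; [lra | apply pow_le; lra | | apply IH; intros; apply Hin; now right].
    specialize (Hin nu (or_introl eq_refl)).
    replace (c + r * cis t - nu)%C with (r * cis t - (nu - c))%C by ring.
    apply Rle_trans with (2 := Cmod_triangle_rev _ _); rewrite Cmod_rho_cis; lra. }
  assert (Hpn : forall t, node_prod (c + r * cis t) ns <> 0).
  { intros t; apply Cmod_gt_0; apply Rlt_le_trans with (2 := Hprod t); auto. }
  assert (Hcp : forall t, continuous (fun t => node_prod (c + r * cis t) ns) t).
  { intros t; clear - Hcg; induction ns as [|nu ns IH]; [apply continuous_const |].
    simpl; apply continuous_Cmult; auto; apply continuous_circle_minus. }
  assert (HG : Cmod (cauchy_transform (fun t => (h t / node_prod (c + r * cis t) ns)%C) c)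
     <= (2 * PI - 0) * (B / (r - W) ^ length ns)).
  { apply Cmod_CI_le_const; [lra | |].
    - apply ex_CI_continuous; intros t _; apply continuous_div_circle; auto.
      intros s; apply continuous_Cmult; auto; apply (continuous_Cinv (fun t => node_prod (c + r * cis t) ns)); auto.
    - intros t _.
      replace (c + r * cis t - c)%C with (r * cis t)%C by ring.
      assert (Er : Cmod (r * cis t) = r) by (apply Cmod_rho_cis; lra).
      assert (Nr : (r * cis t)%C <> 0) by (apply Cmod_gt_0; lra).
      unfold h; replace (f (c + r * cis t) * (r * cis t) / node_prod (c + r * cis t) ns / (r * cis t))%C
        with (f (c + r * cis t) / node_prod (c + r * cis t) ns)%C
        by (field; repeat split; auto; [apply cis_neq_0 | apply RtoC_neq; lra]).
      rewrite Cmod_div by auto; unfold Rdiv; apply Rmult_le_compat; auto; [apply Cmod_ge_0 | |].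
      + left; apply Rinv_0_lt_compat, Cmod_gt_0; auto.
      + apply Rinv_le_contravar; auto. }
  assert (Cmod (node_prod c ns) * Cmod (cauchy_transform (fun t => (h t / node_prod (c + r * cis t) ns)%C) c)
    <= Cmod (node_prod c ns) * ((2 * PI - 0) * (B / (r - W) ^ length ns)))
    by (apply Rmult_le_compat_l; auto; apply Cmod_ge_0).
  apply Rmult_le_reg_l with (2 * PI); lra.
Qed.

End Interpolation.

Section Window.
Variables (nu : nat -> C) (n0 : nat).

(** Nodes are added in pairs symmetric about [n0], so that each induction step on the node
    polynomial meets two factors with the same bound. *)
Fixpoint window (M : nat) : list C :=
  match M with
  | O => [nu n0]
  | S k => nu (n0 + S k) :: nu (n0 - S k) :: window k
  end.

Lemma length_window M : length (window M) = (2 * M + 1)%nat.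
Proof. induction M; simpl; [auto | rewrite IHM; lia]. Qed.

Lemma In_window x M : (M <= n0)%nat -> In x (window M) ->
  exists i, (n0 - M <= i <= n0 + M)%nat /\ x = nu i.
Proof.
  induction M; intros HM Hx.
  - destruct Hx as [<-|[]]; exists n0; split; auto; lia.
  - destruct Hx as [<-|[<-|Hx]].
    + exists (n0 + S M)%nat; split; auto; lia.
    + exists (n0 - S M)%nat; split; auto; lia.
    + destruct IHM as [i [Hi E]]; [lia | auto | exists i; split; auto; lia].
Qed.

Lemma window_separated (delta : R) M : (M <= n0)%nat ->
  (forall i j, (n0 - M <= i <= n0 + M)%nat -> (n0 - M <= j <= n0 + M)%nat -> i <> j -> delta <= Cmod (nu j - nu i)) ->
  ForallOrdPairs (fun a b => delta <= Cmod (b - a)) (window M).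
Proof.
  induction M; intros HM H.
  - repeat constructor.
  - simpl; constructor; [| constructor].
    + rewrite Forall_forall; intros x [<-|Hx]; [apply H; lia |].
      destruct (In_window x M ltac:(lia) Hx) as [i [Hi ->]]; apply H; lia.
    + rewrite Forall_forall; intros x Hx.
      destruct (In_window x M ltac:(lia) Hx) as [i [Hi ->]]; apply H; lia.
    + apply IHM; [lia | intros; apply H; lia].
Qed.

(** The inductive step of bounding the product [(a + D) ... (a + M D)] by the [M]-th power of its
    mean. Using the mean instead of the largest factor gains nearly [2] per node, without which the
    final count of exponents would fail. *)
Lemma AP_power_le a D (M : nat) : 0 <= a -> 0 <= D ->
  (a + (INR M + 1) * D / 2) ^ M * (a + INR (S M) * D) <= (a + (INR (S M) + 1) * D / 2) ^ S M.
Proof.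
  intros Ha HD; rewrite S_INR; assert (HM := pos_INR M).
  set (u := a + (INR M + 1) * D / 2); assert (Hu : 0 <= u) by (unfold u; nra).
  replace (a + (INR M + 1 + 1) * D / 2) with (u + D / 2) by (unfold u; field).
  replace (a + (INR M + 1) * D) with (u + (INR M + 1) * (D / 2)) by (unfold u; field).
  set (h := D / 2); assert (Hh : 0 <= h) by (unfold h; lra).
  (* With [u] and [h] free, the claim says that two terms of the binomial expansion of
     [(u + h) ^ (m + 1)] are at most the whole. *)
  clearbody u h; clear a D Ha HD.
  assert (K : forall m, u ^ m * (u + (INR m + 1) * h) <= (u + h) ^ S m); [| apply K].
  induction m; [simpl; lra |].
  rewrite S_INR, <- tech_pow_Rmult, <- (tech_pow_Rmult (u + h) (S m)).
  apply Rle_trans with ((u + h) * (u ^ m * (u + (INR m + 1) * h))); [| apply Rmult_le_compat_l; lra].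
  assert (0 <= u ^ m) by now apply pow_le.
  assert (Hm := pos_INR m).
  assert (0 <= u ^ m * ((INR m + 1) * (h * h))) by (apply Rmult_le_pos; auto; apply Rmult_le_pos; nra).
  lra.
Qed.

Lemma window_prod_le (c : C) (a D : R) M : 0 <= a -> 0 <= D -> (M <= n0)%nat ->
  (forall j, (j <= M)%nat -> Cmod (c - nu (n0 + j)%nat) <= a + INR j * D /\ Cmod (c - nu (n0 - j)%nat) <= a + INR j * D) ->
  Cmod (node_prod c (window M)) <= a * ((a + (INR M + 1) * D / 2) ^ M) ^ 2.
Proof.
  intros Ha HD; induction M; intros HM H.
  - destruct (H O (le_n _)) as [H0 _]; rewrite Nat.add_0_r in H0; simpl in *.
    rewrite Cmod_mult, Cmod_1; lra.
  - assert (IH := IHM ltac:(lia) ltac:(intros; apply H; lia)); clear IHM.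
    destruct (H (S M) (le_n _)) as [H1 H2].
    simpl window; simpl node_prod; rewrite !Cmod_mult.
    set (P := (a + (INR M + 1) * D / 2) ^ M) in *.
    set (x := a + INR (S M) * D) in *.
    assert (Q := AP_power_le a D M Ha HD); fold P x in Q.
    assert (HP : 0 <= P) by (apply pow_le; pose proof (pos_INR M); nra).
    assert (Hx : 0 <= x) by (apply Rle_trans with (2 := H1), Cmod_ge_0).
    apply Rle_trans with (x * (x * (a * P ^ 2))).
    { apply Rmult_le_compat; auto; [apply Cmod_ge_0 | apply Rmult_le_pos; apply Cmod_ge_0 |].
      apply Rmult_le_compat; auto; apply Cmod_ge_0. }
    replace (x * (x * (a * P ^ 2))) with (a * (P * x) ^ 2) by ring.
    apply Rmult_le_compat_l; auto; apply pow_incr; split; auto; apply Rmult_le_pos; auto.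
Qed.

End Window.

Lemma mul_sin_ge al : - (PI / 2) <= al <= PI / 2 -> PI / 2 * Rabs (sin al) - cos al <= al * sin al.
Proof.
  assert (HP := PI_gt_3).
  assert (K : forall b, 0 <= b <= PI / 2 -> PI / 2 * Rabs (sin b) - cos b <= b * sin b).
  { intros b Hb; assert (0 <= sin b) by (apply sin_ge_0; lra); rewrite Rabs_right by lra.
    assert (H1 := mul_cos_le_sin (PI / 2 - b) ltac:(lra)); rewrite cos_shift, sin_shift in H1; lra. }
  intros Ha; destruct (Rle_lt_dec 0 al); [apply K; lra |].
  specialize (K (- al) ltac:(lra)); rewrite sin_neg, cos_neg, Rabs_Ropp in K; lra.
Qed.

Lemma exp_pow x n : exp x ^ n = exp (INR n * x).
Proof.
  induction n; [simpl; now rewrite Rmult_0_l, exp_0 |].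
  rewrite S_INR, <- tech_pow_Rmult, IHn, <- exp_plus; f_equal; ring.
Qed.

Lemma exp_opp_1_le : exp (- (1)) <= 3 / 8.
Proof.
  assert (H := exp_lower_3 1 ltac:(lra)); rewrite exp_Ropp.
  replace (3 / 8) with (/ (8 / 3)) by field; apply Rinv_le_contravar; lra.
Qed.

Lemma sandwich_nat x : 0 <= x -> exists M : nat, x <= INR M <= x + 1.
Proof. intros Hx; destruct (nfloor_ex x Hx) as [n Hn]; exists (S n); rewrite S_INR; lra. Qed.

Section XiLike.
Variables (f : C -> C) (A : R).
Hypothesis Hf : xi_like f A.

(** [mul_sin_ge] exchanges the angle in [Psi] for the decay [PI / 4 * |Im w|]; its error [cos]
    cancels the [- 1] beside the logarithm. The left half-plane follows by evenness. *)
Lemma vertical_upper l w : 2 * PI <= l -> 1 <= Cmod w <= l ->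
  Cmod (f w) <= exp (A + 4 * ln l + Rabs (Re w) * loglam l / 2 - PI / 4 * Rabs (Im w)).
Proof.
  assert (HP := PI_gt_3).
  assert (K : 2 * PI <= l -> forall w, 0 <= Re w -> 1 <= Cmod w <= l ->
    Cmod (f w) <= exp (A + 4 * ln l + Rabs (Re w) * loglam l / 2 - PI / 4 * Rabs (Im w))).
  { clear w; intros Hl w Hre Hw; destruct (polar_half w Hre) as [t [Ht E]].
    set (rho := Cmod w) in *.
    assert (U := xl_upper f A Hf rho t ltac:(lra) Ht).
    rewrite <- E in U; apply Rle_trans with (1 := U), exp_le_compat.
    assert (Er : Re w = rho * cos t) by (rewrite E; unfold cis; simpl; ring).
    assert (Ei : Im w = rho * sin t) by (rewrite E; unfold cis; simpl; ring).
    rewrite (Rabs_right (Re w)) by lra.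
    rewrite Ei, Rabs_mult, (Rabs_right rho) by lra.
    assert (L1 := ln_le_compat rho l ltac:(lra) ltac:(lra)).
    assert (L2 : ln (rho / (2 * PI)) <= loglam l).
    { apply ln_le_compat; [apply Rdiv_lt_0_compat; lra |]; unfold Rdiv; apply Rmult_le_compat_r; [| lra].
      left; apply Rinv_0_lt_compat; lra. }
    assert (S := mul_sin_ge t Ht); unfold Psi.
    assert (rho * (PI / 2 * Rabs (sin t) - cos t) <= rho * (t * sin t)) by (apply Rmult_le_compat_l; lra).
    assert (Re w * ln (rho / (2 * PI)) <= Re w * loglam l) by (apply Rmult_le_compat_l; lra).
    rewrite Er in *; lra. }
  intros Hl Hw; destruct (Rle_lt_dec 0 (Re w)) as [H|H]; [apply K; auto |].
  rewrite <- (xl_even f A Hf w).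
  replace (Rabs (Re w)) with (Rabs (Re (- w)%C)) by (rewrite re_opp; apply Rabs_Ropp).
  replace (Rabs (Im w)) with (Rabs (Im (- w)%C)) by (rewrite im_opp; apply Rabs_Ropp).
  apply K; auto; [rewrite re_opp; lra | now rewrite Cmod_opp].
Qed.

(** Real part [5 / 2] is the closest to the axis at which the lower Stirling bound holds. The angle
    is at most [PI / 2], and [- 5 / 4] is half of [5 / 2] times the [- 1] in [Psi]. *)
Lemma vertical_lower T : 8 <= T -> exp (- A - 5 / 4 - PI / 4 * T) <= Cmod (f (5 / 2, T)).
Proof.
  intros HT; assert (HP := PI_gt_3); assert (HP4 := PI_4).
  destruct (polar_half (5 / 2, T) ltac:(simpl; lra)) as [t [Ht E]].
  set (rho := Cmod (5 / 2, T)) in *.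
  assert (Hrho : T <= rho).
  { unfold rho; apply Rle_trans with (2 := Im_le_Cmod _); simpl; apply Rle_abs. }
  assert (Er : 5 / 2 = rho * cos t).
  { apply (f_equal Re) in E; unfold cis in E; simpl in E; lra. }
  assert (Ei : T = rho * sin t).
  { apply (f_equal Im) in E; unfold cis in E; simpl in E; lra. }
  assert (Lo := xl_lower_right f A Hf rho t ltac:(lra) Ht ltac:(lra)).
  rewrite <- E in Lo; apply Rle_trans with (2 := Lo), exp_le_compat.
  assert (L1 : 0 <= ln rho) by (rewrite <- ln_1; apply ln_le_compat; lra).
  assert (L2 : 0 <= ln (rho / (2 * PI))).
  { rewrite <- ln_1; apply ln_le_compat; [lra |].
    apply Rmult_le_reg_r with (2 * PI); [lra |]; replace (rho / (2 * PI) * (2 * PI)) with rho by (field; lra); lra. }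
  unfold Psi.
  replace (rho / 2 * (cos t * (ln (rho / (2 * PI)) - 1) - t * sin t)) with
    (/ 2 * ((rho * cos t) * (ln (rho / (2 * PI)) - 1) - t * (rho * sin t))) by field.
  rewrite <- Er, <- Ei.
  assert (t * T <= PI / 2 * T) by (apply Rmult_le_compat_r; lra); lra.
Qed.

(** [y ^ (2 n)] is at most [exp (- 2 n)] with [2 n] about [l L / 2], which cancels the leading term
    of [f l]; the next term of [Psi l 0] is [- l / 2]. *)
Lemma node_upper n l y : 10 <= l -> (l * C_derive f l)%C = (2 * INR n * f l)%C -> 0 < y <= exp (- (1)) ->
  y ^ (2 * n) * Cmod (f l) <= exp (A + 4 * bound_M A + 4 * ln l - l / 2).
Proof.
  intros Hl Hs Hy; assert (HP := PI_gt_3).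
  assert (U := xl_upper f A Hf l 0 ltac:(lra) ltac:(lra)).
  rewrite cis_0, Cmult_1_r, Psi_0 in U.
  assert (B := two_n_bound f A Hf n l Hl Hs); apply Rabs_le_between in B.
  apply Rle_trans with (exp (- (1)) ^ (2 * n) * exp (A + 4 * ln l + l / 2 * (loglam l - 1))).
  - apply Rmult_le_compat; auto; [apply pow_le; lra | apply Cmod_ge_0 | apply pow_incr; lra].
  - rewrite exp_pow, <- exp_plus, mult_INR; apply exp_le_compat; simpl INR; lra.
Qed.

End XiLike.

(* The Newton remainder: each of the [2 M] outer nodes gains a factor at most [exp (-5/4)]. *)
Lemma node_ratio_pow (P Q : R) (M : nat) : 0 <= P -> 0 < Q -> P <= 267 / 1000 * Q ->
  (P ^ M) ^ 2 / Q ^ (2 * M) <= exp (- (5 / 2 * INR M)).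
Proof.
  intros HP HQ H.
  (* From [exp (- / 16) >= 15 / 16], raised to the power [20]. *)
  assert (E : 267 / 1000 <= exp (- (5 / 4))).
  { replace (- (5 / 4)) with (INR 20 * (- / 16)) by (simpl; field); rewrite <- exp_pow.
    apply Rle_trans with ((15 / 16) ^ 20); [lra | apply pow_incr; pose proof (exp_ineq1_le (- / 16)); lra]. }
  assert (HQm : 0 < Q ^ (2 * M)) by now apply pow_lt.
  apply Rmult_le_reg_r with (Q ^ (2 * M)); auto.
  replace ((P ^ M) ^ 2 / Q ^ (2 * M) * Q ^ (2 * M)) with ((P ^ M) ^ 2) by (field; lra).
  rewrite <- pow_mult, Nat.mul_comm.
  replace (exp (- (5 / 2 * INR M))) with (exp (- (5 / 4)) ^ (2 * M)).
  2: { rewrite exp_pow, mult_INR; f_equal; simpl; field. }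
  rewrite <- Rpow_mult_distr; apply pow_incr; split; auto.
  apply Rle_trans with (1 := H), Rmult_le_compat_r; lra.
Qed.

(** * The imaginary axis *)

Lemma Cmod_imag t : Cmod (0, t) = Rabs t.
Proof.
  replace ((0, t) : C) with (Ci * t)%C by (apply C_ext; simpl; ring).
  rewrite Cmod_mult, Cmod_Ci, Cmod_R; ring.
Qed.

(** From [l = 2 pi exp L] and [exp L >= (L / 4) ^ 4]. It makes the amplification [exp (O (L ^ 3))]
    of the interpolation negligible against [exp (- c l)]. *)
Lemma cube_le_of_loglam l : 0 < l -> 1000000 <= loglam l -> 2000 * loglam l ^ 3 <= l.
Proof.
  intros Hl HL; assert (HP := PI_gt_3); set (L := loglam l) in *.
  assert (El : l = 2 * PI * exp L).
  { unfold L, loglam; rewrite exp_ln by (apply Rdiv_lt_0_compat; lra); field; lra. }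
  assert (E4 : (L / 4) ^ 4 <= exp L).
  { replace L with (INR 4 * (L / 4)) at 2 by (simpl; field); rewrite <- exp_pow.
    apply pow_incr; split; [lra | apply id_le_exp]. }
  assert (L3 : 0 < L ^ 3) by (apply pow_lt; lra).
  replace ((L / 4) ^ 4) with (L * L ^ 3 / 256) in E4 by field.
  assert (1000000 * L ^ 3 <= L * L ^ 3) by (apply Rmult_le_compat_r; lra).
  assert (exp L <= l) by (rewrite El; pose proof (exp_pos L); nra); lra.
Qed.

Section XiLike.
Variables (f : C -> C) (A : R).
Hypothesis Hf : xi_like f A.

(* Numerical core: with [L = loglam l], the interpolation bound through [2 M + 1] nodes, [M ~ L ^ 2], is smaller than the value it bounds. *)
Lemma interpolation_too_small (l y : R) (M : nat) (ns : list C) :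
  10 <= l -> 1000000 <= loglam l -> 25 / y <= loglam l -> 10 * Rabs A <= loglam l ->
  0 < y <= exp (- (1)) -> loglam l ^ 2 <= INR M <= loglam l ^ 2 + 1 -> length ns = (2 * M + 1)%nat ->
  (forall nu, In nu ns -> Cmod (nu - (5 / 2, y * l)) <= 5 / 2 + INR M * (4 * y / loglam l) /\
    Cmod (f nu) <= exp (- (49 / 100 * l))) ->
  ForallOrdPairs (fun a b => y / loglam l <= Cmod (b - a)) ns ->
  Cmod (node_prod (5 / 2, y * l) ns) <= 5 / 2 * ((5 / 2 + (INR M + 1) * (4 * y / loglam l) / 2) ^ M) ^ 2 ->
  False.
Proof.
  intros Hl HL Hy25 HA Hy HM Hlen Hns Hsep Hprod.
  assert (HP := PI_gt_3); assert (HP4 := PI_4).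
  assert (Hl3 := cube_le_of_loglam l ltac:(lra) HL).
  assert (Hlnl : ln l <= loglam l + 7).
  { unfold loglam; rewrite ln_div by lra.
    assert (ln (2 * PI) <= 2 * PI - 1); [| lra].
    pose proof (exp_ineq1_le (ln (2 * PI))); rewrite exp_ln in *; lra. }
  set (L := loglam l) in *; set (m := INR M) in *.
  assert (Hy38 : y <= 3 / 8) by (pose proof exp_opp_1_le; lra).
  assert (HyL : 25 <= y * L).
  { apply (Rmult_le_compat_r y) in Hy25; [| lra]; replace (25 / y * y) with 25 in Hy25 by (field; lra); lra. }
  assert (HL2 : 1000000 * L <= L ^ 2) by nra.
  assert (HL3 : 1000000 * L ^ 2 <= L ^ 3) by (simpl; nra).
  (* The distance allowed per index step along the axis; [w = m * D], about [4 y L], is then the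
     half-length of the window. *)
  set (D := 4 * y / L) in *.
  assert (HD : 0 < D) by (apply Rdiv_lt_0_compat; lra).
  assert (ED : D * L = 4 * y) by (unfold D; field; lra).
  set (w := m * D) in *.
  (* [w] is at least [L ^ 2 * D = 4 y L], and [25 / y <= L]. A large [w] hides the offset [5 / 2]
     between the axis and the centre. *)
  assert (Hw100 : 100 <= w).
  { apply Rle_trans with (L ^ 2 * D); [| apply Rmult_le_compat_r; lra].
    replace (L ^ 2 * D) with (L * (D * L)) by ring; rewrite ED; lra. }
  assert (HwL : w * L = 4 * y * m) by (unfold w; rewrite Rmult_assoc, ED; ring).
  assert (HDs : D <= / 100) by (apply Rmult_le_reg_r with L; lra).
  (* The factors of the node polynomial have mean about [w / 2] at the centre and size at least
     [r - W], about [2 w], on the circle. The ratio [/ 4] remains below [267 / 1000] when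
     [w >= 100]. *)
  set (r := 3 * w); set (W := 5 / 2 + w).
  assert (HwM : w <= m / 100000) by (apply Rmult_le_reg_r with L; [lra |]; rewrite HwL; nra).
  assert (HAb := Rle_abs A); assert (HAb2 := Rabs_pos A).
  set (T0 := y * l).
  assert (HT0 : 1000 * L <= T0).
  { unfold T0; apply Rle_trans with (y * (2000 * L ^ 3)); [| apply Rmult_le_compat_l; lra].
    replace (y * (2000 * L ^ 3)) with (2000 * (y * L) * L ^ 2) by ring; nra. }
  assert (Hrl : r <= 5 * L).
  { unfold r; apply Rmult_le_reg_r with L; [lra |].
    replace (3 * w * L) with (3 * (w * L)) by ring; rewrite HwL.
    assert (y * m <= 3 / 8 * m) by (apply Rmult_le_compat_r; lra).
    replace (5 * L * L) with (5 * L ^ 2) by ring; lra. }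
  fold T0 in Hprod, Hns.
  assert (Lo := vertical_lower f A Hf T0 ltac:(lra)).
  set (B := exp (A + 4 * ln l + (r + 5 / 2) * L / 2 - PI / 4 * (T0 - r))).
  assert (HB : forall t, Cmod (f (((5 / 2)%R, T0) + r * cis t)%C) <= B).
  { intros t; set (g := (((5 / 2)%R, T0) + r * cis t)%C).
    assert (Gr : Cmod (r * cis t) = r) by (apply Cmod_rho_cis; unfold r; lra).
    assert (R1 := Re_le_Cmod (r * cis t)); assert (I1 := Im_le_Cmod (r * cis t)); rewrite Gr in R1, I1.
    apply Rabs_le_between in R1; apply Rabs_le_between in I1.
    assert (ER : Re g = 5 / 2 + Re (r * cis t)) by reflexivity.
    assert (EI : Im g = T0 + Im (r * cis t)) by reflexivity.
    assert (GI1 : T0 - r <= Rabs (Im g)) by (rewrite EI; apply Rle_trans with (2 := Rle_abs _); lra).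
    assert (GI2 : Rabs (Im g) <= T0 + r) by (rewrite EI; apply Rabs_le; lra).
    assert (GR : Rabs (Re g) <= r + 5 / 2) by (rewrite ER; apply Rabs_le; lra).
    assert (G1 : T0 - r <= Cmod g) by (apply Rle_trans with (2 := Im_le_Cmod g); auto).
    assert (G2 : Cmod g <= l).
    { apply Rle_trans with (1 := Cmod_le_Re_Im g).
      assert (T0 <= 3 / 8 * l) by (apply Rmult_le_compat_r; lra).
      clear - GR GI2 Hrl H HL HL2 HL3 Hl3; lra. }
    assert (Hl7 : 2 * PI <= l) by lra.
    apply Rle_trans with (1 := vertical_upper f A Hf l g Hl7 ltac:(lra)); apply exp_le_compat; fold L.
    assert (Rabs (Re g) * L <= (r + 5 / 2) * L) by (apply Rmult_le_compat_r; lra).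
    assert (PI / 4 * (T0 - r) <= PI / 4 * Rabs (Im g)) by (apply Rmult_le_compat_l; lra); lra. }
  assert (Hdel : 0 < y / L) by (apply Rdiv_lt_0_compat; lra).
  assert (Hdel1 : y / L <= 2 * W) by (unfold W, D in *; lra).
  assert (I := interpolation_bound (5 / 2, T0) r ltac:(unfold r; lra) f ns (exp (- (49 / 100 * l))) (y / L) W B
    (xl_holo f A Hf) Hdel Hdel1 ltac:(unfold W, r; lra) ltac:(left; apply exp_pos) Hns Hsep HB).
  rewrite Hlen in I.
  assert (Em : INR (2 * M + 1) = 2 * m + 1) by (rewrite plus_INR, mult_INR; fold m; simpl; ring).
  (* The values at the nodes: their amplification is [exp] of about [2 L ^ 3], at most [l / 1000],
     while the target is only as small as [exp (- 3 / 8 * l)] because [PI / 4 * y <= 3 / 8]. *)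
  assert (T1 : exp (- (49 / 100 * l)) * (INR (2 * M + 1) * (2 * W / (y / L)) ^ (2 * M + 1))
    <= exp (- A - 5 / 4 - PI / 4 * T0) / 4).
  { assert (Q1 : 0 <= 2 * W / (y / L)) by (apply Rdiv_le_0_compat; lra).
    assert (Q2 : 2 * W / (y / L) <= exp L).
    { replace (2 * W / (y / L)) with (5 * L / y + 8 * m).
      2: { unfold W, w, D; field; lra. }
      assert (5 * L / y <= L * L).
      { apply Rmult_le_reg_r with y; [lra |]; replace (5 * L / y * y) with (5 * L) by (field; lra); nra. }
      apply Rle_trans with (L ^ 3); [simpl in *; nra |].
      assert (E : l = 2 * PI * exp L).
      { unfold L, loglam; rewrite exp_ln by (apply Rdiv_lt_0_compat; lra); field; lra. }
      pose proof (exp_pos L); nra. }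
    apply Rle_trans with (exp (- (49 / 100 * l)) * (exp (2 * m + 1) * exp ((2 * m + 1) * L))).
    { apply Rmult_le_compat_l; [left; apply exp_pos |].
      apply Rmult_le_compat; [apply pos_INR | now apply pow_le | rewrite Em; apply id_le_exp |].
      rewrite <- Em, <- exp_pow; apply pow_incr; auto. }
    rewrite <- !exp_plus.
    apply Rle_trans with (exp (- A - 5 / 4 - PI / 4 * T0 - 2)).
    - apply exp_le_compat.
      assert (PI / 4 * T0 <= 3 / 8 * l) by (apply Rle_trans with (1 * (3 / 8 * l)); [apply Rmult_le_compat; unfold T0; nra | lra]).
      assert ((2 * m + 1) * L <= (2 * L ^ 2 + 3) * L) by (apply Rmult_le_compat_r; lra).
      replace ((2 * L ^ 2 + 3) * L) with (2 * L ^ 3 + 3 * L) in * by ring; lra.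
    - replace (- A - 5 / 4 - PI / 4 * T0 - 2) with ((- A - 5 / 4 - PI / 4 * T0) + - (2)) by ring.
      rewrite (exp_plus (- A - 5 / 4 - PI / 4 * T0)); apply Rmult_le_compat_l; [left; apply exp_pos |].
      rewrite exp_Ropp; apply Rinv_le_contravar; [lra |].
      replace 2 with (1 + 1) by ring; rewrite exp_plus; pose proof (exp_ineq1_le 1); nra. }
  (* The remainder: [node_ratio_pow] gains [5 / 2 * m] in the exponent, the growth of [f] on the
     circle costs [r * L / 2 = 6 y m], at most [9 / 4 * m], and all else is a small fraction of
     [m]. *)
  assert (T2 : Cmod (node_prod (5 / 2, T0) ns) * (B / (r - W) ^ (2 * M + 1)) <= exp (- A - 5 / 4 - PI / 4 * T0) / 4).
  { set (P := 5 / 2 + (m + 1) * D / 2) in *; set (Q := r - W).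
    assert (HQ : 197 <= Q) by (unfold Q, r, W; lra).
    assert (HPQ : P <= 267 / 1000 * Q) by (unfold P, Q, r, W; replace ((m + 1) * D / 2) with (w / 2 + D / 2) by (unfold w; field); lra).
    assert (HP0 : 0 <= P) by (unfold P; replace ((m + 1) * D / 2) with (w / 2 + D / 2) by (unfold w; field); lra).
    assert (HQm : 0 < Q ^ (2 * M)) by (apply pow_lt; lra).
    assert (HB0 : 0 < B) by apply exp_pos.
    apply Rle_trans with (5 / 2 * (P ^ M) ^ 2 * (B / Q ^ (2 * M + 1))).
    { apply Rmult_le_compat_r; auto; apply Rdiv_le_0_compat; [lra | apply pow_lt; lra]. }
    rewrite pow_add, pow_1.
    replace (5 / 2 * (P ^ M) ^ 2 * (B / (Q ^ (2 * M) * Q))) with ((5 / 2 / Q * B) * ((P ^ M) ^ 2 / Q ^ (2 * M))) by (field; split; lra).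
    assert (N := node_ratio_pow P Q M HP0 ltac:(lra) HPQ); fold m in N.
    assert (S1 : 5 / 2 / Q * B <= / 4 * B).
    { apply Rmult_le_compat_r; [lra |]; apply Rmult_le_reg_r with Q; [lra |].
      replace (5 / 2 / Q * Q) with (5 / 2) by (field; lra); lra. }
    apply Rle_trans with (/ 4 * B * exp (- (5 / 2 * m))).
    { apply Rmult_le_compat; auto; [apply Rmult_le_pos; [apply Rdiv_le_0_compat |]; lra |].
      apply Rdiv_le_0_compat; auto; apply pow2_ge_0. }
    replace (/ 4 * B * exp (- (5 / 2 * m))) with (B * exp (- (5 / 2 * m)) / 4) by field.
    apply Rmult_le_compat_r; [lra |]; unfold B; rewrite <- exp_plus; apply exp_le_compat.
    assert (R1 : r * L <= 9 / 2 * m).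
    { unfold r; rewrite Rmult_assoc, HwL.
      assert (y * m <= 3 / 8 * m) by (apply Rmult_le_compat_r; lra); lra. }
    assert (R2 : PI / 4 * r <= 1 * r) by (apply Rmult_le_compat_r; unfold r; lra).
    assert (R3 : r <= 3 * (m / 100000)) by (unfold r; lra).
    assert (R4 : L <= m / 1000000) by lra.
    lra. }
  assert (0 < exp (- A - 5 / 4 - PI / 4 * T0)) by apply exp_pos.
  lra.
Qed.

End XiLike.

Section XiLike.
Variables (f : C -> C) (A : R).
Hypothesis Hf : xi_like f A.

Lemma imaginary_axis_false (lam : nat -> R) (y : R) (N : nat) : 0 < y <= exp (- (1)) ->
  (forall n, (N <= n)%nat -> / 2 < lam n /\
    (lam n * C_derive f (lam n))%C = (2 * INR n * f (lam n))%C /\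
    Cmod (f (0, y * lam n)) <= y ^ (2 * n) * Cmod (f (lam n))) -> False.
Proof.
  intros Hy Hlam; assert (HP := PI_gt_3).
  set (MA := bound_M A); assert (HMA : 0 < MA) by apply exp_pos.
  destruct (scaling_spacing f A Hf) as [l0 [Hl0 Hsp]].
  destruct (scaling_unbounded f A Hf l0) as [n1 Hn1].
  set (N' := Nat.max N n1).
  assert (HN : forall i, (N' <= i)%nat -> l0 < lam i /\ (lam i * C_derive f (lam i))%C = (2 * INR i * f (lam i))%C /\
    Cmod (f (0, y * lam i)) <= y ^ (2 * i) * Cmod (f (lam i))).
  { intros i Hi; destruct (Hlam i ltac:(lia)) as [H1 [H2 H3]]; repeat split; auto; apply (Hn1 i); auto; lia. }
  (* Each summand meets one threshold for [L]; the last leaves room for the lower half of the window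
     above [N']. *)
  set (K := 1000000 + 25 / y + 10 * Rabs A + 10 * MA + INR N').
  assert (P1 : 0 <= 25 / y) by (apply Rdiv_le_0_compat; lra).
  assert (P2 := Rabs_pos A); assert (P3 := pos_INR N').
  destruct (loglam_eventually K) as [l2 [Hl2 HK]].
  destruct (scaling_unbounded f A Hf l2) as [n2 Hn2].
  set (n := Nat.max N' n2); set (l := lam n).
  destruct (HN n ltac:(lia)) as [Hl [Hs Hfl]]; fold l in Hl, Hs, Hfl.
  assert (HLK : K <= loglam l) by (apply HK; left; apply (Hn2 n); auto; [lia | lra]).
  set (L := loglam l) in *; unfold K in HLK.
  assert (Hl3 : 2000 * L ^ 3 <= l) by (apply cube_le_of_loglam; fold L; lra).
  assert (HL2 : 1000000 * L <= L ^ 2) by nra.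
  assert (HL3 : 1000000 * L ^ 2 <= L ^ 3) by (simpl; nra).
  assert (Hlnl : ln l <= L + 7).
  { unfold L, loglam; rewrite ln_div by lra.
    assert (ln (2 * PI) <= 2 * PI - 1); [| pose proof PI_4; lra].
    pose proof (exp_ineq1_le (ln (2 * PI))); rewrite exp_ln in *; lra. }
  destruct (sandwich_nat (L ^ 2) ltac:(lra)) as [M HM].
  set (m := INR M) in *.
  assert (HnM : (M + N' <= n)%nat).
  { apply INR_le; rewrite plus_INR; fold m.
    assert (B := two_n_bound f A Hf n l ltac:(lra) Hs); apply Rabs_le_between in B; fold L MA in B.
    assert (l * 1000000 <= l * L) by (apply Rmult_le_compat_l; lra); lra. }
  assert (Hwin : forall i, (n - M <= i <= n + M)%nat -> (N' <= i)%nat /\ Rabs (INR i - INR n) <= m).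
  { intros i Hi; split; [lia |].
    assert (X1 : INR n <= INR i + m) by (unfold m; rewrite <- plus_INR; apply le_INR; lia).
    assert (X2 : INR i <= INR n + m) by (unfold m; rewrite <- plus_INR; apply le_INR; lia).
    apply Rabs_le; lra. }
  assert (Hnear : forall i, (n - M <= i <= n + M)%nat -> Rabs (lam i - l) * L <= 4 * Rabs (INR i - INR n) /\ Rabs (lam i - l) <= l / 100).
  { intros i Hi; destruct (Hwin i Hi) as [H1 H2]; destruct (HN i H1) as [H3 [H4 _]].
    destruct (Hsp n i l (lam i) ltac:(lra) ltac:(lra) Hs H4 ltac:(lra)) as [H5 [_ H6]]; auto. }
  set (nu := fun i => (0, y * lam i) : C).
  assert (Hsep : forall i j, (n - M <= i <= n + M)%nat -> (n - M <= j <= n + M)%nat -> i <> j ->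
    y / L <= Cmod (nu j - nu i)).
  { intros i j Hi Hj Hij; destruct (Hwin i Hi) as [H1 H2]; destruct (Hwin j Hj) as [H1' H2'].
    destruct (HN i H1) as [H3 [H4 _]]; destruct (HN j H1') as [H3' [H4' _]].
    destruct (Hnear i Hi) as [_ H5]; assert (H6 := H5); apply Rabs_le_between in H6.
    assert (Hd : Rabs (INR j - INR i) <= lam i / 1000).
    { apply Rle_trans with (m + m); [| lra].
      replace (INR j - INR i) with ((INR j - INR n) - (INR i - INR n)) by ring.
      apply Rle_trans with (1 := Rabs_triang _ _); rewrite Rabs_Ropp; lra. }
    destruct (Hsp i j (lam i) (lam j) ltac:(lra) ltac:(lra) H4 H4' Hd) as [_ [H7 _]].
    (* Distinct indices differ by one at least, so [2 <= |lam j - lam i| * loglam (lam i) <= 2 L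
       |lam j - lam i|], which is the separation [y / L] of the nodes. *)
    assert (H8 : 1 <= Rabs (INR j - INR i)).
    { rewrite !INR_IZR_INZ, <- minus_IZR, <- abs_IZR; apply IZR_le; lia. }
    assert (H9 : loglam (lam i) <= 2 * L).
    { assert (R1 := ln_ratio_bounds l (lam i) ltac:(lra) ltac:(lra)).
      assert (R2 := loglam_ratio l (lam i) ltac:(lra) ltac:(lra)); fold L in R2.
      assert (2 * Rabs (lam i - l) / l <= 1).
      { apply Rmult_le_reg_r with l; [lra |]; replace (2 * Rabs (lam i - l) / l * l) with (2 * Rabs (lam i - l)) by (field; lra); lra. }
      pose proof (Rle_abs (ln (lam i / l))); lra. }
    replace (nu j - nu i)%C with ((0, y * (lam j - lam i)) : C) by (unfold nu; apply C_ext; simpl; ring).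
    rewrite Cmod_imag, Rabs_mult, (Rabs_right y) by lra; unfold Rdiv; apply Rmult_le_compat_l; [lra |].
    apply Rmult_le_reg_r with L; [lra |]; rewrite Rinv_l by lra.
    pose proof (Rabs_pos (lam j - lam i)).
    assert (Rabs (lam j - lam i) * loglam (lam i) <= Rabs (lam j - lam i) * (2 * L)) by (apply Rmult_le_compat_l; auto); lra. }
  assert (Hdist : forall i j, (j <= M)%nat -> (n - M <= i <= n + M)%nat -> Rabs (INR i - INR n) = INR j ->
    Cmod ((5 / 2, y * l) - nu i) <= 5 / 2 + INR j * (4 * y / L)).
  { intros i j Hj Hi E; destruct (Hnear i Hi) as [H5 _]; rewrite E in H5.
    apply Rle_trans with (1 := Cmod_le_Re_Im _).
    replace (Re ((5 / 2, y * l) - nu i)) with (5 / 2) by (simpl; ring).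
    replace (Im ((5 / 2, y * l) - nu i)) with (y * (l - lam i)) by (simpl; ring).
    rewrite (Rabs_right (5 / 2)), Rabs_mult, (Rabs_right y), Rabs_minus_sym by lra.
    apply Rplus_le_compat_l; apply Rmult_le_reg_r with L; [lra |].
    replace (INR j * (4 * y / L) * L) with (y * (4 * INR j)) by (field; lra).
    rewrite Rmult_assoc; apply Rmult_le_compat_l; lra. }
  apply (interpolation_too_small f A Hf l y M (window nu n M)); auto; fold L; fold m; try lra.
  - apply length_window.
  - intros x Hx; destruct (In_window nu n x M ltac:(lia) Hx) as [i [Hi ->]].
    destruct (Hwin i Hi) as [H1 H2]; destruct (HN i H1) as [H3 [H4 H5]].
    destruct (Hnear i Hi) as [H6 H7]; apply Rabs_le_between in H7.
    split.
    + rewrite Cmod_minus_sym.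
      assert (E : exists j, (j <= M)%nat /\ Rabs (INR i - INR n) = INR j).
      { exists (Z.to_nat (Z.abs (Z.of_nat i - Z.of_nat n))); split; [lia |].
        rewrite !INR_IZR_INZ, <- minus_IZR, <- abs_IZR, Z2Nat.id by lia; auto. }
      destruct E as [j [Hj E]].
      apply Rle_trans with (1 := Hdist i j Hj Hi E), Rplus_le_compat_l, Rmult_le_compat_r.
      * apply Rdiv_le_0_compat; lra.
      * now apply le_INR.
    (* Passing from [- lam i / 2] to [- 49 / 100 * l] absorbs the one per cent between [lam i] and
       [l] and the logarithmic terms. *)
    + apply Rle_trans with (1 := H5).
      apply Rle_trans with (1 := node_upper f A Hf i (lam i) y ltac:(lra) H4 Hy), exp_le_compat; fold MA.
      assert (ln (lam i) <= ln l + 1).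
      { assert (ln (lam i / l) <= 1).
        { assert (R1 := ln_ratio_bounds l (lam i) ltac:(lra) ltac:(apply Rabs_le; lra)).
          apply Rle_trans with (1 := Rle_abs _), Rle_trans with (1 := R1).
          apply Rmult_le_reg_r with l; [lra |]; replace (2 * Rabs (lam i - l) / l * l) with (2 * Rabs (lam i - l)) by (field; lra).
          assert (Rabs (lam i - l) <= l / 100) by (apply Rabs_le; lra); lra. }
        rewrite ln_div in * by lra; lra. }
      pose proof (Rle_abs A); lra.
  - apply window_separated; [lia | intros; apply Hsep; auto].
  - apply window_prod_le; [lra | apply Rdiv_le_0_compat; lra | lia |].
    intros j Hj; split; (apply Hdist; [auto | lia |]).
    + rewrite plus_INR; replace (INR n + INR j - INR n) with (INR j) by ring; apply Rabs_right, Rle_ge, pos_INR.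
    + rewrite minus_INR by lia; replace (INR n - INR j - INR n) with (- INR j) by ring.
      rewrite Rabs_Ropp; apply Rabs_right, Rle_ge, pos_INR.
Qed.

End XiLike.

(** * The three limits *)

Lemma nth_root_lt_1 n x : nth_root n x < 1 -> x < 1.
Proof.
  unfold nth_root; intros H; destruct (Rlt_dec 0 x) as [Hx|Hx]; [| lra].
  destruct (Rlt_le_dec x 1) as [H1|H1]; auto; exfalso.
  assert (1 <= Rpower x (/ INR n)); [| lra].
  unfold Rpower; rewrite <- exp_0 at 1; apply exp_le_compat, Rmult_le_pos.
  (* At [n = 0] the exponent is [/ 0 = 0], so it is still nonnegative. *)
  - destruct (pos_INR n) as [Hn|<-]; [left; now apply Rinv_0_lt_compat | rewrite Rinv_0; lra].
  - rewrite <- ln_1; apply ln_le_compat; lra.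
Qed.

Lemma nth_root_gt_1 n x : 1 < nth_root n x -> 1 < x.
Proof.
  unfold nth_root; intros H; destruct (Rlt_dec 0 x) as [Hx|Hx]; [| lra].
  destruct (Rlt_le_dec 1 x) as [H1|H1]; auto; exfalso.
  assert (Rpower x (/ INR n) <= 1); [| lra].
  unfold Rpower; rewrite <- exp_0; apply exp_le_compat.
  assert (0 <= / INR n) by (destruct (pos_INR n) as [Hn|<-]; [left; now apply Rinv_0_lt_compat | rewrite Rinv_0; lra]).
  assert (ln x <= 0) by (rewrite <- ln_1; apply ln_le_compat; lra); nra.
Qed.

Lemma Rbar_lim_0 (u : nat -> Rbar) : (forall n, Rbar_le 0 (u n)) ->
  (forall b, 0 < b -> eventually (fun n => Rbar_lt (u n) b)) -> is_Rbar_lim_seq u 0.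
Proof.
  intros H0 H; split; [| intros b Hb; apply H, Hb].
  intros a Ha; exists O; intros n _; apply Rbar_lt_le_trans with (2 := H0 n), Ha.
Qed.

Section XiLike.
Variables (f : C -> C) (A : R).
Hypothesis Hf : xi_like f A.

Lemma phase_lt_1 n l z : Rbar_lt (abs_exp_phase f n l z) 1 ->
  f (l * z)%C <> 0 /\ Cmod z ^ (2 * n) * Cmod (f l) < Cmod (f (l * z)%C).
Proof.
  unfold abs_exp_phase; destruct (Ceq_dec (f (l * z)%C) 0) as [E|E]; [intros [] |].
  intros H; split; auto; apply nth_root_lt_1 in H.
  assert (P := proj1 (Cmod_gt_0 _) E).
  rewrite Cmod_div, Cmod_mult, Cmod_pow in H by auto.
  apply (Rmult_lt_compat_r _ _ _ P) in H.
  replace (Cmod z ^ (2 * n) * Cmod (f l) / Cmod (f (l * z)%C) * Cmod (f (l * z)%C))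
    with (Cmod z ^ (2 * n) * Cmod (f l)) in H by (field; lra); lra.
Qed.

Lemma phase_gt_1 n l z : Rbar_lt 1 (abs_exp_phase f n l z) ->
  f (l * z)%C = 0 \/ Cmod (f (l * z)%C) < Cmod z ^ (2 * n) * Cmod (f l).
Proof.
  unfold abs_exp_phase; destruct (Ceq_dec (f (l * z)%C) 0) as [E|E]; [now left |].
  intros H; right; apply nth_root_gt_1 in H.
  assert (P := proj1 (Cmod_gt_0 _) E).
  rewrite Cmod_div, Cmod_mult, Cmod_pow in H by auto.
  apply (Rmult_lt_compat_r _ _ _ P) in H.
  replace (Cmod z ^ (2 * n) * Cmod (f l) / Cmod (f (l * z)%C) * Cmod (f (l * z)%C))
    with (Cmod z ^ (2 * n) * Cmod (f l)) in H by (field; lra); lra.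
Qed.

Lemma right_half_reduction z : exists t, - (PI / 2) <= t <= PI / 2 /\
  Rabs (Re z) = Cmod z * cos t /\ (z = (Cmod z * cis t)%C \/ z = (- (Cmod z * cis t))%C) /\
  forall l : R, f (l * z)%C = f (l * (Cmod z * cis t))%C.
Proof.
  destruct (Rle_lt_dec 0 (Re z)) as [H|H].
  - destruct (polar_half z H) as [t [Ht E]]; exists t; split; auto; split; [| split].
    + rewrite Rabs_right by lra; rewrite E at 1; unfold cis; simpl; ring.
    + now left.
    + intros l; now rewrite <- E.
  - destruct (polar_half (- z)%C ltac:(rewrite re_opp; lra)) as [t [Ht E]]; rewrite Cmod_opp in E.
    exists t; split; auto; split; [| split].
    + rewrite Rabs_left by lra; rewrite <- re_opp, E; unfold cis; simpl; ring.
    + right; rewrite <- E; ring.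
    + intros l; rewrite <- E, <- (xl_even f A Hf (l * z)%C); f_equal; ring.
Qed.

Section Sequence.
Variable lam : nat -> R.
Hypothesis Hlam : eventually (fun n => / 2 < lam n /\ (lam n * C_derive f (lam n))%C = (2 * INR n * f (lam n))%C).

Lemma eventually_scaled (P : nat -> R -> Prop) l0 : (forall n l, l0 <= l ->
    (l * C_derive f l)%C = (2 * INR n * f l)%C -> P n l) -> eventually (fun n => P n (lam n)).
Proof.
  intros HP; destruct Hlam as [N HN]; destruct (scaling_unbounded f A Hf l0) as [n1 Hn1].
  exists (N + n1)%nat; intros n Hn; destruct (HN n ltac:(lia)) as [H1 H2].
  apply HP; auto; left; apply (Hn1 n); auto; lia.
Qed.

(** The hypothesis contradicts [phase_small], so off the imaginary axis the leading nonzero one of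
    [phase_A] and [phase_B] is positive, and [phase_large] upgrades [E > 1] to exponential
    growth. *)
Lemma growth_outside (z : C) : z <> 0 -> (z ^ 2)%C <> 1 ->
  eventually (fun n => Rbar_lt 1 (abs_exp_phase f n (lam n) z)) ->
  exists c, 0 < c /\ eventually (fun n =>
    exp (c * lam n) * Cmod (f (lam n * z)%C) <= Cmod z ^ (2 * n) * Cmod (f (lam n))).
Proof.
  intros Hz Hz1 Hev; assert (HP := PI_gt_3).
  destruct (right_half_reduction z) as [t [Ht [Hre [Hzt Hfz]]]].
  set (r := Cmod z) in *; assert (Hr : 0 < r) by now apply Cmod_gt_0.
  assert (Hct : 0 <= cos t) by (apply cos_ge_0; lra).
  assert (Hlarge : 0 < phase_A r t \/ (phase_A r t = 0 /\ 0 < phase_B r t) -> exists c, 0 < c /\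
    eventually (fun n => exp (c * lam n) * Cmod (f (lam n * z)%C) <= r ^ (2 * n) * Cmod (f (lam n)))).
  { intros H; destruct (phase_large f A Hf r t Hr Ht H) as [c [l0 [Hc [_ H1]]]]; exists c; split; auto.
    apply (eventually_scaled (fun n l => exp (c * l) * Cmod (f (l * z)%C) <= r ^ (2 * n) * Cmod (f l)) l0).
    intros n l Hl Hs; rewrite Hfz; now apply H1. }
  assert (Hlt : eventually (fun n => Cmod (f (lam n * z)%C) < r ^ (2 * n) * Cmod (f (lam n)))).
  { destruct Hev as [N1 H1]; destruct Hlam as [N2 H2]; exists (N1 + N2)%nat; intros n Hn.
    destruct (phase_gt_1 _ _ _ (H1 n ltac:(lia))) as [E|H]; auto.
    rewrite E, Cmod_0; apply Rmult_lt_0_compat; [apply pow_lt; auto |].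
    apply Cmod_gt_0, (xl_neq_0 f A Hf); destruct (H2 n ltac:(lia)); lra. }
  assert (Hsmall : 0 < r * cos t -> phase_A r t < 0 \/ (phase_A r t = 0 /\ phase_B r t < 0) -> False).
  { intros Hx H; destruct (phase_small f A Hf r t Hr Ht Hx H) as [l0 H1].
    destruct (eventually_scaled (fun n l => r ^ (2 * n) * Cmod (f l) <= Cmod (f (l * z)%C)) l0) as [N1 HN1].
    { intros n l Hl Hs; rewrite Hfz; now apply H1. }
    destruct Hlt as [N2 HN2].
    specialize (HN1 (N1 + N2)%nat ltac:(lia)); specialize (HN2 (N1 + N2)%nat ltac:(lia)); cbv beta in *; lra. }
  destruct (Rlt_le_dec 0 (phase_A r t)) as [HA|HA]; [apply Hlarge; now left |].
  (* On the imaginary axis [phase_A <= 0] means [r <= exp (- (1))], the range of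
     [imaginary_axis_false]. *)
  destruct (Req_dec (cos t) 0) as [Hc0|Hc0].
  - exfalso.
    assert (Hr1 : 0 < r <= exp (- (1))).
    { split; auto; rewrite <- (exp_ln r) by auto; apply exp_le_compat.
      unfold phase_A in HA; rewrite Hc0 in HA; lra. }
    assert (Hst : sin t = 1 \/ sin t = - (1)).
    { assert (P := sin2_cos2 t); rewrite Hc0 in P; unfold Rsqr in P.
      assert (E : (sin t - 1) * (sin t + 1) = 0) by lra.
      apply Rmult_integral in E; destruct E; [left | right]; lra. }
    assert (Himag : forall l : R, f (0, r * l) = f (l * z)%C).
    { intros l; rewrite Hfz; unfold cis; rewrite Hc0; destruct Hst as [-> | ->].
      - f_equal; apply C_ext; simpl; ring.
      - rewrite <- (xl_even f A Hf); f_equal; apply C_ext; simpl; ring. }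
    destruct Hlt as [N1 H1]; destruct Hlam as [N2 H2].
    apply (imaginary_axis_false f A Hf lam r (N1 + N2) Hr1).
    intros n Hn; destruct (H2 n ltac:(lia)) as [H3 H4]; repeat split; auto.
    rewrite Himag; left; apply H1; lia.
  - assert (Hx : 0 < r * cos t) by (apply Rmult_lt_0_compat; lra).
    destruct HA as [HA|HA]; [exfalso; apply Hsmall; auto |].
    destruct (phase_B_sign r t Hr Ht Hx HA) as [HB1 HB2].
    destruct (Rtotal_order (r * cos t) 1) as [H|[H|H]].
    + exfalso; apply Hsmall; auto.
    (* [phase_A = 0] with [r * cos t = 1] gives [ln r = 0], hence [cos t = 1] and [z] is [1] or
       [-1]. *)
    + exfalso; apply Hz1.
      assert (Er : r = 1).
      { apply ln_inv; [auto | lra |]; rewrite ln_1; unfold phase_A in HA; lra. }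
      rewrite Er, Rmult_1_l in H.
      assert (Hs0 : sin t = 0).
      { assert (P := sin2_cos2 t); rewrite H in P; unfold Rsqr in P.
        assert (E : sin t * sin t = 0) by lra; apply Rmult_integral in E; tauto. }
      assert (Ec : cis t = 1) by (unfold cis; rewrite H, Hs0; reflexivity).
      rewrite Er, Ec in Hzt; destruct Hzt as [-> | ->]; simpl; ring.
    + apply Hlarge; right; auto.
Qed.

Lemma exp_over_id_unbounded (c c' a : R) : 0 < c -> 0 < c' ->
  exists l0, 1 <= l0 /\ forall l, l0 <= l -> a < c' / l * exp (c * l) - 1.
Proof.
  intros Hc Hc'; set (k := c' * c ^ 2 / 2).
  assert (Hk : 0 < k) by (unfold k; apply Rdiv_lt_0_compat; [apply Rmult_lt_0_compat; auto; apply pow_lt; auto | lra]).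
  exists (1 + (Rabs a + 1) / k); assert (Ha := Rle_abs a); assert (Ha0 := Rabs_pos a).
  assert (Q : 0 <= (Rabs a + 1) / k) by (apply Rdiv_le_0_compat; lra).
  split; [lra |]; intros l Hl.
  assert (S := sq_le_2exp (c * l) ltac:(apply Rmult_le_pos; lra)).
  assert (E : k * l <= c' / l * exp (c * l)).
  { replace (k * l) with (c' / l * ((c * l) ^ 2 / 2)) by (unfold k; field; lra).
    apply Rmult_le_compat_l; [apply Rdiv_le_0_compat; lra | lra]. }
  assert (k * (1 + (Rabs a + 1) / k) <= k * l) by (apply Rmult_le_compat_l; lra).
  replace (k * (1 + (Rabs a + 1) / k)) with (k + Rabs a + 1) in H by (field; lra); lra.
Qed.

Lemma taylor_poly_large (z : C) (a : R) : z <> 0 -> (z ^ 2)%C <> 1 ->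
  eventually (fun n => Rbar_lt 1 (abs_exp_phase f n (lam n) z)) ->
  eventually (fun n => f (lam n * z)%C <> 0 ->
    a * Cmod (f (lam n * z)%C) < Cmod (taylor_poly f (2 * n) (lam n * z)%C)).
Proof.
  intros Hz Hz1 Hev; destruct (growth_outside z Hz Hz1 Hev) as [c [Hc [N1 H1]]].
  (* For [Cmod z < 1] the lower bound concerns the polynomial minus [f], hence the subtracted term;
     exponential growth makes it negligible. *)
  assert (K : exists c' l0, 0 < c' /\ forall n l, l0 <= l -> (l * C_derive f l)%C = (2 * INR n * f l)%C ->
    c' / l * (Cmod z ^ (2 * n) * Cmod (f l)) - Cmod (f (l * z)%C) <= Cmod (taylor_poly f (2 * n) (l * z)%C)).
  { destruct (Rlt_le_dec (Cmod z) 1) as [H|H].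
    - destruct (tail_lower f A Hf z Hz H) as [c' [l0 [Hc' [_ H2]]]]; exists c', l0; split; auto.
      intros n l Hl Hs; specialize (H2 n l Hl Hs).
      pose proof (Cmod_triangle_minus (taylor_poly f (2 * n) (l * z)%C) (f (l * z)%C)); lra.
    - destruct (poly_lower f A Hf z H Hz1) as [c' [l0 [Hc' [_ H2]]]]; exists c', l0; split; auto.
      intros n l Hl Hs; specialize (H2 n l Hl Hs).
      pose proof (Cmod_ge_0 (f (l * z)%C)); lra. }
  destruct K as [c' [l0 [Hc' HK]]].
  destruct (exp_over_id_unbounded c c' a Hc Hc') as [l1 [Hl1 Hexp]].
  destruct (eventually_scaled (fun n l => 1 <= l /\ a < c' / l * exp (c * l) - 1 /\
    c' / l * (Cmod z ^ (2 * n) * Cmod (f l)) - Cmod (f (l * z)%C) <= Cmod (taylor_poly f (2 * n) (l * z)%C)) (Rmax l0 l1))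
    as [N2 H2].
  { intros n l Hl Hs; assert (Ha := Rle_trans _ _ _ (Rmax_l _ _) Hl); assert (Hb := Rle_trans _ _ _ (Rmax_r _ _) Hl).
    repeat split; auto; lra. }
  exists (N1 + N2)%nat; intros n Hn Hne; specialize (H1 n ltac:(lia)).
  destruct (H2 n ltac:(lia)) as [H3 [H4 H5]]; apply Rlt_le_trans with (2 := H5).
  assert (P := proj1 (Cmod_gt_0 _) Hne); set (F := Cmod (f (lam n * z)%C)) in *.
  apply Rlt_le_trans with ((c' / lam n * exp (c * lam n) - 1) * F); [apply Rmult_lt_compat_r; auto |].
  assert (c' / lam n * (exp (c * lam n) * F) <= c' / lam n * (Cmod z ^ (2 * n) * Cmod (f (lam n)))).
  { apply Rmult_le_compat_l; auto; apply Rdiv_le_0_compat; lra. }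
  lra.
Qed.

Theorem ratio_inside z : eventually (fun n => Omega f n (lam n) z) ->
  is_Rbar_lim_seq (fun n => abs_quot_sub1 (taylor_poly f (2 * n) (lam n * z)%C) (f (lam n * z)%C)) 0.
Proof.
  intros [N HN]; apply Rbar_lim_0.
  { intros n; unfold abs_quot_sub1; destruct Ceq_dec; simpl; auto; apply Cmod_ge_0. }
  intros b Hb.
  destruct (Rlt_le_dec (Cmod z) 1) as [Hz|Hz].
  - destruct (tail_upper f A Hf z (b / 2) Hz ltac:(lra)) as [l0 [_ H]].
    destruct (eventually_scaled _ l0 H) as [N1 H1].
    exists (N + N1)%nat; intros n Hn; destruct (HN n ltac:(lia)) as [_ Hp].
    apply phase_lt_1 in Hp; destruct Hp as [Hne Hlt]; specialize (H1 n ltac:(lia)); cbv beta in H1.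
    unfold abs_quot_sub1; destruct Ceq_dec as [E|E]; [contradiction |]; unfold Rbar_lt.
    assert (P := proj1 (Cmod_gt_0 _) E).
    replace (taylor_poly f (2 * n) (lam n * z) / f (lam n * z) - 1)%C
      with ((taylor_poly f (2 * n) (lam n * z) - f (lam n * z)) / f (lam n * z))%C by (field; auto).
    rewrite Cmod_div by auto; apply Rmult_lt_reg_r with (Cmod (f (lam n * z)%C)); auto.
    unfold Rdiv; rewrite Rmult_assoc, Rinv_l, Rmult_1_r by lra.
    apply Rle_lt_trans with (1 := H1).
    apply Rle_lt_trans with (b / 2 * Cmod (f (lam n * z)%C)); [apply Rmult_le_compat_l; lra |].
    apply Rmult_lt_compat_r; lra.
  (* [Omega] eventually contains no point with [Cmod z >= 1]: there [ln (Cmod z) >= 0] and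
     [|Re z| < 1] make [phase_A] positive, which forces [E >= 1] for large [n]. *)
  - exfalso.
    destruct (right_half_reduction z) as [t [Ht [Hre [_ Hfz]]]].
    assert (Hre1 : Rabs (Re z) < 1) by (destruct (HN N ltac:(lia)); auto).
    assert (HA : 0 < phase_A (Cmod z) t).
    { unfold phase_A; assert (0 <= ln (Cmod z)) by (rewrite <- ln_1; apply ln_le_compat; lra); lra. }
    destruct (phase_large f A Hf (Cmod z) t ltac:(lra) Ht (or_introl HA)) as [c [l0 [Hc [_ H]]]].
    destruct (eventually_scaled (fun n l => 0 < l -> exp (c * l) * Cmod (f (l * z)%C) <= Cmod z ^ (2 * n) * Cmod (f l)) l0) as [N1 H1].
    { intros n l Hl Hs _; rewrite Hfz; now apply H. }
    destruct Hlam as [N2 H2].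
    set (n := (N + N1 + N2)%nat); destruct (HN n ltac:(lia)) as [_ Hp].
    destruct (H2 n ltac:(lia)) as [Hl _]; specialize (H1 n ltac:(lia) ltac:(lra)); cbv beta in H1.
    apply phase_lt_1 in Hp; destruct Hp as [Hne Hlt].
    assert (1 <= exp (c * lam n)) by (rewrite <- exp_0; apply exp_le_compat, Rmult_le_pos; lra).
    pose proof (Cmod_ge_0 (f (lam n * z)%C)); nra.
Qed.

Theorem ratio_mho_minus z : eventually (fun n => mho_minus f n (lam n) z) ->
  is_Rbar_lim_seq (fun n => abs_quot (taylor_poly f (2 * n) (lam n * z)%C) (f (lam n * z)%C)) 0.
Proof.
  intros [N HN]; apply Rbar_lim_0.
  { intros n; unfold abs_quot; destruct Ceq_dec; simpl; auto; apply Cmod_ge_0. }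
  intros b Hb.
  assert (Hz : 1 < Cmod z).
  { destruct (HN N ltac:(lia)) as [H _]; apply Rlt_le_trans with (1 := H), Re_le_Cmod. }
  destruct (poly_upper f A Hf z (b / 2) Hz ltac:(lra)) as [l0 [_ H]].
  destruct (eventually_scaled _ l0 H) as [N1 H1].
  exists (N + N1)%nat; intros n Hn; destruct (HN n ltac:(lia)) as [_ Hp].
  apply phase_lt_1 in Hp; destruct Hp as [Hne Hlt]; specialize (H1 n ltac:(lia)); cbv beta in H1.
  unfold abs_quot; destruct Ceq_dec as [E|E]; [contradiction |]; unfold Rbar_lt.
  assert (P := proj1 (Cmod_gt_0 _) E).
  rewrite Cmod_div by auto; apply Rmult_lt_reg_r with (Cmod (f (lam n * z)%C)); auto.
  unfold Rdiv; rewrite Rmult_assoc, Rinv_l, Rmult_1_r by lra.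
  apply Rle_lt_trans with (1 := H1).
  apply Rle_lt_trans with (b / 2 * Cmod (f (lam n * z)%C)); [apply Rmult_le_compat_l; lra |].
  apply Rmult_lt_compat_r; lra.
Qed.

Theorem ratio_mho_plus z : eventually (fun n => mho_plus f n (lam n) z) ->
  is_Rbar_lim_seq (fun n => abs_quot (taylor_poly f (2 * n) (lam n * z)%C) (f (lam n * z)%C)) p_infty.
Proof.
  intros Hev; split; [| intros b []].
  intros a _; unfold mho_plus in Hev.
  destruct (Ceq_dec z 0) as [->|Hz].
  (* For [n >= 1] the power [0 ^ (2 n)] vanishes, so the phase at [z = 0] can exceed [1] only
     through [f 0 = 0], where the quotient is infinite by convention. *)
  - destruct Hev as [N HN]; exists (S N); intros n Hn.
    destruct (phase_gt_1 _ _ _ (HN n ltac:(lia))) as [E|H].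
    + unfold abs_quot; destruct Ceq_dec; [exact I | contradiction].
    + exfalso; rewrite Cmod_0, pow_i, Rmult_0_l in H by lia.
      pose proof (Cmod_ge_0 (f (lam n * 0)%C)); lra.
  - destruct (Ceq_dec (z ^ 2)%C 1) as [Hz1|Hz1].
    (* At [z = 1] and [z = -1] evenness gives [E = 1] exactly, so these points never lie in the
       set. *)
    + exfalso; destruct Hev as [N1 H1]; destruct Hlam as [N2 H2].
      set (n := (N1 + N2)%nat); destruct (H2 n ltac:(lia)) as [Hl _].
      assert (Nz := xl_neq_0 f A Hf (lam n) ltac:(lra)).
      assert (E : f (lam n * z)%C = f (lam n)).
      { assert (E : ((z - 1) * (z + 1) = 0)%C) by (transitivity (z ^ 2 - 1)%C; [simpl; ring | rewrite Hz1; ring]).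
        destruct (Ceq_dec (z - 1)%C 0) as [E1|E1]; [| destruct (Ceq_dec (z + 1)%C 0) as [E2|E2]].
        - replace z with (RtoC 1); [f_equal; ring |]; transitivity (1 + (z - 1))%C; [rewrite E1 |]; ring.
        - rewrite <- (xl_even f A Hf); f_equal.
          transitivity (lam n - lam n * (z + 1))%C; [ring | rewrite E2; ring].
        - contradiction (Cmult_neq_0 _ _ E1 E2). }
      assert (Ez : Cmod z = 1).
      { assert (X : Cmod z ^ 2 = 1) by (rewrite <- Cmod_pow, Hz1; apply Cmod_1).
        pose proof (Cmod_ge_0 z); nra. }
      destruct (phase_gt_1 _ _ _ (H1 n ltac:(lia))) as [H|H]; rewrite E in H; [contradiction |].
      rewrite Ez, pow1 in H; lra.
    + destruct (taylor_poly_large z a Hz Hz1 Hev) as [N HN]; exists N; intros n Hn; specialize (HN n Hn).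
      unfold abs_quot; destruct Ceq_dec as [E|E]; [exact I |]; unfold Rbar_lt; specialize (HN E).
      assert (P := proj1 (Cmod_gt_0 _) E); rewrite Cmod_div by auto.
      apply Rmult_lt_reg_r with (Cmod (f (lam n * z)%C)); auto.
      unfold Rdiv; rewrite Rmult_assoc, Rinv_l, Rmult_1_r by lra; auto.
Qed.

End Sequence.
End XiLike.

Theorem corollary3p2 (xi : C -> C) (lambda : nat -> R)
    (Hxi : is_riemann_xi xi)
    (Hlambda : eventually (fun n =>
       unique (is_scaling (shifted_xi xi) n) (lambda n)))
    (z : C) :
  (eventually (fun n => Omega (shifted_xi xi) n (lambda n) z) ->
   is_Rbar_lim_seq
     (fun n => abs_quot_sub1 (taylor_poly (shifted_xi xi) (2 * n) (lambda n * z)%C)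
                             (xi (/ 2 + lambda n * z)%C))
     (Finite 0))
  /\
  (eventually (fun n => mho_minus (shifted_xi xi) n (lambda n) z) ->
   is_Rbar_lim_seq
     (fun n => abs_quot (taylor_poly (shifted_xi xi) (2 * n) (lambda n * z)%C)
                        (xi (/ 2 + lambda n * z)%C))
     (Finite 0))
  /\
  (eventually (fun n => mho_plus (shifted_xi xi) n (lambda n) z) ->
   is_Rbar_lim_seq
     (fun n => abs_quot (taylor_poly (shifted_xi xi) (2 * n) (lambda n * z)%C)
                        (xi (/ 2 + lambda n * z)%C))
     p_infty).
Proof.
  destruct (shifted_xi_like xi Hxi) as [A [_ Hf]].
  assert (Hlam : eventually (fun n => / 2 < lambda n /\
    (lambda n * C_derive (shifted_xi xi) (lambda n))%C = (2 * INR n * shifted_xi xi (lambda n))%C)).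
  { destruct Hlambda as [N HN]; exists (S N); intros n Hn.
    apply (is_scaling_eq (shifted_xi xi) A Hf); [apply (HN n); lia | lia]. }
  split; [| split]; intros H.
  - exact (ratio_inside _ A Hf lambda Hlam z H).
  - exact (ratio_mho_minus _ A Hf lambda Hlam z H).
  - exact (ratio_mho_plus _ A Hf lambda Hlam z H).
Qed.
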